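(* Let $\varphi: \Gamma_1 \to \Gamma_2$ be a group morphism between virtually polycyclic groups $\Gamma_1,\Gamma_2$, and let $\rho_i: \Gamma_i \to \mathrm{Aff}(N_i)$, $i\in\{1,2\}$, be translation-like NIL-affine crystallographic actions, where $N_1,N_2$ are connected and simply connected nilpotent Lie groups. Then there exists an affine map $\alpha \in \mathrm{aff}(N_1,N_2)$ such that $$\rho_2(\varphi(\gamma)) \circ \alpha = \alpha \circ \rho_1(\gamma)$$ for all $\gamma \in \Gamma_1$.
   Context: A group $\Gamma$ is virtually polycyclic if it has a subnormal series $1=\Gamma_0 \triangleleft \Gamma_1 \triangleleft \dots \triangleleft \Gamma_k=\Gamma$ in which every quotient $\Gamma_{i+1}/\Gamma_i$ is finite or infinite cyclic. For a connected and simply connected nilpotent Lie group $N$, $\mathrm{Aff}(N) = N \rtimes \mathrm{Aut}(N)$ acts on $N$ by $(x,\delta)\cdot n = x\,\delta(n)$; $N \le \mathrm{Aff}(N)$ denotes the subgroup of left translations. A NIL-affine action of $\Gamma$ is a group morphism $\rho:\Gamma \to \mathrm{Aff}(N)$. An action of a (discrete) group is crystallographic if it is properly discontinuous and cocompact. $\mathrm{Aff}(N)$ is regarded as a real algebraic group (group of real points of a linear algebraic $\mathbb{R}$-group; $N$ with its unipotent algebraic structure, $\mathrm{Aut}(N) \cong \mathrm{Aut}(\mathrm{Lie}(N))$). $\overline{\rho(\Gamma)}$ denotes the real Zariski closure of $\rho(\Gamma)$ in $\mathrm{Aff}(N)$, and $U(G)$ denotes the unipotent radical of a real algebraic group $G$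 (the set of unipotent elements of the maximal closed normal solvable subgroup of $G$; for virtually solvable $G$, such as $\overline{\rho(\Gamma)}$, it is the set of all unipotent elements of $G$). A NIL-affine action $\rho: \Gamma \to \mathrm{Aff}(N)$ of a virtually polycyclic group is translation-like if $U(\overline{\rho(\Gamma)})$ acts by left translations on $N$, i.e. $U(\overline{\rho(\Gamma)}) \le N$. $\mathrm{aff}(N_1,N_2)$ is the set of pairs $\alpha=(x,\delta)$ with $x\in N_2$ and $\delta:N_1\to N_2$ a continuous group morphism, identified with the map $\alpha: N_1\to N_2$, $\alpha(n)=\delta(n)\,x$ (right translation part). *)

(* Defs.v *)
From HB Require Import structures.
From mathcomp Require Import all_boot all_order all_algebra.
From mathcomp Require Import generic_quotient.
From mathcomp Require Import all_classical all_reals all_analysis.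

Set Implicit Arguments.
Unset Strict Implicit.
Unset Printing Implicit Defensive.

Import Order.TTheory GRing.Theory Num.Theory.
Import numFieldNormedType.Exports.

Local Open Scope classical_set_scope.
Local Open Scope ring_scope.

(* Subgroups of a possibly infinite group are represented by sets. *)
Section Groups.
Variable G : groupType.
Implicit Types A B H : set G.

Definition is_subgroup H := H 1%g /\ forall x y, H x -> H y -> H (x * y^-1)%g.

Definition is_normal_in A B :=
  A `<=` B /\ forall x y, A x -> B y -> A (x ^ y)%g.

Definition left_cosets A B : set (set G) :=
  [set [set (x * a)%g | a in A] | x in B].

Definition finite_quotient A B := finite_set (left_cosets A B).

Definition abelian_quotient A B :=
  forall x y, B x -> B y -> A [~ x, y]%g.

(* B / A is generated by the coset of a, and is infinite *)
Definition infinite_cyclic_quotient A B :=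
  infinite_set (left_cosets A B) /\
  exists2 a, B a &
    forall x, B x -> exists n : nat, A (a ^- n * x)%g \/ A (a ^+ n * x)%g.

Definition has_subnormal_series (P : set G -> set G -> Prop) H :=
  exists (k : nat) (S : nat -> set G),
    [/\ S 0%N = [set 1%g], S k = H,
        forall i, (i <= k)%N -> is_subgroup (S i) &
        forall i, (i < k)%N ->
          is_normal_in (S i) (S i.+1) /\ P (S i) (S i.+1)].

Definition is_solvable H := has_subnormal_series abelian_quotient H.

Fixpoint upper_central (k : nat) : set G :=
  if k is k'.+1 then [set x | forall y, upper_central k' [~ x, y]%g]
  else [set 1%g].

Definition is_nilpotent := exists k, upper_central k = [set: G].

End Groups.

Definition virtually_polycyclic (G : groupType) :=
  @has_subnormal_series G
    (fun A B => finite_quotient A B \/ infinite_cyclic_quotient A B) [set: G].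

Section SimplyConnected.
Variables (R : realType) (T : topologicalType).

Local Notation I := (`[0, 1]%classic : set R).

Definition path_connected := forall x y : T,
  exists f : R -> T, [/\ {within I, continuous f}, f 0 = x & f 1 = y].

(* homotopy with fixed end points from the loop f to the constant loop *)
Definition null_homotopic (f : R -> T) :=
  exists h : R * R -> T,
    [/\ {within I `*` I, continuous h},
        forall t, I t -> h (t, 0) = f t,
        forall t, I t -> h (t, 1) = f 0 &
        forall s, I s -> h (0, s) = f 0 /\ h (1, s) = f 0].

Definition simply_connected := path_connected /\
  forall f : R -> T, {within I, continuous f} -> f 0 = f 1 -> null_homotopic f.

End SimplyConnected.

(* U is meant to be open and V finite-dimensional; the value of f outside U is
   irrelevant. *)
Fixpoint Ck (R : realType) (V W : normedModType R) (k : nat) (U : set V)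
    (f : V -> W) : Prop :=
  if k is k'.+1 then
    (forall x, U x -> differentiable f x) /\
    (forall v, Ck k' U (fun x => 'D_v f x))
  else forall x, U x -> {for x, continuous f}.

Definition smooth_on (R : realType) (V W : normedModType R) (U : set V)
    (f : V -> W) := forall k, Ck k U f.

(* The values of [chart_map] outside [chart_dom], and those of [chart_inv]
   outside [chart_im], are irrelevant. *)
Record chart (R : realType) (T : topologicalType) (n : nat) := Chart {
  chart_dom : set T;
  chart_map :> T -> 'rV[R]_n;
  chart_inv : 'rV[R]_n -> T;
  chart_dom_open : open chart_dom;
  chart_im_open : open (chart_map @` chart_dom);
  chart_mapK : forall x, chart_dom x -> chart_inv (chart_map x) = x;
  chart_map_continuous :
    forall x, chart_dom x -> {for x, continuous chart_map};
  chart_inv_continuous :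
    forall v, (chart_map @` chart_dom) v -> {for v, continuous chart_inv}
}.

Definition chart_im (R : realType) (T : topologicalType) (n : nat)
  (c : chart R T n) : set 'rV[R]_n := c @` chart_dom c.

HB.mixin Record isLieGroup (R : realType) G
    of monoid.Group G & Topological G := {
  lie_dim : nat;
  lie_atlas : set (chart R G lie_dim);
  lie_hausdorff : hausdorff_space G;
  lie_second_countable : @second_countable G;
  lie_atlas_cover : forall x : G, exists c, lie_atlas c /\ chart_dom c x;
  lie_atlas_smooth : forall c d, lie_atlas c -> lie_atlas d ->
    smooth_on (chart_im c `&` chart_inv c @^-1` chart_dom d)
      (fun v => d (chart_inv c v));
  lie_mul_continuous : continuous (fun p : G * G => (p.1 * p.2)%g);
  lie_inv_continuous : continuous (fun x : G => x^-1%g);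
  lie_mul_smooth : forall c d e, lie_atlas c -> lie_atlas d -> lie_atlas e ->
    smooth_on [set p : 'rV[R]_lie_dim * 'rV[R]_lie_dim |
        [/\ chart_im c p.1, chart_im d p.2 &
            chart_dom e (chart_inv c p.1 * chart_inv d p.2)%g]]
      (fun p => e (chart_inv c p.1 * chart_inv d p.2)%g);
  lie_inv_smooth : forall c d, lie_atlas c -> lie_atlas d ->
    smooth_on [set v | chart_im c v /\ chart_dom d (chart_inv c v)^-1%g]
      (fun v => d (chart_inv c v)^-1%g)
}.

#[short(type="lieGroupType")]
HB.structure Definition LieGroup (R : realType) :=
  { G of isLieGroup R G & monoid.Group G & Topological G }.

(* Automorphisms of the Lie group G; continuous morphisms of Lie groups are
   automatically smooth. *)
Record lie_aut (R : realType) (G : lieGroupType R) := LieAut {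
  aut_fun :> G -> G;
  aut_inv : G -> G;
  aut_funM : {morph aut_fun : x y / (x * y)%g};
  aut_fun_continuous : continuous aut_fun;
  aut_inv_continuous : continuous aut_inv;
  aut_funK : cancel aut_fun aut_inv;
  aut_invK : cancel aut_inv aut_fun
}.

Section LieAut.
Variables (R : realType) (G : lieGroupType R).
Implicit Types d e : lie_aut G.

Lemma lie_aut_ext d e : aut_fun d =1 aut_fun e -> d = e.
Proof.
case: d => f f' fM fC f'C fK f'K; case: e => g g' gM gC g'C gK g'K /= /funext fg.
case: _ / fg in gM gC gK g'K *.
have fg' : f' = g' by apply/funext => x; rewrite -[in LHS](g'K x) fK.
case: _ / fg' in g'C gK g'K *.
by congr LieAut; exact: Prop_irrelevance.
Qed.

Lemma id_autM : {morph (@id G) : x y / (x * y)%g}. Proof. by []. Qed.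
Lemma id_aut_continuous : continuous (@id G). Proof. by move=> x. Qed.

Definition id_aut : lie_aut G :=
  LieAut id_autM id_aut_continuous id_aut_continuous
    (fun=> erefl) (fun=> erefl).

Lemma comp_autM d e : {morph (d \o e) : x y / (x * y)%g}.
Proof. by move=> x y /=; rewrite !aut_funM. Qed.

Lemma comp_aut_continuous d e : continuous (d \o e).
Proof.
by move=> x; apply: continuous_comp; exact: aut_fun_continuous.
Qed.

Lemma comp_aut_inv_continuous d e : continuous (aut_inv e \o aut_inv d).
Proof.
by move=> x; apply: continuous_comp; exact: aut_inv_continuous.
Qed.

Definition comp_aut d e : lie_aut G :=
  LieAut (@comp_autM d e) (@comp_aut_continuous d e)
    (@comp_aut_inv_continuous d e)
    (can_comp (@aut_funK _ _ d) (@aut_funK _ _ e))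
    (can_comp (@aut_invK _ _ e) (@aut_invK _ _ d)).

Lemma inv_autM d : {morph (aut_inv d) : x y / (x * y)%g}.
Proof.
by move=> x y; apply: (can_inj (@aut_funK _ _ d)); rewrite aut_funM !aut_invK.
Qed.

Definition inv_aut d : lie_aut G :=
  LieAut (@inv_autM d) (@aut_inv_continuous _ _ d) (@aut_fun_continuous _ _ d)
    (@aut_invK _ _ d) (@aut_funK _ _ d).

Lemma aut_fun1 d : d 1%g = 1%g.
Proof. by apply: (mulgI (d 1%g)); rewrite -aut_funM !mulg1. Qed.

End LieAut.

Record Aff (R : realType) (G : lieGroupType R) := MkAff {
  aff_trans : G;
  aff_lin : lie_aut G
}.

Section AffGroup.
Variables (R : realType) (G : lieGroupType R).
Implicit Types a b : Aff G.

HB.instance Definition _ := gen_eqMixin (Aff G).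
HB.instance Definition _ := gen_choiceMixin (Aff G).

Definition aff_one : Aff G := MkAff 1%g (id_aut G).
Definition aff_mul a b : Aff G :=
  MkAff (aff_trans a * aff_lin a (aff_trans b))%g
        (comp_aut (aff_lin a) (aff_lin b)).
Definition aff_inv a : Aff G :=
  MkAff (inv_aut (aff_lin a) (aff_trans a)^-1)%g (inv_aut (aff_lin a)).

Lemma aff_ext a b : aff_trans a = aff_trans b ->
  aff_lin a =1 aff_lin b -> a = b.
Proof. by case: a b => [x d] [y e] /= -> /lie_aut_ext ->. Qed.

Lemma aff_mulA : associative aff_mul.
Proof.
by move=> a b c; apply: aff_ext => //=; rewrite aut_funM mulgA.
Qed.

Lemma aff_mul1 : left_id aff_one aff_mul.
Proof. by move=> a; apply: aff_ext => //=; rewrite mul1g. Qed.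

Lemma aff_mulr1 : right_id aff_one aff_mul.
Proof. by move=> a; apply: aff_ext => //=; rewrite aut_fun1 mulg1. Qed.

Lemma aff_mulV : left_inverse aff_one aff_inv aff_mul.
Proof.
move=> a; apply: aff_ext => [/=|x /=]; last exact: aut_funK.
by rewrite -inv_autM mulVg; exact: (aut_fun1 (inv_aut _)).
Qed.

Lemma aff_mulrV : right_inverse aff_one aff_inv aff_mul.
Proof.
move=> a; apply: aff_ext => [/=|x /=]; last exact: aut_invK.
by rewrite aut_invK mulgV.
Qed.

HB.instance Definition _ := isGroup.Build (Aff G)
  aff_mulA aff_mul1 aff_mulr1 aff_mulV aff_mulrV.

Definition aff_act a (x : G) : G := (aff_trans a * aff_lin a x)%g.

Lemma aff_act1 x : aff_act 1%g x = x.
Proof. by rewrite /aff_act /= mul1g. Qed.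

Lemma aff_actM a b x : aff_act (a * b)%g x = aff_act a (aff_act b x).
Proof. by rewrite /aff_act /= aut_funM mulgA. Qed.

Definition left_translations : set (Aff G) :=
  [set a | aff_lin a = id_aut G].

End AffGroup.

Section Algebraic.
Variables (R : realType) (G : lieGroupType R).

Local Notation n := (@lie_dim R G).

(* A chart around 1; it identifies Lie(G), as a vector space, with R^n. *)
Definition chart1 : chart R G n := sval (cid (@lie_atlas_cover R G 1%g)).

Definition one_parameter (g : R -> G) :=
  continuous g /\ forall s t, g (s + t) = (g s * g t)%g.

(* x = exp(v) *)
Definition is_exp (v : 'rV[R]_n) (x : G) :=
  exists g : R -> G,
    [/\ one_parameter g, is_derive (0 : R) (1 : R) (chart1 \o g) v & g 1 = x].

(* When G is connected, simply connected and nilpotent, exp is a bijection,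
   of which this is the inverse. *)
Definition lie_log (x : G) : 'rV[R]_n := xget 0 [set v | is_exp v x].

(* The matrix of the automorphism of Lie(G) given by the differential of d at
   1, acting on row vectors. *)
Definition lie_diff (d : lie_aut G) : 'M[R]_n :=
  'J (fun v => chart1 (d (chart_inv chart1 v))) (chart1 1%g).

(* The real coordinate ring of Aff(G): polynomials in the logarithmic
   coordinates on G, the entries of a matrix in GL(Lie(G)), and the inverse of
   its determinant. *)
Inductive regular : (Aff G -> R) -> Prop :=
| regular_cst (c : R) : regular (fun=> c)
| regular_log (i : 'I_n) : regular (fun a => lie_log (aff_trans a) ord0 i)
| regular_entry (i j : 'I_n) : regular (fun a => lie_diff (aff_lin a) i j)
| regular_invdet : regular (fun a => (\det (lie_diff (aff_lin a)))^-1)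
| regular_add f g : regular f -> regular g -> regular (fun a => f a + g a)
| regular_mul f g : regular f -> regular g -> regular (fun a => f a * g a).

Definition zariski_closed (Z : set (Aff G)) :=
  exists2 S : set (Aff G -> R), S `<=` regular &
    Z = [set a | forall f, S f -> f a = 0].

Definition zariski_closure (A : set (Aff G)) : set (Aff G) :=
  \bigcap_(Z in [set Z | zariski_closed Z /\ A `<=` Z]) Z.

(* Intrinsic unipotence in a linear algebraic group: right translation by u is
   a locally unipotent operator on the coordinate ring. *)
Definition unipotent (u : Aff G) := forall f, regular f ->
  exists k : nat,
    iter k (fun (h : Aff G -> R) a => h (a * u)%g - h a) f = (fun=> 0).

Definition closed_normal_solvable (K H : set (Aff G)) :=
  [/\ is_subgroup H, zariski_closed H, is_normal_in H K & is_solvable H].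

Definition is_solvable_radical (K H : set (Aff G)) :=
  closed_normal_solvable K H /\
  forall H', closed_normal_solvable K H' -> H' `<=` H.

Definition unipotent_radical (K : set (Aff G)) : set (Aff G) :=
  [set u | unipotent u /\ exists2 H, is_solvable_radical K H & H u].

End Algebraic.

Section Actions.
Variables (R : realType) (G : lieGroupType R) (Gam : groupType).
Variable rho : {multiplicative Gam -> Aff G}.

Lemma rho_1 : rho 1%g = 1%g.
Proof. by apply: (mulgI (rho 1%g)); rewrite -gmulfM !mulg1. Qed.

Definition translation_like :=
  unipotent_radical (zariski_closure (range rho)) `<=` @left_translations R G.

Definition properly_discontinuous := forall K : set G, compact K ->
  finite_set [set c | (aff_act (rho c) @` K) `&` K !=set0].

Definition orbit_rel (x y : G) : bool :=
  `[< exists c, aff_act (rho c) x = y >].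

Lemma orbit_rel_refl : reflexive orbit_rel.
Proof. by move=> x; apply/asboolP; exists 1%g; rewrite rho_1 aff_act1. Qed.

Lemma orbit_rel_sym : symmetric orbit_rel.
Proof.
suff s x y : orbit_rel x y -> orbit_rel y x.
  by move=> x y; apply/idP/idP; exact: s.
move=> /asboolP[c <-]; apply/asboolP; exists c^-1%g.
by rewrite -aff_actM -gmulfM mulVg rho_1 aff_act1.
Qed.

Lemma orbit_rel_trans : transitive orbit_rel.
Proof.
move=> y x z /asboolP[c <-] /asboolP[d <-]; apply/asboolP; exists (d * c)%g.
by rewrite gmulfM aff_actM.
Qed.

Definition orbit_equiv := EquivRel _ orbit_rel_refl orbit_rel_sym orbit_rel_trans.

Definition orbit_space := quotient_topology {eq_quot orbit_equiv}%qT.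

Definition cocompact := compact [set: orbit_space].

Definition crystallographic := properly_discontinuous /\ cocompact.

End Actions.

Record aff_map (R : realType) (N1 N2 : lieGroupType R) := AffMap {
  aff_map_trans : N2;
  aff_map_lin : N1 -> N2;
  aff_map_linM : {morph aff_map_lin : x y / (x * y)%g};
  aff_map_lin_continuous : continuous aff_map_lin
}.

Definition aff_map_fun (R : realType) (N1 N2 : lieGroupType R)
  (al : aff_map N1 N2) (x : N1) : N2 :=
  (aff_map_lin al x * aff_map_trans al)%g.

Coercion aff_map_fun : aff_map >-> Funclass.

(* Main.v *)
(* Through the logarithm, N1 and N2 become their Lie algebras with the polynomial
   Baker-Campbell-Hausdorff law. Some power of every element of Gamma_i has a semisimple
   linear part: the unipotent Jordan part of rho_i(g) lies in the Zariski closure, and for g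
   in a solvable normal subgroup of finite index it lies in the unipotent radical, hence is a
   translation. By induction along the subnormal series, a normal subgroup D of finite index
   in Gamma_1 then has commuting semisimple linear parts on N1 x N2, all of them polynomials
   in the linear part of one g0. In N1 x N2 with the diagonal action, D spans a subalgebra
   invariant under the linear parts, built in two steps (first the translations of D, then
   all of D). Proper discontinuity on N1 makes it meet Lie(N2) trivially and cocompactness
   makes it project onto Lie(N1), so it is the graph of a Lie algebra morphism whose
   exponential delta conjugates the D-actions. The remaining choice of the translation part
   is a point of a nilpotent group on which Gamma_1 / D acts by affine maps; it is a
   barycenter of a finite orbit. *)
Require Import Defs.
From HB Require Import structures.
From mathcomp Require Import all_boot all_order all_algebra complex ring lra zify mxred perm.
From mathcomp Require Import all_classical all_reals all_analysis.
Set Implicit Arguments.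
Unset Strict Implicit.
Unset Printing Implicit Defensive.
Import Order.TTheory GRing.Theory Num.Theory.
Import numFieldNormedType.Exports.
Local Open Scope classical_set_scope.
Local Open Scope ring_scope.

(** * The exponential map of a Lie group near the identity *)

(** The groups come with an atlas only, so the exponential is built by hand from one estimate: in a
    chart at 1 the product is x + y up to C|x||y|. The recurring tool afterwards is a principle on
    finite sums of terms mu^m p(k), with mu nonzero and p a polynomial: if such a sum vanishes
    whenever k = m, it vanishes for all (k, m). It separates the semisimple and unipotent factors of
    a commuting product. It yields the real Jordan parts, their compatibility with the bracket, the
    unipotent part inside the Zariski closure, and the invariance of the spans under each factor.
    The obstacle is that linear parts outside D need not commute with those of D, so the graph is
    built for D alone. Being the smallest subalgebra that contains the translation parts of D, it
    makes delta the only morphism compatible with D. Transporting an equivariant map by an element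
    of Gamma_1 therefore returns the same delta and moves only the translation part, which is why
    the remaining freedom carries an action of Gamma_1 / D. *)

Ltac vring := apply/matrixP => ? ?; rewrite ?mxE; ring.

Lemma term_le_sum (R : realType) (I : finType) (F : I -> R) i :
  (forall j, 0 <= F j) -> F i <= \sum_j F j.
Proof.
by move=> F0; rewrite (bigD1 i) //= lerDl; apply: sumr_ge0 => j _.
Qed.

Section SecondDifference.
Variables (R : realType) (n m : nat).
Local Notation V := ('rV[R]_n * 'rV[R]_n)%type.
Implicit Types (p a : V).

Definition pair_basis (k : 'I_n + 'I_n) : V :=
  match k with
  | inl i => (delta_mx 0 i, 0)
  | inr i => (0, delta_mx 0 i)
  end.

Definition pair_coord a (k : 'I_n + 'I_n) : R :=
  match k with inl i => a.1 0 i | inr i => a.2 0 i end.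

Lemma pair_coordE a : a = \sum_k pair_coord a k *: pair_basis k.
Proof.
rewrite big_sumType /=; case: a => x y /=.
rewrite [X in _ = X + _](_ : _ = (x, 0)); last first.
  rewrite [x in RHS]row_sum_delta; apply/esym.
  elim/big_rec2: _ => // i u v _ <-; congr pair => /=.
  by rewrite scaler0 add0r.
rewrite [X in _ = _ + X](_ : _ = (0, y)); last first.
  rewrite [y in RHS]row_sum_delta; apply/esym.
  elim/big_rec2: _ => // i u v _ <-; congr pair => /=.
  by rewrite scaler0 add0r.
by congr pair => /=; rewrite ?addr0 ?add0r.
Qed.

Lemma row_coord_le k (x : 'rV[R]_k) i : `|x 0 i| <= `|x|.
Proof. by rewrite /Num.Def.normr /= mx_normrE; apply: (le_bigmax _ _ (0, i)). Qed.

Lemma row_norm_le k (x : 'rV[R]_k) (B : R) : 0 <= B ->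
  (forall i, `|x 0 i| <= B) -> `|x| <= B.
Proof.
move=> B0 xB; rewrite /Num.Def.normr /= mx_normrE.
by apply: bigmax_le => // -[i j] _ /=; rewrite (ord1 i).
Qed.

Lemma pair_coord_le a k : `|pair_coord a k| <= `|a|.
Proof.
by case: k => i /=; rewrite (le_trans (row_coord_le _ _)) // prod_normE;
  rewrite le_max lexx ?orbT.
Qed.

(** The mean value theorem is applied to one coordinate of t |-> f (p + t a) at a time; the factor n
    + n counts the basis vectors in which the direction a is expanded. *)
Lemma increment_le (f : V -> 'rV[R]_m) p a (B : R) : 0 <= B ->
  (forall t : R, 0 <= t <= 1 -> differentiable f (p + t *: a)) ->
  (forall (t : R) k, 0 <= t <= 1 -> `|'D_(pair_basis k) f (p + t *: a)| <= B) ->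
  `|f (p + a) - f p| <= (n + n)%:R * B * `|a|.
Proof.
move=> B0 fd fB; apply: row_norm_le => [|i]; first by rewrite !mulr_ge0.
pose g (t : R) := f (p + t *: a) 0 i.
have gd (t : R) : 0 <= t <= 1 -> is_derive t 1 g ('D_a f (p + t *: a) 0 i).
  move=> t01.
  have fd' := fd _ t01.
  have lineE : (fun h : R => h^-1 *: (((fun t : R => f (p + t *: a)) \o shift t) (h *: 1) - f (p + t *: a))) =
      (fun h : R => h^-1 *: ((f \o shift (p + t *: a)) (h *: a) - f (p + t *: a))).
    apply/funext => h /=; congr (_ *: (f _ - _)).
    rewrite [h *: (1 : R)]mulr1 scalerDl.
    by rewrite addrCA.
  have hD : 'D_1 (fun t : R => f (p + t *: a)) t = 'D_a f (p + t *: a).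
    by rewrite /derive /= lineE.
  have hdv : derivable (fun t : R => f (p + t *: a)) t 1.
    by rewrite /derivable lineE; exact: diff_derivable.
  apply: DeriveDef.
    have : derivable (fun t : R => f (p + t *: a)) t 1 by [].
    by move/derivable_mxP; apply.
  rewrite -hD -[LHS]/('D_1 (fun t => (fun t : R => f (p + t *: a)) t 0 i) t).
  by rewrite (derive_mx hdv) mxE.
have := @MVT R g (fun t => 'D_a f (p + t *: a) 0 i) 0 1 ltr01.
case=> [x||c].
- by rewrite in_itv /= => /andP[x0 x1]; apply: gd; rewrite !ltW.
- apply: derivable_within_continuous => x; rewrite in_itv /= => x01.
  by have [] := gd _ x01.
rewrite in_itv /= => /andP[c0 c1]; rewrite subr0 mulr1 /g scale1r scale0r addr0.
have c01 : 0 <= c <= 1 by rewrite !ltW.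
rewrite !mxE => ->.
rewrite deriveE; last exact: fd.
have {}fB k : `|'d f (p + c *: a) (pair_basis k)| <= B.
  by rewrite -deriveE; [exact: fB|exact: fd].
move: fB; set L := 'd f _ => fB.
rewrite {1}(pair_coordE a) linear_sum summxE.
apply: le_trans (ler_norm_sum _ _ _) _.
apply: (@le_trans _ _ (\sum_(k : 'I_n + 'I_n) B * `|a|)); last first.
  by rewrite sumr_const card_sum !card_ord -[leRHS]mulrA mulr_natl.
apply: ler_sum => k _; rewrite linearZ mxE normrM mulrC.
apply: ler_pM => //; last exact: pair_coord_le.
exact: le_trans (row_coord_le _ _) (fB k).
Qed.

(** [increment_le] is applied twice, to q |-> f (q + a) - f q along b and to each partial derivative
    along a. Through [local_chart], this is all that the proof takes from the smoothness of the
    multiplication. *)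
Lemma second_difference_le (U : set V) (f : V -> 'rV[R]_m) (p0 : V) :
  Ck 2 U f -> nbhs p0 U ->
  exists r C : R, [/\ 0 < r, 0 <= C & forall p a b, `|p - p0| <= r ->
    `|a| <= r -> `|b| <= r ->
    `|f (p + a + b) - f (p + a) - f (p + b) + f p| <= C * `|a| * `|b|].
Proof.
move=> [fd f2] U0.
have Up0 : U p0 by exact: nbhs_singleton.
pose D2 k l := 'D_(pair_basis l) ('D_(pair_basis k) f).
have : \forall q \near p0, U q /\
    forall k l, `|D2 k l q| <= `|D2 k l p0| + 1.
  apply: filterI => //.
  apply: (@filter_forall _ _ (fun k q => forall l, `|D2 k l q| <= `|D2 k l p0| + 1) (nbhs p0) _) => k.
  apply: (@filter_forall _ _ (fun l q => `|D2 k l q| <= `|D2 k l p0| + 1) (nbhs p0) _) => l.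
  have /(_ p0 Up0) cD := (f2 (pair_basis k)).2 (pair_basis l).
  by apply: (cvgr_norm_le (D2 k l p0)); [exact: cD|rewrite ltrDl].
move=> /nbhs_ballP[e /= e0 eB].
pose B := \sum_k \sum_l (`|D2 k l p0| + 1).
have B0 : 0 <= B by do 2!(apply: sumr_ge0 => ? _); rewrite addr_ge0.
have eU q : `|q - p0| < e -> U q.
  by move=> qe; apply: (eB q _).1; rewrite -ball_normE /ball_ /= distrC.
have eD q k l : `|q - p0| < e -> `|D2 k l q| <= B.
  move=> qe; apply: (@le_trans _ _ (`|D2 k l p0| + 1)).
    by apply: (eB q _).2; rewrite -ball_normE /ball_ /= distrC.
  apply: (@le_trans _ _ (\sum_l (`|D2 k l p0| + 1))).
    by apply: (@term_le_sum _ _ (fun l => `|D2 k l p0| + 1)) => j; rewrite addr_ge0.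
  apply: (@term_le_sum _ _ (fun k => \sum_l (`|D2 k l p0| + 1)) k) => j.
  by apply: sumr_ge0 => ? _; rewrite addr_ge0.
(* With radius e / 4 the points p + s a + t b stay within 3e / 4 of p0, inside the ball where U and
   the derivative bounds hold. *)
exists (e / 4), ((n + n)%:R * ((n + n)%:R * B)); split.
- by rewrite divr_gt0.
- by rewrite !mulr_ge0.
move=> p a b pr ar br.
have small (s t : R) : 0 <= s <= 1 -> 0 <= t <= 1 ->
    `|p + s *: a + t *: b - p0| < e.
  move=> /andP[s0 s1] /andP[t0 t1].
  have -> : p + s *: a + t *: b - p0 = (p - p0) + s *: a + t *: b.
    by rewrite addrAC [p + _ - _]addrAC.
  apply: (le_lt_trans (ler_normD _ _)).
  apply: (@le_lt_trans _ _ (e / 4 + e / 4 + e / 4)); last by lra.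
  apply: lerD; [apply: (le_trans (ler_normD _ _)); apply: lerD|] => //.
    by rewrite normrZ ger0_norm // (le_trans _ ar) // ler_piMl.
  by rewrite normrZ ger0_norm // (le_trans _ br) // ler_piMl.
have z01 : 0 <= (0 : R) <= 1 by rewrite lexx ler01.
have o01 : 0 <= (1 : R) <= 1 by rewrite lexx ler01.
pose g q := f (q + a) - f q.
have dfa (t : R) : 0 <= t <= 1 -> differentiable f (p + t *: b + a).
  move=> t01; apply: fd; apply: eU.
  by have := small 1 t o01 t01; rewrite scale1r [p + a + _]addrAC.
have df (t : R) : 0 <= t <= 1 -> differentiable f (p + t *: b).
  move=> t01; apply: fd; apply: eU.
  by have := small 0 t z01 t01; rewrite scale0r addr0.
have dsh (t : R) : 0 <= t <= 1 ->
    differentiable (fun q => f (q + a)) (p + t *: b).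
  move=> t01; apply: (differentiable_comp (f := fun q : V => q + a) (g := f)).
    by [].
  exact: dfa.
have -> : f (p + a + b) - f (p + a) - f (p + b) + f p = g (p + b) - g p.
  rewrite /g [p + b + a]addrAC opprB.
  by vring.
have := @increment_le g p b ((n + n)%:R * B * `|a|).
rewrite -!mulrA; apply => //; first by rewrite !mulr_ge0.
  by move=> t t01; apply: differentiableB; [exact: dsh|exact: df].
move=> t k t01.
have -> : 'D_(pair_basis k) g (p + t *: b) =
    'D_(pair_basis k) f (p + t *: b + a) - 'D_(pair_basis k) f (p + t *: b).
  rewrite /g -[LHS]/('D_(pair_basis k) ((fun q => f (q + a)) - f) _).
  have shE : 'D_(pair_basis k) (fun q => f (q + a)) (p + t *: b) =
      'D_(pair_basis k) f (p + t *: b + a).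
    rewrite /derive /=.
    rewrite [X in X @ _](_ : _ = (fun h : R => h^-1 *: ((f \o shift (p + t *: b + a))
      (h *: pair_basis k) - f (p + t *: b + a)))) //.
    by apply/funext => h /=; rewrite [RHS]/= !addrA.
  by rewrite deriveB ?shE //; [exact/diff_derivable/dsh|exact/diff_derivable/df].
rewrite mulrA; apply: (@increment_le ('D_(pair_basis k) f) (p + t *: b) a B B0) => [s s01|s l s01].
  apply: (f2 (pair_basis k)).1; apply: eU.
  by have := small s t s01 t01; rewrite [p + s *: a + _]addrAC.
by apply: eD; have := small s t s01 t01; rewrite [p + s *: a + _]addrAC.
Qed.
End SecondDifference.

Section LocalChart.
Variables (R : realType) (G : lieGroupType R).
Local Notation n := (@lie_dim R G).
Local Notation c1 := (@chart1 R G).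
Local Notation p0 := (c1 1%g).

Definition kap (x : 'rV[R]_n) : G := chart_inv c1 (x + p0).

Lemma chart1_atlas : lie_atlas c1.
Proof. exact: (svalP (cid (@lie_atlas_cover R G 1%g))).1. Qed.

Lemma chart1_dom1 : chart_dom c1 1%g.
Proof. exact: (svalP (cid (@lie_atlas_cover R G 1%g))).2. Qed.

Lemma kap0 : kap 0 = 1%g.
Proof. by rewrite /kap add0r chart_mapK //; exact: chart1_dom1. Qed.

Lemma chart1_im_nbhs : nbhs p0 (chart_im c1).
Proof.
apply: open_nbhs_nbhs; split; first exact: chart_im_open.
by exists 1%g => //; exact: chart1_dom1.
Qed.

Lemma chart_invK (v : 'rV[R]_n) : chart_im c1 v -> c1 (chart_inv c1 v) = v.
Proof. by move=> [x dx <-]; rewrite chart_mapK. Qed.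

Lemma norm_ball_nbhs (V : normedModType R) (p : V) (A : set V) :
  nbhs p A -> exists2 e : R, 0 < e & forall x, `|x - p| <= e -> A x.
Proof.
move=> /nbhs_ballP[e /= e0 eA]; exists (e / 2); first by rewrite divr_gt0.
move=> x xe; apply: eA; rewrite -ball_normE /ball_ /= distrC.
by apply: le_lt_trans xe _; lra.
Qed.

Definition mulU := [set p : 'rV[R]_n * 'rV[R]_n |
        [/\ chart_im c1 p.1, chart_im c1 p.2 &
            chart_dom c1 (chart_inv c1 p.1 * chart_inv c1 p.2)%g]].

Lemma mulU_nbhs : nbhs (p0, p0) mulU.
Proof.
have ci : {for p0, continuous (chart_inv c1)}.
  by apply: chart_inv_continuous; exact: nbhs_singleton chart1_im_nbhs.
have e1 : chart_inv c1 p0 = 1%g by rewrite chart_mapK //; exact: chart1_dom1.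
have hm : (fun p : 'rV[R]_n * 'rV[R]_n => (chart_inv c1 p.1 * chart_inv c1 p.2)%g) @ (p0, p0)
    --> (1%g : G).
  have h2 : (fun p : 'rV[R]_n * 'rV[R]_n => (chart_inv c1 p.1, chart_inv c1 p.2)) @ (p0, p0)
      --> (1%g : G, 1%g : G).
    have ci1 : chart_inv c1 @ p0 --> (1%g : G) by move: ci; rewrite /prop_for /= /continuous_at e1.
    apply: cvg_pair.
      exact: (cvg_comp fst (chart_inv c1) cvg_fst ci1).
    exact: (cvg_comp snd (chart_inv c1) cvg_snd ci1).
  have h3 : (fun p : G * G => (p.1 * p.2)%g) @ ((1%g, 1%g) : G * G) --> (1%g : G).
    have := @lie_mul_continuous R G (1%g, 1%g).
    by rewrite /continuous_at /= (mulg1 1%g).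
  exact: (cvg_comp _ _ h2 h3).
have d1 : nbhs (1%g : G) (chart_dom c1).
  by apply: open_nbhs_nbhs; split; [exact: chart_dom_open|exact: chart1_dom1].
have hd := hm _ d1.
have h1 : nbhs ((p0, p0) : 'rV[R]_n * 'rV[R]_n) (fun p => chart_im c1 p.1).
  by exists (chart_im c1, setT) => [|[p q] []//]; split; [exact: chart1_im_nbhs|exact: filterT].
have h2 : nbhs ((p0, p0) : 'rV[R]_n * 'rV[R]_n) (fun p => chart_im c1 p.2).
  by exists (setT, chart_im c1) => [|[p q] []//]; split; [exact: filterT|exact: chart1_im_nbhs].
apply: filterS (filterI (filterI h1 h2) hd).
by move=> p [[? ?] ?]; split.
Qed.

Definition kmul (x y : 'rV[R]_n) : 'rV[R]_n := c1 (kap x * kap y)%g - p0.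

Lemma local_chart : exists r C : R, [/\ 0 < r, 0 <= C,
  forall x, `|x| <= r -> c1 (kap x) - p0 = x /\ {for x, continuous kap},
  forall x y, `|x| <= r -> `|y| <= r -> (kap x * kap y)%g = kap (kmul x y) &
  (forall x x' y, `|x| <= r -> `|x'| <= r -> `|y| <= r ->
     `|kmul x y - kmul x' y - (x - x')| <= C * `|x - x'| * `|y|) /\
  (forall x y y', `|x| <= r -> `|y| <= r -> `|y'| <= r ->
     `|kmul x y - kmul x y' - (y - y')| <= C * `|x| * `|y - y'|)].
Proof.
have [r1 r10 r1U] := norm_ball_nbhs mulU_nbhs.
have [r2 [C [r20 C0 sd]]] := second_difference_le
  (@lie_mul_smooth _ _ _ _ _ chart1_atlas chart1_atlas chart1_atlas 2%N) mulU_nbhs.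
have r1E x y : `|x| <= r1 -> `|y| <= r1 -> mulU (x + p0, y + p0).
  move=> xr yr; apply: r1U.
  rewrite (_ : _ - _ = (x, y)); last by congr pair; rewrite /= addrK.
  by rewrite prod_normE ge_max xr.
have r1n : `|0 : 'rV[R]_n| <= r1 by rewrite normr0 ltW.
have cK x : `|x| <= r1 -> c1 (kap x) - p0 = x.
  by move=> xr; have [h _ _] := r1E x 0 xr r1n; rewrite /kap chart_invK ?addrK.
exists (Num.min r1 (r2 / 2)), C.
have rle x : `|x| <= Num.min r1 (r2 / 2) -> `|x| <= r1 /\ `|x| <= r2 / 2.
  by rewrite le_min => /andP[].
split => //.
- by rewrite lt_min r10 divr_gt0.
- move=> x /rle[xr _]; split; first exact: cK.
  have [h _ _] := r1E x 0 xr r1n.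
  have := chart_inv_continuous h => hc.
  have hs : continuous (fun x : 'rV[R]_n => x + p0).
    by move=> z; apply: (@cvgD _ _ _ (nbhs z) _ id (cst p0)); [exact: cvg_id|exact: cvg_cst].
  exact: (cvg_comp (fun x => x + p0) (chart_inv c1) (hs x) hc).
- move=> x y /rle[xr _] /rle[yr _].
  have [_ _ h] := r1E x y xr yr.
  by rewrite {3}/kap /kmul subrK chart_mapK.
have k0 x : `|x| <= r1 -> kmul x 0 = x by move=> xr; rewrite /kmul kap0 mulg1 cK.
have k0' x : `|x| <= r1 -> kmul 0 x = x by move=> xr; rewrite /kmul kap0 mul1g cK.
have r2h (x y : 'rV[R]_n) : `|x| <= r2 / 2 -> `|y| <= r2 / 2 -> `|x - y| <= r2.
  by move=> xr yr; rewrite (le_trans (ler_normB _ _)) // [leRHS]splitr lerD.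
split.
- move=> x x' y /rle[xr xs] /rle[x'r x's] /rle[yr ys].
  have := sd (x' + p0, p0) (x - x', 0) (0, y).
  rewrite (_ : (x' + p0, p0) - _ = (x', 0)); last by congr pair; rewrite /= ?addrK ?subrr.
  rewrite !prod_normE /= normr0 [Num.max _ 0]max_l // [Num.max `|x - _| 0]max_l //.
  rewrite [Num.max 0 _]max_r //.
  have a1 : `|x'| <= r2 by move: x's r20; lra.
  have a2 : `|y| <= r2 by move: ys r20; lra.
  move=> /(_ a1 (r2h _ _ xs x's) a2); congr (`|_| <= _).
  rewrite /=.
  have -> : x' + p0 + (x - x') + 0 = x + p0 by vring.
  have -> : x' + p0 + (x - x') = x + p0 by vring.
  rewrite !addr0 [p0 + y]addrC.
  have -> : x - x' = kmul x 0 - kmul x' 0 by rewrite !k0.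
  rewrite /kmul /kap !add0r.
  by vring.
- move=> x y y' /rle[xr xs] /rle[yr ys] /rle[y'r y's].
  have := sd (p0, y' + p0) (x, 0) (0, y - y').
  rewrite (_ : (p0, y' + p0) - _ = (0, y')); last by congr pair; rewrite /= ?addrK ?subrr.
  rewrite !prod_normE /= normr0 [Num.max _ 0]max_l // [Num.max 0 _]max_r //.
  rewrite [Num.max 0 _]max_r //.
  have a1 : `|y'| <= r2 by move: y's r20; lra.
  have a2 : `|x| <= r2 by move: xs r20; lra.
  move=> /(_ a1 a2 (r2h _ _ ys y's)); congr (`|_| <= _).
  rewrite /=.
  have -> : y' + p0 + 0 + (y - y') = y + p0 by vring.
  have -> : y' + p0 + (y - y') = y + p0 by vring.
  rewrite !addr0 [p0 + x]addrC.
  have -> : y - y' = kmul 0 y - kmul 0 y' by rewrite !k0'.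
  rewrite /kmul /kap !add0r.
  by vring.
Qed.
End LocalChart.

Section Limits.
Variable R : realType.

Lemma half_expS (K : R) k : K / 2 ^+ k.+1 = K / 2 ^+ k / 2.
Proof. by rewrite exprS invfM mulrA mulrAC. Qed.

Lemma le_half_exp (a b K : R) : (forall k, a <= b + K / 2 ^+ k) -> a <= b.
Proof.
move=> h; rewrite leNgt; apply/negP => ba.
have K0 : 0 < K by have := h 0%N; rewrite expr0 divr1; lra.
have d0 : 0 < a - b by rewrite subr_gt0.
have [k kd] : exists k : nat, K < (a - b) * 2 ^+ k.
  exists (Num.truncn (K / (a - b))).+1.
  rewrite -ltr_pdivrMl // mulrC.
  apply: lt_le_trans (truncnS_gt _) _.
  by rewrite -natrX ler_nat ltnW // ltn_expl.
have := h k; rewrite -lerBlDl ler_pdivlMr ?exprn_gt0 //.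
by rewrite leNgt kd.
Qed.

Lemma le_harmonic (a b K : R) : (forall k : nat, a <= b + K / k.+1%:R) -> a <= b.
Proof.
move=> h; rewrite leNgt; apply/negP => ba.
have K0 : 0 < K by have := h 0%N; rewrite divr1; lra.
have d0 : 0 < a - b by rewrite subr_gt0.
have := h (Num.truncn (K / (a - b))).
rewrite -lerBlDl ler_pdivlMr ?ltr0n //.
rewrite leNgt => /negP; apply.
by rewrite -ltr_pdivrMl // mulrC truncnS_gt.
Qed.

Lemma norm_half_exp0 (V : normedModType R) (x : V) (K : R) :
  (forall k, `|x| <= K / 2 ^+ k) -> x = 0.
Proof.
move=> h; apply/eqP; rewrite -normr_eq0; apply/eqP/le_anti.
by rewrite normr_ge0 andbT; apply: (@le_half_exp _ _ K) => k; rewrite add0r.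
Qed.

Lemma norm_harmonic0 (V : normedModType R) (x : V) (K : R) :
  (forall k : nat, `|x| <= K / k.+1%:R) -> x = 0.
Proof.
move=> h; apply/eqP; rewrite -normr_eq0; apply/eqP/le_anti.
by rewrite normr_ge0 andbT; apply: (@le_harmonic _ _ K) => k; rewrite add0r.
Qed.

(** The limit is the supremum of the lower ends of the nested intervals of radius 2K / 2^k around u
    k. *)
Lemma geometric_limit (u : nat -> R) (K : R) :
  (forall k, `|u k.+1 - u k| <= K / 2 ^+ k) ->
  exists l, forall k, `|u k - l| <= 2 * K / 2 ^+ k.
Proof.
move=> h.
have step k j : `|u (k + j)%N - u k| <= 2 * K / 2 ^+ k - 2 * K / 2 ^+ (k + j).
  elim: j => [|j IH]; first by rewrite addn0 !subrr normr0.
  rewrite addnS -(subrKA (u (k + j)%N)); apply: le_trans (ler_normD _ _) _.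
  by have := h (k + j)%N; rewrite half_expS; move: IH; lra.
have K0 : 0 <= K.
  by have := h 0%N; rewrite expr0 divr1; apply: le_trans.
have Kk k : 0 <= 2 * K / 2 ^+ k by rewrite divr_ge0 ?mulr_ge0 ?exprn_ge0.
have sep k j : u j - 2 * K / 2 ^+ j <= u k + 2 * K / 2 ^+ k.
  have [jk|jk] := leqP j k.
    have := step j (k - j)%N; rewrite subnKC // ler_distl => /andP[].
    by have := Kk k; lra.
  have := step k (j - k)%N; rewrite (subnKC (ltnW jk)) ler_distl => /andP[].
  by have := Kk j; lra.
pose E := [set x | exists k, x = u k - 2 * K / 2 ^+ k].
have Esup : has_sup E.
  split; first by exists (u 0%N - 2 * K / 2 ^+ 0); exists 0%N.
  by exists (u 0%N + 2 * K / 2 ^+ 0) => _ [k ->]; exact: sep.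
exists (sup E) => k; rewrite ler_distlC; apply/andP; split.
  by apply: ub_le_sup; [exact: Esup.2|exists k].
by apply: ge_sup; [exact: Esup.1|move=> _ [j ->]; exact: sep].
Qed.

Lemma row_norm_coord k (x : 'rV[R]_k) i : `|x 0 i| <= `|x|.
Proof. by rewrite /Num.Def.normr /= mx_normrE; apply: (le_bigmax _ _ (0, i)). Qed.

Lemma row_norm_bound k (x : 'rV[R]_k) (B : R) : 0 <= B ->
  (forall i, `|x 0 i| <= B) -> `|x| <= B.
Proof.
move=> B0 xB; rewrite /Num.Def.normr /= mx_normrE.
by apply: bigmax_le => // -[i j] _ /=; rewrite (ord1 i).
Qed.

Lemma geometric_limit_row n (u : nat -> 'rV[R]_n) (K : R) :
  (forall k, `|u k.+1 - u k| <= K / 2 ^+ k) ->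
  exists l, forall k, `|u k - l| <= 2 * K / 2 ^+ k.
Proof.
move=> h.
have K0 : 0 <= K by have := h 0%N; rewrite expr0 divr1; apply: le_trans.
have /choice[l lP] i : exists l, forall k, `|u k 0 i - l| <= 2 * K / 2 ^+ k.
  apply: geometric_limit => k; apply: le_trans (h k).
  by have := row_norm_coord (u k.+1 - u k) i; rewrite !mxE.
exists (\row_i l i) => k; apply: row_norm_bound.
  by rewrite divr_ge0 ?mulr_ge0 ?exprn_ge0.
by move=> i; rewrite !mxE.
Qed.
End Limits.

(** * The exponential of a local group law close to addition *)

Section LocalExp.
Variables (R : realType) (X : groupType) (n : nat).
Local Notation V := 'rV[R]_n.
Variables (kap : V -> X) (m : V -> V -> V) (r C r1 : R).
Hypotheses (r0 : 0 < r) (C0 : 0 <= C) (r10 : 0 < r1) (Cr1 : 2 * C * r1 <= 1)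
  (rr1 : 2 * r1 <= r).
Hypothesis kap0 : kap 0 = 1%g.
Hypothesis kapI : forall x y, `|x| <= r -> `|y| <= r -> kap x = kap y -> x = y.
Hypothesis kapM : forall x y, `|x| <= r -> `|y| <= r ->
  (kap x * kap y)%g = kap (m x y).
Hypothesis mx0 : forall x, `|x| <= r -> m x 0 = x.
Hypothesis m0x : forall x, `|x| <= r -> m 0 x = x.
Hypothesis mL : forall x x' y, `|x| <= r -> `|x'| <= r -> `|y| <= r ->
  `|m x y - m x' y - (x - x')| <= C * `|x - x'| * `|y|.
Hypothesis mR : forall x y y', `|x| <= r -> `|y| <= r -> `|y'| <= r ->
  `|m x y - m x y' - (y - y')| <= C * `|x| * `|y - y'|.
Hypothesis kapV : forall eps : R, 0 < eps ->
  exists2 rho : R, 0 < rho & forall x, `|x| <= rho ->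
  exists2 y, `|y| <= eps & (kap x * kap y)%g = 1%g.

Fixpoint pw (x : V) (j : nat) : V := if j is j'.+1 then m (pw x j') x else 0.

Lemma pw0 j : pw 0 j = 0.
Proof. by elim: j => //= j ->; rewrite mx0 // normr0 ltW. Qed.

(** The size bound is the Lipschitz bound with y = 0, but the induction needs it as well: it keeps
    the j-th powers in the ball where [mL] and [mR] hold for the step to j + 1. *)
Lemma pw_lip_bound (rho : R) j x y : `|x| <= rho -> `|y| <= rho -> j%:R * rho <= r1 ->
  `|pw x j - pw y j - j%:R *: (x - y)| <= 2 * C * j%:R ^+ 2 * rho * `|x - y|
  /\ `|pw x j| <= 2 * j%:R * rho.
Proof.
have Cj (J : R) : J * rho <= r1 -> 2 * C * (J * rho) <= 1.
  move=> h; apply: le_trans Cr1; apply: ler_wpM2l => //; exact: mulr_ge0.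
move=> xr yr jr; have rho0 : 0 <= rho := le_trans (normr_ge0 x) xr.
have main : forall j x y, `|x| <= rho -> `|y| <= rho -> j%:R * rho <= r1 ->
    `|pw x j - pw y j - j%:R *: (x - y)| <= 2 * C * j%:R ^+ 2 * rho * `|x - y|.
  clear j x y xr yr jr; elim=> [|j IH] x y xr yr jr.
    by rewrite /= scale0r !subr0 normr0 expr0n !mulr0 !mul0r.
  set J : R := j%:R.
  have J0 : 0 <= J by exact: ler0n.
  have jr' : J * rho <= r1.
    by apply: le_trans jr; rewrite ler_wpM2r // ler_nat.
  have CJ := Cj _ jr'.
  have norm2 z w : `|z| <= rho -> `|w| <= rho -> `|pw z j - pw w j| <= 2 * J * `|z - w|.
    move=> zr wr; have h := IH z w zr wr jr'.
    rewrite -(subrK (J *: (z - w)) (pw z j - pw w j)).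
    apply: le_trans (ler_normD _ _) _; rewrite normrZ (ger0_norm J0).
    apply: le_trans (lerD h (lexx _)) _.
    rewrite [leRHS](_ : _ = 1 * (J * `|z - w|) + J * `|z - w|); last by ring.
    rewrite lerD2r -/J.
    rewrite (_ : _ * `|z - w| = (2 * C * (J * rho)) * (J * `|z - w|)); last by ring.
    by rewrite ler_wpM2r // mulr_ge0.
  have norm1 z : `|z| <= rho -> `|pw z j| <= 2 * J * rho.
    move=> zr; have := norm2 z 0 zr; rewrite pw0 !subr0 normr0 => /(_ rho0).
    by move=> h; apply: le_trans h _; rewrite ler_wpM2l // mulr_ge0.
  have small z : `|z| <= rho -> `|pw z j| <= r.
    move=> zr; apply: le_trans (norm1 z zr) _; rewrite -mulrA.
    by apply: le_trans rr1; rewrite ler_wpM2l.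
  have rhor : rho <= r.
    apply: le_trans (_ : r1 <= r); last by move: rr1 r10; lra.
    by apply: le_trans jr; rewrite ler_peMl // ler1n.
  have xr' := le_trans xr rhor; have yr' := le_trans yr rhor.
  have e : pw x j.+1 - pw y j.+1 - j.+1%:R *: (x - y) =
    (m (pw x j) x - m (pw y j) x - (pw x j - pw y j)) +
    (m (pw y j) x - m (pw y j) y - (x - y)) +
    (pw x j - pw y j - J *: (x - y)).
    by rewrite /= -natr1 /J; vring.
  rewrite e; clear e.
  apply: (@le_trans _ _ (C * (2 * J * `|x - y|) * rho + C * (2 * J * rho) * `|x - y|
    + 2 * C * J ^+ 2 * rho * `|x - y|)).
    apply: le_trans (ler_normD _ _) _; apply: lerD; last exact: IH.
    apply: le_trans (ler_normD _ _) _; apply: lerD.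
      apply: le_trans (mL (small x xr) (small y yr) xr') _.
      apply: ler_pM => //; first by rewrite mulr_ge0.
      by apply: ler_wpM2l => //; exact: norm2.
    apply: le_trans (mR (small y yr) xr' yr') _.
    by apply: ler_wpM2r => //; apply: ler_wpM2l => //; exact: norm1.
  rewrite -natr1 -/J.
  rewrite -subr_ge0.
  (* The step costs 4 C J rho |x - y|, while the factor 2 C J^2 grows by 2 C (2 J + 1); the
     difference is what is left over. *)
  rewrite (_ : _ - _ = 2 * C * rho * `|x - y|); last by ring.
  by rewrite !mulr_ge0.
split; first exact: main.
have h := main j x 0 xr _ jr; rewrite pw0 !subr0 normr0 in h.
rewrite -(subrK (j%:R *: x) (pw x j)).
apply: le_trans (ler_normD _ _) _.
apply: le_trans (lerD (h rho0) (lexx _)) _.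
rewrite normrZ ger0_norm //.
apply: (@le_trans _ _ (1 * (j%:R * `|x|) + j%:R * `|x|)).
  rewrite lerD2r.
  rewrite [leLHS](_ : _ = (2 * C * (j%:R * rho)) * (j%:R * `|x|)); last by ring.
  by rewrite ler_wpM2r ?mulr_ge0 // Cj.
rewrite [leLHS](_ : _ = 2 * j%:R * `|x|); last by ring.
by rewrite ler_wpM2l // mulr_ge0.
Qed.

Lemma pw_lip (rho : R) j x y : `|x| <= rho -> `|y| <= rho -> j%:R * rho <= r1 ->
  `|pw x j - pw y j - j%:R *: (x - y)| <= 2 * C * j%:R ^+ 2 * rho * `|x - y|.
Proof. by move=> a b c; have [] := pw_lip_bound a b c. Qed.

Lemma pw_le j x : j%:R * `|x| <= r1 -> `|pw x j| <= 2 * j%:R * `|x|.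
Proof. by move=> c; have [] := pw_lip_bound (lexx _) (lexx _) c. Qed.

Lemma pw_small j x : j%:R * `|x| <= r1 -> `|pw x j| <= r.
Proof.
by move=> c; apply: le_trans (pw_le c) _; rewrite -mulrA; move: c rr1; lra.
Qed.

Lemma pw_near j x : j%:R * `|x| <= r1 ->
  `|pw x j - j%:R *: x| <= 2 * C * j%:R ^+ 2 * `|x| ^+ 2.
Proof.
move=> c; have z : `|0 : V| <= `|x| by rewrite normr0.
by have := pw_lip (lexx _) z c; rewrite pw0 !subr0 => h; rewrite [`|x| ^+ 2]expr2 mulrA.
Qed.

Lemma pw_lip2 (rho : R) j x y : `|x| <= rho -> `|y| <= rho -> j%:R * rho <= r1 ->
  `|pw x j - pw y j| <= 2 * j%:R * `|x - y|.
Proof.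
move=> xr yr jr.
rewrite -(subrK (j%:R *: (x - y)) (pw x j - pw y j)).
apply: le_trans (ler_normD _ _) _; rewrite normrZ ger0_norm //.
apply: le_trans (lerD (pw_lip xr yr jr) (lexx _)) _.
rewrite [leRHS](_ : _ = 1 * (j%:R * `|x - y|) + j%:R * `|x - y|); last by ring.
rewrite lerD2r.
rewrite [leLHS](_ : _ = (2 * C * (j%:R * rho)) * (j%:R * `|x - y|)); last by ring.
rewrite ler_wpM2r // ?mulr_ge0 //; apply: le_trans Cr1.
by rewrite ler_wpM2l // mulr_ge0.
Qed.

Lemma le_r1_r (x : V) : `|x| <= r1 -> `|x| <= r.
Proof. by move: rr1 r10; lra. Qed.

Lemma kap_pw j x : j%:R * `|x| <= r1 -> kap (pw x j) = (kap x ^+ j)%g.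
Proof.
elim: j => [|j IH] jx; first by rewrite /= expg0 kap0.
have jx' : j%:R * `|x| <= r1.
  by apply: le_trans jx; rewrite ler_wpM2r // ler_nat.
rewrite /= expgSr -IH // kapM //; first exact: pw_small.
apply: le_r1_r; apply: le_trans jx.
by rewrite ler_peMl // ler1n.
Qed.

(** Both sides are the same power in the group, and both are small enough for the injectivity of
    [kap]. *)
Lemma pw_comp j k x : 2 * (j * k)%:R * `|x| <= r1 -> pw (pw x j) k = pw x (j * k).
Proof.
move=> h; have [->|k0] := posnP k; first by rewrite muln0.
have jk : (j * k)%:R * `|x| <= r1.
  by apply: le_trans h; rewrite ler_wpM2r // ler_peMl // ler1n.
have jx : j%:R * `|x| <= r1.
  by apply: le_trans jk; rewrite ler_wpM2r // ler_nat leq_pmulr.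
have kj : k%:R * `|pw x j| <= r1.
  apply: le_trans h; rewrite natrM mulrA mulrAC -mulrA [leRHS]mulrC.
  rewrite [leRHS](_ : _ = k%:R * (2 * j%:R * `|x|)); last by ring.
  by apply: ler_wpM2l => //; apply: pw_le.
apply: kapI; [exact: pw_small|exact: pw_small|].
by rewrite kap_pw // kap_pw // kap_pw // expgnA.
Qed.

Definition dy (v : V) (k : nat) : V := (2 ^+ k)^-1 *: v.
Definition u (v : V) (k : nat) : V := pw (dy v k) (2 ^ k).

Lemma norm_dy v k : `|dy v k| = `|v| / 2 ^+ k.
Proof. by rewrite normrZ ger0_norm ?invr_ge0 ?exprn_ge0 // mulrC. Qed.

Lemma natr_exp2 k : (2 ^ k)%:R = 2 ^+ k :> R.
Proof. by rewrite natrX. Qed.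

Lemma mul_exp2_dy k (a : R) : 2 ^+ k * (a / 2 ^+ k) = a.
Proof. by rewrite mulrC divfK // expf_neq0. Qed.

Lemma div_exp2_le (a : R) k : 0 <= a -> a / 2 ^+ k <= a.
Proof. by move=> a0; rewrite ler_pdivrMr ?exprn_gt0 // ler_peMr // exprn_ege1 // ler1n. Qed.

(** With h = v / 2^(k+1), the two terms are the 2^k-th powers of [pw h 2] and of 2h. These points
    differ by O(|h|^2), and taking 2^k-th powers multiplies the distance by at most 2 * 2^k. *)
Lemma u_step v k : 2 * `|v| <= r1 -> `|u v k.+1 - u v k| <= 4 * C * `|v| ^+ 2 / 2 ^+ k.
Proof.
move=> vr.
set h := dy v k.+1.
have q0 : (2 ^+ k : R) != 0 by rewrite expf_neq0.
have hn : `|h| = `|v| / 2 ^+ k / 2 by rewrite norm_dy half_expS.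
have h2 : dy v k = 2%:R *: h.
  by rewrite /h /dy scalerA exprS invfM mulrA divff // mul1r.
have bq : 2 ^+ k * `|h| = `|v| / 2 by rewrite hn; field.
have p2 : `|pw h 2| <= 4 * `|h|.
  have := @pw_le 2 h; rewrite (_ : 2 * 2%:R = 4 :> R); last by ring.
  apply; apply: le_trans vr; rewrite ler_pM2l // hn.
  have : `|v| / 2 ^+ k <= `|v|.
    exact: div_exp2_le.
  by have := normr_ge0 v; lra.
have -> : u v k.+1 = pw (pw h 2) (2 ^ k).
  rewrite pw_comp; first by rewrite -expnS.
  rewrite natrM natr_exp2 (_ : _ * `|h| = 4 * (2 ^+ k * `|h|)); last by ring.
  by rewrite bq; move: vr; lra.
rewrite /u h2.
have rho : (2 ^ k)%:R * (4 * `|h|) <= r1.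
  by rewrite natr_exp2 mulrCA bq; move: vr; lra.
apply: le_trans (pw_lip2 p2 _ rho) _.
  by rewrite normrZ ger0_norm // ler_wpM2r // ler_nat.
have n2 : `|pw h 2 - 2%:R *: h| <= 2 * C * 2%:R ^+ 2 * `|h| ^+ 2.
  apply: pw_near; apply: le_trans rho; rewrite mulrA ler_wpM2r //.
  rewrite -[leLHS]mul1r; apply: ler_pM => //; last by rewrite ler_nat.
  by rewrite natr_exp2 exprn_ege1 // ler1n.
apply: le_trans (ler_wpM2l _ n2) _; first by rewrite mulr_ge0.
rewrite natr_exp2 hn le_eqVlt; apply/orP; left; apply/eqP; field.
by rewrite q0.
Qed.

Lemma expP : exists e : V -> V, forall v, 2 * `|v| <= r1 ->
  forall k, `|u v k - e v| <= 8 * C * `|v| ^+ 2 / 2 ^+ k.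
Proof.
have /choice[e eP] v : exists l : V, 2 * `|v| <= r1 ->
    forall k, `|u v k - l| <= 8 * C * `|v| ^+ 2 / 2 ^+ k.
  have [vr|_] := leP (2 * `|v|) r1; last by exists 0.
  have [l lP] := geometric_limit_row (fun k => u_step k vr).
  exists l => _ k; apply: le_trans (lP k) _.
  rewrite le_eqVlt; apply/orP; left; apply/eqP; congr (_ / _); ring.
by exists e.
Qed.

Definition e := sval (cid expP).

Lemma e_lim v k : 2 * `|v| <= r1 -> `|u v k - e v| <= 8 * C * `|v| ^+ 2 / 2 ^+ k.
Proof. by move=> vr; exact: (svalP (cid expP)). Qed.

Lemma e_lip (rho : R) v w : `|v| <= rho -> `|w| <= rho -> 2 * rho <= r1 ->
  `|e v - e w - (v - w)| <= 2 * C * rho * `|v - w|.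
Proof.
move=> vr wr rr.
have v2 : 2 * `|v| <= r1 by move: vr rr; lra.
have w2 : 2 * `|w| <= r1 by move: wr rr; lra.
have rho0 : 0 <= rho := le_trans (normr_ge0 v) vr.
apply: (@le_half_exp _ _ _ (8 * C * `|v| ^+ 2 + 8 * C * `|w| ^+ 2)) => k.
have q0 : (2 ^+ k : R) != 0 by rewrite expf_neq0.
have q1 : 0 < (2 ^+ k : R) by rewrite exprn_gt0.
have := @pw_lip (rho / 2 ^+ k) (2 ^ k) (dy v k) (dy w k).
rewrite !norm_dy natr_exp2 mul_exp2_dy !ler_pM2r ?invr_gt0 // => /(_ vr wr).
have -> : dy v k - dy w k = dy (v - w) k by rewrite /dy scalerBr.
have -> : 2 ^+ k *: dy (v - w) k = v - w by rewrite /dy scalerA divff // scale1r.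
rewrite norm_dy -/(u v k) -/(u w k) => h1.
have {}h1 : `|u v k - u w k - (v - w)| <= 2 * C * rho * `|v - w|.
  apply: le_trans (h1 _) _; first by move: rr rho0; lra.
  by rewrite le_eqVlt; apply/orP; left; apply/eqP; field.
have -> : e v - e w - (v - w) = (u v k - u w k - (v - w)) + (- (u v k - e v) + (u w k - e w)).
  by vring.
apply: le_trans (ler_normD _ _) _; apply: lerD => //.
apply: le_trans (ler_normD _ _) _; rewrite normrN mulrDl.
by apply: lerD; exact: e_lim.
Qed.

Lemma e0 : e 0 = 0.
Proof.
have z : 2 * `|0 : V| <= r1 by rewrite normr0 mulr0 ltW.
have := e_lim 0 z; rewrite normr0 expr0n mulr0 mul0r.
rewrite /u /dy scaler0 pw0 sub0r normrN normr_le0 => /eqP //.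
Qed.

Lemma e_near v : 2 * `|v| <= r1 -> `|e v - v| <= 2 * C * `|v| ^+ 2.
Proof.
move=> vr; have := @e_lip `|v| v 0 (lexx _); rewrite normr0 e0 !subr0.
by move=> /(_ (normr_ge0 _) vr); rewrite expr2 mulrA.
Qed.

Lemma Cr_le (a : R) : 0 <= a -> a <= r1 -> 2 * C * a <= 1.
Proof. by move=> a0 ar; apply: le_trans Cr1; rewrite ler_wpM2l // mulr_ge0. Qed.

Lemma e_lip2 v w : 2 * `|v| <= r1 -> 2 * `|w| <= r1 -> `|e v - e w| <= 2 * `|v - w|.
Proof.
move=> vr wr; rewrite -(subrK (v - w) (e v - e w)).
apply: le_trans (ler_normD _ _) _; rewrite mulrDl mul1r lerD2r.
apply: le_trans (@e_lip (r1 / 2) _ _ _ _ _) _; [by move: vr; lra|by move: wr; lra|by lra|].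
rewrite -[leRHS]mul1r ler_wpM2r // Cr_le //; first by rewrite divr_ge0 // ltW.
by move: r10; lra.
Qed.

Lemma e_le v : 2 * `|v| <= r1 -> `|e v| <= 2 * `|v|.
Proof.
move=> vr; have z : 2 * `|0 : V| <= r1 by rewrite normr0 mulr0 ltW.
by have := e_lip2 vr z; rewrite e0 !subr0.
Qed.

(** Any point within O(4^-k) of v / 2^k can replace it in the limit that defines [e]. This gives the
    behaviour of [e] on multiples and on opposites. *)
Lemma e_approx v x k (K : R) : 2 * `|v| <= r1 -> `|x| <= r1 / 2 ^+ k ->
  `|x - dy v k| <= K / 2 ^+ k / 2 ^+ k ->
  `|pw x (2 ^ k) - e v| <= (2 * K + 8 * C * `|v| ^+ 2) / 2 ^+ k.
Proof.
move=> vr xr xK; rewrite mulrDl -(subrKA (u v k)).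
apply: le_trans (ler_normD _ _) _; apply: lerD; last exact: e_lim.
have q1 : 0 < (2 ^+ k : R) by rewrite exprn_gt0.
apply: le_trans (@pw_lip2 (r1 / 2 ^+ k) _ _ _ xr _ _) _.
- by rewrite norm_dy ler_pM2r ?invr_gt0 //; move: vr (normr_ge0 v); lra.
- by rewrite natr_exp2 mul_exp2_dy.
rewrite natr_exp2; apply: le_trans (ler_wpM2l _ xK) _; first by rewrite mulr_ge0 ?ltW.
by rewrite le_eqVlt; apply/orP; left; apply/eqP; field; rewrite expf_neq0.
Qed.

(** Powers of one element commute, so the j-th power of [u v k] is the 2^k-th power of
    [pw (dy v k) j], a point within O(4^-k) of j v / 2^k. *)
Lemma e_pw v j : (0 < j)%N -> 2 * j%:R * `|v| <= r1 -> pw (e v) j = e (j%:R *: v).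
Proof.
move=> j0 jv.
have j1 : 1 <= j%:R :> R by rewrite ler1n.
have vr : 2 * `|v| <= r1.
  by apply: le_trans jv; rewrite ler_wpM2r // ler_peMr.
have jvr : 2 * `|j%:R *: v| <= r1 by rewrite normrZ ger0_norm // mulrA.
apply/eqP; rewrite -subr_eq0; apply/eqP.
apply: (@norm_half_exp0 _ _ _ (2 * j%:R * (8 * C * `|v| ^+ 2) +
  (2 * (2 * C * j%:R ^+ 2 * `|v| ^+ 2) + 8 * C * `|j%:R *: v| ^+ 2))) => k.
have q1 : 0 < (2 ^+ k : R) by rewrite exprn_gt0.
have jr : j%:R * (2 * `|v|) <= r1 by rewrite mulrCA mulrA.
have uv : `|u v k| <= 2 * `|v|.
  apply: le_trans (pw_le _) _; rewrite norm_dy natr_exp2 ?mul_exp2_dy //.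
    by move: vr (normr_ge0 v); lra.
  by rewrite -mulrA mul_exp2_dy.
have e1 : pw (u v k) j = pw (pw (dy v k) j) (2 ^ k).
  rewrite /u !pw_comp ?(mulnC j) // natrM norm_dy natr_exp2.
    by rewrite (_ : _ * _ = 2 * j%:R * `|v|) //; field; rewrite expf_neq0.
  by rewrite (_ : _ * _ = 2 * j%:R * `|v|) //; field; rewrite expf_neq0.
rewrite mulrDl -(subrKA (pw (u v k) j)).
apply: le_trans (ler_normD _ _) _; apply: lerD.
  apply: le_trans (pw_lip2 (e_le vr) uv jr) _.
  by rewrite -[leRHS]mulrA ler_wpM2l ?mulr_ge0 // distrC; exact: e_lim.
have jd : j%:R * `|dy v k| <= r1 / 2 ^+ k / 2.
  by rewrite norm_dy mulrA -[leRHS]mulrA [_ / 2]mulrC mulrA ler_pM2r ?invr_gt0 //; move: jv; lra.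
have jd' : r1 / 2 ^+ k <= r1.
  exact: div_exp2_le (ltW r10).
have jd'' : j%:R * `|dy v k| <= r1 by move: jd jd' (mulr_ge0 (ler0n R j) (normr_ge0 (dy v k))); lra.
rewrite e1; apply: e_approx => //.
  by apply: le_trans (pw_le jd'') _; move: jd; lra.
rewrite (_ : dy (j%:R *: v) k = j%:R *: dy v k); last first.
  by rewrite /dy !scalerA mulrC.
apply: le_trans (pw_near jd'') _; rewrite norm_dy.
by rewrite le_eqVlt; apply/orP; left; apply/eqP; field; rewrite expf_neq0.
Qed.

Lemma kap_e_nat v j : 2 * j%:R * `|v| <= r1 -> (kap (e v) ^+ j)%g = kap (e (j%:R *: v)).
Proof.
move=> jv; have [->|j0] := posnP j; first by rewrite expg0 scale0r e0 kap0.
have j1 : 1 <= j%:R :> R by rewrite ler1n.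
have vr : 2 * `|v| <= r1.
  by apply: le_trans jv; rewrite ler_wpM2r // ler_peMr.
rewrite -e_pw // kap_pw //; apply: le_trans jv; rewrite -[leRHS]mulrA [leRHS]mulrCA.
by rewrite ler_wpM2l // e_le.
Qed.

Lemma m_near x y : `|x| <= r -> `|y| <= r -> `|m x y - (x + y)| <= C * `|x| * `|y|.
Proof.
move=> xr yr; have z : `|0 : V| <= r by rewrite normr0 ltW.
by have := mR xr yr z; rewrite mx0 // !subr0 -addrA -opprD.
Qed.

Lemma m_near2 x y : `|x| <= r1 -> `|y| <= r -> `|m x y - (x + y)| <= `|y| / 2.
Proof.
move=> xr yr; apply: le_trans (m_near (le_r1_r xr) yr) _.
have := ler_wpM2r (normr_ge0 y) (Cr_le (normr_ge0 x) xr).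
by rewrite mul1r; lra.
Qed.

Lemma m_lip x x' y y' : `|x| <= r1 -> `|x'| <= r1 -> `|y| <= r1 -> `|y'| <= r1 ->
  `|m x y - m x' y'| <= 2 * `|x - x'| + 2 * `|y - y'|.
Proof.
move=> xr x'r yr y'r.
have a1 := mL (le_r1_r xr) (le_r1_r x'r) (le_r1_r yr).
have a2 := mR (le_r1_r x'r) (le_r1_r yr) (le_r1_r y'r).
have -> : m x y - m x' y' = (m x y - m x' y - (x - x')) + (x - x') +
  ((m x' y - m x' y' - (y - y')) + (y - y')) by vring.
apply: le_trans (ler_normD _ _) _; apply: lerD.
  apply: le_trans (ler_normD _ _) _; rewrite mulrDl mul1r lerD2r.
  apply: le_trans a1 _; rewrite mulrAC -[leRHS]mul1r ler_wpM2r //.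
  by have := Cr_le (normr_ge0 y) yr; have := mulr_ge0 C0 (normr_ge0 y); lra.
apply: le_trans (ler_normD _ _) _; rewrite mulrDl mul1r lerD2r.
apply: le_trans a2 _; rewrite -[leRHS]mul1r ler_wpM2r //.
by have := Cr_le (normr_ge0 x') x'r; have := mulr_ge0 C0 (normr_ge0 x'); lra.
Qed.

Lemma m_small x y : `|x| <= r1 / 2 -> `|y| <= r1 / 2 -> `|m x y| <= r.
Proof.
move=> xr yr.
have xr' : `|x| <= r1 by move: xr r10; lra.
have yr' : `|y| <= r by apply: le_r1_r; move: yr r10; lra.
rewrite -(subrK (x + y) (m x y)); apply: le_trans (ler_normD _ _) _.
have := m_near2 xr' yr'; have := ler_normD x y; move: xr yr rr1 r10; lra.
Qed.

(** The local inverse y of x = v / 2^k satisfies x + y = O(|x|^2), so it is an admissible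
    approximation of - v / 2^k and its 2^k-th powers tend to e (- v). *)
Lemma kap_e_opp v : 8 * `|v| <= r1 -> (kap (e v) * kap (e (- v)) = 1)%g.
Proof.
move=> vr.
have v0 := normr_ge0 v.
have v2 : 2 * `|v| <= r1 by move: vr v0; lra.
have v2' : 2 * `|- v| <= r1 by rewrite normrN.
have [rho rho0 rhoP] := kapV (divr_gt0 r10 (ltr0n _ 2)).
have [k0 k0P] : exists k0, forall k, (k0 <= k)%N -> `|v| / 2 ^+ k <= rho.
  exists (Num.truncn (`|v| / rho)).+1 => k kk.
  rewrite ler_pdivrMr ?exprn_gt0 // mulrC -ler_pdivrMr //.
  apply: ltW; apply: lt_le_trans (truncnS_gt _) _.
  rewrite -natrX ler_nat; apply: leq_trans kk _; apply: ltnW; exact: ltn_expl.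
have evr : `|e v| <= r1 / 2 by apply: le_trans (e_le v2) _; move: vr; lra.
have evr' : `|e (- v)| <= r1 / 2.
  by apply: le_trans (e_le v2') _; rewrite normrN; move: vr; lra.
have half1 : r1 / 2 <= r1 by move: r10; lra.
rewrite kapM; [|exact/le_r1_r/(le_trans evr)|exact/le_r1_r/(le_trans evr')].
rewrite (_ : m _ _ = 0) ?kap0 //.
apply: (@norm_half_exp0 _ _ _ (40 * C * `|v| ^+ 2)) => j.
(* The local inverse is available only from level k0 on, so level j is replaced by k0 + j, whose
   bound is stronger. *)
apply: (@le_trans _ _ (40 * C * `|v| ^+ 2 / 2 ^+ (k0 + j))); last first.
  apply: ler_wpM2l; first by rewrite !mulr_ge0.
  rewrite lef_pV2 ?posrE ?exprn_gt0 // ler_weXn2l ?ler1n // leq_addl //.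
move: (k0P _ (leq_addr j k0)); set k := (k0 + j)%N => kr.
set x := dy v k.
have q1 : 0 < (2 ^+ k : R) by rewrite exprn_gt0.
have xv : `|x| = `|v| / 2 ^+ k by rewrite norm_dy.
have vk : `|v| / 2 ^+ k <= `|v|.
  exact: div_exp2_le.
have xr : `|x| <= r1 / 2 by rewrite xv; move: vr vk v0; lra.
have [y yr xy1] : exists2 y, `|y| <= r1 / 2 & (kap x * kap y)%g = 1%g.
  by apply: rhoP; rewrite xv.
have xr1 : `|x| <= r1 := le_trans xr half1.
have yr1 : `|y| <= r1 := le_trans yr half1.
have mxy : m x y = 0.
  apply: kapI; rewrite ?kap0 -?kapM //; try exact: le_r1_r.
    exact: m_small.
  by rewrite normr0 ltW.
have xy : `|x + y| <= C * `|x| * `|y|.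
  have := m_near (le_r1_r xr1) (le_r1_r yr1).
  by rewrite mxy sub0r normrN.
have y2 : `|y| <= 2 * `|x|.
  have h1 := ler_wpM2r (normr_ge0 y) (Cr_le (normr_ge0 x) xr1).
  have h2 : `|y| <= `|x + y| + `|x|.
    by rewrite -{1}[y](addKr x) addrC; apply: le_trans (ler_normB _ _) _.
  by move: h1 h2 xy; rewrite mul1r; lra.
have xy2 : `|y - dy (- v) k| <= 2 * C * `|v| ^+ 2 / 2 ^+ k / 2 ^+ k.
  have -> : y - dy (- v) k = x + y by rewrite /dy scalerN opprK addrC.
  apply: le_trans xy _.
  apply: le_trans (ler_wpM2l _ y2) _; first by rewrite mulr_ge0.
  rewrite xv le_eqVlt; apply/orP; left; apply/eqP; field.
  by rewrite expf_neq0.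
have yk : `|y| <= r1 / 2 ^+ k.
  apply: le_trans y2 _; rewrite xv mulrA ler_pM2r ?invr_gt0 //.
have pe := e_approx v2' yk xy2.
have ue := e_lim k v2.
have yj : (2 ^ k)%:R * `|y| <= r1.
  by rewrite natr_exp2; apply: le_trans (ler_wpM2l (ltW q1) yk) _; rewrite mul_exp2_dy.
have xj : (2 ^ k)%:R * `|x| <= r1.
  by rewrite natr_exp2 xv mul_exp2_dy; move: v2 v0; lra.
have ur : `|u v k| <= r1 / 2.
  apply: le_trans (pw_le xj) _; rewrite natr_exp2 -/x xv -mulrA mul_exp2_dy.
  by move: vr; lra.
have pr : `|pw y (2 ^ k)| <= r1 / 2.
  apply: le_trans (pw_le yj) _.
  apply: (@le_trans _ _ (2 * 2 ^+ k * (2 * `|x|))).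
    by rewrite natr_exp2 ler_wpM2l // mulr_ge0 // ltW.
  by rewrite xv (_ : _ * _ = 4 * `|v|); [move: vr; lra|field; rewrite expf_neq0].
have mup : m (u v k) (pw y (2 ^ k)) = 0.
  apply: kapI; rewrite ?kap0 -?kapM //; try exact: m_small.
  - by rewrite normr0 ltW.
  - rewrite /u -/x !kap_pw // -(mulg1_eq xy1) expVgn mulgV //.
  - exact/le_r1_r/(le_trans ur).
  - exact/le_r1_r/(le_trans pr).
rewrite -[m _ _]subr0 -mup.
apply: le_trans (m_lip (le_trans evr half1) (le_trans ur half1) (le_trans evr' half1)
  (le_trans pr half1)) _.
rewrite (distrC (e v)) (distrC (e (- v))).
move: pe ue; rewrite normrN => pe ue.
apply: (@le_trans _ _ (2 * (8 * C * `|v| ^+ 2 / 2 ^+ k) +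
  2 * ((2 * (2 * C * `|v| ^+ 2) + 8 * C * `|v| ^+ 2) / 2 ^+ k))).
  by apply: lerD; rewrite ler_wpM2l.
by rewrite le_eqVlt; apply/orP; left; apply/eqP; field; rewrite expf_neq0.
Qed.

(** For s and t with a common denominator both sides are powers of one element. General s and t are
    rounded down to multiples of 1 / q, at a cost O(1 / q). *)
Lemma kap_e_add v (s t : R) : 0 <= s -> 0 <= t -> 8 * ((s + t) * `|v|) <= r1 ->
  (kap (e (s *: v)) * kap (e (t *: v)))%g = kap (e ((s + t) *: v)).
Proof.
move=> s0 t0 str.
have v0 := normr_ge0 v.
have sv0 := mulr_ge0 s0 v0; have tv0 := mulr_ge0 t0 v0.
have sr : 8 * (s * `|v|) <= r1 by move: str; rewrite mulrDl; lra.
have tr : 8 * (t * `|v|) <= r1 by move: str; rewrite mulrDl; lra.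
have half1 : r1 / 2 <= r1 by move: r10; lra.
have eb (a : R) : 0 <= a -> a <= s + t -> `|e (a *: v)| <= r1 / 2 /\ 2 * `|a *: v| <= r1.
  move=> a0 ast.
  have h : `|a *: v| <= (s + t) * `|v| by rewrite normrZ ger0_norm // ler_wpM2r.
  have h2 : 2 * `|a *: v| <= r1 by move: h str (normr_ge0 (a *: v)); lra.
  split=> //; apply: le_trans (e_le h2) _; move: h str; lra.
have [es es2] : `|e (s *: v)| <= r1 / 2 /\ 2 * `|s *: v| <= r1 by apply: eb; lra.
have [et et2] : `|e (t *: v)| <= r1 / 2 /\ 2 * `|t *: v| <= r1 by apply: eb; lra.
have [est est2] : `|e ((s + t) *: v)| <= r1 / 2 /\ 2 * `|(s + t) *: v| <= r1.
  by apply: eb; lra.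
rewrite kapM; [|exact/le_r1_r/(le_trans es)|exact/le_r1_r/(le_trans et)].
congr kap; apply/eqP; rewrite -subr_eq0; apply/eqP.
apply: (@norm_harmonic0 _ _ _ (12 * `|v|)) => k.
have [q qE] : exists q : R, q = k.+1%:R by exists k.+1%:R.
have q0 : 0 < q by rewrite qE ltr0n.
pose fl (a : R) := Num.truncn (a * q).
have flP (a : R) : 0 <= a -> 0 <= (fl a)%:R / q <= a /\ a - (fl a)%:R / q <= q^-1.
  move=> a0; have /andP[h1 h2] := truncn_itv (mulr_ge0 a0 (ltW q0)).
  rewrite -/(fl a) in h1 h2.
  split; first by rewrite (divr_ge0 (ler0n _ _) (ltW q0)) /= ler_pdivrMr.
  have h3 : a <= ((fl a)%:R + 1) / q by rewrite ler_pdivlMr // natr1 ltW.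
  by move: h3; rewrite mulrDl mul1r -lerBlDl.
have [/andP[a0 a1] a2] := flP s s0; have [/andP[b0 b1] b2] := flP t t0.
set a := (fl s)%:R / q in a0 a1 a2; set b := (fl t)%:R / q in b0 b1 b2.
have [ea ea2] : `|e (a *: v)| <= r1 / 2 /\ 2 * `|a *: v| <= r1 by apply: eb; lra.
have [eB eB2] : `|e (b *: v)| <= r1 / 2 /\ 2 * `|b *: v| <= r1 by apply: eb; lra.
have [eab eab2] : `|e ((a + b) *: v)| <= r1 / 2 /\ 2 * `|(a + b) *: v| <= r1.
  by apply: eb; lra.
have pwE (c : R) j : c = j%:R / q -> 2 * `|c *: v| <= r1 ->
    kap (e (c *: v)) = (kap (e (q^-1 *: v)) ^+ j)%g.
  move=> -> h; rewrite kap_e_nat; last first.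
    by move: h; rewrite -scalerA normrZ (ger0_norm (ler0n _ _)) mulrA.
  by rewrite scalerA.
have mab : m (e (a *: v)) (e (b *: v)) = e ((a + b) *: v).
  apply: kapI; first exact: m_small.
    by apply: le_r1_r; exact: le_trans half1.
  rewrite -kapM; [|exact/le_r1_r/(le_trans ea)|exact/le_r1_r/(le_trans eB)].
  rewrite (pwE a (fl s)) // (pwE b (fl t)) // (pwE (a + b) (fl s + fl t)%N) ?expgnDr //.
  by rewrite natrD mulrDl.
have d1 : `|e (s *: v) - e (a *: v)| <= 2 * (`|v| / q).
  apply: le_trans (e_lip2 es2 ea2) _; rewrite ler_wpM2l // -scalerBl normrZ mulrC.
  by rewrite ler_wpM2l // ger0_norm // subr_ge0.
have d2 : `|e (t *: v) - e (b *: v)| <= 2 * (`|v| / q).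
  apply: le_trans (e_lip2 et2 eB2) _; rewrite ler_wpM2l // -scalerBl normrZ mulrC.
  by rewrite ler_wpM2l // ger0_norm // subr_ge0.
have d3 : `|e ((a + b) *: v) - e ((s + t) *: v)| <= 4 * (`|v| / q).
  apply: le_trans (e_lip2 eab2 est2) _.
  rewrite -scalerBl normrZ.
  have h : `|a + b - (s + t)| <= q^-1 + q^-1.
    rewrite distrC (_ : s + t - (a + b) = (s - a) + (t - b)); last by ring.
    by rewrite ger0_norm; [exact: lerD|rewrite addr_ge0 // subr_ge0].
  by move: (ler_wpM2r v0 h); rewrite mulrDl [q^-1 * _]mulrC; lra.
rewrite -(subrKA (m (e (a *: v)) (e (b *: v)))) {2}mab.
apply: le_trans (ler_normD _ _) _.
have := m_lip (le_trans es half1) (le_trans ea half1) (le_trans et half1) (le_trans eB half1).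
by rewrite -qE -mulrA; move: d1 d2 d3; lra.
Qed.

Lemma kap_e_lin v (s t : R) : 8 * ((`|s| + `|t|) * `|v|) <= r1 ->
  (kap (e (s *: v)) * kap (e (t *: v)))%g = kap (e ((s + t) *: v)).
Proof.
wlog s0 : v s t / 0 <= s.
  move=> wl h; have [s0|s0] := leP 0 s; first exact: wl.
  have := wl (- v) (- s) (- t); rewrite !normrN !scalerN -!scaleNr !opprK -opprD.
  by rewrite scaleNr -scalerN !scaleNr !scalerN !opprK; apply => //; rewrite oppr_ge0 ltW.
rewrite (ger0_norm s0) => str.
have v0 := normr_ge0 v.
have opp (c : R) : `|c| <= s + `|t| -> (kap (e (c *: v)) * kap (e (- c *: v)) = 1)%g.
  move=> cst; rewrite scaleNr kap_e_opp // normrZ; apply: le_trans str.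
  by rewrite ler_wpM2l // ler_wpM2r.
have [t0|t0] := leP 0 t.
  by apply: kap_e_add => //; rewrite -{1}(ger0_norm t0).
have ot : (kap (e (- t *: v)) * kap (e (t *: v)) = 1)%g.
  by have := opp (- t); rewrite opprK normrN; apply; rewrite lerDr.
have [st|st] := leP 0 (s + t).
  have h := @kap_e_add v (s + t) (- t) st.
  rewrite addrK in h.
  rewrite -h; first last.
  - by apply: le_trans str; rewrite ler_wpM2l // ler_wpM2r // lerDl.
  - by rewrite oppr_ge0 ltW.
  by rewrite -mulgA ot ?mulg1.
have h := @kap_e_add v (- (s + t)) s _ s0.
rewrite opprD addrAC addNr add0r in h.
have E1 : (kap (e (t *: v)) = (kap (e (- t *: v)))^-1)%g.
  exact/esym/mulg1_eq.
have E2 : (kap (e ((s + t) *: v)) = (kap (e ((- s - t) *: v)))^-1)%g.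
  apply/esym/mulg1_eq; have := opp (- (s + t)); rewrite opprK normrN opprD; apply.
  by apply: le_trans (ler_normD _ _) _; rewrite (ger0_norm s0).
rewrite E1 E2 -h.
- by rewrite invgM mulVKg.
- by rewrite -opprD oppr_ge0 ltW.
- by apply: le_trans str; rewrite ler_wpM2l // ler_wpM2r //; have := ler_norm (- t); rewrite normrN; move: s0; lra.
Qed.

Lemma trunc_bound (a : R) : a <= r1 * (Num.truncn (a / r1)).+1%:R.
Proof. by rewrite [leRHS]mulrC -ler_pdivrMr // ltW // truncnS_gt. Qed.

(** The local exponential extended to all v by rescaling and taking powers; by [exE] any other large
    enough k gives the same value. *)
Definition ex (v : V) : X :=
  let k := (Num.truncn (16 * `|v| / r1)).+1 in (kap (e (k%:R^-1 *: v)) ^+ k)%g.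

Lemma exE v k : (0 < k)%N -> 16 * `|v| <= r1 * k%:R ->
  ex v = (kap (e (k%:R^-1 *: v)) ^+ k)%g.
Proof.
have refine (j l : nat) : (0 < j)%N -> (0 < l)%N -> 16 * `|v| <= r1 * j%:R ->
    kap (e (j%:R^-1 *: v)) = (kap (e ((j * l)%:R^-1 *: v)) ^+ l)%g.
  move=> j0 l0 h.
  have j0' : 0 < j%:R :> R by rewrite ltr0n.
  have l0' : l%:R != 0 :> R by rewrite pnatr_eq0 -lt0n.
  rewrite kap_e_nat.
    by rewrite scalerA natrM invfM mulrCA divff // mulr1.
  rewrite normrZ ger0_norm ?invr_ge0 // natrM.
  rewrite (_ : _ * _ = 2 * (`|v| / j%:R)); last by field; rewrite l0' gt_eqF.
  move: h; rewrite -ler_pdivrMr // -mulrA; have := divr_ge0 (normr_ge0 v) (ltW j0').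
  by lra.
move=> k0 kv; rewrite /ex; set l := (Num.truncn _).+1.
have lv : 16 * `|v| <= r1 * l%:R.
  exact: trunc_bound.
by rewrite (refine l k) // (refine k l) // -!expgnA mulnC (mulnC k).
Qed.

Lemma ex_small v : 16 * `|v| <= r1 -> ex v = kap (e v).
Proof. by move=> vr; rewrite (@exE _ 1%N) ?mulr1 // invr1 scale1r expg1. Qed.

Lemma exD v (s t : R) : ex ((s + t) *: v) = (ex (s *: v) * ex (t *: v))%g.
Proof.
pose k := (Num.truncn (16 * ((`|s| + `|t|) * `|v|) / r1)).+1.
have k0' : 0 < k%:R :> R by rewrite ltr0n.
have kv : 16 * ((`|s| + `|t|) * `|v|) <= r1 * k%:R.
  exact: trunc_bound.
have kE (c : R) : `|c| <= `|s| + `|t| -> ex (c *: v) = (kap (e (c *: (k%:R^-1 *: v))) ^+ k)%g.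
  move=> h; rewrite (@exE _ k) //; first by rewrite !scalerA mulrC.
  by apply: le_trans kv; rewrite normrZ ler_wpM2l // ler_wpM2r.
have vk : 8 * ((`|s| + `|t|) * `|k%:R^-1 *: v|) <= r1.
  rewrite normrZ ger0_norm ?invr_ge0 // mulrCA [_^-1 * _]mulrC.
  rewrite !mulrA ler_pdivrMr //.
  have := mulr_ge0 (addr_ge0 (normr_ge0 s) (normr_ge0 t)) (normr_ge0 v).
  by move: kv; lra.
rewrite !kE ?ler_normD ?lerDl ?lerDr //.
rewrite -kap_e_lin // expgMn //.
by rewrite /commute kap_e_lin // addrC -kap_e_lin // addrC.
Qed.

Lemma ex_inj v w : 16 * `|v| <= r1 -> 16 * `|w| <= r1 -> ex v = ex w -> v = w.
Proof.
move=> vr wr; rewrite !ex_small //.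
have small x : 16 * `|x| <= r1 -> `|e x| <= r.
  move=> xr; apply: le_r1_r; apply: le_trans (e_le _) _; move: xr (normr_ge0 x); lra.
move=> /(kapI (small _ vr) (small _ wr)) evw.
apply/eqP; rewrite -subr_eq0 -normr_le0.
have := @e_lip (r1 / 2) v w.
rewrite evw subrr sub0r normrN => h.
have {}h : `|v - w| <= 2 * C * (r1 / 2) * `|v - w|.
  by apply: h; [move: vr (normr_ge0 v)|move: wr (normr_ge0 w)|]; lra.
have : 2 * C * (r1 / 2) * `|v - w| <= 2^-1 * `|v - w|.
  by rewrite ler_wpM2r //; move: Cr1; lra.
by move: h; lra.
Qed.

Lemma e_surj y : 4 * `|y| <= r1 -> exists2 v, `|v| <= 2 * `|y| & e v = y.
Proof.
move=> yr; have y0 := normr_ge0 y.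
have rr : 2 * (2 * `|y|) <= r1 by rewrite mulrA; move: yr; lra.
have contr v w : `|v| <= 2 * `|y| -> `|w| <= 2 * `|y| ->
    `|(e v - v) - (e w - w)| <= `|v - w| / 2.
  move=> vr wr; have := e_lip vr wr rr.
  have -> : e v - e w - (v - w) = e v - v - (e w - w) by vring.
  move=> h; apply: le_trans h _; rewrite [leRHS]mulrC ler_wpM2r //.
  have := ler_wpM2l C0 rr; move: Cr1; lra.
pose T (v : V) := y - (e v - v).
pose s := fix s k := if k is k'.+1 then T (s k') else 0 : V.
have sr k : `|s k| <= 2 * `|y|.
  elim: k => [|k IH] /=; first by rewrite normr0; lra.
  apply: le_trans (ler_normB _ _) _.
  have := contr (s k) 0 IH; rewrite normr0 e0 !subr0 => /(_ ltac:(lra)).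
  by move: IH; lra.
have sd k : `|s k.+1 - s k| <= `|y| / 2 ^+ k.
  elim: k => [|k IH]; first by rewrite /= /T e0 !subr0 expr0 divr1.
  rewrite [s k.+2]/= [X in _ - X]/= /T.
  have -> : y - (e (s k.+1) - s k.+1) - (y - (e (s k) - s k)) =
    - ((e (s k.+1) - s k.+1) - (e (s k) - s k)) by vring.
  rewrite normrN; apply: le_trans (contr _ _ (sr _) (sr _)) _.
  by rewrite half_expS ler_pM2r // invr_gt0.
have [l lP] := geometric_limit_row sd.
have lr : `|l| <= 2 * `|y|.
  apply: (@le_half_exp _ _ _ (2 * `|y|)) => k.
  have -> : l = s k - (s k - l) by vring.
  by apply: le_trans (ler_normB _ _) _; apply: lerD.
exists l => //; apply/eqP; rewrite -subr_eq0; apply/eqP.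
apply: (@norm_half_exp0 _ _ _ (5 * `|y|)) => k.
have -> : e l - y = (e l - e (s k)) - (s k.+1 - s k) by rewrite /= /T; vring.
apply: le_trans (ler_normB _ _) _.
have l2 : 2 * `|l| <= r1 by move: lr rr; lra.
have s2 : 2 * `|s k| <= r1 by move: (sr k) rr; lra.
have := e_lip2 l2 s2; rewrite (distrC l); have := lP k; have := sd k.
by rewrite -!mulrA; lra.
Qed.

(** In the chart the error splits into that of the local law and the second difference of eta = e -
    id. The unknown p also occurs in eta p, but with Lipschitz constant 1 / 16, so this term is
    absorbed on the left: 10 * 16 / 15 is below 11. *)
Lemma ex_mul v w : 256 * `|v| <= r1 -> 256 * `|w| <= r1 ->
  exists2 p, (ex v * ex w)%g = ex p & `|p - (v + w)| <= 11 * C * `|v| * `|w|.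
Proof.
move=> vr wr; have v0 := normr_ge0 v; have w0 := normr_ge0 w.
have ev : `|e v| <= 2 * `|v| by apply: e_le; move: vr; lra.
have ew : `|e w| <= 2 * `|w| by apply: e_le; move: wr; lra.
have evr : `|e v| <= r1 by move: ev vr; lra.
have ewr : `|e w| <= r by apply: le_r1_r; move: ew wr; lra.
have M1 := m_near2 evr ewr.
have M2 := m_near (le_r1_r evr) ewr.
set M := m (e v) (e w) in M1 M2.
have Mr : `|M| <= 2 * `|v| + 3 * `|w|.
  rewrite -(subrK (e v + e w) M); apply: le_trans (ler_normD _ _) _.
  by have := ler_normD (e v) (e w); move: M1 ev ew; lra.
have [p pr pM] : exists2 p, `|p| <= 2 * `|M| & e p = M.
  by apply: e_surj; move: Mr vr wr; lra.
exists p.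
  rewrite !ex_small; [|move: pr Mr vr wr; lra|move: wr; lra|move: vr; lra].
  by rewrite kapM ?pM //; exact: le_r1_r.
pose eta x := e x - x.
have vw := ler_normD v w.
have etaL (rho : R) x y : `|x| <= rho -> `|y| <= rho -> 2 * rho <= r1 ->
    `|eta x - eta y| <= 2 * C * rho * `|x - y|.
  move=> a b c; have -> : eta x - eta y = e x - e y - (x - y) by rewrite /eta; vring.
  exact: e_lip.
have eta1 : `|eta p - eta (v + w)| <= `|p - (v + w)| / 16.
  apply: le_trans (@etaL (r1 / 16) _ _ _ _ _) _; [by move: pr Mr vr wr; lra|by move: vw vr wr; lra|by lra|].
  by rewrite [leRHS]mulrC ler_wpM2r //; move: Cr1; lra.
have eta2 : `|eta v + eta w - eta (v + w)| <= 6 * C * `|v| * `|w|.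
  have main a b : 256 * `|a| <= r1 -> 256 * `|b| <= r1 -> `|b| <= `|a| ->
      `|eta a + eta b - eta (a + b)| <= 6 * C * `|a| * `|b|.
    move=> ar br ba; have a0 := normr_ge0 a; have b0 := normr_ge0 b.
    have -> : eta a + eta b - eta (a + b) = (eta b - eta 0) - (eta (a + b) - eta a).
      by rewrite /eta e0; vring.
    have h1 : `|eta b - eta 0| <= 2 * C * `|a| * `|b|.
      apply: le_trans (etaL `|a| _ _ ba _ _) _; [by rewrite normr0|by lra|].
      by rewrite subr0.
    have h2 : `|eta (a + b) - eta a| <= 2 * C * (2 * `|a|) * `|b|.
      apply: le_trans (etaL (2 * `|a|) _ _ _ _ _) _.
      - by have := ler_normD a b; lra.
      - by lra.
      - by lra.
      - by rewrite addrAC subrr add0r.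
    by apply: le_trans (ler_normB _ _) _; move: h1 h2; lra.
  have [ba|ab] := leP `|w| `|v|; first exact: main.
  have := main w v wr vr (ltW ab); rewrite [eta w + _]addrC [w + v]addrC.
  by rewrite mulrAC.
have M3 : `|M - (e v + e w)| <= 4 * C * `|v| * `|w|.
  apply: le_trans M2 _.
  have := ler_pM (normr_ge0 _) (normr_ge0 _) ev ew.
  by move=> /(ler_wpM2l C0); rewrite -!mulrA; lra.
have E : p - (v + w) = (eta v + eta w - eta (v + w)) - (eta p - eta (v + w)) + (M - (e v + e w)).
  by rewrite /eta pM; vring.
have : `|p - (v + w)| <= 6 * C * `|v| * `|w| + `|p - (v + w)| / 16 + 4 * C * `|v| * `|w|.
  rewrite {1}E; apply: le_trans (ler_normD _ _) _; apply: lerD => //.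
  by apply: le_trans (ler_normB _ _) _; apply: lerD.
have := mulr_ge0 (mulr_ge0 C0 v0) w0.
by lra.
Qed.
End LocalExp.

Section LieExp.
Variables (R : realType) (G : lieGroupType R).
Local Notation n := (@lie_dim R G).
Local Notation c1 := (@chart1 R G).
Local Notation p0 := (c1 1%g).
Local Notation kp := (@kap R G).

Lemma kap_nbhs (eps : R) : 0 < eps ->
  nbhs (1%g : G) [set kp x | x in [set x | `|x| <= eps]].
Proof.
move=> e0.
have hd : nbhs (1%g : G) (chart_dom c1).
  by apply: open_nbhs_nbhs; split; [exact: chart_dom_open|exact: chart1_dom1].
have hc : nbhs (1%g : G) [set x | `|c1 x - p0| <= eps].
  have cc := chart_map_continuous (@chart1_dom1 R G).
  have /cvgrPdist_le /(_ eps e0) := cc.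
  by apply: filterS => x /=; rewrite distrC.
apply: filterS (filterI hd hc) => x [dx /= cx].
by exists (c1 x - p0) => //; rewrite /kap subrK chart_mapK.
Qed.

Lemma lie_exp_exists : exists (ex : 'rV[R]_n -> G) (r C : R),
  [/\ 0 < r, 0 <= C,
      forall v (s t : R), ex ((s + t) *: v) = (ex (s *: v) * ex (t *: v))%g,
      forall v w, `|v| <= r -> `|w| <= r -> ex v = ex w -> v = w &
      forall v w, `|v| <= r -> `|w| <= r ->
        exists2 p, (ex v * ex w)%g = ex p & `|p - (v + w)| <= C * `|v| * `|w|] /\
  [/\ forall eps : R, 0 < eps -> nbhs (1%g : G) [set ex x | x in [set x | `|x| <= eps]],
      forall A : set G, nbhs (1%g : G) A -> exists2 d : R, 0 < d & forall v, `|v| <= d -> A (ex v),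
      forall v, `|v| <= r -> `|c1 (ex v) - p0 - v| <= C * `|v| ^+ 2 &
      forall x, `|x| <= r -> exists v, [/\ kp x = ex v, `|v| <= 2 * `|x| & `|v - x| <= C * `|x| ^+ 2]].
Proof.
have [r [C [r0 C0 kK kM [mL mR]]]] := local_chart G.
(* Small enough for both 2 C r1 <= 1 and 2 r1 <= r. *)
pose r1 := r / (2 + 2 * C * r).
have Cr0 : 0 <= 2 * C * r by rewrite mulr_ge0 // ?mulr_ge0 // ltW.
have d0 : 0 < 2 + 2 * C * r by rewrite ltr_pwDl.
have r10 : 0 < r1 by rewrite divr_gt0.
have Cr1 : 2 * C * r1 <= 1 by rewrite /r1 mulrA ler_pdivrMr // mul1r lerDr.
have rr1 : 2 * r1 <= r.
  by rewrite /r1 mulrA ler_pdivrMr // mulrC ler_pM2l // lerDl.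
have k0 : kp 0 = 1%g := kap0 G.
have kI x y : `|x| <= r -> `|y| <= r -> kp x = kp y -> x = y.
  by move=> xr yr xy; rewrite -(kK x xr).1 -(kK y yr).1 xy.
have m0 (x : 'rV[R]_n) : `|x| <= r -> kmul x 0 = x.
  by move=> xr; rewrite /kmul k0 mulg1 (kK x xr).1.
have m0' (x : 'rV[R]_n) : `|x| <= r -> kmul 0 x = x.
  by move=> xr; rewrite /kmul k0 mul1g (kK x xr).1.
have z0 : `|0 : 'rV[R]_n| <= r by rewrite normr0 ltW.
have kc0 (A : set G) : nbhs (1%g : G) A -> exists2 d : R, 0 < d & forall x, `|x| <= d -> A (kp x).
  move=> A1; have := (kK 0 z0).2; rewrite /prop_for /= /continuous_at k0 => /(_ A A1) h.
  have [d d0' dP] := @norm_ball_nbhs R _ _ _ h.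
  by exists d => // x xd; apply: dP; rewrite subr0.
have kV (eps : R) : 0 < eps -> exists2 rho : R, 0 < rho & forall x, `|x| <= rho ->
    exists2 y, `|y| <= eps & (kp x * kp y)%g = 1%g.
  move=> e0.
  have h1 : nbhs (1%g : G) [set x | [set kp x | x in [set x | `|x| <= eps]] (x^-1)%g].
    have := @lie_inv_continuous R G 1%g.
    rewrite /continuous_at invg1 => h; apply: (h [set kp x | x in [set x | `|x| <= eps]]).
    exact: kap_nbhs.
  have [d d0' dP] := kc0 _ h1.
  exists d => // x /dP[y yr yx]; exists y => //.
  by rewrite yx mulgV.
have r4pos : 0 < r1 / 256 by rewrite divr_gt0.
have C4pos : 0 <= 11 * C by rewrite mulr_ge0.
pose E := @e R G n kp (@kmul R G) r C r1 r0 C0 r10 Cr1 rr1 k0 kI kM m0 mL mR.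
pose EX := @ex R G n kp (@kmul R G) r C r1 r0 C0 r10 Cr1 rr1 k0 kI kM m0 mL mR.
have exs v : 16 * `|v| <= r1 -> EX v = kp (E v) by exact: ex_small.
have r4 (v : 'rV[R]_n) : `|v| <= r1 / 256 -> 256 * `|v| <= r1 by lra.
have le16 (v : 'rV[R]_n) : `|v| <= r1 / 256 -> 16 * `|v| <= r1.
  by have := normr_ge0 v; lra.
have Esmall v : 16 * `|v| <= r1 -> `|E v| <= r.
  move=> vr; have : `|E v| <= 2 * `|v| by apply: e_le; move: vr (normr_ge0 v); lra.
  by have := rr1; move: vr (normr_ge0 v); lra.
have surj y : 4 * `|y| <= r1 -> exists2 v, `|v| <= 2 * `|y| & E v = y by exact: e_surj.
have nearE v : 2 * `|v| <= r1 -> `|E v - v| <= 2 * C * `|v| ^+ 2 by exact: e_near.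
exists EX, (r1 / 256), (11 * C); split; split.
- exact r4pos.
- exact C4pos.
- by move=> v s t; apply: exD.
- by move=> v w vr wr; apply: ex_inj; exact: le16.
- by move=> v w vr wr; apply: ex_mul; exact: r4.
- move=> eps e0.
  pose d := Num.min (eps / 2) (r1 / 32).
  have d0' : 0 < d by rewrite lt_min !divr_gt0.
  apply: filterS (kap_nbhs d0') => _ [x /= xd <-].
  move: xd; rewrite le_min => /andP[xe xr].
  have [|v vx vE] := surj x; first by move: xr (normr_ge0 x); lra.
  exists v; first by rewrite /=; move: vx xe; lra.
  by rewrite exs ?vE //; move: vx xr; lra.
- move=> A /kc0[d d0' dP]; exists (Num.min (d / 2) (r1 / 32)).
    by rewrite lt_min !divr_gt0.
  move=> v; rewrite le_min => /andP[vd vr].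
  rewrite exs; last by move: vr (normr_ge0 v); lra.
  apply: dP; have : `|E v| <= 2 * `|v| by apply: e_le; move: vr (normr_ge0 v); lra.
  by move: vd; lra.
- move=> v vr; have v16 := le16 v vr.
  rewrite exs // (kK _ (Esmall _ v16)).1.
  apply: le_trans (nearE v _) _; first by move: v16 (normr_ge0 v); lra.
  by rewrite ler_wpM2r ?sqr_ge0 // ler_wpM2r //; lra.
- move=> x xr.
  have [|v vx vE] := surj x; first by move: xr (normr_ge0 x); lra.
  exists v; split => //.
    by rewrite exs ?vE //; move: vx xr (normr_ge0 x); lra.
  rewrite distrC -{1}vE.
  apply: le_trans (nearE v _) _; first by move: vx xr (normr_ge0 x); lra.
  have h : `|v| ^+ 2 <= (2 * `|x|) ^+ 2 by rewrite lerXn2r // ?nnegrE ?mulr_ge0.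
  have := ler_wpM2l C0 h; rewrite exprMn.
  by have := mulr_ge0 C0 (sqr_ge0 `|x|); lra.
Qed.
End LieExp.

(** * The adjoint action and the bracket *)

(** X carries no topology here: closeness to 1 means having a small logarithm, which is enough for
    all limits in this part. *)
Record locexp (R : realType) (X : groupType) (n : nat) := LocExp {
  lex :> 'rV[R]_n -> X;
  lrad : R;
  lcst : R;
  lrad_gt0 : 0 < lrad;
  lcst_ge0 : 0 <= lcst;
  lex_add : forall v (s t : R), lex ((s + t) *: v) = (lex (s *: v) * lex (t *: v))%g;
  lex_inj : forall v w, `|v| <= lrad -> `|w| <= lrad -> lex v = lex w -> v = w;
  lex_mul : forall v w, `|v| <= lrad -> `|w| <= lrad ->
    exists2 p, (lex v * lex w)%g = lex p & `|p - (v + w)| <= lcst * `|v| * `|w|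
}.

Section Germs.
Variables (R : realType) (X : groupType) (n : nat) (E : locexp R X n).
Local Notation V := 'rV[R]_n.
Implicit Types (y z : R -> X) (v w : V).

Lemma lex_zero : E 0 = 1%g.
Proof.
have := lex_add E 0 0 0; rewrite !scaler0 => h.
by apply: (mulgI (E 0)); rewrite mulg1 -h.
Qed.

Lemma lex_opp v : E (- v) = (E v)^-1%g.
Proof.
apply/esym/mulg1_eq; have := lex_add E v 1 (- 1).
by rewrite subrr scale0r lex_zero scale1r scaleN1r => <-.
Qed.

Lemma lex_nat v k : E (k%:R *: v) = (E v ^+ k)%g.
Proof.
elim: k => [|k IH]; first by rewrite scale0r lex_zero expg0.
by rewrite -natr1 lex_add IH scale1r expgSr.
Qed.

Lemma lex_comm v (s t : R) : commute (E (s *: v)) (E (t *: v)).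
Proof. by rewrite /commute -!lex_add addrC. Qed.

(** v is the velocity at t = 0 of the curve y, read through the exponential and tested on positive
    t. *)
Definition germ y v := exists K t0 : R, 0 < t0 /\
  forall t, 0 < t <= t0 -> exists2 q, y t = E q & `|q - t *: v| <= K * t ^+ 2.

Lemma germ_weaken y v (e : R) : 0 < e -> germ y v -> exists K t0 : R, [/\ 0 < t0, t0 <= 1, 0 <= K &
  forall t, 0 < t <= t0 -> exists q, [/\ y t = E q, `|q - t *: v| <= K * t ^+ 2,
    `|q| <= e & `|q| <= (`|v| + K) * t]].
Proof.
move=> e0 [K [t0 [t00 h]]].
pose K' := Num.max K 0.
have K'0 : 0 <= K' by rewrite le_max lexx orbT.
have KK' : K <= K' by rewrite le_max lexx.
have d0 : 0 < `|v| + K' + 1 by rewrite ltr_wpDl // addr_ge0.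
exists K', (Num.min (Num.min t0 1) (e / (`|v| + K' + 1))); split => //.
- by rewrite !lt_min t00 ltr01 divr_gt0.
- by rewrite !ge_min lexx orbT.
move=> t; rewrite !le_min ler_pdivlMr // => /and3P[tp /andP[tt0 t1] te].
have [|q qE qb] := h t; first by rewrite tp.
have t0' := ltW tp.
have qb' : `|q - t *: v| <= K' * t ^+ 2.
  by apply: le_trans qb _; rewrite ler_wpM2r // sqr_ge0.
have qt : `|q| <= (`|v| + K') * t.
  rewrite -(subrK (t *: v) q) addrC; apply: le_trans (ler_normD _ _) _.
  rewrite normrZ (ger0_norm t0') mulrDl [t * _]mulrC lerD2l.
  apply: le_trans qb' _; rewrite ler_wpM2l // expr2 -[leRHS]mul1r ler_wpM2r //.
exists q; split => //; apply: le_trans qt _; apply: le_trans te.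
by rewrite [leRHS]mulrC ler_wpM2r // lerDl.
Qed.

Lemma germ_lin v : germ (fun t => E (t *: v)) v.
Proof.
exists 0, 1; split => // t _; exists (t *: v) => //.
by rewrite subrr normr0 mul0r.
Qed.

Lemma germ1 : germ (fun=> 1%g) 0.
Proof.
exists 0, 1; split => // t _; exists 0; first by rewrite lex_zero.
by rewrite scaler0 subrr normr0 mul0r.
Qed.

Lemma germV y v : germ y v -> germ (fun t => (y t)^-1%g) (- v).
Proof.
move=> [K [t0 [t00 h]]]; exists K, t0; split => // t /h[q -> qb].
by exists (- q); [rewrite lex_opp|rewrite scalerN -opprD normrN].
Qed.

Lemma germM y z v w : germ y v -> germ z w -> germ (fun t => y t * z t)%g (v + w).
Proof.
move=> /(germ_weaken (lrad_gt0 E))[K [t0 [t00 t01 K0 h]]].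
move=> /(germ_weaken (lrad_gt0 E))[L [s0 [s00 s01 L0 g]]].
exists (lcst E * (`|v| + K) * (`|w| + L) + K + L), (Num.min t0 s0).
split; first by rewrite lt_min t00.
move=> t; rewrite le_min => /and3P[tp tt ts].
have [|q [-> qb qr qt]] := h t; first by rewrite tp.
have [|p [-> pb pr pt]] := g t; first by rewrite tp.
have [a -> ab] := lex_mul qr pr; exists a => //.
have -> : a - t *: (v + w) = (a - (q + p)) + (q - t *: v) + (p - t *: w) by vring.
rewrite !mulrDl; apply: le_trans (ler_normD _ _) _; apply: lerD => //.
apply: le_trans (ler_normD _ _) _; apply: lerD => //.
apply: le_trans ab _.
have := ler_pM (normr_ge0 _) (normr_ge0 _) qt pt.
move=> /(ler_wpM2l (lcst_ge0 E)); rewrite mulrA => h1; apply: le_trans h1 _.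
by rewrite le_eqVlt; apply/orP; left; apply/eqP; ring.
Qed.

Lemma germ_uniq y v w : germ y v -> germ y w -> v = w.
Proof.
move=> /(germ_weaken (lrad_gt0 E))[K [t0 [t00 t01 K0 h]]].
move=> /(germ_weaken (lrad_gt0 E))[L [s0 [s00 s01 L0 g]]].
pose m := Num.min t0 s0.
have m0 : 0 < m by rewrite lt_min t00.
apply/eqP; rewrite -subr_eq0; apply/eqP.
apply: (@norm_harmonic0 _ _ _ ((K + L) * m)) => k.
pose t := m / k.+1%:R.
have tp : 0 < t by rewrite divr_gt0.
have tm : t <= m by rewrite ler_pdivrMr // ler_peMr ?(ltW m0) // ler1n.
move: (tm); rewrite {2}/m le_min => /andP[tt ts].
have [|q [yq qb qr _]] := h t; first by rewrite tp.
have [|p [yp pb pr _]] := g t; first by rewrite tp.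
have qp : q = p by apply: (lex_inj qr pr); rewrite -yq -yp.
have : `|t *: (v - w)| <= (K + L) * t ^+ 2.
  have -> : t *: (v - w) = (p - t *: w) - (q - t *: v) by rewrite qp; vring.
  apply: le_trans (ler_normB _ _) _; rewrite mulrDl addrC; exact: lerD.
rewrite normrZ (ger0_norm (ltW tp)) expr2 mulrA [_ * t * t]mulrC.
by rewrite ler_pM2l // /t mulrA.
Qed.

Lemma germ_eq y z v : (exists2 t0 : R, 0 < t0 & forall t, 0 < t <= t0 -> y t = z t) ->
  germ y v -> germ z v.
Proof.
move=> [s0 s00 e] [K [t0 [t00 h]]]; exists K, (Num.min s0 t0); split.
  by rewrite lt_min s00.
move=> t; rewrite le_min => /and3P[tp ts tt].
by rewrite -e ?tp //; apply: h; rewrite tp.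
Qed.

Lemma lex_line_inj v w : (forall t : R, E (t *: v) = E (t *: w)) -> v = w.
Proof.
move=> h; apply: (@germ_uniq (fun t => E (t *: v))); first exact: germ_lin.
apply: (@germ_eq (fun t => E (t *: w))); last exact: germ_lin.
by exists 1.
Qed.

Lemma lex_small1 (g : X) (K : R) :
  (forall k : nat, exists2 q, g = E q & `|q| <= K / k.+1%:R) -> g = 1%g.
Proof.
move=> h.
have [j jr] : exists j : nat, forall k : nat, (j <= k)%N -> K / k.+1%:R <= lrad E.
  exists (Num.truncn (K / lrad E)) => k jk.
  rewrite ler_pdivrMr // mulrC -ler_pdivrMr ?lrad_gt0 //.
  apply: ltW; apply: lt_le_trans (truncnS_gt _) _; by rewrite ler_nat ltnS.
have [q gq qb] := h j.
have qr : `|q| <= lrad E := le_trans qb (jr _ (leqnn j)).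
suff q0 : q = 0 by rewrite gq q0 lex_zero.
have K0 : 0 <= K.
  by have [p _ pb] := h 0%N; move: pb; rewrite divr1; apply: le_trans.
apply: (@norm_harmonic0 _ _ _ K) => k.
have [p gp pb] := h (j + k)%N.
have pr : `|p| <= lrad E := le_trans pb (jr _ (leq_addr _ _)).
have -> : q = p by apply: (lex_inj qr pr); rewrite -gq -gp.
apply: le_trans pb _; apply: ler_wpM2l => //.
by rewrite lef_pV2 ?posrE ?ltr0n // ler_nat ltnS leq_addl.
Qed.

(** A continuity argument without topology: if |w| exceeded the radius, the multiple s w of norm
    exactly [lrad E] would have the same exponential as a vector of at most half that norm. *)
Lemma lex_line_small w :
  (forall s : R, 0 <= s -> s <= 1 -> exists2 q, E (s *: w) = E q & `|q| <= lrad E / 2) ->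
  `|w| <= lrad E.
Proof.
move=> h; have [r rE] : exists r, r = lrad E by exists (lrad E).
have r0 : 0 < r by rewrite rE lrad_gt0.
rewrite -rE in h *; rewrite leNgt; apply/negP => rw.
have w0 : 0 < `|w| := lt_trans r0 rw.
pose s := r / `|w|.
have s0 : 0 <= s by rewrite divr_ge0 // ltW.
have s1 : s <= 1 by rewrite ler_pdivrMr // mul1r ltW.
have sn : `|s *: w| = r by rewrite normrZ ger0_norm // divfK // gt_eqF.
have [q qE qr] := h s s0 s1.
have qs : s *: w = q.
  apply: (@lex_inj _ _ _ E) => //; rewrite -rE ?sn //.
  by apply: le_trans qr _; lra.
by move: qr; rewrite -qs sn; lra.
Qed.
End Germs.

Section Linearization.
Variables (R : realType) (X X' : groupType) (n n' : nat).
Variables (E : locexp R X n) (E' : locexp R X' n').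

Definition cont1 (f : 'rV[R]_n -> X') := forall eps : R, 0 < eps ->
  exists2 d : R, 0 < d & forall v, `|v| <= d -> exists2 w, f v = E' w & `|w| <= eps.

(** Local injectivity forces the logarithm at d / 2^(k+1) to be half of the one at d / 2^k, so g
    agrees with a line at the dyadic multiples of d. Continuity at 0 makes the quotient at any other
    t arbitrarily close to 1, hence equal to 1. *)
Lemma one_param (g : R -> X') : (forall s t, g (s + t) = (g s * g t)%g) ->
  (forall eps : R, 0 < eps -> exists2 d : R, 0 < d &
     forall t, `|t| <= d -> exists2 w, g t = E' w & `|w| <= eps) ->
  exists v, forall t, g t = E' (t *: v).
Proof.
move=> gD gc.
have r2 : 0 < lrad E' / 2 by rewrite divr_gt0 // lrad_gt0.
have rle : lrad E' / 2 <= lrad E' by have := lrad_gt0 E'; lra.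
have [d d0 dP] := gc _ r2.
have [a ga ar] := dP d (eq_ind_r (fun x => x <= d) (lexx d) (gtr0_norm d0)).
have dyad k : g (d / 2 ^+ k) = E' ((2 ^+ k)^-1 *: a).
  elim: k => [|k IH]; first by rewrite expr0 divr1 invr1 scale1r.
  have [|b gb br] := dP (d / 2 ^+ k.+1).
    rewrite ger0_norm ?divr_ge0 ?exprn_ge0 ?(ltW d0) //.
    by rewrite ler_pdivrMr ?exprn_gt0 // ler_peMr ?(ltW d0) // exprn_ege1 // ler1n.
  rewrite gb; congr (E' _).
  have b2 : 2%:R *: b = (2 ^+ k)^-1 *: a.
    apply: (@lex_inj _ _ _ E').
    - by rewrite normrZ ger0_norm //; move: br; lra.
    - rewrite normrZ ger0_norm ?invr_ge0 ?exprn_ge0 //.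
      apply: le_trans rle; apply: le_trans ar.
      by rewrite ler_piMl // invf_le1 ?exprn_gt0 // exprn_ege1 // ler1n.
    - rewrite lex_nat -IH expg2 -gb -gD; congr g.
      by rewrite half_expS -splitr.
  rewrite exprS invfM -scalerA -b2 scalerA mulVf ?scale1r // pnatr_eq0.
pose v := d^-1 *: a.
have natE (t : R) j : g (j%:R * t) = (g t ^+ j)%g.
  elim: j => [|j IH].
    rewrite mul0r expg0; apply: (mulgI (g 0)); by rewrite -gD addr0 mulg1.
  by rewrite -natr1 mulrDl mul1r gD IH expgSr.
have gdy j k : g (j%:R * (d / 2 ^+ k)) = E' ((j%:R * (d / 2 ^+ k)) *: v).
  rewrite natE dyad -lex_nat; congr (E' _); rewrite /v !scalerA; congr (_ *: _).
  by field; rewrite expf_neq0 // gt_eqF.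
have g0 : g 0 = 1%g by apply: (mulgI (g 0)); rewrite -gD addr0 mulg1.
have gN t : g (- t) = (g t)^-1%g by apply/esym/mulg1_eq; rewrite -gD subrr.
have pos t : 0 <= t -> g t = E' (t *: v).
  move=> t0.
  suff : ((E' (t *: v))^-1 * g t = 1)%g.
    by move/(congr1 (fun x => E' (t *: v) * x)%g); rewrite mulVKg mulg1.
  apply: (@lex_small1 _ _ _ E' _ 1) => i.
  pose e := Num.min (Num.min (lrad E') 1) ((i.+1%:R)^-1 / (3 + lcst E')).
  have C0 := lcst_ge0 E'.
  have c3 : 0 < 3 + lcst E' by rewrite ltr_pwDl.
  have e0 : 0 < e by rewrite !lt_min lrad_gt0 ltr01 divr_gt0 ?invr_gt0 ?ltr0n.
  have [d1 d10 d1P] := gc _ e0.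
  have [k kP] : exists k : nat, d / 2 ^+ k <= d1 /\ d / 2 ^+ k * `|v| <= e.
    pose m := Num.max (d / d1) (d * `|v| / e).
    exists (Num.truncn m).+1.
    have mk : m <= 2 ^+ (Num.truncn m).+1.
      apply: ltW; apply: lt_le_trans (truncnS_gt _) _.
      by rewrite -natrX ler_nat ltnW // ltn_expl.
    move: mk; rewrite ge_max => /andP[m1 m2].
    rewrite ler_pdivrMr ?exprn_gt0 // mulrC -ler_pdivrMr // m1; split => //.
    by rewrite mulrAC ler_pdivrMr ?exprn_gt0 // [leRHS]mulrC -ler_pdivrMr.
  case: kP => k1 k2.
  pose h := d / 2 ^+ k.
  have h0 : 0 < h by rewrite divr_gt0 // exprn_gt0.
  pose j := Num.truncn (t / h).
  have /andP[j1 j2] := truncn_itv (divr_ge0 t0 (ltW h0)).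
  pose s := t - j%:R * h.
  have s0 : 0 <= s by rewrite subr_ge0 -ler_pdivlMr.
  have sh : s <= h by move: j2; rewrite ltr_pdivrMr // -natr1 mulrDl mul1r -/j => /ltW; rewrite lerBlDl.
  have tE : t = j%:R * h + s by rewrite /s addrC subrK.
  have [|w gw wr] := d1P s; first by rewrite ger0_norm // (le_trans sh).
  have er : e <= lrad E' by rewrite !ge_min lexx.
  have e1 : e <= 1 by rewrite !ge_min lexx orbT.
  have ei : (3 + lcst E') * e <= i.+1%:R^-1.
    by rewrite mulrC -ler_pdivlMr // ge_min lexx orbT.
  have svr : `|- s *: v| <= e.
    rewrite normrZ normrN ger0_norm //; apply: le_trans k2.
    by rewrite ler_wpM2r.
  have wr' := le_trans wr er.
  have [p pE pb] := lex_mul (le_trans svr er) wr'.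
  exists p.
    rewrite tE lex_add gD gdy -/h gw invgM -!mulgA mulKg -pE.
    by rewrite scaleNr lex_opp.
  have b1 : lcst E' * `|- s *: v| * `|w| <= lcst E' * e.
    rewrite -mulrA ler_wpM2l // -[leRHS]mulr1; apply: ler_pM => //.
    exact: le_trans wr e1.
  have : `|p| <= (`|- s *: v| + `|w|) + lcst E' * `|- s *: v| * `|w|.
    rewrite -(subrK (- s *: v + w) p) addrC; apply: le_trans (ler_normD _ _) _.
    by apply: lerD => //; exact: ler_normD.
  rewrite mul1r => h1; apply: le_trans h1 _; apply: le_trans ei.
  apply: (@le_trans _ _ (e + e + lcst E' * e)); first by apply: lerD => //; apply: lerD.
  have three (x : R) : 0 <= x -> x + x <= 3 * x by move=> ?; lra.
  by rewrite mulrDl lerD2r; apply: three; exact: ltW.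
exists v => t; have [t0|t0] := leP 0 t; first exact: pos.
have nt : 0 <= - t by rewrite oppr_ge0 ltW.
by rewrite -[t in LHS]opprK gN (pos _ nt) -lex_opp -scaleNr opprK.
Qed.

Variable om : X -> X'.
Hypothesis omM : {morph om : x y / (x * y)%g}.
Hypothesis omC : cont1 (om \o E).

Lemma linearization_line v : exists w, forall t : R, om (E (t *: v)) = E' (t *: w).
Proof.
apply: one_param => [s t|eps e0]; first by rewrite lex_add omM.
have [d d0 dP] := omC e0.
exists (d / (`|v| + 1)) => [|t]; first by rewrite divr_gt0 // ltr_wpDl.
have v1 : 0 < `|v| + 1 by rewrite ltr_wpDl.
rewrite ler_pdivlMr // => tv; apply: dP; rewrite normrZ; apply: le_trans tv.
by rewrite ler_wpM2l // lerDl.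
Qed.

Definition dmap v := sval (cid (linearization_line v)).

Lemma dmapP v (t : R) : om (E (t *: v)) = E' (t *: dmap v).
Proof. exact: (svalP (cid (linearization_line v))). Qed.

Lemma dmap1 v : om (E v) = E' (dmap v).
Proof. by have := dmapP v 1; rewrite !scale1r. Qed.

Lemma dmap_uniq v w : (forall t : R, om (E (t *: v)) = E' (t *: w)) -> w = dmap v.
Proof. by move=> h; apply: (@lex_line_inj _ _ _ E') => t; rewrite -h dmapP. Qed.

Lemma dmapZ (c : R) v : dmap (c *: v) = c *: dmap v.
Proof. by apply/esym/dmap_uniq => t; rewrite !scalerA dmapP. Qed.

Lemma dmap_bound : exists2 K : R, 0 <= K & forall v, `|dmap v| <= K * `|v|.
Proof.
have [r rE] : exists r, r = lrad E' by exists (lrad E').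
have r0 : 0 < r by rewrite rE lrad_gt0.
have [|d d0 dP] := omC (_ : 0 < r / 4); first by rewrite divr_gt0.
have small v : `|v| <= d -> `|dmap v| <= r / 2.
  move=> vd; rewrite leNgt; apply/negP => h.
  pose t := (r / 2) / `|dmap v|.
  have dv0 : 0 < `|dmap v| by apply: lt_trans h; rewrite divr_gt0.
  have t0 : 0 <= t by rewrite divr_ge0 // ?(ltW dv0) // divr_ge0 // ltW.
  have t1 : t <= 1 by rewrite ler_pdivrMr // mul1r ltW.
  have tn : `|t *: dmap v| = r / 2.
    by rewrite normrZ ger0_norm // divfK // gt_eqF.
  have [|w wE wr] := dP (t *: v).
    by rewrite normrZ ger0_norm // (le_trans _ vd) // ler_piMl.
  have : w = t *: dmap v.
    apply: (@lex_inj _ _ _ E'); rewrite -?rE.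
    - by move: wr; lra.
    - by rewrite tn; lra.
    - by rewrite -wE /= dmapP.
  by move=> wt; move: wr; rewrite wt tn; lra.
exists (r / 2 / d) => [|v]; first by rewrite divr_ge0 ?(ltW d0) // divr_ge0 // ltW.
have [->|v0] := eqVneq v 0.
  have -> : dmap 0 = 0 by rewrite -(scale0r (0 : 'rV[R]_n)) dmapZ scale0r.
  by rewrite !normr0 mulr0.
have nv : 0 < `|v| by rewrite normr_gt0.
have := small ((d / `|v|) *: v).
rewrite normrZ ger0_norm ?divr_ge0 ?(ltW d0) ?(ltW nv) // divfK ?gt_eqF // => /(_ (lexx _)).
rewrite dmapZ normrZ ger0_norm ?divr_ge0 ?(ltW d0) ?(ltW nv) //.
rewrite mulrAC ler_pdivrMr // mulrC -ler_pdivlMr // => h.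
by rewrite (_ : _ * `|v| = r / 2 * `|v| / d) //; ring.
Qed.

Lemma germ_om0 y : germ E y 0 -> germ E' (om \o y) 0.
Proof.
move=> [K [t0 [t00 h]]]; have [L L0 LP] := dmap_bound.
exists (L * K), t0; split => // t /h[q yq]; rewrite scaler0 subr0 => qb.
exists (dmap q); first by rewrite /= yq dmap1.
rewrite scaler0 subr0; apply: le_trans (LP q) _.
by rewrite -mulrA ler_wpM2l.
Qed.

(** The curve exp(-t(v+w)) exp(tv) exp(tw) has velocity 0. A morphism preserves velocity 0 by the
    norm bound alone, before linearity is known, and the velocity of the image is computed factor by
    factor. *)
Lemma dmapD v w : dmap (v + w) = dmap v + dmap w.
Proof.
pose y t := (E (t *: - (v + w)) * E (t *: v) * E (t *: w))%g.
have yg : germ E y 0.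
  have := germM (germM (germ_lin E (- (v + w))) (germ_lin E v)) (germ_lin E w).
  by have -> : - (v + w) + v + w = 0 by vring.
have := germ_om0 yg.
have oy : germ E' (om \o y) (dmap (- (v + w)) + dmap v + dmap w).
  apply: (@germ_eq _ _ _ _ (fun t => E' (t *: dmap (- (v + w))) * E' (t *: dmap v) *
    E' (t *: dmap w))%g).
    by exists 1 => // t _; rewrite /= !omM !dmapP.
  by apply: germM; [apply: germM|]; exact: germ_lin.
move=> /(germ_uniq oy).
have -> : dmap (- (v + w)) = - dmap (v + w) by rewrite -scaleN1r dmapZ scaleN1r.
by rewrite -addrA => /eqP; rewrite addrC subr_eq0 => /eqP.
Qed.

Definition dmx : 'M[R]_(n, n') := \matrix_i dmap (delta_mx 0 i).

Lemma dmxE v : v *m dmx = dmap v.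
Proof.
have dsum (I : Type) (s : seq I) (F : I -> 'rV[R]_n) :
    dmap (\sum_(i <- s) F i) = \sum_(i <- s) dmap (F i).
  elim: s => [|i s IH]; last by rewrite !big_cons dmapD IH.
  by rewrite !big_nil -(scale0r (0 : 'rV[R]_n)) dmapZ scale0r.
rewrite {2}(row_sum_delta v) dsum mulmx_sum_row; apply: eq_bigr => i _.
by rewrite dmapZ rowK.
Qed.

Lemma dmxP v : om (E v) = E' (v *m dmx).
Proof. by rewrite dmxE dmap1. Qed.

Lemma dmx_uniq (D : 'M[R]_(n, n')) : (forall v, om (E v) = E' (v *m D)) -> D = dmx.
Proof.
move=> h; apply/row_matrixP => i; rewrite !rowE dmxE; apply: dmap_uniq => t.
by rewrite h scalemxAl.
Qed.
End Linearization.

Section PolyTools.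
Variable R : numFieldType.
Implicit Types p q : {poly R}.

Lemma poly_nat_eq0 p : (forall j : nat, p.[j%:R] = 0) -> p = 0.
Proof.
move=> h; apply/eqP; apply/negPn/negP => p0.
pose rs : seq R := [seq j%:R | j <- iota 0 (size p)].
have r1 : all (root p) rs by apply/allP => _ /mapP[j _ ->]; rewrite rootE h.
have r2 : uniq rs.
  rewrite map_inj_uniq ?iota_uniq // => i j /eqP.
  by rewrite eqr_nat => /eqP.
by have := max_poly_roots p0 r1 r2; rewrite size_map size_iota ltnn.
Qed.

Lemma poly_nat_eq p q : (forall j : nat, p.[j%:R] = q.[j%:R]) -> p = q.
Proof.
move=> h; apply/eqP; rewrite -subr_eq0; apply/eqP/poly_nat_eq0 => j.
by rewrite !hornerE h subrr.
Qed.

(** The binomial coefficient X choose k as a polynomial. *)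
Definition bpol (k : nat) : {poly R} := (k`!%:R)^-1 *: \prod_(i < k) ('X - i%:R%:P).

Lemma bpol_nat k (j : nat) : (bpol k).[j%:R] = 'C(j, k)%:R.
Proof.
rewrite hornerZ horner_prod.
have fk : k`!%:R != 0 :> R by rewrite pnatr_eq0 -lt0n fact_gt0.
apply: (mulfI fk); rewrite mulrA divff // mul1r -natrM mulnC bin_ffact ffact_prod natr_prod.
have [jk|kj] := ltnP j k.
  rewrite (bigD1 (Ordinal jk)) //= !hornerE subrr mul0r.
  by rewrite (bigD1 (Ordinal jk)) //= subnn mul0r.
apply: eq_bigr => i _; rewrite !hornerE natrB //.
by apply: leq_trans kj; exact: ltnW.
Qed.

Lemma bpol0 : bpol 0 = 1.
Proof. by rewrite /bpol big_ord0 fact0 invr1 scale1r. Qed.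

End PolyTools.

Lemma poly_lipschitz (R : realType) (p : {poly R}) (B : R) : exists2 L : R, 0 <= L & forall x y, `|x| <= B -> `|y| <= B ->
  `|p.[x]| <= L /\ `|p.[x] - p.[y]| <= L * `|x - y|.
Proof.
wlog B0 : B / 0 <= B.
  move=> wl; have [B0|B0] := leP 0 B; first exact: wl.
  by exists 0 => // x y xB; have := lt_le_trans B0 (normr_ge0 x); rewrite ltNge xB.
elim/poly_ind: p => [|p c [L L0 h]].
  by exists 0 => // x y _ _; rewrite !horner0 subrr normr0 mul0r.
exists (L * B + `|c| + L + L * B).
  by rewrite !addr_ge0 // mulr_ge0.
move=> x y xB yB; have [h1 h2] := h x y xB yB; have [h3 _] := h y y yB yB.
rewrite !hornerE.
have hb : `|p.[x] * x| <= L * B by rewrite normrM ler_pM.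
split.
  apply: le_trans (ler_normD _ _) _.
  by have := mulr_ge0 L0 B0; have := normr_ge0 c; move: hb L0; lra.
have -> : p.[x] * x + c - (p.[y] * y + c) = (p.[x] - p.[y]) * x + p.[y] * (x - y) by ring.
apply: le_trans (ler_normD _ _) _; rewrite !normrM.
apply: (@le_trans _ _ (L * `|x - y| * B + L * `|x - y|)).
  by apply: lerD; [apply: ler_pM|rewrite ler_wpM2r].
rewrite -subr_ge0.
rewrite (_ : _ - _ = (L * B + `|c|) * `|x - y|); last by ring.
by rewrite mulr_ge0 // addr_ge0 // mulr_ge0.
Qed.


Section MatrixNorm.
Variable R : realType.

Lemma mx_norm_coord m n (A : 'M[R]_(m, n)) i j : `|A i j| <= `|A|.
Proof. by rewrite [`|A|]/Num.Def.normr /= mx_normrE; apply: (le_bigmax _ _ (i, j)). Qed.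

Lemma mx_norm_bound m n (A : 'M[R]_(m, n)) (B : R) : 0 <= B ->
  (forall i j, `|A i j| <= B) -> `|A| <= B.
Proof.
move=> B0 xB; rewrite [`|A|]/Num.Def.normr /= mx_normrE.
by apply: bigmax_le => // -[i j] _ /=.
Qed.

Lemma mulmx_norm m n p (A : 'M[R]_(m, n)) (B : 'M[R]_(n, p)) :
  `|A *m B| <= n%:R * `|A| * `|B|.
Proof.
apply: mx_norm_bound => [|i j]; first by rewrite !mulr_ge0.
rewrite mxE; apply: le_trans (ler_norm_sum _ _ _) _.
apply: (@le_trans _ _ (\sum_(k < n) `|A| * `|B|)).
  by apply: ler_sum => k _; rewrite normrM ler_pM // mx_norm_coord.
by rewrite sumr_const card_ord -[leRHS]mulrA mulr_natl.
Qed.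
End MatrixNorm.

Section Adjoint.
Variables (R : realType) (X : groupType) (n : nat) (E : locexp R X n).
Local Notation V := 'rV[R]_n.
Implicit Types (u v w : V) (x : X).

Definition cj x (y : X) : X := (x * y * x^-1)%g.
Lemma cjM x : {morph cj x : y z / (y * z)%g}.
Proof. by move=> y z; rewrite /cj -!mulgA mulKg. Qed.

Hypothesis cjC : forall x, cont1 E (cj x \o E).

Definition Ad x : 'M[R]_n := dmx (@cjM x) (@cjC x).

Lemma AdP x v : (x * E v * x^-1)%g = E (v *m Ad x).
Proof. exact: (dmxP (@cjM x) (@cjC x)). Qed.

Lemma Ad_uniq x (D : 'M[R]_n) : (forall v, (x * E v * x^-1)%g = E (v *m D)) -> D = Ad x.
Proof. by move=> h; exact: (dmx_uniq (@cjM x) (@cjC x)). Qed.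

Lemma AdM x y : Ad (x * y) = Ad y * Ad x.
Proof.
apply/esym/Ad_uniq => v; rewrite mulmxA -AdP -AdP invgM; rewrite !mulgA //.
Qed.

Lemma Ad1 : Ad 1 = 1.
Proof. by apply/esym/Ad_uniq => v; rewrite mulmx1 invg1 mulg1 mul1g. Qed.

Lemma AdX x k : Ad (x ^+ k) = Ad x ^+ k.
Proof. by elim: k => [|k IH]; rewrite ?expg0 ?Ad1 // expgSr AdM IH exprS. Qed.

Lemma germ_cj (y : R -> X) v x : germ E y v -> germ E (fun t => x * y t * x^-1)%g (v *m Ad x).
Proof.
move=> [K [t0 [t00 h]]]; exists (n%:R * K * `|Ad x|), t0; split => // t /h[q -> qb].
exists (q *m Ad x); first by rewrite AdP.
rewrite scalemxAl -mulmxBl; apply: le_trans (mulmx_norm _ _) _.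
rewrite [leRHS](_ : _ = n%:R * (K * t ^+ 2) * `|Ad x|); last by ring.
by rewrite ler_wpM2r // ler_wpM2l.
Qed.

(** The tangent counterpart of the upper central series, phrased with [Ad] because the bracket is
    defined only later, with the help of the nilpotency that this filtration gives. *)
Fixpoint fil k v : Prop := if k is k'.+1 then forall x, fil k' (v *m Ad x - v) else v = 0.

Lemma filD k v w : fil k v -> fil k w -> fil k (v + w).
Proof.
elim: k v w => [|k IH] v w /= fv fw; first by rewrite fv fw addr0.
by move=> x; rewrite mulmxDl opprD addrACA; exact: IH.
Qed.

Lemma filZ k (c : R) v : fil k v -> fil k (c *: v).
Proof.
elim: k v => [|k IH] v /= fv; first by rewrite fv scaler0.
by move=> x; rewrite -scalemxAl -scalerBr; exact: IH.
Qed.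

Lemma filS k v : fil k v -> fil k.+1 v.
Proof.
elim: k v => [|k IH] v fv x; first by rewrite fv mul0mx subrr.
exact: IH.
Qed.

(** If y has velocity v, the commutator curve [~ y t, x^-1] has velocity v Ad x - v and lies one
    step lower in the central series. *)
Lemma upper_central_fil k (y : R -> X) v : germ E y v ->
  (exists2 t0 : R, 0 < t0 & forall t, 0 < t <= t0 -> upper_central k (y t)) -> fil k v.
Proof.
elim: k y v => [|k IH] y v gy [t0 t00 h].
  apply: (germ_uniq gy); apply: (germ_eq _ (germ1 E)).
  by exists t0 => // t /h ->.
move=> x; apply: (IH (fun t => [~ y t, x^-1])%g); last first.
  by exists t0 => // t /h; apply.
apply: (@germ_eq _ _ _ _ (fun t => (y t)^-1 * (x * y t * x^-1))%g).
  by exists 1 => // t _; rewrite commgEl conjgE invgK !mulgA.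
by rewrite addrC; apply: germM; [exact: germV|exact: germ_cj].
Qed.

Variable K : nat.
Hypothesis nilX : upper_central K = [set: X].

Lemma filT v : fil K v.
Proof.
apply: (upper_central_fil (germ_lin E v)); exists 1 => // t _.
by rewrite nilX.
Qed.

Lemma Ad_nil x : (Ad x - 1) ^+ K = 0.
Proof.
suff h k v : fil k v -> v *m (Ad x - 1) ^+ k = 0.
  by apply/row_matrixP => i; rewrite rowE h ?row0 //; exact: filT.
elim: k v => [|k IH] v; first by move=> /= ->; rewrite mul0mx.
by move=> fv; rewrite exprS mulmxA IH // mulmxBr mulmx1; exact: fv.
Qed.

(** The product formula gives a small logarithm of E u E v E (- u); [lex_line_small], used along the
    segment from 0 to v, identifies it with v Ad (E u). Testing on d times the basis vectors bounds
    the matrix. *)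
Lemma Ad_near : exists L d : R, [/\ 0 < d, 0 <= L & forall u, `|u| <= d ->
  `|Ad (E u) - 1| <= L * `|u|].
Proof.
have r0 := lrad_gt0 E; have C0 := lcst_ge0 E.
set r := lrad E in r0; set C := lcst E in C0.
pose C1 := C + 1; have C10 : 0 < C1 by rewrite ltr_pwDr.
pose d := Num.min (r / 4) (4 * C1)^-1.
have d0 : 0 < d by rewrite lt_min divr_gt0 // invr_gt0 mulr_gt0.
have dr : d <= r / 4 by rewrite ge_min lexx.
have dC : C * d <= 4^-1.
  apply: (@le_trans _ _ (C1 * d)); first by rewrite ler_wpM2r ?(ltW d0) // lerDl.
  rewrite -ler_pdivlMl // mulrC; apply: (@le_trans _ _ (4 * C1)^-1).
    by rewrite ge_min lexx orbT.
  by rewrite invfM mulrC.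
have main u v : `|u| <= d -> `|v| <= d -> exists q, [/\ E (v *m Ad (E u)) = E q,
    `|q - v| <= 4 * C * d * `|u| & `|q| <= r / 2].
  move=> ud vd; have ur : `|u| <= r by move: ud dr r0; lra.
  have vr : `|v| <= r by move: vd dr r0; lra.
  have [p pE pb] := lex_mul ur vr; rewrite -/C in pb.
  have Cu : C * `|u| <= 4^-1 by apply: le_trans dC; rewrite ler_wpM2l.
  have pn : `|p| <= 3 * d.
    rewrite -(subrK (u + v) p); apply: le_trans (ler_normD _ _) _.
    have h1 := ler_wpM2r (normr_ge0 v) Cu.
    by have := ler_normD u v; move: pb h1 ud vd d0; lra.
  have pr : `|p| <= r by move: pn dr d0; lra.
  have nur : `|- u| <= r by rewrite normrN.
  have [q qE qb] := lex_mul pr nur; rewrite -/C normrN in qb.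
  have qv : `|q - v| <= 4 * C * d * `|u|.
    have -> : q - v = (q - (p - u)) + (p - (u + v)) by vring.
    apply: le_trans (ler_normD _ _) _.
    have h1 := ler_wpM2l (mulr_ge0 C0 (normr_ge0 u)) pn.
    have h2 := ler_wpM2l (mulr_ge0 C0 (normr_ge0 u)) vd.
    by move: qb pb h1 h2; lra.
  have qr : `|q| <= r / 2.
    rewrite -(subrK v q); apply: le_trans (ler_normD _ _) _.
    have h1 := ler_wpM2r (normr_ge0 u) dC.
    have e1 : 4 * C * d * `|u| = 4 * (C * d * `|u|) by ring.
    by move: qv vd ud dr h1; rewrite e1; lra.
  exists q; split => //; by rewrite -AdP -lex_opp pE qE.
have main' u v : `|u| <= d -> `|v| <= d -> `|v *m Ad (E u) - v| <= 4 * C * d * `|u|.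
  move=> ud vd; have [q [qE qv qr]] := main u v ud vd.
  suff -> : v *m Ad (E u) = q by [].
  apply: (@lex_inj _ _ _ E) => //; last by apply: le_trans qr _; move: r0; rewrite -/r; lra.
  apply: lex_line_small => s s0 s1.
  have [|p [pE _ pr]] := main u (s *: v) ud.
    by rewrite normrZ ger0_norm // (le_trans _ vd) // ler_piMl.
  by exists p => //; rewrite -pE scalemxAl.
exists (4 * C), d; split => // [|u ud]; first by rewrite mulr_ge0.
apply: mx_norm_bound => [|i j]; first by rewrite !mulr_ge0.
have de : `|d *: delta_mx 0 i : V| <= d.
  rewrite normrZ (ger0_norm (ltW d0)) -[leRHS]mulr1 ler_wpM2l ?(ltW d0) //.
  apply: mx_norm_bound => // k l; rewrite mxE.
  by case: (_ && _); rewrite ?normr1 ?normr0.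
have := main' u _ ud de.
rewrite -scalemxAl -scalerBr normrZ (ger0_norm (ltW d0)) -rowE.
rewrite (_ : 4 * C * d * `|u| = d * (4 * C * `|u|)); last by ring.
rewrite ler_pM2l // => h; apply: le_trans h.
have := mx_norm_coord (row i (Ad (E u)) - delta_mx 0 i) 0 j.
by rewrite !mxE eqxx [j == i]eq_sym.
Qed.
End Adjoint.

Definition expmx (R : realType) n (K : nat) (A : 'M[R]_n) : 'M[R]_n :=
  \sum_(k < K) (k`!%:R)^-1 *: A ^+ k.

Lemma mulrmxE (R : realType) n (A B : 'M[R]_n) i j : (A * B) i j = \sum_k A i k * B k j.
Proof. by rewrite -mulmxE mxE. Qed.

Lemma exprZmx (R : realType) n (a : R) (A : 'M[R]_n) k : (a *: A) ^+ k = a ^+ k *: A ^+ k.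
Proof.
elim: k => [|k IH]; first by rewrite !expr0 scale1r.
by rewrite !exprS IH -!mulmxE -scalemxAl -scalemxAr scalerA.
Qed.

Lemma quadratic_eq0 (R : realType) (W : normedModType R) (w : W) (K t0 : R) : 0 < t0 ->
  (forall t, 0 < t <= t0 -> `|t *: w| <= K * t ^+ 2) -> w = 0.
Proof.
move=> t00 h; apply: (@norm_harmonic0 _ _ _ (K * t0)) => k.
have t1 : 0 < t0 / k.+1%:R <= t0.
  by rewrite divr_gt0 //= ler_pdivrMr // ler_peMr ?(ltW t00) // ler1n.
have := h _ t1; case/andP: t1 => t1 _.
rewrite normrZ (ger0_norm (ltW t1)) expr2 mulrA [_ * _ * (_ / _)]mulrC ler_pM2l //.
by rewrite mulrA.
Qed.

Lemma poly_taylor2 (R : realType) (p : {poly R}) : exists2 L : R, 0 <= L &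
  forall t, `|t| <= 1 -> `|p.[t] - p.[0] - t * (p^`()).[0]| <= L * t ^+ 2.
Proof.
elim/poly_ind: p => [|p c _].
  by exists 0 => // t _; rewrite deriv0 !horner0 mulr0 !subr0 normr0 mul0r.
have [L L0 h] := poly_lipschitz p 1; exists L => // t t1.
have z1 : `|0 : R| <= 1 by rewrite normr0.
have [_ h2] := h t 0 t1 z1.
rewrite derivD derivM derivX derivC !(hornerD, hornerM, hornerX, hornerC) !mulr0 !add0r addr0 mulr1.
have -> : p.[t] * t + c - c - t * p.[0] = t * (p.[t] - p.[0]) by ring.
rewrite normrM; apply: le_trans (ler_wpM2l (normr_ge0 t) h2) _.
by rewrite subr0 mulrCA -expr2 real_normK // num_real.
Qed.

Section MatrixGerms.
Variables (R : realType) (n : nat).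
Implicit Types (M N : R -> 'M[R]_n) (A B : 'M[R]_n).

Definition mgerm M A := exists K t0 : R, 0 < t0 /\
  forall t, 0 < t <= t0 -> `|M t - 1 - t *: A| <= K * t ^+ 2.

Lemma mgerm_uniq M A B : mgerm M A -> mgerm M B -> A = B.
Proof.
move=> [K [t0 [t00 h]]] [L [s0 [s00 g]]].
apply/eqP; rewrite -subr_eq0; apply/eqP.
apply: (@quadratic_eq0 _ _ _ (K + L) (Num.min t0 s0)); first by rewrite lt_min t00.
move=> t; rewrite le_min => /and3P[tp tt ts].
have -> : t *: (A - B) = (M t - 1 - t *: B) - (M t - 1 - t *: A).
  by apply/matrixP => i j; rewrite !mxE; ring.
apply: le_trans (ler_normB _ _) _; rewrite mulrDl addrC; apply: lerD.
  by apply: h; rewrite tp.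
by apply: g; rewrite tp.
Qed.

Lemma mgermM M N A B : mgerm M A -> mgerm N B -> mgerm (fun t => M t * N t) (A + B).
Proof.
move=> [K [t0 [t00 h]]] [L [s0 [s00 g]]].
exists (n%:R * (K + `|A|) * (L + `|B|) + K + L), (Num.min (Num.min t0 s0) 1).
split; first by rewrite !lt_min t00 s00 ltr01.
move=> t; rewrite !le_min => /and3P[tp /andP[tt ts] t1].
have {}h : `|M t - 1 - t *: A| <= K * t ^+ 2 by apply: h; rewrite tp.
have {}g : `|N t - 1 - t *: B| <= L * t ^+ 2 by apply: g; rewrite tp.
have lin (P : 'M[R]_n) C k : `|P - 1 - t *: C| <= k * t ^+ 2 -> `|P - 1| <= (k + `|C|) * t.
  move=> hh; rewrite -(subrK (t *: C) (P - 1)); apply: le_trans (ler_normD _ _) _.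
  have tl := ltW tp.
  have k0 : 0 <= k.
    by rewrite -(pmulr_lge0 _ (exprn_gt0 2 tp)); apply: le_trans hh.
  rewrite mulrDl normrZ (ger0_norm tl) [t * _]mulrC lerD2r; apply: le_trans hh _.
  by rewrite ler_wpM2l // expr2 -[leRHS]mul1r ler_wpM2r.
have -> : M t * N t - 1 - t *: (A + B) =
    (M t - 1) *m (N t - 1) + (M t - 1 - t *: A) + (N t - 1 - t *: B).
  rewrite mulmxBl !mulmxBr !mul1mx !mulmx1 mulmxE; apply/matrixP => i j; rewrite !mxE; ring.
apply: le_trans (ler_normD _ _) _; rewrite mulrDl; apply: lerD => //.
apply: le_trans (ler_normD _ _) _; rewrite mulrDl; apply: lerD => //.
apply: le_trans (mulmx_norm _ _) _.
rewrite [leRHS](_ : _ = n%:R * ((K + `|A|) * t) * ((L + `|B|) * t)); last by ring.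
by apply: ler_pM => //; rewrite ?mulr_ge0 //; [rewrite ler_wpM2l // lin|exact: lin].
Qed.
End MatrixGerms.

Section Bracket.
Variables (R : realType) (X : groupType) (n : nat) (E : locexp R X n).
Local Notation V := 'rV[R]_n.
Implicit Types (u v w : V) (x : X).
Hypothesis cjC : forall x, cont1 E (cj x \o E).
Variable K : nat.
Hypothesis nilX : upper_central K = [set: X].
Local Notation Ad := (Ad cjC).
Local Notation fil := (fil cjC).

(** The entries of Ad (E v)^t as polynomials in t, by the binomial series, which stops because Ad (E
    v) - 1 is nilpotent. *)
Definition adp v : 'M[{poly R}]_n :=
  \matrix_(i, j) \sum_(k < K) ((Ad (E v) - 1) ^+ k) i j *: bpol R k.
Definition adq v (t : R) : 'M[R]_n := map_mx (fun p : {poly R} => p.[t]) (adp v).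

Lemma adqE v t : adq v t = \sum_(k < K) (bpol R k).[t] *: (Ad (E v) - 1) ^+ k.
Proof.
apply/matrixP => i j; rewrite !mxE horner_sum summxE; apply: eq_bigr => k _.
by rewrite hornerZ mxE mulrC.
Qed.

Lemma adq_nat v (j : nat) : adq v j%:R = Ad (E (j%:R *: v)).
Proof.
rewrite lex_nat AdX -{1}[Ad (E v)](subrKC 1) exprDn_comm; last exact/commr_sym/commr1.
rewrite adqE.
under [RHS]eq_bigr do rewrite expr1n mul1r.
under [LHS]eq_bigr => k _ do rewrite bpol_nat scaler_nat.
rewrite -(big_mkord xpredT (fun k => (Ad (E v) - 1) ^+ k *+ 'C(j, k))).
rewrite -[RHS](big_mkord xpredT (fun k => (Ad (E v) - 1) ^+ k *+ 'C(j, k))).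
have tail a b : (forall k, (a <= k < b)%N -> (Ad (E v) - 1) ^+ k *+ 'C(j, k) = 0) -> (a <= b)%N ->
    \sum_(0 <= k < b) (Ad (E v) - 1) ^+ k *+ 'C(j, k) =
    \sum_(0 <= k < a) (Ad (E v) - 1) ^+ k *+ 'C(j, k).
  move=> h ab; rewrite (@big_cat_nat _ _ _ a) //= [X in _ + X]big_nat_cond [X in _ + X]big1 ?addr0 //.
  by move=> k; rewrite andbT => /h.
have [jK|Kj] := leqP j.+1 K.
  by rewrite (tail j.+1 K) // => k /andP[jk _]; rewrite bin_small // mulr0n.
rewrite (tail K j.+1) // ?(ltnW Kj) // => k /andP[Kk _].
by rewrite -(subnK Kk) exprD (Ad_nil cjC nilX) mulr0 mul0rn.
Qed.

Lemma adq_coord v t i j : adq v t i j = (adp v i j).[t].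
Proof. by rewrite mxE. Qed.

Lemma adp_comp v (m : nat) : (0 < m)%N ->
  forall t, adq (m%:R^-1 *: v) (m%:R * t) = adq v t.
Proof.
move=> m0 t; apply/matrixP => i j; rewrite !adq_coord.
have m0' : m%:R != 0 :> R by rewrite pnatr_eq0 -lt0n.
have -> : adp v i j = adp (m%:R^-1 *: v) i j \Po (m%:R *: 'X).
  apply: poly_nat_eq => k; rewrite horner_comp !hornerE -natrM -!adq_coord !adq_nat.
  by rewrite natrM scalerA mulrAC divff // mul1r.
by rewrite horner_comp !hornerE.
Qed.

Lemma adq_lipschitz v (T : R) : exists2 B : R, 0 <= B & forall x y : R, `|x| <= T -> `|y| <= T ->
  `|adq v x| <= B /\ `|adq v x - adq v y| <= B * `|x - y|.
Proof.
have /choice[L LP] (ij : 'I_n * 'I_n) : exists L : R, 0 <= L /\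
    forall x y : R, `|x| <= T -> `|y| <= T -> `|(adp v ij.1 ij.2).[x]| <= L /\
    `|(adp v ij.1 ij.2).[x] - (adp v ij.1 ij.2).[y]| <= L * `|x - y|.
  by have [L L0 h] := poly_lipschitz (adp v ij.1 ij.2) T; exists L.
have S0 : 0 <= \sum_ij L ij by apply: sumr_ge0 => ij _; exact: (LP ij).1.
have LS ij : L ij <= \sum_ij L ij.
  rewrite (bigD1 ij) //= lerDl; apply: sumr_ge0 => k _; exact: (LP k).1.
exists (\sum_ij L ij) => // x y xT yT; split; apply: mx_norm_bound => //.
- move=> i j; rewrite adq_coord; apply: le_trans (LS (i, j)).
  by have [_ /(_ x y xT yT)[]] := LP (i, j).
- by rewrite mulr_ge0.
move=> i j; have -> : (adq v x - adq v y) i j = adq v x i j - adq v y i j by rewrite !mxE.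
rewrite !adq_coord.
apply: le_trans (ler_wpM2r _ (LS (i, j))) => //.
by have [_ /(_ x y xT yT)[]] := LP (i, j).
Qed.

(** The two sides agree at rational t, by subdividing v. A real t is rounded down to a / m, and
    [Ad_near] controls the remaining factor. *)
Lemma adq_ge0 v t : 0 <= t -> Ad (E (t *: v)) = adq v t.
Proof.
move=> t0.
have [L [d [d0 L0 near]]] := Ad_near cjC.
have [B B0 lip] := adq_lipschitz v t.
apply/eqP; rewrite -subr_eq0; apply/eqP.
apply: (@norm_harmonic0 _ _ _ (n%:R * (L * `|v|) * B + B)) => k.
pose m := (Num.truncn (`|v| / d) + k).+1.
have m0 : 0 < m%:R :> R by rewrite ltr0n.
have md : `|v| / m%:R <= d.
  rewrite ler_pdivrMr // mulrC -ler_pdivrMr //; apply: ltW.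
  by apply: lt_le_trans (truncnS_gt _) _; rewrite ler_nat ltnS leq_addr.
apply: (@le_trans _ _ ((n%:R * (L * `|v|) * B + B) / m%:R)); last first.
  rewrite ler_wpM2l ?addr_ge0 ?mulr_ge0 //.
  by rewrite lef_pV2 ?posrE ?ltr0n // ler_nat ltnS leq_addl.
have /andP[a1 a2] := truncn_itv (mulr_ge0 t0 (ltW m0)).
set a := Num.truncn _ in a1 a2.
pose s := t - a%:R / m%:R.
have s0 : 0 <= s by rewrite subr_ge0 ler_pdivrMr.
have am0 : 0 <= a%:R / m%:R :> R by exact: divr_ge0.
have sm : s <= m%:R^-1.
  have h3 : t <= (a%:R + 1) / m%:R by rewrite ler_pdivlMr // natr1 ltW.
  by rewrite /s lerBlDl; apply: le_trans h3 _; rewrite mulrDl mul1r.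
have tE : t = a%:R / m%:R + s by rewrite /s addrC subrK.
have Qa : Ad (E ((a%:R / m%:R) *: v)) = adq v (a%:R / m%:R).
  have e : m%:R * (a%:R / m%:R) = a%:R :> R by rewrite mulrC divfK // gt_eqF.
  by rewrite -(@adp_comp v m isT) e adq_nat scalerA.
rewrite {1}tE lex_add AdM Qa.
have -> : Ad (E (s *: v)) * adq v (a%:R / m%:R) - adq v t =
   (Ad (E (s *: v)) - 1) *m adq v (a%:R / m%:R) + (adq v (a%:R / m%:R) - adq v t).
  by rewrite mulmxBl mul1mx addrA subrK.
apply: le_trans (ler_normD _ _) _; rewrite [leRHS]mulrDl.
have ta : `|a%:R / m%:R| <= t by rewrite ger0_norm // -subr_ge0.
have tt : `|t| <= t by rewrite ger0_norm.
have [Bb Bl] := lip _ _ ta tt.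
have sv : `|s *: v| <= `|v| / m%:R by rewrite normrZ ger0_norm // mulrC ler_wpM2l.
apply: lerD.
  apply: le_trans (mulmx_norm _ _) _.
  rewrite [leRHS](_ : _ = n%:R * (L * (`|v| / m%:R)) * B); last by ring.
  apply: ler_pM => //.
  rewrite ler_wpM2l //; apply: le_trans (near _ (le_trans sv md)) _.
  by rewrite ler_wpM2l.
apply: le_trans Bl _; rewrite ler_wpM2l // distrC ger0_norm //.
Qed.

(** The identity holds at pairs of integers; both sides are polynomial in each variable, and the
    variables are freed one after the other. *)
Lemma adqD v s t : adq v (s + t) = adq v s * adq v t.
Proof.
have nn (k l : nat) : adq v (k%:R + l%:R) = adq v k%:R * adq v l%:R.
  by rewrite -natrD !adq_nat addnC !lex_nat expgnDr AdM.
have pn (l : nat) r : adq v (r + l%:R) = adq v r * adq v l%:R.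
  apply/matrixP => i j; rewrite adq_coord.
  pose p := adp v i j \Po ('X + l%:R%:P).
  pose q := \sum_k (adp v i k * (adq v l%:R k j)%:P).
  have pq : p = q.
    apply: poly_nat_eq => k; rewrite /p /q horner_comp !hornerE horner_sum -adq_coord nn.
    by rewrite mulrmxE; apply: eq_bigr => h _; rewrite !(hornerM, hornerC) -adq_coord.
  have := congr1 (fun p : {poly R} => p.[r]) pq.
  rewrite /p /q horner_comp !hornerE horner_sum => ->.
  by rewrite mulrmxE; apply: eq_bigr => h _; rewrite !(hornerM, hornerC) -adq_coord.
apply/matrixP => i j; rewrite adq_coord.
pose p := adp v i j \Po ('X + s%:P).
pose q := \sum_k ((adq v s i k)%:P * adp v k j).
have pq : p = q.
  apply: poly_nat_eq => k; rewrite /p /q horner_comp !hornerE horner_sum -adq_coord.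
  rewrite addrC pn.
  by rewrite mulrmxE; apply: eq_bigr => h _; rewrite !(hornerM, hornerC) -adq_coord.
have := congr1 (fun p : {poly R} => p.[t]) pq.
rewrite /p /q horner_comp !hornerE horner_sum addrC => ->.
by rewrite mulrmxE; apply: eq_bigr => h _; rewrite !(hornerM, hornerC) -adq_coord.
Qed.

Lemma adq0 v : adq v 0 = 1.
Proof. by rewrite -[0]/(0%:R) adq_nat scale0r lex_zero Ad1. Qed.

Lemma adqP v t : Ad (E (t *: v)) = adq v t.
Proof.
have [t0|t0] := leP 0 t; first exact: adq_ge0.
have h1 : adq v t * adq v (- t) = 1 by rewrite -adqD subrr adq0.
have h2 : Ad (E (- t *: v)) * Ad (E (t *: v)) = 1.
  by rewrite -AdM scaleNr lex_opp mulgV Ad1.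
rewrite adq_ge0 ?oppr_ge0 ?ltW // in h2.
by rewrite -[LHS]mul1r -h1 -mulrA h2 mulr1.
Qed.

(** This is ad v acting on row vectors: the derivative at t = 0 of Ad (E (t v)). *)
Definition br v : 'M[R]_n := \matrix_(i, j) ((adp v i j)^`()).[0].

Lemma adp_deriv v i j : (adp v i j)^`() = \sum_k ((br v i k)%:P * adp v k j).
Proof.
apply: poly_nat_eq => l; set t : R := l%:R.
pose p := adp v i j \Po ('X + t%:P).
pose q := \sum_k (adp v i k * (adq v t k j)%:P).
have pq : p = q.
  apply: poly_nat_eq => k; rewrite /p /q horner_comp !hornerE horner_sum -adq_coord.
  by rewrite adqD mulrmxE; apply: eq_bigr => h _; rewrite !(hornerM, hornerC) -adq_coord.
have := congr1 (fun p : {poly R} => (p^`()).[0]) pq.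
rewrite /p /q deriv_comp hornerM horner_comp derivD derivX derivC addr0 hornerC mulr1
  hornerD hornerX hornerC add0r => ->.
rewrite raddf_sum /= !horner_sum; apply: eq_bigr => k _.
by rewrite derivM derivC mulr0 addr0 !(hornerM, hornerC) -adq_coord [br v i k]mxE.
Qed.

Lemma adp_coef v k i j : (adp v i j)`_k = (k`!%:R)^-1 * (br v ^+ k) i j.
Proof.
elim: k i j => [|k IH] i j.
  rewrite fact0 invr1 mul1r expr0 -horner_coef0 -adq_coord adq0 //.
have := congr1 (fun p : {poly R} => p`_k) (adp_deriv v i j).
rewrite coef_deriv coef_sum => h.
have k0 : k.+1%:R != 0 :> R by rewrite pnatr_eq0.
have f0 : k`!%:R != 0 :> R by rewrite pnatr_eq0 -lt0n fact_gt0.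
apply: (mulfI k0); rewrite -mulr_natl in h; rewrite h.
rewrite factS natrM invfM mulrA mulrA divff // mul1r exprS mulrmxE big_distrr /=.
by apply: eq_bigr => l _; rewrite coefCM IH mulrCA.
Qed.

(** [adp_deriv] is a linear differential equation with constant matrix [br v], which determines the
    Taylor coefficients; the degree is below K because only binomials of index below K occur. *)
Lemma adqE_exp v t : adq v t = expmx K (t *: br v).
Proof.
apply/matrixP => i j; rewrite adq_coord /expmx summxE.
have sz : (size (adp v i j) <= K)%N.
  rewrite mxE; apply: (leq_trans (size_sum _ _ _)); apply/bigmax_leqP => k _.
  apply: (leq_trans (size_scale_leq _ _)); apply: (leq_trans (size_scale_leq _ _)).
  by rewrite size_prod_XsubC /index_enum -enumT size_enum_ord.
rewrite (horner_coef_wide _ sz); apply: eq_bigr => k _.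
by rewrite adp_coef exprZmx !mxE; ring.
Qed.

Lemma Ad_exp v : Ad (E v) = expmx K (br v).
Proof. by rewrite -{1}[v]scale1r adqP adqE_exp scale1r. Qed.

Lemma mgerm_line v (c : R) : mgerm (fun t => Ad (E (t *: (c *: v)))) (c *: br v).
Proof.
have /choice[L LP] (ij : 'I_n * 'I_n) : exists L : R, 0 <= L /\
    forall t : R, `|t| <= 1 -> `|(adp v ij.1 ij.2).[t] - (adp v ij.1 ij.2).[0]
      - t * ((adp v ij.1 ij.2)^`()).[0]| <= L * t ^+ 2.
  by have [L L0 h] := poly_taylor2 (adp v ij.1 ij.2); exists L.
have S0 : 0 <= \sum_ij L ij by apply: sumr_ge0 => ij _; exact: (LP ij).1.
have LS ij : L ij <= \sum_ij L ij.
  rewrite (bigD1 ij) //= lerDl; apply: sumr_ge0 => k _; exact: (LP k).1.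
have c1 : 0 < `|c| + 1 by rewrite ltr_wpDl.
exists ((\sum_ij L ij) * c ^+ 2), (`|c| + 1)^-1; split; first by rewrite invr_gt0.
move=> t /andP[t0 tc]; rewrite scalerA adqP -(adq0 v).
have tc1 : `|t * c| <= 1.
  have tl := ltW t0; rewrite normrM (ger0_norm tl) -(mulVf (lt0r_neq0 c1)).
  by rewrite ler_pM // ?(ltW t0) // lerDl.
apply: mx_norm_bound => [|i j]; first by apply: mulr_ge0 (sqr_ge0 _); apply: mulr_ge0 (sqr_ge0 _).
have -> : (adq v (t * c) - adq v 0 - t *: (c *: br v)) i j =
    (adp v i j).[t * c] - (adp v i j).[0] - t * c * ((adp v i j)^`()).[0].
  by rewrite !mxE mulrA.
apply: le_trans ((LP (i, j)).2 _ tc1) _; rewrite -mulrA -exprMn [c * t]mulrC.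
by rewrite ler_wpM2r ?sqr_ge0.
Qed.

Lemma brZ (c : R) v : br (c *: v) = c *: br v.
Proof.
apply: (mgerm_uniq _ (mgerm_line v c)).
by have := mgerm_line (c *: v) 1; rewrite !scale1r.
Qed.

Lemma mgerm_small (y : R -> X) : germ E y 0 -> mgerm (fun t => Ad (y t)) 0.
Proof.
have [L [d [d0 L0 near]]] := Ad_near cjC.
move=> /(germ_weaken d0)[k [t0 [t00 _ k0 h]]].
exists (L * k), t0; split => // t /h[q [-> qb qd _]].
rewrite scaler0 subr0; apply: le_trans (near q qd) _; rewrite -mulrA ler_wpM2l //.
by move: qb; rewrite scaler0 subr0.
Qed.

Lemma brD v w : br (v + w) = br v + br w.
Proof.
pose y t := (E (t *: - (v + w)) * E (t *: v) * E (t *: w))%g.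
have yg : germ E y 0.
  have := germM (germM (germ_lin E (- (v + w))) (germ_lin E v)) (germ_lin E w).
  by have -> : - (v + w) + v + w = 0 by vring.
have line u : mgerm (fun t => Ad (E (t *: u))) (br u).
  by have := mgerm_line u 1; rewrite !scale1r.
have := mgermM (line w) (mgermM (line v) (line (- (v + w)))).
have -> : (fun t => Ad (E (t *: w)) * (Ad (E (t *: v)) * Ad (E (t *: - (v + w))))) =
    (fun t => Ad (y t)) by apply/funext => t; rewrite /y !AdM.
move=> /mgerm_uniq/(_ (mgerm_small yg)).
rewrite -scaleN1r brZ scaleN1r addrA => /eqP; rewrite subr_eq0 addrC => /eqP ->//.
Qed.

Lemma br_self v : v *m br v = 0.
Proof.
have fixv t : v *m Ad (E (t *: v)) = v.
  apply: (@lex_line_inj _ _ _ E) => s.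
  rewrite scalemxAl -AdP lex_comm mulgK //.
have := mgerm_line v 1; rewrite !scale1r => -[k [t0 [t00 h]]].
apply: (@quadratic_eq0 _ _ _ (n%:R * `|v| * k) t0 t00) => t tt.
have -> : t *: (v *m br v) = - (v *m (Ad (E (t *: v)) - 1 - t *: br v)).
  by rewrite !mulmxBr fixv mulmx1 subrr sub0r opprK scalemxAr.
rewrite normrN; apply: le_trans (mulmx_norm _ _) _; rewrite -[leRHS]mulrA ler_wpM2l ?mulr_ge0 //.
exact: h.
Qed.

Fixpoint bfil k v : Prop := if k is k'.+1 then forall u, bfil k' (v *m br u) else v = 0.

(** Differentiating the binomial series writes ad u as a combination of positive powers of Ad (E u)
    - 1; the constant term has derivative 0. *)
Lemma br_fil k u v : fil k.+1 v -> fil k (v *m br u).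
Proof.
move=> fv.
have fN j w : fil k.+1 w -> fil k (w *m (Ad (E u) - 1) ^+ j.+1).
  elim: j w => [|j IH] w fw.
    by rewrite expr1 mulmxBr mulmx1; exact: fw.
  rewrite exprS mulmxA; apply: IH; apply: filS.
  by rewrite mulmxBr mulmx1; exact: fw.
have -> : v *m br u = \sum_(j < K) (bpol R j)^`().[0] *: (v *m (Ad (E u) - 1) ^+ j).
  apply/rowP => i; rewrite mxE summxE.
  under eq_bigr => l _ do rewrite [br u l i]mxE [adp u l i]mxE raddf_sum /= horner_sum big_distrr /=.
  rewrite exchange_big /=; apply: eq_bigr => j _; rewrite [in RHS]mxE [in RHS]mxE big_distrr /=.
  by apply: eq_bigr => l _; rewrite derivZ hornerZ; ring.
elim/big_ind: _ => [|a b|j _].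
- by elim: k {fv fN} => //= k IH x; rewrite mul0mx subrr.
- exact: filD.
case: j => -[|j] jK; last by apply: filZ; exact: fN.
rewrite /= bpol0 -[1]/(1%:P) derivC horner0 scale0r.
by elim: k {fv fN} => //= k IH x; rewrite mul0mx subrr.
Qed.

Lemma bfilT v : bfil K v.
Proof.
have h k w : fil k w -> bfil k w.
  elim: k w => [//|k IH] w fw u; apply: IH; exact: br_fil.
by apply: h; exact: filT.
Qed.
End Bracket.

Lemma poly_taylor (R : realType) (p : {poly R}) (B : R) : exists2 L : R, 0 <= L &
  forall x y, `|x| <= B -> `|y| <= B ->
    `|p.[y] - p.[x] - (y - x) * p^`().[x]| <= L * (y - x) ^+ 2.
Proof.
elim/poly_ind: p => [|p c [L L0 h]].
  by exists 0 => // x y _ _; rewrite deriv0 !horner0 mulr0 !subr0 normr0 mul0r.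
have [M M0 g] := poly_lipschitz p B; exists (`|B| * L + M).
  by rewrite addr_ge0 // mulr_ge0.
move=> x y xB yB; rewrite derivD derivM derivX derivC !(hornerD, hornerM, hornerX, hornerC) addr0 mulr1.
have -> : p.[y] * y + c - (p.[x] * x + c) - (y - x) * (p^`().[x] * x + p.[x]) =
  x * (p.[y] - p.[x] - (y - x) * p^`().[x]) + (y - x) * (p.[y] - p.[x]) by ring.
apply: le_trans (ler_normD _ _) _; rewrite [leRHS]mulrDl !normrM; apply: lerD.
  rewrite -mulrA; apply: ler_pM => //; last exact: h.
  by apply: le_trans xB _; exact: ler_norm.
have [_ g2] := g y x yB xB.
apply: le_trans (ler_wpM2l (normr_ge0 _) g2) _.
by rewrite mulrCA -expr2 real_normK // num_real.
Qed.

Lemma riemann_sum (R : realType) (P : {poly R}) : exists2 L : R, 0 <= L &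
  forall m : nat, `|m.+1%:R^-1 * (\sum_(k < m.+1) P^`().[k%:R / m.+1%:R]) - (P.[1] - P.[0])|
    <= L / m.+1%:R.
Proof.
have [L L0 h] := poly_taylor P 1; exists L => // m.
have m0 : 0 < m.+1%:R :> R by rewrite ltr0n.
have ub (k : nat) : (k <= m.+1)%N -> `|k%:R / m.+1%:R : R| <= 1.
  by move=> km; rewrite ger0_norm ?divr_ge0 // ler_pdivrMr // mul1r ler_nat.
have -> : P.[1] - P.[0] =
    \sum_(k < m.+1) (P.[k.+1%:R / m.+1%:R] - P.[k%:R / m.+1%:R]).
  rewrite -(big_mkord xpredT (fun k => P.[k.+1%:R / m.+1%:R] - P.[k%:R / m.+1%:R])).
  by rewrite (telescope_sumr (fun k => P.[k%:R / m.+1%:R])) // divff ?gt_eqF // mul0r.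
rewrite mulr_sumr -sumrB; apply: le_trans (ler_norm_sum _ _ _) _.
apply: (@le_trans _ _ (\sum_(k < m.+1) L * m.+1%:R^-1 ^+ 2)).
  apply: ler_sum => k _; rewrite distrC.
  have e : k.+1%:R / m.+1%:R - k%:R / m.+1%:R = m.+1%:R^-1 :> R.
    by rewrite -mulrBl -natr1 addrC addKr mul1r.
  by have := h _ _ (ub k (ltnW (ltn_ord k))) (ub k.+1 (ltn_ord k)); rewrite e.
rewrite sumr_const card_ord -mulr_natl expr2.
by rewrite le_eqVlt; apply/orP; left; apply/eqP; field; rewrite gt_eqF.
Qed.

Lemma le_harmonic_add (R : realType) (x y Q : R) (m : nat) :
  (forall k : nat, (m <= k)%N -> x <= y + Q / k.+1%:R) -> x <= y.
Proof.
move=> h; rewrite -subr_le0.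
have [Q0|Q0] := leP Q 0.
  have := h m (leqnn m); rewrite -lerBlDl => h1; apply: le_trans h1 _.
  by rewrite mulr_le0_ge0.
rewrite leNgt; apply/negP => xy.
pose k := (m + Num.truncn (Q / (x - y)))%N.
have := h k (leq_addr _ _); rewrite -lerBlDl leNgt => /negP; apply.
rewrite ltr_pdivrMr // mulrC -ltr_pdivrMr //; apply: lt_le_trans (truncnS_gt _) _.
by rewrite ler_nat ltnS leq_addl.
Qed.

Section ProductEstimate.
Variables (R : realType) (X : groupType) (n : nat) (E : locexp R X n).
Local Notation V := 'rV[R]_n.

Lemma product_estimate (f : nat -> V) (P : nat -> X) (s : R) m :
  P 0%N = 1%g -> (forall k, (k < m)%N -> P k.+1 = (E (f k) * P k)%g) ->
  \sum_(k < m) `|f k| <= s -> 2 * s <= lrad E -> 2 * lcst E * s <= 1 ->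
  exists q, [/\ P m = E q, `|q| <= 2 * s & `|q - \sum_(k < m) f k| <= 2 * lcst E * s ^+ 2].
Proof.
move=> P0; have C0 := lcst_ge0 E.
elim: m s => [|m IH] s PS.
  rewrite big_ord0 => s0 _ _; exists 0; rewrite big_ord0 P0 lex_zero subrr normr0; split => //.
    by rewrite mulr_ge0.
  by apply: mulr_ge0 (sqr_ge0 _); rewrite mulr_ge0.
rewrite !big_ord_recr /= => fs sr sC.
set a := \sum_(i < m) `|f i| in fs; set b := `|f m| in fs.
have a0 : 0 <= a by apply: sumr_ge0.
have b0 : 0 <= b by exact: normr_ge0.
have as_ : a <= s by move: fs b0; lra.
have Cas : 2 * lcst E * a <= 1.
  by apply: le_trans sC; apply: ler_wpM2l => //; rewrite mulr_ge0.
have [||||q [Pq qa qb]] := IH a => //.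
- by move=> k km; apply: PS; exact: ltnW.
- by move: as_ sr; lra.
have br : `|f m| <= lrad E by rewrite -/b; move: as_ fs sr a0; lra.
have qr : `|q| <= lrad E by move: qa as_ sr; lra.
have [p pE pb] := lex_mul br qr; exists p.
have main : `|p - (\sum_(k < m) f k + f m)| <= 2 * lcst E * s ^+ 2.
  have -> : p - (\sum_(k < m) f k + f m) = (p - (f m + q)) + (q - \sum_(k < m) f k).
    by move: (\sum_(k < m) f k) => z; vring.
  apply: le_trans (ler_normD _ _) _.
  apply: (@le_trans _ _ (2 * lcst E * (b * a + a ^+ 2))).
    rewrite mulrDr; apply: lerD => //; apply: le_trans pb _.
    rewrite [leRHS](_ : _ = lcst E * b * (2 * a)); last by ring.
    by rewrite ler_wpM2l // mulr_ge0.
  rewrite ler_wpM2l ?mulr_ge0 // (_ : b * a + a ^+ 2 = (a + b) * a); last by ring.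
  by rewrite expr2 ler_pM // addr_ge0.
split => //; first by rewrite PS // Pq pE.
have sm : `|\sum_(k < m) f k + f m| <= s.
  apply: le_trans (ler_normD _ _) _; apply: le_trans fs; rewrite lerD2r; exact: ler_norm_sum.
rewrite -(subrK (\sum_(k < m) f k + f m) p).
apply: le_trans (ler_normD _ _) _; rewrite mulr_natl mulr2n; apply: lerD => //.
apply: le_trans main _; rewrite expr2 mulrA -[leRHS]mul1r; apply: ler_wpM2r => //.
by apply: le_trans as_.
Qed.
End ProductEstimate.

(** * The differential of the exponential *)

Section DExp.
Variables (R : realType) (X : groupType) (n : nat) (E : locexp R X n).
Local Notation V := 'rV[R]_n.
Implicit Types (u v w c : V) (x : X).
Hypothesis cjC : forall x, cont1 E (cj x \o E).
Variable K : nat.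
Hypothesis nilX : upper_central K = [set: X].
Local Notation Ad := (Ad cjC).
Local Notation br := (br cjC K).
Local Notation adq := (adq cjC K).

(** A truncation of (1 - exp (- A)) / A, the left-trivialised differential of the exponential at a
    point c with ad c = A. *)
Definition dexp (A : 'M[R]_n) : 'M[R]_n := \sum_(k < K) ((-1) ^+ k / k.+1`!%:R) *: A ^+ k.

Lemma br_sum I (r : seq I) (F : I -> V) : br (\sum_(i <- r) F i) = \sum_(i <- r) br (F i).
Proof.
elim: r => [|i r IH]; last by rewrite !big_cons (brD cjC nilX) IH.
by rewrite !big_nil -(scale0r (0 : V)) (brZ cjC nilX) scale0r.
Qed.

Lemma br_bound : exists2 B : R, 0 <= B & forall c, `|br c| <= B * `|c|.
Proof.
exists (\sum_i `|br (delta_mx 0 i)|) => [|c]; first exact: sumr_ge0.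
rewrite {1}(row_sum_delta c) br_sum; apply: le_trans (ler_norm_sum _ _ _) _.
rewrite mulr_suml; apply: ler_sum => i _; rewrite (brZ cjC nilX) normrZ mulrC.
by apply: ler_wpM2l => //; exact: mx_norm_coord.
Qed.

Lemma expr_mx_bound (A : 'M[R]_n) (B : R) k : `|A| <= B -> `|A ^+ k| <= (1 + n%:R * B) ^+ k.
Proof.
move=> AB; have B0 : 0 <= B := le_trans (normr_ge0 _) AB.
have B1 : 0 <= 1 + n%:R * B by rewrite addr_ge0 // mulr_ge0.
elim: k => [|k IH].
  rewrite !expr0; apply: mx_norm_bound => // i j.
  by rewrite mxE; case: (_ == _); rewrite ?normr1 ?normr0.
rewrite !exprS -mulmxE; apply: le_trans (mulmx_norm _ _) _; apply: ler_pM => //.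
by apply: le_trans (ler_wpM2l _ AB) _ => //; rewrite lerDr.
Qed.

Lemma mxpoly_bound (a : nat -> R) (A : 'M[R]_n) (B : R) : (forall k, `|a k| <= 1) -> `|A| <= B ->
  `|\sum_(k < K) a k *: A ^+ k| <= K%:R * (1 + n%:R * B) ^+ K.
Proof.
move=> a1 AB; have B0 : 0 <= B := le_trans (normr_ge0 _) AB.
have B1 : 1 <= 1 + n%:R * B by rewrite lerDl mulr_ge0.
have [Z ZE] : exists Z, Z = (1 + n%:R * B) ^+ K by exists ((1 + n%:R * B) ^+ K).
rewrite -ZE; apply: le_trans (ler_norm_sum _ _ _) _.
rewrite mulr_natl -[in leRHS](card_ord K) -sumr_const; apply: ler_sum => k _.
rewrite ZE.
rewrite normrZ -[leRHS]mul1r; apply: ler_pM => //.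
apply: le_trans (expr_mx_bound _ AB) _; apply: ler_weXn2l => //; exact: ltnW.
Qed.

Lemma invf_le1 k : `|(k`!%:R : R)^-1| <= 1.
Proof. by rewrite ger0_norm // invf_le1 ?ler1n ?ltr0n fact_gt0. Qed.

Lemma adq_bound (T : R) : exists2 M : R, 0 <= M & forall c (t : R), `|c| <= T -> `|t| <= 1 ->
  `|adq c t| <= M /\ `|dexp (br c)| <= M.
Proof.
have [B B0 h] := br_bound.
exists (K%:R * (1 + n%:R * (B * `|T|)) ^+ K).
  by rewrite mulr_ge0 // exprn_ge0 // addr_ge0 // !mulr_ge0.
move=> c t cT t1.
have bT : `|br c| <= B * `|T|.
  by apply: le_trans (h c) _; rewrite ler_wpM2l // (le_trans cT) // ler_norm.
split.
  rewrite (adqE_exp cjC nilX); apply: (mxpoly_bound (a := fun k => k`!%:R^-1)); first exact: invf_le1.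
  by rewrite normrZ; apply: le_trans bT; rewrite ler_piMl.
apply: (mxpoly_bound (a := fun k => (-1) ^+ k / k.+1`!%:R)) bT => k.
by rewrite normrM normrX normrN1 expr1n mul1r invf_le1.
Qed.

Lemma dexp_sum c : exists2 L : R, 0 <= L & forall m : nat,
  `|m.+1%:R^-1 *: (\sum_(k < m.+1) adq c (- (k%:R / m.+1%:R))) - dexp (br c)| <= L / m.+1%:R.
Proof.
pose P (ij : 'I_n * 'I_n) : {poly R} :=
  \sum_(k < K) ((-1) ^+ k / k.+1`!%:R * (br c ^+ k) ij.1 ij.2) *: 'X^(k.+1).
have /choice[L LP] ij : exists L : R, 0 <= L /\ forall m : nat,
  `|m.+1%:R^-1 * (\sum_(k < m.+1) (P ij)^`().[k%:R / m.+1%:R]) - ((P ij).[1] - (P ij).[0])|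
    <= L / m.+1%:R by have [L L0 h] := riemann_sum (P ij); exists L.
have S0 : 0 <= \sum_ij L ij by apply: sumr_ge0 => ij _; exact: (LP ij).1.
have LS ij : L ij <= \sum_ij L ij.
  rewrite (bigD1 ij) //= lerDl; apply: sumr_ge0 => k _; exact: (LP k).1.
have P1 i j : (P (i, j)).[1] - (P (i, j)).[0] = (dexp (br c)) i j.
  rewrite /P !horner_sum summxE -sumrB; apply: eq_bigr => k _.
  by rewrite !hornerE expr1n expr0n /= mulr0 subr0 mulr1 mxE.
have Pd i j (t : R) : (P (i, j))^`().[t] = adq c (- t) i j.
  rewrite (adqE_exp cjC nilX) /P raddf_sum /= horner_sum summxE; apply: eq_bigr => k _.
  rewrite exprZmx !mxE derivZ derivXn !(hornerE, hornerMn) /= (exprNn t).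
  have f0 : k`!%:R != 0 :> R by rewrite pnatr_eq0 -lt0n fact_gt0.
  have k0 : k.+1%:R != 0 :> R by rewrite pnatr_eq0.
  rewrite factS natrM -[t ^+ k *+ k.+1]mulr_natr; move: (k`!%:R) (k.+1%:R) f0 k0 => a b a0 b0.
  by field; rewrite a0.
exists (\sum_ij L ij) => // m; apply: mx_norm_bound => [|i j]; first by rewrite divr_ge0.
rewrite !mxE summxE -P1.
under eq_bigr do rewrite -Pd.
apply: le_trans ((LP (i, j)).2 m) _; rewrite ler_wpM2r //.
Qed.

Lemma conj_prod (x y : X) (m : nat) (P : nat -> X) : P 0%N = 1%g ->
  (forall k, P k.+1 = (x ^- k * y * x ^+ k) * P k)%g -> ((x * y) ^+ m = x ^+ m * P m)%g.
Proof.
move=> P0 PS; elim: m => [|m IH]; first by rewrite P0 !expg0 mulg1.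
by rewrite !expgS IH PS -!mulgA mulVKg.
Qed.

(* E(c + w) is the m-th power of E(c/m + w/m); moving the factors E(c/m) to the left
   leaves a product of m small conjugates, whose logarithms form a Riemann sum. *)
Lemma dexpP (T : R) : exists d Q : R, [/\ 0 < d, 0 <= Q & forall c w, `|c| <= T -> `|w| <= d ->
  exists2 w', E (c + w) = (E c * E w')%g & `|w' - w *m dexp (br c)| <= Q * `|w| ^+ 2].
Proof.
have r0 := lrad_gt0 E; have C0 := lcst_ge0 E.
have [M M0 Mb] := adq_bound T.
pose mu := n%:R * 2 * M + 1.
have mu0 : 0 < mu by rewrite ltr_wpDl // !mulr_ge0.
pose C1 := lcst E + 1; have C10 : 0 < C1 by rewrite ltr_wpDl.
pose d := Num.min (lrad E / (4 * mu)) (4 * C1 * mu)^-1.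
have d0 : 0 < d by rewrite lt_min divr_gt0 ?mulr_gt0 // invr_gt0 !mulr_gt0.
exists d, (2 * lcst E * mu ^+ 2); split => // [|c w cT wd].
  by apply: mulr_ge0 (sqr_ge0 _); rewrite mulr_ge0.
have T0 : 0 <= T := le_trans (normr_ge0 _) cT.
have s1 : 4 * (mu * `|w|) <= lrad E.
  have : `|w| <= lrad E / (4 * mu) by apply: le_trans wd _; rewrite ge_min lexx.
  by rewrite ler_pdivlMr ?mulr_gt0 // mulrC -mulrA.
have s2 : 4 * lcst E * (mu * `|w|) <= 1.
  have : `|w| <= (4 * C1 * mu)^-1 by apply: le_trans wd _; rewrite ge_min lexx orbT.
  rewrite -[X in _ <= X]mul1r ler_pdivlMr ?mulr_gt0 // => h; apply: le_trans h.
  rewrite [leRHS](_ : _ = 4 * C1 * (mu * `|w|)); last by ring.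
  by apply: ler_wpM2r; [rewrite mulr_ge0 // ltW|rewrite ler_wpM2l // lerDl].
have [L L0 LP] := dexp_sum c.
pose Q := n%:R * (2 * lcst E * T * `|w|) * M + n%:R * `|w| * L.
pose m0 := Num.truncn (4 * C1 * (T + `|w| + 1) + 4 * (T + `|w|) / lrad E).
have level m : (m0 <= m)%N -> exists q, [/\ E (c + w) = (E c * E q)%g, `|q| <= lrad E &
   `|q - w *m dexp (br c)| <= 2 * lcst E * mu ^+ 2 * `|w| ^+ 2 + Q / m.+1%:R].
  move=> mm; have N0 : 0 < m.+1%:R :> R by rewrite ltr0n.
  have big : 4 * C1 * (T + `|w| + 1) + 4 * (T + `|w|) / lrad E <= m.+1%:R.
    by apply: ltW; apply: lt_le_trans (truncnS_gt _) _; rewrite ler_nat ltnS.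
  have i0 : 0 <= m.+1%:R^-1 :> R by rewrite invr_ge0 ltW.
  have b1 : 4 * C1 * (T + `|w| + 1) <= m.+1%:R.
    by apply: le_trans big; rewrite lerDl divr_ge0 // ?(ltW r0) // mulr_ge0 // addr_ge0.
  have b2 : 4 * (T + `|w|) <= lrad E * m.+1%:R.
    rewrite [leRHS]mulrC -ler_pdivrMr //; apply: le_trans big; rewrite lerDr; apply: mulr_ge0; last by rewrite !addr_ge0.
    by rewrite mulr_ge0 // ltW.
  pose a := m.+1%:R^-1 *: c; pose b := m.+1%:R^-1 *: w.
  have aE : `|a| = `|c| / m.+1%:R by rewrite normrZ ger0_norm // mulrC.
  have bE : `|b| = `|w| / m.+1%:R by rewrite normrZ ger0_norm // mulrC.
  have abr : 4 * (`|a| + `|b|) <= lrad E.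
    rewrite aE bE -mulrDl mulrA ler_pdivrMr //; apply: le_trans b2.
    by rewrite ler_wpM2l // lerD2r.
  have aC : 4 * lcst E * `|a| <= 1.
    rewrite aE mulrA ler_pdivrMr // mul1r; apply: le_trans b1.
    apply: ler_pM => //; first by rewrite mulr_ge0.
      by rewrite ler_wpM2l // lerDl.
    by move: cT (normr_ge0 w); lra.
  have na := normr_ge0 a; have nb := normr_ge0 b.
  have ar : `|- a| <= lrad E by rewrite normrN; move: abr; lra.
  have abn : `|a + b| <= `|a| + `|b| by exact: ler_normD.
  have abr' : `|a + b| <= lrad E by move: abn abr; lra.
  have [b' b'E b'b] := lex_mul ar abr'; rewrite normrN addKr in b'b.
  have b'n0 : `|b'| <= `|b| + (`|a| + `|b|).
    rewrite -(subrK b b') addrC; apply: le_trans (ler_normD _ _) _; rewrite lerD2l.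
    apply: le_trans b'b _; apply: le_trans (ler_wpM2l _ abn) _; first by rewrite mulr_ge0.
    rewrite -[leRHS]mul1r; apply: ler_wpM2r; first by rewrite addr_ge0.
    by apply: le_trans aC; apply: ler_wpM2r => //; move: C0; lra.
  have b'r : `|b'| <= lrad E by move: b'n0 abr; lra.
    have ar1 : `|a| <= lrad E by rewrite -normrN.
    have [p pE pb] := lex_mul ar1 b'r.
  have abE : (E a * E b' = E (a + b))%g by rewrite -b'E lex_opp mulVKg.
  have pab : p = a + b.
    apply: (@lex_inj _ _ _ E) => //; last by rewrite -pE.
    rewrite -(subrK (a + b') p); apply: le_trans (ler_normD _ _) _.
    have h1 : lcst E * `|a| * `|b'| <= 4^-1 * `|b'|.
      by apply: ler_wpM2r => //; move: aC; lra.
    by have := ler_normD a b'; move: pb h1 b'n0 abr; lra.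
  have b'b2 : `|b' - b| <= lcst E * `|a| * `|b'|.
    by move: pb; rewrite pab (_ : a + b - (a + b') = - (b' - b)) ?normrN //; vring.
  have b'n : `|b'| <= 2 * `|b|.
    have h1 : lcst E * `|a| * `|b'| <= 4^-1 * `|b'| by apply: ler_wpM2r => //; move: aC; lra.
    have : `|b'| <= `|b' - b| + `|b| by rewrite -{1}(subrK b b'); exact: ler_normD.
    by move: b'b2 h1 nb; lra.
  have b'b3 : `|b' - b| <= 2 * lcst E * T * `|w| / m.+1%:R / m.+1%:R.
    apply: le_trans b'b2 _; apply: (@le_trans _ _ (lcst E * (T / m.+1%:R) * (2 * `|b|))).
      apply: ler_pM => //; first by rewrite mulr_ge0.
      by apply: ler_wpM2l => //; rewrite aE ler_wpM2r.
    by rewrite bE le_eqVlt; apply/orP; left; apply/eqP; field; rewrite gt_eqF.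
  pose f k := b' *m adq c (- (k%:R / m.+1%:R)).
  pose P := fix P k : X := if k is k'.+1 then (E (f k') * P k')%g else 1%g.
  have fE k : E (f k) = (E a ^- k * E b' * E a ^+ k)%g.
    rewrite /f -(adqP cjC nilX) -AdP -lex_nat -!lex_opp scaleNr opprK /a.
    by rewrite !scalerA.
  have fb k : (k < m.+1)%N -> `|f k| <= mu * `|w| / m.+1%:R.
    move=> km; apply: le_trans (mulmx_norm _ _) _.
    apply: (@le_trans _ _ (n%:R * (2 * `|b|) * M)).
      apply: ler_pM => //; first by apply: ler_wpM2l.
      apply: (Mb c _ cT _).1; rewrite normrN ger0_norm ?divr_ge0 // ler_pdivrMr // mul1r.
      by rewrite ler_nat ltnW.
    rewrite bE [leLHS](_ : _ = n%:R * 2 * M * `|w| / m.+1%:R); last by ring.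
    by do 2 apply: ler_wpM2r => //; rewrite lerDl.
  have sumf : \sum_(k < m.+1) `|f k| <= mu * `|w|.
    apply: (@le_trans _ _ (\sum_(k < m.+1) mu * `|w| / m.+1%:R)).
      by apply: ler_sum => k _; exact: fb.
    by rewrite sumr_const card_ord -[_ *+ _]mulr_natr divfK // gt_eqF.
  have smu : 0 <= mu * `|w| by rewrite mulr_ge0 // ltW.
  have s1' : 2 * (mu * `|w|) <= lrad E by move: s1; lra.
  have s2' : 2 * lcst E * (mu * `|w|) <= 1.
    by move: s2 (mulr_ge0 C0 smu); rewrite -!mulrA; lra.
  have [q [Pq qr qb]] := @product_estimate _ _ _ E f P _ m.+1 erefl (fun _ _ => erefl) sumf s1' s2'.
  exists q; split; last first.
  - have -> : q - w *m dexp (br c) = (q - \sum_(k < m.+1) f k) +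
        ((m.+1%:R *: (b' - b)) *m (m.+1%:R^-1 *: \sum_(k < m.+1) adq c (- (k%:R / m.+1%:R)))
        + w *m (m.+1%:R^-1 *: (\sum_(k < m.+1) adq c (- (k%:R / m.+1%:R))) - dexp (br c))).
      rewrite -mulmx_sumr mulmxBr -scalemxAl -!scalemxAr scalerA divff ?gt_eqF // scale1r.
      rewrite mulmxBl /b -scalemxAl; vring.
    apply: le_trans (ler_normD _ _) _; apply: lerD.
      by apply: le_trans qb _; rewrite exprMn mulrA.
    apply: le_trans (ler_normD _ _) _; rewrite [leRHS]mulrDl; apply: lerD.
      apply: le_trans (mulmx_norm _ _) _.
      rewrite -mulrA -[leRHS]mulrA -mulrA ler_wpM2l // [leRHS](_ : _ = 2 * lcst E * T * `|w| / m.+1%:R * M); last by ring.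
      apply: ler_pM => //.
        rewrite normrZ (ger0_norm (ltW N0)) -ler_pdivlMl // mulrC; exact: b'b3.
      rewrite normrZ ger0_norm // -ler_pdivlMl ?invr_gt0 // invrK.
      apply: le_trans (ler_norm_sum _ _ _) _; rewrite mulr_natl -[in leRHS](card_ord m.+1) -sumr_const.
      apply: ler_sum => k _; apply: (Mb c _ cT _).1.
      rewrite normrN ger0_norm ?divr_ge0 // ler_pdivrMr // mul1r.
      by rewrite ler_nat ltnW.
    apply: le_trans (mulmx_norm _ _) _; rewrite -[leRHS]mulrA ler_wpM2l ?mulr_ge0 //; exact: LP.
  - by apply: le_trans qr _; exact: s1'.
  rewrite -Pq -[c + w](@scalerK _ _ m.+1%:R) ?gt_eqF // .
  have -> : m.+1%:R^-1 *: (m.+1%:R *: (c + w)) = m.+1%:R *: (a + b).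
    by rewrite /a /b -scalerDr !scalerA mulrC.
  rewrite lex_nat -abE (@conj_prod _ _ _ P) // => [|k]; last by rewrite /= fE.
  by rewrite -lex_nat /a scalerA divff ?gt_eqF // scale1r.
(* By local injectivity the logarithm q is the same at every level, so the bounds with an extra Q /
   (k + 1) for all large k give the bound without it. *)
have [q [qE qr _]] := level m0 (leqnn _).
exists q => //; apply: (@le_harmonic_add _ _ _ Q m0) => k /level[p [pE pr pb]].
suff -> : q = p by [].
apply: (lex_inj qr pr); apply: (mulgI (E c)); rewrite -qE -pE //.
Qed.
End DExp.

Definition pev (R : realType) n (c : 'rV[{poly R}]_n) (t : R) : 'rV[R]_n :=
  \row_i (c 0 i).[t].
Definition pder (R : realType) n (c : 'rV[{poly R}]_n) : 'rV[{poly R}]_n :=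
  \row_i (c 0 i)^`().

Lemma pev_bounds (R : realType) n (c : 'rV[{poly R}]_n) : exists2 L : R, 0 <= L &
  forall x y, `|x| <= 1 -> `|y| <= 1 -> [/\ `|pev c x| <= L, `|pev (pder c) x| <= L,
    `|pev c y - pev c x| <= L * `|y - x| &
    `|pev c y - pev c x - (y - x) *: pev (pder c) x| <= L * (y - x) ^+ 2].
Proof.
have /choice[L LP] (i : 'I_n) : exists L : R, 0 <= L /\
    forall x y, `|x| <= 1 -> `|y| <= 1 -> [/\ `|(c 0 i).[x]| <= L, `|(c 0 i)^`().[x]| <= L,
    `|(c 0 i).[y] - (c 0 i).[x]| <= L * `|y - x| &
    `|(c 0 i).[y] - (c 0 i).[x] - (y - x) * (c 0 i)^`().[x]| <= L * (y - x) ^+ 2].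
  have [L1 L10 h1] := poly_lipschitz (c 0 i) 1.
  have [L2 L20 h2] := poly_lipschitz (c 0 i)^`() 1.
  have [L3 L30 h3] := poly_taylor (c 0 i) 1.
  exists (L1 + L2 + L3); split; first by rewrite !addr_ge0.
  move=> x y xB yB; have [a1 a2] := h1 _ _ yB xB; have [b1 b2] := h2 _ _ xB yB.
  have [e1 _] := h1 _ _ xB yB.
  have l1 : L1 <= L1 + L2 + L3 by rewrite -addrA lerDl addr_ge0.
  have l2 : L2 <= L1 + L2 + L3 by rewrite addrAC lerDr addr_ge0.
  have l3 : L3 <= L1 + L2 + L3 by rewrite lerDr addr_ge0.
  split; first exact: le_trans l1.
  - exact: le_trans l2.
  - by apply: le_trans a2 _; apply: ler_wpM2r.
  by apply: le_trans (h3 _ _ xB yB) _; apply: ler_wpM2r => //; exact: sqr_ge0.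
have S0 : 0 <= \sum_i L i by apply: sumr_ge0 => i _; exact: (LP i).1.
have LS i : L i <= \sum_i L i.
  rewrite (bigD1 i) //= lerDl; apply: sumr_ge0 => k _; exact: (LP k).1.
exists (\sum_i L i) => // x y xB yB; have q0 : 0 <= (y - x) ^+ 2 := sqr_ge0 _.
split; (apply: mx_norm_bound => [|k i];
  [by first [exact: S0|apply: mulr_ge0]|rewrite ord1 !mxE; have [_ /(_ x y xB yB)[h1 h2 h3 h4]] := LP i]).
- exact: le_trans (LS i).
- exact: le_trans (LS i).
- by apply: le_trans h3 _; apply: ler_wpM2r.
by apply: le_trans h4 _; apply: ler_wpM2r.
Qed.

Section Ode.
Variables (R : realType) (X : groupType) (n : nat) (E : locexp R X n).
Local Notation V := 'rV[R]_n.
Implicit Types (u v w c : V) (x : X).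
Hypothesis cjC : forall x, cont1 E (cj x \o E).
Variable K : nat.
Hypothesis nilX : upper_central K = [set: X].
Local Notation Ad := (Ad cjC).
Local Notation br := (br cjC K).

(* The steps g(t)^-1 g(t+h) of g(t) = E(c(t)) E(-tv) are O(h^2), hence g is constant. *)
Lemma ode_exp (c : 'rV[{poly R}]_n) v :
  (forall t, pev (pder c) t *m dexp K (br (pev c t)) = v) ->
  E (pev c 1) = (E (pev c 0) * E v)%g.
Proof.
move=> ode.
have r0 := lrad_gt0 E; have C0 := lcst_ge0 E.
have [T T0 cT] := pev_bounds c.
have [M M0 Mb] := adq_bound cjC nilX (Num.max T `|v|).
have [d [Q [d0 Q0 DE]]] := dexpP cjC nilX T.
have Mc (t : R) : `|t| <= 1 -> `|dexp K (br (pev c t))| <= M.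
  move=> t1; apply: (Mb _ 0 _ _).2; last by rewrite normr0.
  by rewrite le_max; have [-> _ _ _] := cT t t t1 t1.
have Mv (t : R) : `|t| <= 1 -> `|Ad (E (t *: v))| <= M.
  move=> t1; rewrite (adqP cjC nilX); apply: (Mb _ t _ t1).1.
  by rewrite le_max lexx orbT.
pose Q1 := Q * T ^+ 2 + n%:R * T * M.
have Q10 : 0 <= Q1.
  by apply: addr_ge0; [apply: mulr_ge0 (sqr_ge0 _)|rewrite !mulr_ge0].
pose Q2 := lcst E * (Q1 + `|v|) * `|v| + Q1.
have Q20 : 0 <= Q2 by rewrite addr_ge0 // !mulr_ge0 // addr_ge0.
pose Q3 := n%:R * Q2 * M.
have Q30 : 0 <= Q3 by rewrite !mulr_ge0.
pose g t := (E (pev c t) * E (- t *: v))%g.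
have step (t h : R) : 0 <= t -> 0 <= h -> h <= 1 -> t + h <= 1 -> T * h <= d ->
    (Q1 + `|v|) * h <= lrad E ->
    exists2 f, g (t + h) = (g t * E f)%g & `|f| <= Q3 * h ^+ 2.
  move=> t0 h0 h1 th Thd hr.
  have t1 : `|t| <= 1 by rewrite ger0_norm //; move: th h0; lra.
  have th1 : `|t + h| <= 1 by rewrite ger0_norm // addr_ge0.
  have [cb cb' cl ct] := cT _ _ t1 th1.
  move: cl ct; rewrite (_ : t + h - t = h) => [|]; last by ring.
  rewrite (ger0_norm h0).
  set w := pev c (t + h) - pev c t => cl ct.
  have [|w' wE wb] := DE (pev c t) w cb; first exact: le_trans Thd.
  have hh : 0 <= h ^+ 2 := sqr_ge0 h.
  have w'b : `|w' - h *: v| <= Q1 * h ^+ 2.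
    have -> : w' - h *: v = (w' - w *m dexp K (br (pev c t))) +
       (w - h *: pev (pder c) t) *m dexp K (br (pev c t)).
      by rewrite [(w - h *: _) *m _]mulmxBl -scalemxAl ode addrA subrK.
    apply: le_trans (ler_normD _ _) _; rewrite mulrDl; apply: lerD.
      apply: le_trans wb _; rewrite -mulrA ler_wpM2l // -exprMn.
      by rewrite lerXn2r // ?nnegrE ?normr_ge0 // mulr_ge0.
    apply: le_trans (mulmx_norm _ _) _.
    rewrite [leRHS](_ : _ = n%:R * (T * h ^+ 2) * M); last by ring.
    by apply: ler_pM => //; [apply: ler_wpM2l|exact: Mc].
  have h2 : h ^+ 2 <= h by rewrite expr2 -[leRHS]mulr1 ler_wpM2l.
  have w'n : `|w'| <= (Q1 + `|v|) * h.
    rewrite -(subrK (h *: v) w'); apply: le_trans (ler_normD _ _) _.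
    rewrite mulrDl normrZ (ger0_norm h0) [h * _]mulrC lerD2r.
    by apply: le_trans w'b _; rewrite ler_wpM2l.
  have hvr : `|- h *: v| <= lrad E.
    rewrite normrZ normrN (ger0_norm h0) mulrC; apply: le_trans hr.
    by rewrite ler_wpM2r // lerDr.
  have [p pE pb] := lex_mul (le_trans w'n hr) hvr.
  exists (p *m Ad (E (t *: v))); last first.
    apply: le_trans (mulmx_norm _ _) _.
    rewrite [leRHS](_ : _ = n%:R * (Q2 * h ^+ 2) * M); last by rewrite /Q3; ring.
    apply: ler_pM => //; [apply: ler_wpM2l => //|exact: Mv].
    rewrite -(subrK (w' + - h *: v) p); apply: le_trans (ler_normD _ _) _.
    rewrite mulrDl; apply: lerD; last by rewrite scaleNr.
    apply: le_trans pb _; rewrite normrZ normrN (ger0_norm h0).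
    rewrite [leRHS](_ : _ = lcst E * ((Q1 + `|v|) * h) * (h * `|v|)); last by ring.
    by apply: ler_wpM2r; [rewrite mulr_ge0|rewrite ler_wpM2l].
  rewrite -AdP -pE /g -(subrK (pev c t) (pev c (t + h))) -/w addrC wE opprD scalerDl.
  rewrite [(- t *: v)%R + _]addrC.
  have -> : E (- h *: v + - t *: v) = (E (- h *: v) * E (- t *: v))%g.
    by rewrite -scalerDl lex_add.
  have -> : E (- t *: v) = (E (t *: v))^-1%g by rewrite scaleNr lex_opp.
  by rewrite !mulgA mulgVK.
have [g0 g0E] : exists g0, g0 = g 0 by exists (g 0).
have [g1 g1E] : exists g1, g1 = g 1 by exists (g 1).
have all_steps : exists N0 : nat, forall m : nat, (N0 <= m)%N -> exists2 q : V,
    (g0^-1 * g1)^-1%g = E q & `|q| <= 2 * Q3 / m.+1%:R.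
  pose N0 := Num.truncn (1 + T / d + (Q1 + `|v|) / lrad E + 2 * Q3 / lrad E + 2 * lcst E * Q3).
  exists N0 => m mN.
  have z1 : 0 <= T / d by rewrite divr_ge0 // ltW.
  have z2 : 0 <= (Q1 + `|v|) / lrad E by rewrite divr_ge0 ?(addr_ge0 Q10) // ltW.
  have z3 : 0 <= 2 * Q3 / lrad E by rewrite divr_ge0 ?mulr_ge0 // ltW.
  have z4 : 0 <= 2 * lcst E * Q3 by rewrite !mulr_ge0.
  have big : 1 + T / d + (Q1 + `|v|) / lrad E + 2 * Q3 / lrad E + 2 * lcst E * Q3 <= m.+1%:R.
    by apply: ltW; apply: lt_le_trans (truncnS_gt _) _; rewrite ler_nat ltnS.
  have N0' : 0 < m.+1%:R :> R by rewrite ltr0n.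
  have [h hE] : exists h : R, h = m.+1%:R^-1 by exists m.+1%:R^-1.
  have h0 : 0 < h by rewrite hE invr_gt0.
  have h1 : h * m.+1%:R = 1 by rewrite hE mulVf // gt_eqF.
  have hT (a : R) : a <= m.+1%:R -> a * h <= 1 by move=> am; rewrite mulrC -h1 ler_wpM2l // ltW.
  have hQ (a b : R) : 0 < b -> a / b <= m.+1%:R -> a * h <= b.
    by move=> b0 /hT; rewrite mulrAC ler_pdivrMr // mul1r.
  have e1 : T * h <= d by apply: hQ => //; move: big; lra.
  have e2 : (Q1 + `|v|) * h <= lrad E by apply: hQ => //; move: big; lra.
  have e3 : 2 * Q3 * h <= lrad E by apply: hQ => //; move: big; lra.
  have e4 : 2 * lcst E * Q3 * h <= 1 by apply: hT; move: big; lra.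
  have e5 : h <= 1 by rewrite -[h]mul1r; apply: hT; move: big; lra.
  have /choice[f fP] (k : nat) : exists f : V, (k < m.+1)%N ->
      g (k.+1%:R * h) = (g (k%:R * h)%R * E f)%g /\ `|f| <= Q3 * h ^+ 2.
    have [km|] := ltnP k m.+1; last by exists 0.
    have kh0 : 0 <= k%:R * h by rewrite mulr_ge0 // ltW.
    have kh1 : k%:R * h + h <= 1.
      by rewrite -{2}[h]mul1r -mulrDl natr1; apply: hT; rewrite ler_nat.
    have [f fE fb] := step _ _ kh0 (ltW h0) e5 kh1 e1 e2.
    by exists f => _; rewrite -fE -natr1 mulrDl mul1r.
  (* Inverted, because g grows by factors on the right while [product_estimate] collects factors on
     the left. *)
  pose P (k : nat) := (g0^-1 * g (k%:R * h)%R)^-1%g.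
  have P0 : P 0%N = 1%g by rewrite /P mul0r -g0E mulVg invg1.
  have PS k : (k < m.+1)%N -> P k.+1 = (E (- f k) * P k)%g.
    by move=> km; rewrite /P (fP k km).1 lex_opp !invgM invgK !mulgA.
  have sumf : \sum_(k < m.+1) `|- f k| <= Q3 * h.
    apply: (@le_trans _ _ (\sum_(k < m.+1) Q3 * h ^+ 2)).
      by apply: ler_sum => k _; rewrite normrN (fP k _).2.
    rewrite sumr_const card_ord -[_ *+ _]mulr_natr -mulrA expr2 -[h * h * _]mulrA h1 mulr1 //.
  have s1 : 2 * (Q3 * h) <= lrad E by rewrite mulrA.
  have s2 : 2 * lcst E * (Q3 * h) <= 1 by rewrite mulrA.
  have [q [Pq qr _]] := @product_estimate _ _ _ E (fun k => - f k) P _ m.+1 P0 PS sumf s1 s2.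
  exists q; last by rewrite -hE -mulrA.
  by rewrite -Pq /P mulrC h1 g1E.
have : (g0^-1 * g1)^-1%g = 1%g.
  have [N0 h] := all_steps; apply: (@lex_small1 _ _ _ E _ (2 * Q3)) => k.
  have [q qE qb] := h (N0 + k)%N (leq_addr _ _); exists q => //.
  apply: le_trans qb _; apply: ler_wpM2l; first by rewrite mulr_ge0.
  by rewrite lef_pV2 ?posrE ?ltr0n // ler_nat ltnS leq_addl.
rewrite g0E g1E /g oppr0 scale0r lex_zero mulg1 scaleN1r lex_opp => e.
have : ((E (pev c 0))^-1 * (E (pev c 1) * (E v)^-1) = 1)%g by rewrite -[LHS]invgK e invg1.
by move=> /(congr1 (fun x => E (pev c 0) * x * E v)%g); rewrite mulVKg mulgVK mulg1.
Qed.
End Ode.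

(** * The Baker-Campbell-Hausdorff law *)

Section Integral.
Variable R : realType.

(** At i = 0 the quotient by 0 is 0, so this is the antiderivative that vanishes at 0. *)
Definition intp (p : {poly R}) : {poly R} := \poly_(i < (size p).+1) (p`_i.-1 / i%:R).

Lemma coef_intp p i : (intp p)`_i = p`_i.-1 / i%:R.
Proof.
rewrite coef_poly; case: ltnP => //; case: i => [|i] // pi.
by rewrite /= nth_default // mul0r.
Qed.

Lemma intpD p q : intp (p + q) = intp p + intp q.
Proof. by apply/polyP => i; rewrite coefD !coef_intp coefD mulrDl. Qed.

Lemma intpZX (a : R) k : intp (a *: 'X^k) = (a / k.+1%:R) *: 'X^(k.+1).
Proof.
apply/polyP => -[|i]; rewrite coef_intp !coefZ !coefXn /= ?invr0 ?mulr0 // eqSS.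
by case: eqP => [->|_]; rewrite ?mulr1 // !mulr0 mul0r.
Qed.

Lemma intp0 : intp 0 = 0.
Proof. by apply/polyP => i; rewrite coef_intp !coef0 mul0r. Qed.

Lemma deriv_intp p : (intp p)^`() = p.
Proof.
apply/polyP => i; rewrite coef_deriv coef_intp -[_ *+ _]mulr_natr /= divfK // pnatr_eq0.
Qed.

Lemma horner_intp0 p : (intp p).[0] = 0.
Proof. by rewrite horner_coef0 coef_intp invr0 mulr0. Qed.
End Integral.

Inductive palg (R : realType) (T : Type) (S : set (T -> R)) : (T -> R) -> Prop :=
| palg_cst (c : R) : palg S (fun=> c)
| palg_gen f : S f -> palg S f
| palg_add f g : palg S f -> palg S g -> palg S (fun x => f x + g x)
| palg_mul f g : palg S f -> palg S g -> palg S (fun x => f x * g x).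

Section Palg.
Variables (R : realType) (T : Type) (S : set (T -> R)).

Lemma palg_sum I (r : seq I) (F : I -> T -> R) : (forall i, palg S (F i)) ->
  palg S (fun x => \sum_(i <- r) F i x).
Proof.
move=> h; elim: r => [|i r IH].
  by have -> : (fun x => \sum_(i <- [::]) F i x) = (fun=> 0); [apply/funext => x; rewrite big_nil|exact: palg_cst].
have -> : (fun x => \sum_(j <- i :: r) F j x) = (fun x => F i x + \sum_(j <- r) F j x).
  by apply/funext => x; rewrite big_cons.
exact: palg_add.
Qed.

Lemma palg_sub (f g : T -> R) : palg S f -> palg S g -> palg S (fun x => f x - g x).
Proof.
move=> pf pg; have -> : (fun x => f x - g x) = (fun x => f x + (-1) * g x).
  by apply/funext => x; rewrite mulN1r.
by apply: palg_add pf (palg_mul _ pg); exact: palg_cst.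
Qed.

Lemma palg_prod I (r : seq I) (F : I -> T -> R) : (forall i, palg S (F i)) ->
  palg S (fun x => \prod_(i <- r) F i x).
Proof.
move=> h; elim: r => [|i r IH].
  by have -> : (fun x => \prod_(i <- [::]) F i x) = (fun=> 1); [apply/funext => x; rewrite big_nil|exact: palg_cst].
have -> : (fun x => \prod_(j <- i :: r) F j x) = (fun x => F i x * \prod_(j <- r) F j x).
  by apply/funext => x; rewrite big_cons.
exact: palg_mul.
Qed.

Lemma palg_comp T' (S' : set (T' -> R)) (g : T' -> T) (f : T -> R) :
  (forall s, S s -> palg S' (s \o g)) -> palg S f -> palg S' (f \o g).
Proof.
move=> h; elim=> [c|s /h //|f1 g1 _ h1 _ h2|f1 g1 _ h1 _ h2]; first exact: palg_cst.
  exact: palg_add h1 h2.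
exact: palg_mul h1 h2.
Qed.

(** Polynomials in a time variable whose coefficients lie in [palg S]; they record that a curve
    depends polynomially on its parameters and on time together. *)
Inductive ppol : (T -> {poly R}) -> Prop :=
| ppol0 : ppol (fun=> 0)
| ppol_cons (f : T -> {poly R}) (a : T -> R) (k : nat) : ppol f -> palg S a -> ppol (fun x => f x + a x *: 'X^k).

Lemma ppol_add f g : ppol f -> ppol g -> ppol (fun x => f x + g x).
Proof.
move=> pf; elim=> [|g1 a k _ IH pa].
  by under eq_fun do rewrite addr0.
by under eq_fun do rewrite addrA; exact: ppol_cons.
Qed.

Lemma ppol_mulZX f a k : ppol f -> palg S a -> ppol (fun x => f x * (a x *: 'X^k)).
Proof.
move=> pf pa; elim: pf => [|f1 b l _ IH pb].
  by under eq_fun do rewrite mul0r; exact: ppol0.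
have -> : (fun x => (f1 x + b x *: 'X^l) * (a x *: 'X^k)) =
    (fun x => f1 x * (a x *: 'X^k) + (b x * a x) *: 'X^(l + k)).
  by apply/funext => x; rewrite mulrDl -!mul_polyC polyCM exprD; ring.
by apply: ppol_cons => //; exact: palg_mul.
Qed.

Lemma ppol_mul f g : ppol f -> ppol g -> ppol (fun x => f x * g x).
Proof.
move=> pf; elim=> [|g1 a k _ IH pa].
  by under eq_fun do rewrite mulr0; exact: ppol0.
under eq_fun do rewrite mulrDr; apply: ppol_add => //; exact: ppol_mulZX.
Qed.

Lemma ppol_int f : ppol f -> ppol (fun x => intp (f x)).
Proof.
elim=> [|g a k _ IH pa]; first by under eq_fun do rewrite intp0; exact: ppol0.
under eq_fun do rewrite intpD intpZX; apply: ppol_cons => //.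
by apply: palg_mul pa _; exact: palg_cst.
Qed.

Lemma ppolC a : palg S a -> ppol (fun x => (a x)%:P).
Proof.
move=> pa; have -> : (fun x => (a x)%:P) = (fun x => 0 + a x *: 'X^0).
  by apply/funext => x; rewrite add0r expr0 alg_polyC.
by apply: ppol_cons => //; exact: ppol0.
Qed.

Lemma ppol_horner f t : ppol f -> palg S (fun x => (f x).[t]).
Proof.
elim=> [|g a k _ IH pa]; first by under eq_fun do rewrite horner0; exact: palg_cst.
under eq_fun do rewrite hornerD hornerZ; apply: palg_add => //.
by apply: palg_mul pa _; exact: palg_cst.
Qed.

Variables (I : Type) (e : I -> R).

(** The map e reads the time off the index: the identity for real curves, k |-> k%:R for
    sequences. *)
Definition pcurve (F : T -> I -> R) := exists2 f, ppol f & forall x t, F x t = (f x).[e t].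

Lemma pcurveC a : palg S a -> pcurve (fun x _ => a x).
Proof. by move=> /ppolC pa; exists (fun x => (a x)%:P) => // x t; rewrite hornerC. Qed.

Lemma pcurve_add F G : pcurve F -> pcurve G -> pcurve (fun x t => F x t + G x t).
Proof.
move=> [f pf fE] [g pg gE]; exists (fun x => f x + g x); first exact: ppol_add.
by move=> x t; rewrite hornerD fE gE.
Qed.

Lemma pcurve_mul F G : pcurve F -> pcurve G -> pcurve (fun x t => F x t * G x t).
Proof.
move=> [f pf fE] [g pg gE]; exists (fun x => f x * g x); first exact: ppol_mul.
by move=> x t; rewrite hornerM fE gE.
Qed.

Lemma pcurve_sum J (r : seq J) (F : J -> T -> I -> R) : (forall i, pcurve (F i)) ->
  pcurve (fun x t => \sum_(i <- r) F i x t).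
Proof.
move=> h; elim: r => [|i r IH].
  exists (fun=> 0); first exact: ppol0.
  by move=> x t; rewrite big_nil horner0.
have [f pf fE] := pcurve_add (h i) IH.
by exists f => // x t; rewrite big_cons fE.
Qed.

Definition pcmx m n (A : T -> I -> 'M[R]_(m, n)) := forall i j, pcurve (fun x t => A x t i j).

Lemma pcurve_eq F G : (forall x t, F x t = G x t) -> pcurve F -> pcurve G.
Proof. by move=> h [f pf fE]; exists f => // x t; rewrite -h. Qed.

Lemma pcmx_add m n (A B : T -> I -> 'M[R]_(m, n)) : pcmx A -> pcmx B -> pcmx (fun x t => A x t + B x t).
Proof.
move=> pA pB i j; apply: (pcurve_eq _ (pcurve_add (pA i j) (pB i j))) => x t; by rewrite mxE.
Qed.

Lemma pcmxC m n (A : 'M[R]_(m, n)) : pcmx (fun _ _ => A).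
Proof. by move=> i j; apply: pcurveC; exact: palg_cst. Qed.

Lemma pcmx_scale m n (a : T -> I -> R) (A : T -> I -> 'M[R]_(m, n)) :
  pcurve a -> pcmx A -> pcmx (fun x t => a x t *: A x t).
Proof.
by move=> pa pA i j; apply: (pcurve_eq _ (pcurve_mul pa (pA i j))) => x t; rewrite mxE.
Qed.

Lemma pcmx_mul m n p (A : T -> I -> 'M[R]_(m, n)) (B : T -> I -> 'M[R]_(n, p)) :
  pcmx A -> pcmx B -> pcmx (fun x t => A x t *m B x t).
Proof.
move=> pA pB i j.
apply: (@pcurve_eq (fun x t => \sum_k A x t i k * B x t k j)) => [x t|]; first by rewrite mxE.
by apply: pcurve_sum => k; exact: pcurve_mul.
Qed.

Lemma pcmx_sum m n J (r : seq J) (A : J -> T -> I -> 'M[R]_(m, n)) : (forall i, pcmx (A i)) ->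
  pcmx (fun x t => \sum_(i <- r) A i x t).
Proof.
move=> h i j.
apply: (@pcurve_eq (fun x t => \sum_(k <- r) A k x t i j)) => [x t|]; first by rewrite summxE.
by apply: pcurve_sum => k; exact: h.
Qed.

Lemma pcmx_exp n (A : T -> I -> 'M[R]_n) k : pcmx A -> pcmx (fun x t => A x t ^+ k).
Proof.
move=> pA; elim: k => [|k IH] i j; first by apply: pcurveC; exact: palg_cst.
apply: (pcurve_eq _ (pcmx_mul pA IH i j)) => x t; by rewrite exprS mulmxE.
Qed.

Lemma pcurve_palg T' (S' : set (T' -> R)) (g : T -> I -> T') (f : T' -> R) : palg S' f ->
  (forall s, S' s -> pcurve (fun x t => s (g x t))) -> pcurve (fun x t => f (g x t)).
Proof.
move=> pf h; elim: pf => [c|s /h //|f1 f2 _ h1 _ h2|f1 f2 _ h1 _ h2].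
- by apply: pcurveC; exact: palg_cst.
- exact: pcurve_add.
exact: pcurve_mul.
Qed.
End Palg.

Definition linsub (R : realType) n (s : set 'rV[R]_n) :=
  s 0 /\ forall (a : R) v w, s v -> s w -> s (a *: v + w).

Section Linsub.
Variables (R : realType) (n : nat).
Implicit Types (s : set 'rV[R]_n) (v w : 'rV[R]_n).

Lemma linsubZ s (a : R) v : linsub s -> s v -> s (a *: v).
Proof. by move=> [s0 sZ] sv; have := sZ a v 0 sv s0; rewrite addr0. Qed.

Lemma linsubD s v w : linsub s -> s v -> s w -> s (v + w).
Proof. by move=> [s0 sZ] sv sw; have := sZ 1 v w sv sw; rewrite scale1r. Qed.

Lemma linsubN s v : linsub s -> s v -> s (- v).
Proof. by move=> ls sv; rewrite -scaleN1r; exact: linsubZ. Qed.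

Lemma linsubB s v w : linsub s -> s v -> s w -> s (v - w).
Proof. by move=> ls sv sw; apply: linsubD => //; exact: linsubN. Qed.

Lemma linsub_sum s I (r : seq I) (F : I -> 'rV[R]_n) : linsub s -> (forall i, s (F i)) ->
  s (\sum_(i <- r) F i).
Proof.
move=> ls h; elim/big_ind: _ => [|v w|//]; first exact: ls.1.
exact: linsubD.
Qed.

(** Among the matrices whose row space lies in s, one of maximal rank absorbs every further vector
    of s. *)
Lemma linsub_mx s : linsub s -> exists S : 'M[R]_n, forall v, s v <-> (v <= S)%MS.
Proof.
move=> ls; pose good (S : 'M[R]_n) := forall v, (v <= S)%MS -> s v.
pose P r := `[< exists2 S, good S & \rank S = r >].
have P0 : exists r, P r.
  exists 0%N; apply/asboolP; exists 0; last exact: mxrank0.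
  by move=> v; rewrite submx0 => /eqP ->; exact: ls.1.
have Pn r : P r -> (r <= n)%N by move=> /asboolP[S _ <-]; exact: rank_leq_row.
case: (ex_maxnP P0 Pn) => r /asboolP[S gS Sr] max; exists S => v; split => [sv|]; last exact: gS.
apply: contraT => vS.
have gS' : good (S + <<v>>)%MS.
  move=> w /sub_addsmxP[[a b] /= ->]; apply: linsubD => //; first by apply: gS; exact: submxMl.
  have /sub_rVP[c ->] : (b *m <<v>> <= v)%MS by rewrite (submx_trans (submxMl _ _)) // genmxE.
  exact: linsubZ.
have := max (\rank (S + <<v>>)%MS); rewrite -Sr => /(_ _)/wrap[|le].
  by apply/asboolP; exists (S + <<v>>)%MS.
have : (S + <<v>> <= S)%MS.
  have := mxrank_leqif_sup (addsmxSl S <<v>>%MS); move=> [h1 h2].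
  by rewrite -h2 eqn_leq h1.
by rewrite addsmx_sub submx_refl genmxE /= (negPf vS).
Qed.

Lemma linsub_mulmx s (A : 'M[R]_n) (a : nat -> R) (K : nat) v : linsub s ->
  (forall w, s w -> s (w *m A)) -> s v -> s (v *m \sum_(k < K) a k *: A ^+ k).
Proof.
move=> ls sA sv; rewrite mulmx_sumr; apply: linsub_sum => // k.
rewrite -scalemxAr; apply: linsubZ => //; elim: (k : nat) => [|j IH].
  by rewrite expr0 mulmx1.
by rewrite exprSr -mulmxE mulmxA; exact: sA.
Qed.
End Linsub.

Fixpoint nfil (R : realType) n (br : 'rV[R]_n -> 'M[R]_n) (k : nat) (v : 'rV[R]_n) : Prop :=
  if k is k'.+1 then forall u, nfil br k' (v *m br u) else v = 0.

(* The bracket [w, v] is v *m ebr w; the last field says that d/dt exp(c(t)) = exp(c(t)) v when c' dexp(c) = v. *)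
Record expgrp (R : realType) (X : groupType) (n : nat) := ExpGrp {
  eex :> 'rV[R]_n -> X;
  edeg : nat;
  ebr : 'rV[R]_n -> 'M[R]_n;
  eex_add : forall v (s t : R), eex ((s + t) *: v) = (eex (s *: v) * eex (t *: v))%g;
  ebr_lin : forall (a : R) u v, ebr (a *: u + v) = a *: ebr u + ebr v;
  ebr_self : forall v, v *m ebr v = 0;
  ebr_fil : forall v, nfil ebr edeg v;
  eex_conj : forall u v, (eex u * eex v * (eex u)^-1)%g = eex (v *m expmx edeg (ebr u));
  eex_ode : forall (c : 'rV[{poly R}]_n) v,
    (forall t, pev (pder c) t *m dexp edeg (ebr (pev c t)) = v) ->
    eex (pev c 1) = (eex (pev c 0) * eex v)%g
}.

Lemma locexp_expgrp (R : realType) (X : groupType) n (E : locexp R X n) (K : nat) :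
  (forall x, cont1 E (cj x \o E)) -> upper_central K = [set: X] ->
  exists G : expgrp R X n, forall v, G v = E v.
Proof.
move=> cjC nilX; unshelve eexists (@ExpGrp _ _ _ E K (br cjC K) (lex_add E) _ _ _ _ _) => //.
- by move=> a u v; rewrite (brD cjC nilX) (brZ cjC nilX).
- exact: br_self.
- move=> v; have h k w : bfil cjC K k w -> nfil (br cjC K) k w.
    by elim: k w => [//|k IH] w fw u; apply: IH; exact: fw.
  by apply: h; exact: bfilT.
- by move=> u v; rewrite -(Ad_exp cjC nilX) AdP.
- exact: ode_exp.
Qed.

(** The inverse of [dexp K A] for nilpotent A, as the Neumann series in 1 - dexp. *)
Definition psi (R : realType) n (K : nat) (A : 'M[R]_n) : 'M[R]_n :=
  \sum_(i < K) (1 - dexp K A) ^+ i.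

Lemma dexp_factor (R : realType) n (K : nat) (A : 'M[R]_n) :
  exists2 Q, 1 - dexp K.+1 A = A * Q & forall B, B * A = A * B -> B * Q = Q * B.
Proof.
exists (- \sum_(k < K) ((-1) ^+ k.+1 / k.+2`!%:R) *: A ^+ k).
  rewrite /dexp big_ord_recl /= !expr0 (_ : 1`!%:R = 1 :> R) // divr1 scale1r opprD addrA subrr add0r mulrN.
  rewrite mulr_sumr; congr (- _); apply: eq_bigr => k _.
  by rewrite -mulmxE -scalemxAr mulmxE -exprS.
move=> B BA; rewrite mulrN mulNr mulr_sumr mulr_suml; congr (- _); apply: eq_bigr => k _.
rewrite -mulmxE -scalemxAr -scalemxAl mulmxE; congr (_ *: _).
exact: (commrX k BA).
Qed.

Lemma dexp_nil (R : realType) n (K : nat) (A : 'M[R]_n) : A ^+ K = 0 -> (1 - dexp K A) ^+ K = 0.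
Proof.
case: K => [//|K] AK; have [Q QE QC] := dexp_factor K A.
rewrite QE exprMn_comm ?AK ?mul0r //; exact: QC.
Qed.

Lemma dexp_psi (R : realType) n (K : nat) (A : 'M[R]_n) : A ^+ K = 0 ->
  psi K A *m dexp K A = 1.
Proof.
move=> /dexp_nil AK; apply: mulmx1C; rewrite mulmxE /psi.
have := subrX1 (1 - dexp K A) K; rewrite AK sub0r => h.
rewrite [1 - dexp K A - 1]addrAC subrr add0r mulNr in h.
by apply: oppr_inj; rewrite -h.
Qed.

Section Picard.
Variables (R : realType) (X : groupType) (n : nat) (G : expgrp R X n).
Local Notation V := 'rV[R]_n.
Local Notation K := (edeg G).
Local Notation br := (ebr G).
Implicit Types u v w : V.

Lemma ebr0 : br 0 = 0.
Proof. by have := ebr_lin G (-1) 0 0; rewrite scaler0 addr0 scaleN1r addNr. Qed.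
Lemma ebrD u v : br (u + v) = br u + br v.
Proof. by have := ebr_lin G 1 u v; rewrite !scale1r. Qed.
Lemma ebrZ (a : R) v : br (a *: v) = a *: br v.
Proof. by have := ebr_lin G a v 0; rewrite ebr0 !addr0. Qed.
Lemma ebrN v : br (- v) = - br v.
Proof. by rewrite -scaleN1r ebrZ scaleN1r. Qed.
Lemma ebr_sum I (r : seq I) (F : I -> V) : br (\sum_(i <- r) F i) = \sum_(i <- r) br (F i).
Proof. exact: (big_morph _ ebrD ebr0). Qed.
Lemma ebr_anti u v : u *m br v = - (v *m br u).
Proof.
apply/eqP; rewrite -subr_eq0 opprK; apply/eqP; have := ebr_self G (u + v).
by rewrite ebrD mulmxDr !mulmxDl !ebr_self add0r addr0 addrC.
Qed.

Lemma nfil_lin k : linsub (nfil br k).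
Proof.
elim: k => [|k IH]; split => //=.
- by move=> a v w -> ->; rewrite scaler0 addr0.
- by move=> u; rewrite mul0mx; exact: IH.1.
by move=> a v w fv fw u; rewrite mulmxDl -scalemxAl; exact: IH.2.
Qed.

Lemma nfilS k v : nfil br k v -> nfil br k.+1 v.
Proof.
elim: k v => [|k IH] v fv u; first by rewrite fv mul0mx.
exact: IH.
Qed.

Lemma nfil_le k l v : (k <= l)%N -> nfil br k v -> nfil br l v.
Proof. by move=> /subnK <-; elim: (l - k)%N => [//|j IH] /IH; exact: nfilS. Qed.

Lemma nfil_br k u v : nfil br k v -> nfil br k (v *m br u).
Proof. by case: k => [|k] fv; [rewrite [v]fv mul0mx|apply: nfilS; exact: fv]. Qed.

Lemma ebr_exp v : br v ^+ K = 0.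
Proof.
suff h k w : nfil br k w -> w *m br v ^+ k = 0.
  by apply/row_matrixP => i; rewrite rowE h ?row0 //; exact: ebr_fil.
elim: k w => [|k IH] w; first by move=> /= ->; rewrite mul0mx.
by move=> fw; rewrite exprS -mulmxE mulmxA IH //; exact: fw.
Qed.

(** Paired with a column of the cokernel matrix of s, the curve becomes a polynomial with zero
    derivative. *)
Lemma pev_der_eq (c : 'rV[{poly R}]_n) (s : set V) : linsub s ->
  (forall t, s (pev (pder c) t)) -> forall t, s (pev c t - pev c 0).
Proof.
move=> /linsub_mx[S sS] h t; apply/sS; rewrite submxE.
apply/eqP/rowP => j.
pose p : {poly R} := \sum_i c 0 i * (cokermx S i j)%:P.
have pE (x : R) : p.[x] = (pev c x *m cokermx S) 0 j.
  by rewrite [RHS]mxE horner_sum; apply: eq_bigr => i _; rewrite hornerM hornerC [pev c x _ _]mxE.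
have p'0 : p^`() = 0.
  apply: poly_nat_eq0 => k; rewrite raddf_sum /= horner_sum.
  have /sS := h k%:R; rewrite submxE => /eqP/rowP/(_ j); rewrite [LHS]mxE [RHS]mxE => e.
  by apply: etrans e; apply: eq_bigr => i _; rewrite derivM derivC mulr0 addr0 hornerM hornerC !mxE.
have pc : p = (p.[0])%:P.
  apply/polyP => -[|i]; rewrite coefC /= ?horner_coef0 //.
  have := congr1 (fun q : {poly R} => q`_i) p'0; rewrite coef_deriv coef0 => /eqP.
  by rewrite -mulr_natr mulf_eq0 pnatr_eq0 orbF => /eqP.
by rewrite mulmxBl [LHS]mxE [X in _ + X]mxE -!pE pc !hornerC subrr mxE.
Qed.

Definition intcurve (f : 'rV[{poly R}]_n) u : 'rV[{poly R}]_n :=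
  \row_i ((u 0 i)%:P + intp (f 0 i)).

Lemma pder_intcurve f u : pder (intcurve f u) = f.
Proof. by apply/rowP => i; rewrite !mxE derivD derivC add0r deriv_intp. Qed.

Lemma pev_intcurve f u : pev (intcurve f u) 0 = u.
Proof. by apply/rowP => i; rewrite !mxE hornerD hornerC horner_intp0 addr0. Qed.

Definition v2crd : set (V * V -> R) :=
  [set f | exists i, f = (fun x : V * V => x.1 0 i) \/ f = (fun x : V * V => x.2 0 i)].

Lemma pcmx_pev (c : V * V -> 'rV[{poly R}]_n) : (forall i, ppol v2crd (fun x => c x 0 i)) ->
  pcmx v2crd (@id R) (fun x t => pev (c x) t).
Proof.
move=> pc i j; rewrite ord1; exists (fun x => c x 0 j) => // x t.
by rewrite mxE.
Qed.

Lemma pcmx_br (F : V * V -> R -> V) : pcmx v2crd (@id R) F -> pcmx v2crd (@id R) (fun x t => br (F x t)).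
Proof.
move=> pF; have -> : (fun x t => br (F x t)) =
    (fun x t => \sum_j F x t 0 j *: br (delta_mx 0 j)).
  apply/funext => x; apply/funext => t; rewrite {1}(row_sum_delta (F x t)) ebr_sum.
  by apply: eq_bigr => j _; rewrite ebrZ.
by apply: pcmx_sum => j; apply: pcmx_scale; [exact: pF|exact: pcmxC].
Qed.

Lemma pcmx_psi (F : V * V -> R -> 'M[R]_n) : pcmx v2crd (@id R) F -> pcmx v2crd (@id R) (fun x t => psi K (F x t)).
Proof.
move=> pF; apply: pcmx_sum => i; apply: pcmx_exp; apply: pcmx_add; first exact: pcmxC.
have -> : (fun x t => - dexp K (F x t)) =
    (fun x t => \sum_(k < K) (- ((-1) ^+ k / k.+1`!%:R)) *: F x t ^+ k).
  apply/funext => x; apply/funext => t; rewrite -sumrN; apply: eq_bigr => k _.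
  by rewrite scaleNr.
apply: pcmx_sum => k; apply: pcmx_scale; last exact: pcmx_exp.
by apply: pcurveC; exact: palg_cst.
Qed.

Lemma picard_step (c : V * V -> 'rV[{poly R}]_n) : exists c' : V * V -> 'rV[{poly R}]_n,
  (forall i, ppol v2crd (fun x => c x 0 i)) ->
  (forall i, ppol v2crd (fun x => c' x 0 i)) /\ forall u v, pev (c' (u, v)) 0 = u /\
    forall t, pev (pder (c' (u, v))) t = v *m psi K (br (pev (c (u, v)) t)).
Proof.
have [pc|] := pselect (forall i, ppol v2crd (fun x => c x 0 i)); last by exists c.
have pv : pcmx v2crd (@id R) (fun (x : V * V) (_ : R) => x.2).
  by move=> i j; rewrite ord1; apply: pcurveC; apply: palg_gen; exists j; right.
have pm := pcmx_mul pv (pcmx_psi (pcmx_br (pcmx_pev pc))).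
have /choice[f /all_and2[fp fE]] j : exists f, ppol v2crd f /\
    forall x t, (x.2 *m psi K (br (pev (c x) t))) 0 j = (f x).[t].
  by have [f] := pm 0 j; exists f.
exists (fun x => intcurve (\row_i f i x) x.1) => _; split.
  move=> i; have -> : (fun x => intcurve (\row_i f i x) x.1 0 i) =
      (fun x : V * V => (x.1 0 i)%:P + intp (f i x)) by apply/funext => x; rewrite !mxE.
  apply: ppol_add; last exact: ppol_int.
  by apply: ppolC; apply: palg_gen; exists i; left.
move=> u v; rewrite pev_intcurve pder_intcurve; split => // t.
by apply/rowP => j; rewrite mxE mxE -fE.
Qed.

(* Picard iteration for c' = v psi(br c), c(0) = u stabilises, by nilpotency. *)
Lemma bch_exists : exists bch : V -> V -> V,
  [/\ forall u v, (G u * G v)%g = G (bch u v),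
      forall i, palg v2crd (fun x => bch x.1 x.2 0 i) &
      forall (s : set V) u v w, linsub s ->
        (forall x (t : R), s (x - u - t *: w) -> s (v *m psi K (br x) - w)) ->
        s (bch u v - u - w)].
Proof.
have /choice[F FP] := picard_step.
pose c0 (x : V * V) : 'rV[{poly R}]_n := intcurve 0 x.1.
pose c j := iter j F c0.
have cp j : forall i, ppol v2crd (fun x => c j x 0 i).
  elim: j => [|j IH] i; last exact: (FP _ IH).1.
  have -> : (fun x => c 0%N x 0 i) = (fun x => (x.1 0 i)%:P).
    by apply/funext => x; rewrite !mxE intp0 addr0.
  by apply: ppolC; apply: palg_gen; exists i; left.
have ci j u v : pev (c j (u, v)) 0 = u.
  case: j => [|j]; first exact: pev_intcurve.
  exact: ((FP _ (cp j)).2 u v).1.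
have cS j u v t : pev (pder (c j.+1 (u, v))) t = v *m psi K (br (pev (c j (u, v)) t)).
  by have [_ ->] := (FP _ (cp j)).2 u v.
(* Each Picard step gains one level of the filtration: curves that agree modulo one level have
   right-hand sides that agree modulo the next smaller one. *)
have close j : (j <= K)%N -> forall u v t,
    nfil br (K - j) (pev (c j.+1 (u, v)) t - pev (c j (u, v)) t).
  elim: j => [|j IH] jK u v t; first by rewrite subn0; exact: ebr_fil.
  have {}IH := IH (ltnW jK).
  pose d := c j.+2 (u, v) - c j.+1 (u, v).
  have dE x : pev d x = pev (c j.+2 (u, v)) x - pev (c j.+1 (u, v)) x.
    by apply/rowP => i; rewrite !mxE hornerD hornerN.
  have d'E x : pev (pder d) x = pev (pder (c j.+2 (u, v))) x - pev (pder (c j.+1 (u, v))) x.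
    by apply/rowP => i; rewrite !mxE derivB hornerD hornerN.
  rewrite -dE -[pev d t]subr0.
  have <- : pev d 0 = 0 by rewrite dE !ci subrr.
  apply: pev_der_eq => [|x]; first exact: nfil_lin.
  rewrite d'E !cS -mulmxBr.
  move: {IH}(IH u v x); set a := pev _ _; set b := pev _ _.
  have -> : (K - j = (K - j.+1).+1)%N by rewrite -subSn.
  move: (K - j.+1)%N => k ab.
  have brk w : nfil br k (w *m (br a - br b)).
    by rewrite -ebrN -ebrD ebr_anti; apply: linsubN; [exact: nfil_lin|exact: ab].
  (* differences of polynomials in A = br a and B = br b map everything into nfil k *)
  pose good (P Q : 'M[R]_n) := (forall w, nfil br k (w *m (P - Q))) /\
    forall w, nfil br k w -> nfil br k (w *m Q).
  have lk := nfil_lin k.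
  have gA : good (br a) (br b) by split=> // w; exact: nfil_br.
  have g1 : good 1 1.
    split=> w; rewrite ?subrr ?mulmx0 ?mulmx1 //; move=> *; exact: lk.1.
  have g0 : good 0 0.
    by split=> w; rewrite ?subrr mulmx0; move=> *; exact: lk.1.
  have gD P Q P' Q' : good P Q -> good P' Q' -> good (P + P') (Q + Q').
    move=> [h1 h2] [h3 h4]; split=> w; last by move=> fw; rewrite mulmxDr; apply: linsubD; auto.
    by rewrite opprD addrACA mulmxDr; apply: linsubD; auto.
  have gM P Q P' Q' : good P Q -> good P' Q' -> good (P * P') (Q * Q').
    move=> [h1 h2] [h3 h4]; split=> w; last by move=> fw; rewrite -mulmxE mulmxA; auto.
    have -> : P * P' - Q * Q' = P *m (P' - Q') + (P - Q) *m Q'.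
      by rewrite mulmxBr mulmxBl !mulmxE addrA subrK.
    by rewrite mulmxDr !mulmxA; apply: linsubD; auto.
  have gZ (r : R) P Q : good P Q -> good (r *: P) (r *: Q).
    move=> [h1 h2]; split=> w; last by move=> fw; rewrite -scalemxAr; apply: linsubZ; auto.
    by rewrite -scalerBr -scalemxAr; apply: linsubZ; auto.
  have gX P Q i : good P Q -> good (P ^+ i) (Q ^+ i).
    by move=> gPQ; elim: i => [|i IH]; rewrite ?expr0 // !exprS; apply: gM.
  have gs (I : finType) (P Q : I -> 'M[R]_n) : (forall i, good (P i) (Q i)) ->
      good (\sum_i P i) (\sum_i Q i).
    by move=> h; elim/big_ind2: _ => // *; exact: gD.
  suff [h _] : good (psi K (br a)) (psi K (br b)) by exact: h.
  apply: (gs) => i; apply: (gX); apply: (gD _ _ _ _ g1).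
  rewrite -(scaleN1r (dexp K (br a))) -(scaleN1r (dexp K (br b))).
  by apply: (gZ); apply: (gs) => l; apply: (gZ); apply: (gX _ _ _ gA).
exists (fun u v => pev (c K (u, v)) 1); split.
- move=> u v; rewrite -[in LHS](ci K u v) -eex_ode // => t.
  have e x : pev (c K.+1 (u, v)) x = pev (c K (u, v)) x.
    have := close K (leqnn K) u v x; rewrite subnn => /eqP.
    by rewrite subr_eq0 => /eqP.
  have -> : c K (u, v) = c K.+1 (u, v).
    apply/rowP => i; apply: poly_nat_eq => k; have := e k%:R => /rowP/(_ i).
    by rewrite !mxE.
  by rewrite cS e -mulmxA dexp_psi ?mulmx1 //; exact: ebr_exp.
- move=> i; have -> : (fun x : V * V => pev (c K (x.1, x.2)) 1 0 i) =
      (fun x => (c K x 0 i).[1]) by apply/funext => -[u v]; rewrite mxE.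
  exact: ppol_horner.
move=> s u v w ls H.
(* The initial curve is constant and need not follow u + t w, so the claim starts at the first
   iterate. *)
suff h j (t : R) : s (pev (c j (u, v)) t - u - t *: w) \/ j = 0%N.
  have [] := h K 1; first by rewrite scale1r.
  move=> K0; have z x : x = 0 :> V by have := ebr_fil G x; rewrite K0.
  by rewrite [_ - w]z; exact: ls.1.
elim: j t => [|j IH] t; first by right.
left.
pose d : 'rV[{poly R}]_n := c j.+1 (u, v) - \row_i ((w 0 i)%:P * 'X).
have dE x : pev d x = pev (c j.+1 (u, v)) x - x *: w.
  by apply/rowP => i; rewrite !mxE hornerD hornerN hornerM hornerC hornerX mulrC.
have d'E x : pev (pder d) x = pev (pder (c j.+1 (u, v))) x - w.
  by apply/rowP => i; rewrite !mxE derivB derivM derivC derivX mul0r add0r mulr1 hornerD hornerN hornerC.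
have -> : pev (c j.+1 (u, v)) t - u - t *: w = pev d t - pev d 0.
  by rewrite !dE ci scale0r subr0 addrAC.
apply: pev_der_eq => // x; rewrite d'E cS; case: (IH x) => [sx|j0].
  exact: H sx.
rewrite j0 /c /= /c0; apply: (H _ 0); rewrite scale0r subr0.
have -> : pev (intcurve 0 u) x = u.
  by apply/rowP => i; rewrite !mxE intp0 addr0 hornerC.
by rewrite subrr; exact: ls.1.
Qed.
End Picard.

(** * The logarithm of a simply connected nilpotent Lie group *)

Lemma palg_continuous (R : realType) (T : topologicalType) (S : set (T -> R)) (f : T -> R) :
  (forall s, S s -> continuous s) -> palg S f -> continuous f.
Proof.
move=> h; elim=> [c|s /h //|f1 f2 _ h1 _ h2|f1 f2 _ h1 _ h2] x.
- exact: cvg_cst.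
- by apply: cvgD; [exact: h1|exact: h2].
by apply: cvgM; [exact: h1|exact: h2].
Qed.

Lemma row_cvg (R : realType) n (T : Type) (F : set_system T) (f : T -> 'rV[R]_n) (v : 'rV[R]_n) :
  Filter F -> (forall i, (fun x => f x 0 i) @ F --> v 0 i) -> f @ F --> v.
Proof.
move=> FF h; apply/cvgrPdist_le => e e0.
have : \forall x \near F, forall i, `|v 0 i - f x 0 i| <= e.
  by apply: filter_forall => i; have /cvgrPdist_le := h i; apply.
apply: filterS => x hx; apply: mx_norm_bound => [|k i]; first exact: ltW.
by rewrite ord1 !mxE.
Qed.

Lemma quad_is_derive (R : realType) n (f : R -> 'rV[R]_n) (v : 'rV[R]_n) (C t0 : R) : 0 < t0 -> 0 <= C ->
  (forall t, `|t| <= t0 -> `|f t - f 0 - t *: v| <= C * t ^+ 2) -> is_derive (0 : R) (1 : R) f v.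
Proof.
move=> t00 C0 h.
have c : (fun h => h^-1 *: ((f \o shift 0) (h *: (1 : R)) - f 0)) @ (0 : R)^' --> v.
  apply/cvgrPdist_le => e e0; near=> t.
  have t1 : t != 0 by near: t; exact: nbhs_dnbhs_neq.
  have t2 : `|t| <= t0 by near: t; apply: dnbhs0_le.
  have t3 : `|t| <= e / (C + 1) by near: t; apply: dnbhs0_le; rewrite divr_gt0 // ltr_wpDl.
  rewrite /= addr0 [t *: 1]mulr1.
  have -> : v - t^-1 *: (f t - f 0) = - (t^-1 *: (f t - f 0 - t *: v)).
    by rewrite [in RHS]scalerBr scalerA mulVf // scale1r opprB.
  rewrite normrN normrZ normfV ler_pdivrMl ?normr_gt0 //.
  apply: le_trans (h _ t2) _.
  rewrite -[t ^+ 2]real_normK ?num_real // expr2 mulrCA; apply: ler_wpM2l => //.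
  apply: le_trans (ler_wpM2r _ (_ : C <= C + 1)) _ => //; first by rewrite lerDl.
  by rewrite mulrC -ler_pdivlMr // ltr_wpDl.
by apply: DeriveDef; [exact: (cvgP _ c)|exact: cvg_lim c].
Unshelve. all: by end_near.
Qed.

Lemma poly_near_eq0 (R : realType) (p : {poly R}) (d : R) : 0 < d ->
  (forall t, 0 < t <= d -> p.[t] = 0) -> p = 0.
Proof.
move=> d0 h; apply/eqP; apply/negPn/negP => p0.
pose rs : seq R := [seq d / j.+1%:R | j <- iota 0 (size p)].
have r1 : all (root p) rs.
  apply/allP => _ /mapP[j _ ->]; rewrite rootE h // divr_gt0 //=.
  by rewrite ler_pdivrMr // ler_peMr ?ler1n // ltW.
have r2 : uniq rs.
  rewrite map_inj_uniq ?iota_uniq // => i j /(mulfI (lt0r_neq0 d0))/invr_inj/eqP.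
  by rewrite eqr_nat eqSS => /eqP.
by have := max_poly_roots p0 r1 r2; rewrite size_map size_iota ltnn.
Qed.

Section PolyCurves.
Variables (R : realType) (n : nat).
Local Notation V := 'rV[R]_n.

Definition polycurve (A : R -> V) := exists c : 'rV[{poly R}]_n, forall t, A t = pev c t.

Lemma polycurve_lin v : polycurve (fun t => t *: v).
Proof.
by exists (\row_i ('X * (v 0 i)%:P)) => t; apply/rowP => i; rewrite !mxE hornerM hornerX hornerC.
Qed.

Lemma polycurve_eq (A B : R -> V) (d : R) : polycurve A -> polycurve B -> 0 < d ->
  (forall t, 0 < t <= d -> A t = B t) -> A 1 = B 1.
Proof.
move=> [a aE] [b bE] d0 h; rewrite aE bE; apply/rowP => i; rewrite !mxE.
suff : a 0 i - b 0 i = 0 by move=> /(congr1 (fun p => p.[1])); rewrite hornerD hornerN horner0 => /eqP; rewrite subr_eq0 => /eqP.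
apply: (poly_near_eq0 d0) => t /h; rewrite aE bE => /rowP/(_ i).
by rewrite !mxE hornerD hornerN => ->; rewrite subrr.
Qed.

Lemma polycurve_small (A : R -> V) (e : R) : polycurve A -> A 0 = 0 -> 0 < e ->
  exists2 d : R, 0 < d & forall t, 0 < t <= d -> `|A t| <= e.
Proof.
move=> [a aE] A0 e0; have [L L0 h] := pev_bounds a.
exists (Num.min 1 (e / (L + 1))); first by rewrite lt_min ltr01 divr_gt0 // ltr_wpDl.
move=> t /andP[t0]; rewrite le_min => /andP[t1 te].
have tt : `|t| <= 1 by rewrite ger0_norm // ltW.
have z : `|0 : R| <= 1 by rewrite normr0.
have [_ _ + _] := h 0 t z tt; rewrite -!aE A0 !subr0 => h1; apply: le_trans h1 _.
rewrite (ger0_norm (ltW t0)).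
apply: (@le_trans _ _ ((L + 1) * t)); first by rewrite ler_wpM2r ?lerDl // ltW.
by rewrite mulrC -ler_pdivlMr // ltr_wpDl.
Qed.
End PolyCurves.

Section Bch.
Variables (R : realType) (X : groupType) (n : nat) (G : expgrp R X n).
Local Notation V := 'rV[R]_n.
Implicit Types u v w : V.

Definition bch : V -> V -> V := sval (cid (bch_exists G)).

Lemma bchE u v : (G u * G v)%g = G (bch u v).
Proof. by rewrite /bch; case: cid => f [h _ _] /=; exact: h. Qed.

Lemma bch_palg i : palg (@v2crd R n) (fun x => bch x.1 x.2 0 i).
Proof. by rewrite /bch; case: cid => f [_ h _] /=; exact: h. Qed.

(** An invariance criterion for the differential equation behind [bch]: if the right-hand side lies
    in w + s at all points of u + t w + s, the solution stays in these sets up to t = 1. *)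
Lemma bch_linsub (s : set V) u v w : linsub s ->
  (forall x (t : R), s (x - u - t *: w) -> s (v *m psi (edeg G) (ebr G x) - w)) ->
  s (bch u v - u - w).
Proof. by rewrite /bch; case: cid => f [_ _ h] /=; exact: h. Qed.

Lemma linsub0 : linsub [set 0 : V].
Proof. by split=> // a v w -> ->; rewrite scaler0 addr0. Qed.

Lemma bchu0 u : bch u 0 = u.
Proof.
have := @bch_linsub [set 0] u 0 0 linsub0; rewrite /= subr0 => h.
by apply/eqP; rewrite -subr_eq0 h // => x t _; rewrite mul0mx subr0.
Qed.

Lemma polycurve_bch (A B : R -> V) : polycurve A -> polycurve B ->
  polycurve (fun t => bch (A t) (B t)).
Proof.
move=> [a aE] [b bE].
have /choice[f fP] (i : 'I_n) : exists f : {poly R}, forall t, bch (A t) (B t) 0 i = f.[t].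
  have [|f _ fE] := @pcurve_palg R unit setT R id _ _ (fun _ t => (A t, B t)) _ (bch_palg i).
    move=> s [j [->|->]] /=.
      by exists (fun=> a 0 j); [rewrite -[a 0 j]coefK poly_def; elim/big_ind: _ => *; [exact: ppol0|exact: ppol_add|rewrite -[_ *: _]add0r; apply: ppol_cons; [exact: ppol0|exact: palg_cst]]|move=> x t; rewrite aE mxE].
    by exists (fun=> b 0 j); [rewrite -[b 0 j]coefK poly_def; elim/big_ind: _ => *; [exact: ppol0|exact: ppol_add|rewrite -[_ *: _]add0r; apply: ppol_cons; [exact: ppol0|exact: palg_cst]]|move=> x t; rewrite bE mxE].
  by exists (f tt) => t; rewrite -fE.
by exists (\row_i f i) => t; apply/rowP => i; rewrite fP !mxE.
Qed.

Variable r : R.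
Hypothesis r0 : 0 < r.
Hypothesis injr : forall v w, `|v| <= r -> `|w| <= r -> G v = G w -> v = w.

(** Here G is injective only near 0. That settles small t, and polynomial curves that agree for
    small t agree at t = 1; identities such as associativity become global in this way. *)
Lemma bch_curve_eq (A B : R -> V) : polycurve A -> polycurve B -> A 0 = 0 -> B 0 = 0 ->
  (forall t, G (A t) = G (B t)) -> A 1 = B 1.
Proof.
move=> pA pB A0 B0 AB.
have [d d0 dP] := polycurve_small pA A0 r0; have [e e0 eP] := polycurve_small pB B0 r0.
apply: (@polycurve_eq _ _ A B (Num.min d e)) => //; first by rewrite lt_min d0.
move=> t; rewrite le_min => /and3P[t0 td te]; apply: injr => //.
  by apply: dP; rewrite t0.
by apply: eP; rewrite t0.
Qed.

Lemma bchA u v w : bch (bch u v) w = bch u (bch v w).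
Proof.
have L := @polycurve_lin R n.
have pA : polycurve (fun t => bch (bch (t *: u) (t *: v)) (t *: w)).
  by do !apply: polycurve_bch.
have pB : polycurve (fun t => bch (t *: u) (bch (t *: v) (t *: w))).
  by do !apply: polycurve_bch.
have := bch_curve_eq pA pB; rewrite !scale0r !bchu0 !scale1r; apply=> // t.
by rewrite -!bchE mulgA.
Qed.

Lemma bch_line u (s t : R) : bch (s *: u) (t *: u) = (s + t) *: u.
Proof.
have L := @polycurve_lin R n.
have pA : polycurve (fun x => bch (x *: (s *: u)) (x *: (t *: u))) by exact: polycurve_bch.
have := bch_curve_eq pA (L ((s + t) *: u)); rewrite !scale0r !bchu0 !scale1r; apply=> // x.
by rewrite -bchE !scalerA -eex_add mulrDr.
Qed.

Lemma bch0u u : bch 0 u = u.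
Proof. by have := bch_line u 0 1; rewrite scale0r scale1r add0r scale1r. Qed.

Lemma bchNu u : bch u (- u) = 0.
Proof. by have := bch_line u 1 (-1); rewrite scale1r scaleN1r subrr scale0r. Qed.

End Bch.

Lemma bch_continuous (R : realType) (X : groupType) n (G : expgrp R X n) :
  continuous (fun p : 'rV[R]_n * 'rV[R]_n => bch G p.1 p.2).
Proof.
move=> p; apply: row_cvg => i; apply: palg_continuous (bch_palg G i) p.
move=> s [j [->|->]] p.
  exact: (@cvg_comp _ _ _ fst (fun M : 'rV[R]_n => M 0 j) _ (nbhs p.1) _ cvg_fst (@coord_continuous _ _ _ _ _ p.1)).
exact: (@cvg_comp _ _ _ snd (fun M : 'rV[R]_n => M 0 j) _ (nbhs p.2) _ cvg_snd (@coord_continuous _ _ _ _ _ p.2)).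
Qed.

Lemma bch_cvg (R : realType) (X : groupType) n (G : expgrp R X n) (T : Type) (F : set_system T)
  (FF : Filter F) (f g : T -> 'rV[R]_n) (a b : 'rV[R]_n) :
  f @ F --> a -> g @ F --> b -> (fun t => bch G (f t) (g t)) @ F --> bch G a b.
Proof.
move=> fa gb; exact: (@cvg_comp _ _ _ (fun t => (f t, g t)) (fun p : 'rV[R]_n * 'rV[R]_n => bch G p.1 p.2) F (nbhs (a, b)) _ (cvg_pair fa gb) (@bch_continuous _ _ _ G (a, b))).
Qed.

Section LieGlobal.
Variables (R : realType) (N : lieGroupType R).
Local Notation n := (@lie_dim R N).
Local Notation c1 := (@chart1 R N).
Local Notation p0 := (c1 1%g).
Local Notation V := 'rV[R]_n.
Hypothesis Nnil : @is_nilpotent N.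

Definition exp_topology (E : V -> N) (r C : R) :=
  [/\ forall eps : R, 0 < eps -> nbhs (1%g : N) [set E x | x in [set x | `|x| <= eps]],
      forall A : set N, nbhs (1%g : N) A -> exists2 d : R, 0 < d & forall v, `|v| <= d -> A (E v),
      forall v, `|v| <= r -> `|c1 (E v) - p0 - v| <= C * `|v| ^+ 2 &
      forall x, `|x| <= r -> exists v, [/\ kap x = E v, `|v| <= 2 * `|x| & `|v - x| <= C * `|x| ^+ 2]].

Lemma mulg_cvg (T : Type) (F : set_system T) (FF : Filter F) (f g : T -> N) (x y : N) :
  f @ F --> x -> g @ F --> y -> (fun t => f t * g t)%g @ F --> (x * y)%g.
Proof.
move=> fx gy; have := @lie_mul_continuous R N (x, y) => /= m.
exact: (@cvg_comp _ _ _ (fun t => (f t, g t)) (fun p : N * N => (p.1 * p.2)%g) F (nbhs (x, y)) _ (cvg_pair fx gy) m).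
Qed.

Lemma lmulg_continuous (x : N) : continuous (fun y : N => x * y)%g.
Proof. by move=> y; apply: mulg_cvg; [exact: cvg_cst|exact: cvg_id]. Qed.

Lemma rmulg_continuous (x : N) : continuous (fun y : N => y * x)%g.
Proof. by move=> y; apply: mulg_cvg; [exact: cvg_id|exact: cvg_cst]. Qed.

Lemma exp_cont1 (E : locexp R N n) r C : exp_topology E r C ->
  forall f : N -> N, {for 1%g, continuous f} -> f 1%g = 1%g -> cont1 E (f \o E).
Proof.
move=> [T1 T2 _ _] f fc f1 eps e0.
have /fc /T2[d d0 dP] : nbhs (f 1%g) [set E x | x in [set x | `|x| <= eps]].
  by rewrite f1; exact: T1.
by exists d => // v /dP[w /= we wE]; exists w.
Qed.

Lemma lie_expgrp_local : exists (E : locexp R N n) (G : expgrp R N n) (r C : R),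
  [/\ 0 < r, 0 <= C, exp_topology E r C & forall v, G v = E v].
Proof.
have [ex [r [C [[r0 C0 eD eI eM] T]]]] := lie_exp_exists N.
pose E := LocExp r0 C0 eD eI eM.
have [K nilK] := Nnil.
have cjC x : cont1 E (cj x \o E).
  apply: (@exp_cont1 E r C T (cj x)); last by rewrite /cj mulg1 mulgV.
  apply: (@continuous_comp _ _ _ (fun y : N => x * y)%g (fun y : N => y * x^-1)%g).
    exact: lmulg_continuous.
  exact: rmulg_continuous.
have [G GE] := locexp_expgrp cjC nilK.
by exists E, G, r, C.
Qed.

Section Exp.
Variables (G : expgrp R N n) (r C : R).
Hypotheses (r0 : 0 < r) (C0 : 0 <= C) (T : exp_topology G r C).
Hypothesis injr : forall v w, `|v| <= r -> `|w| <= r -> G v = G w -> v = w.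

Lemma eex_zero : G 0 = 1%g.
Proof.
have := eex_add G 0 0 0; rewrite !scaler0 => h.
by apply: (mulgI (G 0)); rewrite mulg1 -h.
Qed.

Lemma eex_opp v : G (- v) = (G v)^-1%g.
Proof.
apply/esym/mulg1_eq; have := eex_add G v 1 (- 1).
by rewrite subrr scale0r eex_zero scale1r scaleN1r => <-.
Qed.

Lemma nbhs_mulg (x : N) (A : set N) : nbhs x A -> nbhs (1%g : N) [set y | A (x * y)%g].
Proof. by move=> xA; apply: (@lmulg_continuous x 1%g); rewrite mulg1. Qed.

Lemma nbhs_mulgV (x : N) (A : set N) : nbhs (1%g : N) A -> nbhs x [set y | A (x^-1 * y)%g].
Proof. by move=> A1; apply: (@lmulg_continuous x^-1%g x); rewrite mulVg. Qed.

Lemma eex_continuous : continuous G.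
Proof.
move=> v A nA0; have nA := nbhs_mulg nA0; have [_ T2 _ _] := T; have [d d0 dP] := T2 _ nA.
have bc : (fun w : V => bch G (- v) w) @ v --> bch G (- v) v.
  exact: (@bch_cvg _ _ _ G _ (nbhs (v : V)) _ (fun=> - v) id _ _ (cvg_cst _) cvg_id).
suff : nbhs v (fun w => A (G w)) by [].
have b0 : bch G (- v) v = 0 by have := bchNu r0 injr (- v); rewrite opprK.
rewrite b0 in bc; move/cvgrPdist_le : bc => /(_ d d0).
by apply: filterS => w; rewrite sub0r normrN => /dP /=; rewrite -bchE eex_opp mulVKg.
Qed.

(** Translates of a neighbourhood of 1 inside the image show that the image is open and that its
    complement is open too; connectedness concludes. *)
Lemma eex_surj : connected [set: N] -> forall x, exists v, G v = x.
Proof.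
move=> Nc; have [T1 _ _ _] := T.
have rG : range G = setT; last first.
  move=> x; have [v _ vx] : range G x by rewrite rG.
  by exists v.
have loc (x : N) : nbhs x [set y | exists w, (y = x * G w)%g].
  apply: filterS (nbhs_mulgV x (T1 _ ltr01)) => y /= [w _ wE].
  by exists w; rewrite wE mulVKg.
have oG : open (range G).
  rewrite openE => _ [v _ <-]; apply: filterS (loc (G v)) => y [w ->].
  by exists (bch G v w) => //; rewrite bchE.
have cG : closed (range G).
  rewrite -openC openE => x Gx; apply: filterS (loc x) => y [w ->] [v _ vE]; apply: Gx.
  exists (bch G v (- w)) => //; rewrite -bchE vE eex_opp mulgK //.
apply: Nc; first by exists (G 0); exists 0.
  by exists (range G) => //; rewrite setTI.
by exists (range G) => //; rewrite setTI.
Qed.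

Local Notation I := (`[0, 1]%classic : set R).

(** N has no chosen metric, so closeness is measured by the left quotient (h p)^-1 h q. *)
Lemma uniform_continuity (h : R * R -> N) (U : set N) :
  {within I `*` I, continuous h} -> nbhs (1%g : N) U ->
  exists2 d : R, 0 < d & forall p q, (I `*` I) p -> (I `*` I) q ->
    `|p - q| <= d -> U ((h p)^-1 * h q)%g.
Proof.
move=> /subspace_continuousP hc U1.
have cK : compact (I `*` I) by apply: compact_setX; exact: segment_compact.
pose P (d : R) (p : R * R) := forall q, (I `*` I) q -> `|p - q| <= d -> U ((h p)^-1 * h q)%g.
suff cov : forall x, (I `*` I) x -> \forall x' \near x & i \near (0 : R)^'+, (I `*` I) x' -> P i x'.
  move/compact_near_coveringP/near_covering_withinP : cK => cK.
  have := cK R (0 : R)^'+ P _ cov; move=> [e /= e0 eP].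
  exists (e / 2); first by rewrite divr_gt0.
  move=> p q Ip Iq pq; apply: (eP (e / 2)) => //=; last by rewrite divr_gt0.
  by rewrite sub0r normrN gtr0_norm ?divr_gt0 // ltr_pdivrMr // ltr_pMr // ltr1n.
move=> x Ix.
have [V [nV VU]] : exists V : set N, nbhs (1%g : N) V /\ forall a b, V a -> V b -> U (a^-1 * b)%g.
  have m : (fun p : N * N => p.1^-1 * p.2)%g @ (1%g, 1%g) --> (1^-1 * 1 : N)%g.
    apply: mulg_cvg; last exact: cvg_snd.
    exact: (@cvg_comp _ _ _ fst (fun y : N => y^-1%g) _ (nbhs (1%g : N)) _ cvg_fst (@lie_inv_continuous R N 1%g)).
  rewrite invg1 mulg1 in m; have [[A B] /= [nA nB] AB] := m _ U1.
  exists (A `&` B); split; first exact: filterI.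
  by move=> a b [Aa _] [_ Bb]; exact: (AB (a, b)).
have nx : nbhs x [set y | (I `*` I) y -> V ((h x)^-1 * h y)%g].
  exact: (hc x Ix _ (nbhs_mulgV (h x) nV)).
have [e e0 eP] := norm_ball_nbhs nx.
have e2 : 0 < e / 2 by rewrite divr_gt0.
exists ([set y | `|x - y| <= e / 2], [set d | d <= e / 2]).
  split => /=; first exact: (@cvgr_dist_le _ _ _ (nbhs x) _ id x cvg_id _ e2).
  by apply: nbhs_right_le.
move=> [p d] /= [px de] Ip q Iq pq.
have xp : ((h p)^-1 * h q = ((h x)^-1 * h p)^-1 * ((h x)^-1 * h q))%g.
  by rewrite invgM invgK -mulgA mulVKg.
rewrite xp; apply: VU; apply: eP => //.
  by rewrite distrC; apply: le_trans px _; rewrite ler_pdivrMr // ler_pMr // ler1n.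
have -> : q - x = (q - p) + (p - x) by rewrite addrA subrK.
apply: le_trans (ler_normD _ _) _; rewrite [e]splitr; apply: lerD; rewrite distrC //.
exact: le_trans de.
Qed.

(* The points H i j of V lift the grid values h(i/m, j/m); small squares commute, so the
   lift of the last corner does not depend on the row. *)
Lemma loop_trivial (w : V) (h : R * R -> N) : {within I `*` I, continuous h} ->
  (forall t, I t -> h (t, 0) = G (t *: w)) -> (forall t, I t -> h (t, 1) = 1%g) ->
  (forall s, I s -> h (0, s) = 1%g /\ h (1, s) = 1%g) -> w = 0.
Proof.
move=> hc h0 h1 hs.
have [T1 _ _ _] := T.
(* Vectors of norm at most e and their pairwise [bch] products stay within radius r, where G is
   injective. *)
have [e [e0 er bs]] : exists e : R, [/\ 0 < e, e <= r &
    forall a b, `|a| <= e -> `|b| <= e -> `|bch G a b| <= r].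
  have /cvgrPdist_le/(_ r r0)/norm_ball_nbhs[e e0 eP] := @bch_continuous _ _ _ G (0, 0).
  exists (Num.min e r); split.
  - by rewrite lt_min e0.
  - by rewrite ge_min lexx orbT.
  move=> a b; rewrite !le_min => /andP[ae _] /andP[be _].
  have := eP (a, b); rewrite /= bchu0 sub0r normrN; apply.
  by rewrite prod_normE /= !subr0 ge_max ae.
have [d d0 dP] := uniform_continuity hc (T1 e e0).
pose m := (Num.truncn (d^-1 + `|w| / e)).+1.
have m0 : 0 < m%:R :> R by rewrite ltr0n.
have mb : d^-1 + `|w| / e <= m%:R by apply: ltW; exact: truncnS_gt.
have md : m%:R^-1 <= d.
  rewrite -[d]invrK lef_pV2 ?posrE ?invr_gt0 //; apply: le_trans mb.
  by rewrite lerDl divr_ge0 // ltW.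
have mw : `|m%:R^-1 *: w| <= e.
  rewrite normrZ ger0_norm ?invr_ge0 // mulrC ler_pdivrMr // mulrC -ler_pdivrMr //.
  by apply: le_trans mb; rewrite lerDr invr_ge0 ltW.
pose x (i : nat) : R := i%:R / m%:R.
have xI i : (i <= m)%N -> I (x i).
  by move=> im; rewrite /= in_itv /= divr_ge0 //= ler_pdivrMr // mul1r ler_nat.
have xS i : x i.+1 = x i + m%:R^-1 by rewrite /x -natr1 mulrDl mul1r.
have x0 : x 0%N = 0 by rewrite /x mul0r.
have xm : x m = 1 by rewrite /x divff // gt_eqF.
(* [lo] picks a small logarithm of a left quotient when there is one; otherwise its value 0 is never
   looked at. *)
have /choice[lo loP] (pq : (R * R) * (R * R)) : exists a : V,
    (exists2 b : V, `|b| <= e & G b = ((h pq.1)^-1 * h pq.2)%g) ->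
    `|a| <= e /\ G a = ((h pq.1)^-1 * h pq.2)%g.
  have [[b be bE]|] := pselect (exists2 b : V, `|b| <= e & G b = ((h pq.1)^-1 * h pq.2)%g).
    by exists b.
  by exists 0.
pose hz i j := lo ((x i, x j), (x i.+1, x j)).
pose vt i j := lo ((x i, x j), (x i, x j.+1)).
have xx i : `|x i - x i.+1| <= d.
  by rewrite xS opprD addrA subrr sub0r normrN ger0_norm // invr_ge0.
have hzP i j : (i < m)%N -> (j <= m)%N -> `|hz i j| <= e /\
    G (hz i j) = ((h (x i, x j))^-1 * h (x i.+1, x j))%g.
  move=> im jm; apply: loP; have [|||b /= be bE] := dP (x i, x j) (x i.+1, x j); last by exists b.
  - by split; apply: xI => //; exact: ltnW.
  - by split; apply: xI.
  - by rewrite prod_normE /= subrr normr0 ge_max xx ltW.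
have vtP i j : (i <= m)%N -> (j < m)%N -> `|vt i j| <= e /\
    G (vt i j) = ((h (x i, x j))^-1 * h (x i, x j.+1))%g.
  move=> im jm; apply: loP; have [|||b /= be bE] := dP (x i, x j) (x i, x j.+1); last by exists b.
  - by split; apply: xI => //; exact: ltnW.
  - by split; apply: xI.
  - by rewrite prod_normE /= subrr normr0 ge_max xx ltW.
have inje a b : `|a| <= e -> `|b| <= e -> G a = G b -> a = b.
  by move=> ae be; apply: injr; exact: le_trans er.
have n0 : `|0 : V| <= e by rewrite normr0 ltW.
pose H := fix H i j : V := if i is i'.+1 then bch G (H i' j) (hz i' j) else 0.
have claim i j : (i <= m)%N -> (j < m)%N -> H i j.+1 = bch G (H i j) (vt i j).
  move=> + jm; elim: i => [_|i IH im].
    have [v1 v2] := vtP 0%N j isT jm; rewrite /= (bch0u r0 injr).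
    apply: inje => //; rewrite v2 x0 eex_zero.
    by rewrite (hs _ (xI j (ltnW jm))).1 (hs _ (xI j.+1 jm)).1 mulVg.
  have [a1 a2] := hzP i j im (ltnW jm); have [b1 b2] := hzP i j.+1 im jm.
  have [e1 e2] := vtP i j (ltnW im) jm; have [f1 f2] := vtP i.+1 j im jm.
  rewrite /= IH ?(ltnW im) // !(bchA r0 injr); congr (bch G _ _).
  apply: injr; [exact: bs|exact: bs|].
  by rewrite -!bchE a2 b2 e2 f2 !mulgA !mulgK.
have last_col j : (j < m)%N -> H m j.+1 = H m j.
  move=> jm; rewrite claim //; have [v1 v2] := vtP m j (leqnn _) jm.
  have -> : vt m j = 0; last by rewrite bchu0.
  apply: inje => //; rewrite v2 xm eex_zero.
  by rewrite (hs _ (xI j (ltnW jm))).2 (hs _ (xI j.+1 jm)).2 mulVg.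
have top i : (i <= m)%N -> H i m = 0.
  elim: i => [//|i IH im] /=; rewrite IH ?(ltnW im) // (bch0u r0 injr).
  have [v1 v2] := hzP i m im (leqnn _).
  apply: inje => //; rewrite v2 xm eex_zero.
  by rewrite (h1 _ (xI i (ltnW im))) (h1 _ (xI i.+1 im)) mulVg.
have bottom i : (i <= m)%N -> H i 0%N = x i *: w.
  elim: i => [_|i IH im] /=; first by rewrite x0 scale0r.
  rewrite IH ?(ltnW im) // xS -(bch_line r0 injr); congr (bch G _ _).
  have [v1 v2] := hzP i 0%N im isT.
  by apply: inje => //; rewrite v2 x0 (h0 _ (xI _ (ltnW im))) (h0 _ (xI _ im)) xS eex_add mulKg.
have : H m 0%N = H m m.
  have h2 j : (j <= m)%N -> H m j = H m 0%N.
    by elim: j => [//|j IH jm]; rewrite last_col // IH // ltnW.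
  by rewrite h2.
by rewrite bottom // top // xm scale1r.
Qed.

(** If G w = 1, then t |-> G (t w) is a loop, and contracting it forces w = 0. *)
Lemma eex_inj : simply_connected R N -> injective G.
Proof.
move=> [_ Nsc].
have triv w : G w = 1%g -> w = 0.
  move=> w1; have lc : {within I, continuous (fun t : R => G (t *: w))}.
    apply: continuous_subspaceT => t.
    apply: (@cvg_comp _ _ _ (fun t : R => t *: w) G _ (nbhs (t *: w))); last exact: eex_continuous.
    exact: scalel_continuous.
  have [|h [hc h0 h1 hs]] := Nsc _ lc; first by rewrite scale0r scale1r w1 eex_zero.
  apply: (loop_trivial hc) => // [t It|s Is]; first by rewrite h1 // scale0r eex_zero.
  by have [-> ->] := hs s Is; rewrite scale0r eex_zero.
move=> u v uv.
have /triv b0 : G (bch G (- u) v) = 1%g by rewrite -bchE eex_opp uv mulVg.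
by rewrite -(bch0u r0 injr v) -(bchNu r0 injr u) (bchA r0 injr) b0 bchu0.
Qed.
End Exp.
End LieGlobal.

Lemma mulmxr_cvg (R : realType) n m (D : 'M[R]_(n, m)) : continuous (fun v : 'rV[R]_n => v *m D).
Proof.
move=> v; apply/(@cvgrPdist_le _ _ _ (nbhs (v : 'rV[R]_n))) => e e0.
have c0 : 0 < n%:R * `|D| + 1 by rewrite ltr_wpDl // mulr_ge0.
have h : \forall w \near v, `|v - w| <= e / (n%:R * `|D| + 1).
  by apply: (@cvgr_dist_le _ _ _ (nbhs v) _ id v cvg_id); rewrite divr_gt0.
near=> w; rewrite -mulmxBl; apply: le_trans (mulmx_norm _ _) _.
have : `|v - w| <= e / (n%:R * `|D| + 1) by near: w.
rewrite ler_pdivlMr // => h1; apply: le_trans h1.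
by rewrite mulrAC mulrC ler_wpM2l // lerDl.
Unshelve. all: by end_near.
Qed.

Section LieLog.
Variables (R : realType) (N : lieGroupType R).
Local Notation n := (@lie_dim R N).
Local Notation c1 := (@chart1 R N).
Local Notation p0 := (c1 1%g).
Local Notation V := 'rV[R]_n.
Hypothesis Nnil : @is_nilpotent N.
Hypothesis Nc : connected [set: N].
Hypothesis Ns : simply_connected R N.

Theorem lie_log_exp : exists G : expgrp R N n,
  [/\ continuous G, continuous (@lie_log R N), cancel G (@lie_log R N), cancel (@lie_log R N) G &
      forall (d : lie_aut N) v, d (G v) = G (v *m lie_diff d)].
Proof.
have [E [G [r [C [r0 C0 T GE]]]]] := lie_expgrp_local Nnil.
have EG : lex E = eex G by apply/funext => v; rewrite GE.
have [r1 [r10 rr rE]] : exists r1 : R, [/\ 0 < r1, r1 <= r & r1 <= lrad E].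
  exists (Num.min r (lrad E)); split; first by rewrite lt_min r0 lrad_gt0.
    by rewrite ge_min lexx.
  by rewrite ge_min lexx orbT.
have TG : exp_topology G r1 C.
  rewrite -EG; case: T => T1 T2 T3 T4; split => // [v vr|x xr]; first by apply: T3; exact: le_trans rr.
  by apply: T4; exact: le_trans rr.
have injr v w : `|v| <= r1 -> `|w| <= r1 -> G v = G w -> v = w.
  by move=> vr wr vw; apply: (@lex_inj _ _ _ E); [exact: le_trans rE|exact: le_trans rE|rewrite -!GE].
have [T1 T2 T3 T4] := TG.
have Gc : continuous G := eex_continuous r10 TG injr.
have Ginj : injective G := eex_inj r10 TG injr Ns.
have Gz := eex_zero G.
have one_par (v : V) : one_parameter (fun t : R => G (t *: v)).
  split=> [t|s t]; last exact: eex_add.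
  apply: (@cvg_comp _ _ _ (fun t : R => t *: v) G _ (nbhs (t *: v))); last exact: Gc.
  exact: scalel_continuous.
have deriv (v : V) : is_derive (0 : R) (1 : R) (c1 \o (fun t : R => G (t *: v))) v.
  have v1 : 0 < `|v| + 1 by rewrite ltr_wpDl.
  apply: (@quad_is_derive _ _ _ _ (C * `|v| ^+ 2) (r1 / (`|v| + 1))).
  - by rewrite divr_gt0.
  - by apply: mulr_ge0 (sqr_ge0 _).
  move=> t; rewrite ler_pdivlMr // => tr /=; rewrite scale0r Gz.
  have tv : `|t *: v| <= r1.
    by rewrite normrZ; apply: le_trans tr; rewrite ler_wpM2l // lerDl.
  apply: le_trans (T3 _ tv) _; rewrite normrZ exprMn real_normK ?num_real //.
  by rewrite le_eqVlt; apply/orP; left; apply/eqP; ring.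
(* [lie_log] picks some w that is the velocity of a one-parameter group reaching G v at time 1. By
   [one_param] that group is a line G (t w'), so w = w', and injectivity of G gives w = v. *)
have logG : cancel G (@lie_log R N).
  move=> v; rewrite /lie_log; case: xgetP => [w wE [g [[gc gD] gd g1]]|/(_ v)[]]; last first.
    by exists (fun t : R => G (t *: v)); split => //; rewrite scale1r.
  have [w' gw'] : exists w', forall t, g t = E (t *: w').
    apply: one_param => // eps e0.
    have g0 : g 0 = 1%g by apply: (mulgI (g 0)); rewrite -gD addr0 mulg1.
    have : nbhs (0 : R) [set t | [set G x | x in [set x | `|x| <= eps]] (g t)].
      by apply: gc; rewrite g0; exact: T1.
    move=> /norm_ball_nbhs[d d0 dP]; exists d => // t td.
    have [|x /= xe xg] := dP t; first by rewrite subr0.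
    by exists x => //; rewrite -xg GE.
  have gE : g = (fun t : R => G (t *: w')) by apply/funext => t; rewrite gw' GE.
  have ww' : w = w'.
    by rewrite -(derive_val (is_derive := gd)) gE; have := deriv w' => d'; rewrite derive_val.
  by apply: Ginj; rewrite -g1 gE scale1r ww'.
have Glog : cancel (@lie_log R N) G.
  by move=> x; have [v <-] := eex_surj TG Nc x; rewrite logG.
exists G; split => //.
  move=> x; apply/cvgrPdist_le => e e0.
  have bc : (fun w : V => bch G (lie_log x) w) @ (0 : V) --> bch G (lie_log x) 0.
    exact: (@bch_cvg _ _ _ G _ (nbhs (0 : V)) _ (fun=> lie_log x) id _ _ (cvg_cst _) cvg_id).
  move/cvgrPdist_le : bc => /(_ e e0)/norm_ball_nbhs[d d0 dP].
  apply: filterS (nbhs_mulgV x (T1 d d0)) => y /= [w wd wE].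
  have -> : y = G (bch G (lie_log x) w) by rewrite -bchE Glog wE mulVKg.
  by rewrite logG; have := dP w; rewrite /= subr0 bchu0; apply.
move=> d v.
have dC : cont1 E (d \o E).
  apply: (@exp_cont1 _ _ E r C T d); last exact: aut_fun1.
  exact: aut_fun_continuous.
pose D := dmx (@aut_funM _ _ d) dC.
have dD w : d (G w) = G (w *m D) by rewrite !GE; exact: (dmxP (@aut_funM _ _ d) dC).
rewrite dD; congr (G (_ *m _)).
pose f (v : V) := c1 (d (chart_inv c1 v)).
(* The chart and the exponential agree to second order at 1, so d read in the chart has the same
   differential as d read in logarithmic coordinates. *)
suff dfE : 'd f p0 = mulmxr D :> (V -> V).
  by apply/row_matrixP => i; rewrite !rowE /lie_diff /jacobian mul_rV_lin1 /= -/f dfE.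
have Dn (w : V) : `|w *m D| <= n%:R * `|w| * `|D| := mulmx_norm w D.
apply: diff_unique; first exact: mulmxr_cvg.
apply/eqaddoP => eps e0.
pose k := n%:R * `|D|; have k0 : 0 <= k by rewrite mulr_ge0.
pose Q := C * (4 * k ^+ 2) + k * C.
have Q0 : 0 <= Q.
  by apply: addr_ge0; [apply: mulr_ge0 => //; apply: mulr_ge0 (sqr_ge0 _)|exact: mulr_ge0].
pose e1 := Num.min (Num.min r1 (r1 / (2 * k + 1))) (eps / (Q + 1)).
have k1 : 0 < 2 * k + 1 by rewrite ltr_wpDl // mulr_ge0.
have e10 : 0 < e1 by rewrite !lt_min r10 !divr_gt0 // ltr_wpDl.
have : \forall x \near (0 : V), `|x| <= e1 by exact: nbhs0_le.
apply: filterS => x; rewrite !le_min => /andP[/andP[xr xk] xe].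
have [w [kw wx wxx]] := T4 x xr.
have wk : `|w *m D| <= 2 * k * `|x|.
  apply: le_trans (Dn w) _; rewrite mulrAC -/k [leRHS](_ : _ = k * (2 * `|x|)); last by ring.
  by rewrite ler_wpM2l.
have wr : `|w *m D| <= r1.
  apply: le_trans wk _; move: xk; rewrite ler_pdivlMr // mulrC => h; apply: le_trans h.
  by rewrite ler_wpM2r // lerDl.
have -> : (f \o shift p0 - (cst (f p0) + mulmxr D)) x = c1 (d (kap x)) - p0 - x *m D.
  rewrite !fctE /= /f /kap chart_mapK; last exact: chart1_dom1.
  by rewrite aut_fun1 opprD addrA.
rewrite kw dD.
have -> : c1 (G (w *m D)) - p0 - x *m D = (c1 (G (w *m D)) - p0 - w *m D) + (w - x) *m D.
  by rewrite mulmxBl addrA subrK.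
apply: (@le_trans _ _ (Q * `|x| ^+ 2)); last first.
  rewrite expr2 mulrA ler_wpM2r //; move: xe; rewrite ler_pdivlMr ?ltr_wpDl // => h.
  by apply: le_trans h; rewrite mulrC ler_wpM2l // lerDl.
apply: le_trans (ler_normD _ _) _; rewrite /Q mulrDl; apply: lerD.
  apply: le_trans (T3 _ wr) _; rewrite -mulrA ler_wpM2l //.
  have -> : 4 * k ^+ 2 * `|x| ^+ 2 = (2 * k * `|x|) ^+ 2 by ring.
  by rewrite lerXn2r // nnegrE // mulr_ge0 // mulr_ge0.
apply: le_trans (mulmx_norm _ _) _; rewrite mulrAC -/k -[leRHS]mulrA; exact: ler_wpM2l.
Qed.
End LieLog.

(** * Nilpotent groups with a logarithm *)

Record nilgrp (R : realType) (X : groupType) (n : nat) := NilGrp {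
  nexp :> expgrp R X n;
  nlg : X -> 'rV[R]_n;
  nexpK : cancel nexp nlg;
  nlgK : cancel nlg nexp
}.

Definition subalg (R : realType) (X : groupType) n (G : expgrp R X n) (s : set 'rV[R]_n) :=
  linsub s /\ forall u v, s u -> s v -> s (v *m ebr G u).

Lemma linsub_expmx (R : realType) n (s : set 'rV[R]_n) (A : 'M[R]_n) K v : linsub s ->
  (forall w, s w -> s (w *m A)) -> s v -> s (v *m expmx K A).
Proof. exact: (@linsub_mulmx _ _ s A (fun k => k`!%:R^-1) K). Qed.

Lemma linsub_dexp (R : realType) n (s : set 'rV[R]_n) (A : 'M[R]_n) K v : linsub s ->
  (forall w, s w -> s (w *m A)) -> s v -> s (v *m dexp K A).
Proof. exact: (@linsub_mulmx _ _ s A (fun k => (-1) ^+ k / k.+1`!%:R) K). Qed.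

Lemma linsub_psi (R : realType) n (s : set 'rV[R]_n) (A : 'M[R]_n) K v : linsub s ->
  (forall w, s w -> s (w *m A)) -> s v -> s (v *m psi K A).
Proof.
move=> ls sA sv; have -> : psi K A = \sum_(i < K) (1 : R) *: (1 - dexp K A) ^+ i.
  by apply: eq_bigr => i _; rewrite scale1r.
apply: (@linsub_mulmx _ _ s (1 - dexp K A) (fun=> 1)) => // w sw.
by rewrite mulmxBr mulmx1; apply: linsubB => //; exact: linsub_dexp.
Qed.

(** Every term after the first contains the factor A, so it is enough that v A lies in s, even when
    v does not. *)
Lemma linsub_sumX (R : realType) n (s : set 'rV[R]_n) (A : 'M[R]_n) (a : nat -> R) K v : linsub s ->
  (forall w, s w -> s (w *m A)) -> s (v *m A) ->
  s (v *m (\sum_(k < K.+1) a k *: A ^+ k) - a 0%N *: v).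
Proof.
move=> ls sA sv; rewrite big_ord_recl /= expr0 mulmxDr -scalemxAr mulmx1 addrC addKr.
rewrite mulmx_sumr; apply: linsub_sum => // k; rewrite -scalemxAr; apply: linsubZ => //.
rewrite /bump leq0n add1n exprS -mulmxE mulmxA.
have := @linsub_mulmx _ _ s A (fun i => (i == k)%:R) k.+1 _ ls sA sv.
rewrite (bigD1 ord_max) //= eqxx scale1r big1 ?addr0 // => i.
by rewrite -val_eqE /= => /negPf ->; rewrite scale0r.
Qed.

Lemma linsub_expmx1 (R : realType) n (s : set 'rV[R]_n) (A : 'M[R]_n) K v : linsub s -> A ^+ K = 0 ->
  (forall w, s w -> s (w *m A)) -> s (v *m A) -> s (v *m expmx K A - v).
Proof.
move=> ls AK sA sv; case: K AK => [|K] AK; last first.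
  by have := @linsub_sumX _ _ s A (fun k => k`!%:R^-1) K v ls sA sv; rewrite fact0 invr1 scale1r.
have -> : v = 0 by rewrite -[v]mulmx1 -[1%:M]/(A ^+ 0) AK mulmx0.
by rewrite mul0mx subrr; exact: ls.1.
Qed.

Lemma linsub_psi1 (R : realType) n (s : set 'rV[R]_n) (A : 'M[R]_n) K v : linsub s -> A ^+ K = 0 ->
  (forall w, s w -> s (w *m A)) -> s (v *m A) -> s (v *m psi K A - v).
Proof.
move=> ls AK sA sv; case: K AK => [|K] AK.
  have -> : v = 0 by rewrite -[v]mulmx1 -[1%:M]/(A ^+ 0) AK mulmx0.
  by rewrite mul0mx subrr; exact: ls.1.
have h1 w : s w -> s (w *m (1 - dexp K.+1 A)).
  by move=> sw; rewrite mulmxBr mulmx1; apply: linsubB => //; exact: linsub_dexp.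
have h2 : s (v *m (1 - dexp K.+1 A)).
  rewrite mulmxBr mulmx1 -opprB; apply: linsubN => //.
  have := @linsub_sumX _ _ s A (fun k => (-1) ^+ k / k.+1`!%:R) K v ls sA sv.
  by rewrite expr0 divr1 scale1r.
have := @linsub_sumX _ _ s _ (fun=> 1) K v ls h1 h2; rewrite scale1r.
by under eq_bigr do rewrite scale1r.
Qed.

Section NilGroup.
Variables (R : realType) (X : groupType) (n : nat) (G : nilgrp R X n).
Local Notation V := 'rV[R]_n.
Local Notation K := (edeg G).
Local Notation br := (ebr G).
Local Notation lg := (nlg G).
Implicit Types (u v w : V) (x y z : X) (s : set V).

Lemma nlgM x y : lg (x * y)%g = bch G (lg x) (lg y).
Proof. by apply: (can_inj (nexpK G)); rewrite nlgK -bchE !nlgK. Qed.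

Lemma nexp0 : G 0 = 1%g.
Proof.
have := eex_add G 0 0 0; rewrite !scaler0 => h.
by apply: (mulgI (G 0)); rewrite mulg1 -h.
Qed.

Lemma nexpN v : G (- v) = (G v)^-1%g.
Proof.
apply/esym/mulg1_eq; have := eex_add G v 1 (- 1).
by rewrite subrr scale0r nexp0 scale1r scaleN1r => <-.
Qed.

Lemma nexpMn v k : G (k%:R *: v) = (G v ^+ k)%g.
Proof.
elim: k => [|k IH]; first by rewrite scale0r nexp0 expg0.
by rewrite -natr1 eex_add IH scale1r expgSr.
Qed.

Lemma nlg1 : lg 1%g = 0.
Proof. by rewrite -nexp0 nexpK. Qed.

Lemma nlgV x : lg x^-1%g = - lg x.
Proof. by rewrite -{1}(nlgK G x) -nexpN nexpK. Qed.

Lemma nlgX x k : lg (x ^+ k)%g = k%:R *: lg x.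
Proof. by rewrite -{1}(nlgK G x) -nexpMn nexpK. Qed.

Definition nAd x : 'M[R]_n := expmx K (br (lg x)).

Lemma nlgJ x y : lg (x * y * x^-1)%g = lg y *m nAd x.
Proof.
have -> : (x * y * x^-1 = G (lg x) * G (lg y) * (G (lg x))^-1)%g by rewrite !nlgK.
by rewrite eex_conj nexpK.
Qed.

Lemma nAd_uniq x (A : 'M[R]_n) : (forall y, lg (x * y * x^-1)%g = lg y *m A) -> A = nAd x.
Proof.
move=> h; apply/row_matrixP => i; rewrite !rowE.
by rewrite -(nexpK G (delta_mx 0 i)) -h nlgJ.
Qed.

Lemma nAdM x y : nAd (x * y)%g = nAd y *m nAd x.
Proof.
by apply/esym/nAd_uniq => z; rewrite mulmxA -nlgJ -nlgJ invgM !mulgA.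
Qed.

Lemma nAd1 : nAd 1%g = 1.
Proof. by apply/esym/nAd_uniq => z; rewrite mul1g invg1 mulg1 mulmx1. Qed.

Definition sgrp s : set X := [set x | s (lg x)].

Lemma bch_norm s u v : subalg G s -> (forall w, s w -> s (w *m br u)) -> s v ->
  s (bch G u v - u).
Proof.
move=> [ls sb] su sv; have := @bch_linsub _ _ _ G s u v 0 ls; rewrite subr0; apply=> x t.
rewrite scaler0 !subr0 => sx; apply: linsub_psi => // w sw.
rewrite -(subrK u x) ebrD mulmxDr; apply: linsubD => //; [exact: sb|exact: su].
Qed.

Lemma sgrpM s x y : subalg G s -> sgrp s x -> sgrp s y -> sgrp s (x * y)%g.
Proof.
move=> sa sx sy; rewrite /sgrp /= nlgM -(subrK (lg x) (bch _ _ _)).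
apply: linsubD => //; first exact: sa.1.
by apply: bch_norm => // w sw; exact: sa.2.
Qed.

Lemma sgrpV s x : linsub s -> sgrp s x -> sgrp s x^-1%g.
Proof. by move=> ls; rewrite /sgrp /= nlgV; exact: linsubN. Qed.

Lemma sgrp1 s : linsub s -> sgrp s 1%g.
Proof. by move=> [s0 _]; rewrite /sgrp /= nlg1. Qed.

(** The converse follows the differential equation from - lg x with w = lg x: its right-hand side
    stays in lg x + s because x normalises s and br (lg x) kills lg x. *)
Lemma nlg_coset s x y : subalg G s -> (forall w, s w -> s (w *m br (lg x))) ->
  sgrp s (x^-1 * y)%g <-> s (lg y - lg x).
Proof.
move=> sa sx; split=> [sxy|sd].
  by rewrite -(mulVKg x y) nlgM; exact: bch_norm.
set a := lg x in sx sd; rewrite /sgrp /= nlgM nlgV -/a.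
have [ls sb] := sa.
have := @bch_linsub _ _ _ G s (- a) (lg y) a ls; rewrite opprK addrK; apply=> z t.
move=> sz.
have sw w : s w -> s (w *m br z).
  move=> h; have -> : z = (z + a - t *: a) + (t - 1) *: a by vring.
  rewrite ebrD mulmxDr; apply: linsubD => //; first exact: sb.
  by rewrite ebrZ -scalemxAr; apply: linsubZ => //; exact: sx.
have saz : s (a *m br z).
  have -> : z = (z + a - t *: a) + (t - 1) *: a by vring.
  rewrite ebrD ebrZ mulmxDr -scalemxAr ebr_self scaler0 addr0 ebr_anti.
  by apply: linsubN => //; exact: sx.
rewrite -[lg y](subrK a) mulmxDl -addrA; apply: linsubD => //; first exact: linsub_psi.
by apply: linsub_psi1 => //; exact: ebr_exp.
Qed.

Lemma linsub_nAd s x v : linsub s -> (forall w, s w -> s (w *m br (lg x))) -> s v -> s (v *m nAd x).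
Proof. by move=> ls sx sv; exact: linsub_expmx. Qed.

(* v Ad(x^k) is a polynomial in k whose linear coefficient is v br(lg x). *)
Lemma nAd_br s x : linsub s -> (forall w, s w -> s (w *m nAd x)) ->
  forall w, s w -> s (w *m br (lg x)).
Proof.
move=> ls sx w sw; have [S sS] := linsub_mx ls; apply/sS; rewrite submxE; apply/eqP/rowP => j.
set A := br (lg x).
have AK : A ^+ K = 0 := ebr_exp G (lg x).
have AE (k : nat) : nAd (x ^+ k)%g = \sum_(i < K) (k%:R ^+ i / i`!%:R) *: A ^+ i.
  rewrite /nAd nlgX ebrZ /expmx; apply: eq_bigr => i _.
  by rewrite exprZmx scalerA mulrC.
have sk (k : nat) : s (w *m nAd (x ^+ k)%g).
  elim: k => [|k IH]; first by rewrite expg0 nAd1 mulmx1.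
  by rewrite expgS nAdM mulmxA; exact: sx.
pose p : {poly R} := \sum_(i < K) ((w *m A ^+ i *m cokermx S) 0 j / i`!%:R) *: 'X^i.
have p0 : p = 0.
  apply: poly_nat_eq0 => k; have /sS := sk k; rewrite submxE => /eqP/rowP/(_ j).
  rewrite AE mulmx_sumr mulmx_suml summxE [RHS]mxE => e; apply: etrans e.
  rewrite horner_sum; apply: eq_bigr => i _.
  by rewrite -scalemxAr -scalemxAl hornerZ hornerXn [RHS]mxE; ring.
have [K1|K1] := ltnP 1 K.
  have := congr1 (fun q : {poly R} => q`_1) p0; rewrite coef0 coef_sum (bigD1 (Ordinal K1)) //=.
  rewrite big1 ?addr0 => [|i]; last first.
    by rewrite -val_eqE /= coefZ coefXn eq_sym => /negPf ->; rewrite mulr0.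
  by rewrite coefZ coefXn eqxx mulr1 divr1 expr1 => ->; rewrite mxE.
have -> : A = 0.
  by rewrite -[A]expr1 -(subnK K1) exprD AK mulr0.
by rewrite mulmx0 mul0mx.
Qed.

Definition Fil k : set X := sgrp (nfil br k).

Lemma fil_subalg k : subalg G (nfil br k).
Proof. by split; [exact: nfil_lin|move=> u v _; exact: nfil_br]. Qed.

Lemma FilT x : Fil K x.
Proof. exact: ebr_fil. Qed.

Lemma Fil0 x : Fil 0 x -> x = 1%g.
Proof. by rewrite /Fil /sgrp /= => h; rewrite -(nlgK G x) h nexp0. Qed.

Lemma FilV k x : Fil k x -> Fil k x^-1%g.
Proof. by move=> fx; apply: sgrpV fx; exact: nfil_lin. Qed.

Lemma fil_nAd k x v : nfil br k.+1 v -> nfil br k (v *m nAd x - v).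
Proof.
move=> fv; apply: linsub_expmx1; [exact: nfil_lin|exact: ebr_exp| |exact: fv].
by move=> w; exact: nfil_br.
Qed.

Lemma FilJ k x y : Fil k x -> Fil k (y * x * y^-1)%g.
Proof.
rewrite /Fil /sgrp /= nlgJ => fx; apply: linsub_nAd => //; first exact: nfil_lin.
by move=> w; exact: nfil_br.
Qed.

Lemma Fil_coset k x y : Fil k (x^-1 * y)%g <-> nfil br k (lg y - lg x).
Proof. by apply: nlg_coset; [exact: fil_subalg|move=> w; exact: nfil_br]. Qed.

Lemma FilR k x y : Fil k.+1 x -> Fil k (x^-1 * (y * x * y^-1))%g.
Proof. by move=> fx; apply/Fil_coset; rewrite nlgJ; exact: fil_nAd. Qed.

(** Logarithms add up modulo the next smaller level. The later inductions along the filtration rest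
    on this: within one level a correction acts linearly. *)
Lemma nlgM_fil k x y : Fil k.+1 y -> nfil br k (lg (x * y)%g - (lg x + lg y)).
Proof.
move=> fy; rewrite nlgM opprD addrA.
have lk := nfil_lin G k.
apply: bch_linsub => // z t _; apply: linsub_psi1 => //; first exact: ebr_exp.
by move=> w; exact: nfil_br.
Qed.

Lemma nlgM_fil2 k x y : Fil k.+1 x -> nfil br k (lg (x * y)%g - (lg x + lg y)).
Proof.
move=> fx; have lk := nfil_lin G k.
have -> : (x * y = y * (y^-1 * x * y))%g by rewrite !mulgA mulgV mul1g.
have fx' : Fil k.+1 (y^-1 * x * y)%g by have := FilJ y^-1%g fx; rewrite invgK.
have := nlgM_fil y fx'; have := FilR y^-1%g fx; rewrite invgK => /Fil_coset.
move=> h1 h2.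
have -> : lg (y * (y^-1 * x * y))%g - (lg x + lg y) =
  (lg (y * (y^-1 * x * y))%g - (lg y + lg (y^-1 * x * y)%g)) + (lg (y^-1 * x * y)%g - lg x) by vring.
exact: linsubD.
Qed.
End NilGroup.

Section Product.
Variables (R : realType) (X1 X2 : groupType) (n1 n2 : nat).
Variables (G1 : nilgrp R X1 n1) (G2 : nilgrp R X2 n2).
Local Notation V := 'rV[R]_(n1 + n2).
Implicit Types (u v w : V).

Definition pexp v : (X1 * X2)%type := (G1 (lsubmx v), G2 (rsubmx v)).
Definition plg (x : X1 * X2) : V := row_mx (nlg G1 x.1) (nlg G2 x.2).
Definition pbr v : 'M[R]_(n1 + n2) :=
  block_mx (ebr G1 (lsubmx v)) 0 0 (ebr G2 (rsubmx v)).

Lemma lsubmx_lin m k (a : R) (u v : 'rV[R]_(m + k)) : lsubmx (a *: u + v) = a *: lsubmx u + lsubmx v.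
Proof. by apply/rowP => i; rewrite !mxE. Qed.
Lemma rsubmx_lin m k (a : R) (u v : 'rV[R]_(m + k)) : rsubmx (a *: u + v) = a *: rsubmx u + rsubmx v.
Proof. by apply/rowP => i; rewrite !mxE. Qed.
Lemma lsubmxZ m k (a : R) (v : 'rV[R]_(m + k)) : lsubmx (a *: v) = a *: lsubmx v.
Proof. by apply/rowP => i; rewrite !mxE. Qed.
Lemma rsubmxZ m k (a : R) (v : 'rV[R]_(m + k)) : rsubmx (a *: v) = a *: rsubmx v.
Proof. by apply/rowP => i; rewrite !mxE. Qed.

Lemma mul_block_diag m k (v : 'rV[R]_(m + k)) (A : 'M[R]_m) (B : 'M[R]_k) :
  v *m block_mx A 0 0 B = row_mx (lsubmx v *m A) (rsubmx v *m B).
Proof. by rewrite -{1}[v]hsubmxK mul_row_block !mulmx0 addr0 add0r. Qed.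

Lemma block_diag_exp m k (A : 'M[R]_m) (B : 'M[R]_k) i :
  (block_mx A 0 0 B) ^+ i = block_mx (A ^+ i) 0 0 (B ^+ i).
Proof.
elim: i => [|i IH]; first by rewrite !expr0 -[RHS]scalar_mx_block.
by rewrite !exprS IH -!mulmxE mulmx_block !mulmx0 !mul0mx !addr0 add0r.
Qed.

Lemma block_diag_sum m k (I : finType) (a : I -> R) (A : I -> 'M[R]_m) (B : I -> 'M[R]_k) :
  \sum_i a i *: block_mx (A i) 0 0 (B i) = block_mx (\sum_i a i *: A i) 0 0 (\sum_i a i *: B i).
Proof.
rewrite (eq_bigr (fun i => block_mx (a i *: A i) 0 0 (a i *: B i))) => [|i _].
  elim/big_ind3 : _ => // [|A1 B1 C1 A2 B2 C2 -> ->]; first by rewrite block_mx0.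
  by rewrite add_block_mx !addr0.
by rewrite scale_block_mx !scaler0.
Qed.

Lemma nil_sum_widen n (A : 'M[R]_n) (a : nat -> R) K L : A ^+ K = 0 -> (K <= L)%N ->
  \sum_(k < L) a k *: A ^+ k = \sum_(k < K) a k *: A ^+ k.
Proof.
move=> AK /subnK <-; elim: (L - K)%N => [//|j IH]; rewrite addSn big_ord_recr /= IH.
by rewrite exprD AK mulr0 scaler0 addr0.
Qed.

Let Km := maxn (edeg G1) (edeg G2).

Lemma block_sum_max v (a : nat -> R) : \sum_(k < Km) a k *: pbr v ^+ k =
  block_mx (\sum_(k < edeg G1) a k *: ebr G1 (lsubmx v) ^+ k) 0 0
           (\sum_(k < edeg G2) a k *: ebr G2 (rsubmx v) ^+ k).
Proof.
under eq_bigr do rewrite block_diag_exp; rewrite block_diag_sum.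
by rewrite (nil_sum_widen a (ebr_exp G1 _) (leq_maxl _ _)) (nil_sum_widen a (ebr_exp G2 _) (leq_maxr _ _)).
Qed.

Lemma nfil_prod k v : nfil (ebr G1) k (lsubmx v) -> nfil (ebr G2) k (rsubmx v) -> nfil pbr k v.
Proof.
elim: k v => [|k IH] v /= h1 h2; first by rewrite -[v]hsubmxK h1 h2 row_mx0.
by move=> u; apply: IH; rewrite mul_block_diag ?row_mxKl ?row_mxKr.
Qed.

Lemma pev_lsub m k (c : 'rV[{poly R}]_(m + k)) (t : R) : lsubmx (pev c t) = pev (lsubmx c) t.
Proof. by apply/rowP => i; rewrite !mxE. Qed.
Lemma pev_rsub m k (c : 'rV[{poly R}]_(m + k)) (t : R) : rsubmx (pev c t) = pev (rsubmx c) t.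
Proof. by apply/rowP => i; rewrite !mxE. Qed.
Lemma pder_lsub m k (c : 'rV[{poly R}]_(m + k)) : lsubmx (pder c) = pder (lsubmx c).
Proof. by apply/rowP => i; rewrite !mxE. Qed.
Lemma pder_rsub m k (c : 'rV[{poly R}]_(m + k)) : rsubmx (pder c) = pder (rsubmx c).
Proof. by apply/rowP => i; rewrite !mxE. Qed.

(** The degree is the larger of the two; by [nil_sum_widen] a series in a nilpotent matrix does not
    change when it is prolonged. *)
Definition prod_expgrp : expgrp R (X1 * X2)%type (n1 + n2).
Proof.
refine (@ExpGrp R _ _ pexp Km pbr _ _ _ _ _ _).
- by move=> v s t; rewrite /pexp !lsubmxZ !rsubmxZ !eex_add.
- move=> a u v; rewrite /pbr lsubmx_lin rsubmx_lin !ebr_lin scale_block_mx !scaler0 add_block_mx.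
  by rewrite !addr0.
- by move=> v; rewrite mul_block_diag !ebr_self row_mx0.
- move=> v; apply: nfil_prod.
    by apply: (nfil_le (leq_maxl _ _)); exact: ebr_fil.
  by apply: (nfil_le (leq_maxr _ _)); exact: ebr_fil.
- move=> u v; rewrite /expmx (block_sum_max u (fun k => k`!%:R^-1)) /pexp mul_block_diag.
  by rewrite row_mxKl row_mxKr -!eex_conj.
move=> c v ode.
have split2 t : pev (pder c) t *m dexp Km (pbr (pev c t)) =
    row_mx (pev (pder (lsubmx c)) t *m dexp (edeg G1) (ebr G1 (pev (lsubmx c) t)))
           (pev (pder (rsubmx c)) t *m dexp (edeg G2) (ebr G2 (pev (rsubmx c) t))).
  rewrite /dexp (block_sum_max _ (fun k => (-1) ^+ k / k.+1`!%:R)) mul_block_diag.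
  by rewrite !pev_lsub !pev_rsub pder_lsub pder_rsub.
rewrite /pexp !pev_lsub !pev_rsub.
rewrite (@eex_ode _ _ _ G1 (lsubmx c) (lsubmx v)) => [|t]; last by rewrite -(ode t) split2 row_mxKl.
by rewrite (@eex_ode _ _ _ G2 (rsubmx c) (rsubmx v)) => [|t]; last by rewrite -(ode t) split2 row_mxKr.
Defined.

Lemma pexpK : cancel prod_expgrp plg.
Proof. by move=> v; rewrite /plg /= !nexpK hsubmxK. Qed.

Lemma plgK : cancel plg prod_expgrp.
Proof. by move=> [x y]; rewrite /plg /= /pexp row_mxKl row_mxKr !nlgK. Qed.

Definition prod_nilgrp := NilGrp pexpK plgK.
End Product.

Lemma graph_subalg (R : realType) (X1 X2 : groupType) n1 n2 (G1 : nilgrp R X1 n1) (G2 : nilgrp R X2 n2)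
  (L : 'M[R]_(n1, n2)) : (forall u v : 'rV[R]_n1, (v *m L) *m ebr G2 (u *m L) = (v *m ebr G1 u) *m L) ->
  subalg (prod_nilgrp G1 G2) [set v | rsubmx v = lsubmx v *m L].
Proof.
move=> hL; split; first split.
- by rewrite /=; apply/rowP => i; rewrite !mxE big1 // => j _; rewrite !mxE mul0r.
- by move=> a v w /=; rewrite rsubmx_lin lsubmx_lin => -> ->; rewrite mulmxDl scalemxAl.
by move=> u v /= hu hv; rewrite /pbr mul_block_diag row_mxKl row_mxKr hu hv hL.
Qed.

(* The graph of L is a subalgebra of the product. *)
Lemma alg_morph_exp (R : realType) (X1 X2 : groupType) n1 n2 (G1 : nilgrp R X1 n1) (G2 : nilgrp R X2 n2)
  (L : 'M[R]_(n1, n2)) : (forall u v : 'rV[R]_n1, (v *m L) *m ebr G2 (u *m L) = (v *m ebr G1 u) *m L) ->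
  {morph (fun x => G2 (nlg G1 x *m L)) : x y / (x * y)%g}.
Proof.
move=> hL x y; have sa := graph_subalg hL; set s := [set v | _] in sa.
have gs z : sgrp (prod_nilgrp G1 G2) s (z, G2 (nlg G1 z *m L)).
  by rewrite /sgrp /s /= /plg row_mxKl row_mxKr /= nexpK.
have := sgrpM sa (gs x) (gs y); rewrite /sgrp /s /= /plg /= row_mxKl row_mxKr => h.
by rewrite -[RHS](nlgK G2) h.
Qed.

(** * Exponential polynomials and semisimple matrices *)

Section ExpPoly.
Variable F : numFieldType.
Implicit Types (p q : {poly F}) (l : seq (F * {poly F})).

Definition shp p : {poly F} := p \Po ('X + 1%:P).

Lemma shp_nat p (j : nat) : (shp p).[j%:R] = p.[j.+1%:R].
Proof. by rewrite horner_comp !hornerE natr1. Qed.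

Lemma size_shp p : size (shp p) = size p.
Proof. by rewrite size_comp_poly2 // size_XaddC. Qed.

Lemma lead_coef_shp p : lead_coef (shp p) = lead_coef p.
Proof.
by rewrite lead_coef_comp ?size_XaddC // lead_coefXaddC expr1n mulr1.
Qed.

Lemma size_shp_sub p : p != 0 -> (size (shp p - p)%R < size p)%N.
Proof.
move=> p0; have sp : (0 < size p)%N by rewrite size_poly_gt0.
rewrite -(prednK sp) ltnS; apply/leq_sizeP => j; rewrite leq_eqVlt => /orP[/eqP <-|jp].
  have h1 : (shp p)`_(size p).-1 = lead_coef (shp p) by rewrite lead_coefE size_shp.
  by rewrite coefB h1 lead_coef_shp lead_coefE subrr.
have jp' : (size p <= j)%N by rewrite -(prednK sp).
by rewrite coefB !nth_default ?subrr // size_shp.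
Qed.

(** The exponential variable m and the polynomial variable k are kept apart. On the diagonal this is
    an ordinary exponential polynomial; off it the two kinds of growth vary independently. *)
Definition eps l (k m : nat) : F := \sum_(x <- l) x.1 ^+ m * x.2.[k%:R].

(* The operator f(m) |-> f(m + 1) - mu f(m) lowers the degree of the coefficient of mu^m. *)
Lemma eps_uniq_eq0 l : uniq (unzip1 l) -> all (fun x => x.1 != 0) l ->
  (forall m, eps l m m = 0) -> forall x, x \in l -> x.2 = 0.
Proof.
move: {2}(_ + _)%N (leqnn (size l + \sum_(x <- l) size x.2)) => N.
elim: N l => [|N IH] [//|[mu p] l] /=; rewrite big_cons //= => szN.
move=> /andP[mul ul] /andP[mu0 l0] h.
have [p0|p0] := eqVneq p 0.
  have hl m : eps l m m = 0 by have := h m; rewrite /eps big_cons /= p0 horner0 mulr0 add0r.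
  move=> x; rewrite inE => /orP[/eqP -> //|xl]; apply: IH xl => //.
  by move: szN; rewrite p0 size_poly0 add0n addSn ltnS.
pose g (x : F * {poly F}) := (x.1, x.1 *: shp x.2 - mu *: x.2).
have gz m : eps (map g ((mu, p) :: l)) m m = 0.
  have e : eps (map g ((mu, p) :: l)) m m =
      eps ((mu, p) :: l) m.+1 m.+1 - mu * eps ((mu, p) :: l) m m.
    rewrite /eps big_map mulr_sumr -sumrB; apply: eq_bigr => x _.
    by rewrite /g /= hornerD hornerN !hornerZ shp_nat exprS; ring.
  by rewrite e !h mulr0 subrr.
have sg (q : {poly F}) (a b : F) : (size (a *: shp q - b *: q)%R <= size q)%N.
  apply: leq_trans (size_polyD _ _) _; rewrite geq_max size_polyN.
  by rewrite (leq_trans (size_scale_leq _ _)) ?size_shp //= size_scale_leq.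
have all0 : forall x, x \in map g ((mu, p) :: l) -> x.2 = 0.
  apply: IH => //.
  - rewrite size_map /= big_cons /= big_map.
    have s1 : (size (mu *: shp p - mu *: p)%R < size p)%N.
      rewrite -scalerBr (leq_ltn_trans (size_scale_leq _ _)) // size_shp_sub //.
    have s2 : (\sum_(x <- l) size (g x).2 <= \sum_(x <- l) size x.2)%N.
      by apply: leq_sum => x _; exact: sg.
    move: szN; rewrite addSn ltnS; apply: leq_trans.
    by rewrite addSn -addnS leq_add2l -addSn leq_add.
  - by rewrite /unzip1 -map_comp /= mul ul.
  - by rewrite all_map /= mu0.
have lz x : x \in l -> x.2 = 0.
  move=> xl; have : (g x).2 = 0 by apply: all0; apply: map_f; rewrite inE xl orbT.
  rewrite /g /= => /eqP; rewrite subr_eq0 => /eqP e.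
  have xmu : x.1 != mu.
    by apply: contraNneq mul => <-; apply: map_f.
  have /eqP := congr1 lead_coef e; rewrite !lead_coefZ lead_coef_shp -subr_eq0 -mulrBl mulf_eq0.
  by rewrite subr_eq0 (negPf xmu) lead_coef_eq0 => /eqP.
have p00 : p = 0.
  apply: poly_nat_eq0 => j; have := h j; rewrite /eps big_cons /= big_seq big1 ?addr0 => [/eqP|x xl].
    by rewrite mulf_eq0 expf_eq0 (negPf mu0) andbF => /eqP.
  by rewrite lz // horner0 mulr0.
by rewrite p00 eqxx in p0.
Qed.

Definition mrg l := [seq (mu, \sum_(x <- l | x.1 == mu) x.2) | mu <- undup (unzip1 l)].

Lemma eps_mrg l k m : eps (mrg l) k m = eps l k m.
Proof.
rewrite /eps /mrg big_map /=.
transitivity (\sum_(mu <- undup (unzip1 l)) \sum_(x <- l) (if x.1 == mu then x.1 ^+ m * x.2.[k%:R] else 0)).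
  apply: eq_bigr => mu _; rewrite horner_sum mulr_sumr big_mkcond; apply: eq_bigr => x _.
  by case: eqP => // ->.
rewrite exchange_big /= big_seq [RHS]big_seq; apply: eq_bigr => x xl.
rewrite (bigD1_seq x.1) ?undup_uniq ?mem_undup ?map_f //= eqxx big1 ?addr0 // => mu.
by rewrite eq_sym => /negPf ->.
Qed.

Definition expoly (f : nat -> nat -> F) :=
  exists2 l, all (fun x : F * {poly F} => x.1 != 0) l & forall k m, f k m = eps l k m.

(** Once equal bases are merged, vanishing on the diagonal kills every coefficient polynomial, hence
    the whole expression. Evaluating at (1, 0) or (0, 1) then isolates a unipotent or a semisimple
    factor. *)
Lemma expoly_diag0 f : expoly f -> (forall m, f m m = 0) -> forall k m, f k m = 0.
Proof.
move=> [l l0 fE] f0 k m; rewrite fE -eps_mrg /eps big_seq big1 // => x xl.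
have -> : x.2 = 0; last by rewrite horner0 mulr0.
apply: (@eps_uniq_eq0 (mrg l)) => //.
- by rewrite /mrg /unzip1 -map_comp map_id undup_uniq.
- apply/allP => _ /mapP[mu + ->] /=; rewrite mem_undup => /mapP[y yl ->].
  exact: (allP l0).
by move=> j; rewrite eps_mrg -fE.
Qed.

Lemma expoly_ext f g : (forall k m, f k m = g k m) -> expoly f -> expoly g.
Proof. by move=> e [l l0 fE]; exists l => // k m; rewrite -e. Qed.

Lemma expoly_poly p : expoly (fun k _ => p.[k%:R]).
Proof.
exists [:: (1, p)] => [|k m]; first by rewrite /= oner_eq0.
by rewrite /eps big_seq1 /= expr1n mul1r.
Qed.

Lemma expolyC c : expoly (fun _ _ => c).
Proof. by have := expoly_poly c%:P; apply: expoly_ext => k m; rewrite hornerC. Qed.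

Lemma expoly_exp mu : mu != 0 -> expoly (fun _ m => mu ^+ m).
Proof.
move=> mu0; exists [:: (mu, 1%:P)] => [|k m]; first by rewrite /= mu0.
by rewrite /eps big_seq1 /= hornerC mulr1.
Qed.

Lemma expolyD f g : expoly f -> expoly g -> expoly (fun k m => f k m + g k m).
Proof.
move=> [l l0 fE] [l' l0' gE]; exists (l ++ l'); first by rewrite all_cat l0.
by move=> k m; rewrite /eps big_cat /= fE gE.
Qed.

Lemma expolyM f g : expoly f -> expoly g -> expoly (fun k m => f k m * g k m).
Proof.
move=> [l l0 fE] [l' l0' gE].
exists [seq (x.1 * y.1, x.2 * y.2) | x <- l, y <- l'].
  apply/allP => _ /allpairsP[[x y] /= [xl yl ->]] /=.
  by apply: mulf_neq0; [exact: (allP l0 _ xl)|exact: (allP l0' _ yl)].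
move=> k m; rewrite fE gE /eps mulr_suml big_allpairs_dep /=; apply: eq_bigr => x _.
by rewrite mulr_sumr; apply: eq_bigr => y _; rewrite hornerM exprMn; ring.
Qed.

Lemma expoly_sum (I : Type) (r : seq I) (f : I -> nat -> nat -> F) : (forall i, expoly (f i)) ->
  expoly (fun k m => \sum_(i <- r) f i k m).
Proof.
move=> h; elim: r => [|i r IH].
  by apply: (expoly_ext _ (expolyC 0)) => k m; rewrite big_nil.
by apply: (expoly_ext _ (expolyD (h i) IH)) => k m; rewrite big_cons.
Qed.

End ExpPoly.

Section ExpMatrix.
Variable F : numFieldType.

Definition exmx m n (A : nat -> nat -> 'M[F]_(m, n)) := forall i j, expoly (fun k h => A k h i j).

Lemma exmxC m n (A : 'M[F]_(m, n)) : exmx (fun _ _ => A).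
Proof. by move=> i j; exact: expolyC. Qed.

Lemma exmx_ext m n (A B : nat -> nat -> 'M[F]_(m, n)) : (forall k h, A k h = B k h) -> exmx A -> exmx B.
Proof. by move=> e eA i j; apply: (expoly_ext _ (eA i j)) => k h; rewrite e. Qed.

Lemma exmxM m n p (A : nat -> nat -> 'M[F]_(m, n)) (B : nat -> nat -> 'M[F]_(n, p)) :
  exmx A -> exmx B -> exmx (fun k h => A k h *m B k h).
Proof.
move=> eA eB i j; apply: (@expoly_ext _ (fun k h => \sum_a A k h i a * B k h a j)) => [k h|].
  by rewrite mxE.
by apply: expoly_sum => a; exact: expolyM.
Qed.

Lemma exmxD m n (A B : nat -> nat -> 'M[F]_(m, n)) : exmx A -> exmx B -> exmx (fun k h => A k h + B k h).
Proof.
by move=> eA eB i j; apply: (expoly_ext _ (expolyD (eA i j) (eB i j))) => k h; rewrite mxE.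
Qed.

Lemma exmxZ m n (a : nat -> nat -> F) (A : nat -> nat -> 'M[F]_(m, n)) : expoly a -> exmx A ->
  exmx (fun k h => a k h *: A k h).
Proof.
by move=> ea eA i j; apply: (expoly_ext _ (expolyM ea (eA i j))) => k h; rewrite mxE.
Qed.

Lemma exmx_sum m n (I : Type) (r : seq I) (A : I -> nat -> nat -> 'M[F]_(m, n)) :
  (forall i, exmx (A i)) -> exmx (fun k h => \sum_(i <- r) A i k h).
Proof.
move=> eA i j; apply: (expoly_ext _ (expoly_sum r (fun x => eA x i j))) => k h.
by rewrite summxE.
Qed.

Lemma diag_unit n (P : 'M[F]_n) (d : 'rV[F]_n) (A : 'M[F]_n) : P \in unitmx -> A \in unitmx ->
  P *m A = diag_mx d *m P -> forall i, d 0 i != 0.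
Proof.
move=> Pu Au PA i; have : diag_mx d \in unitmx.
  have : diag_mx d *m P \in unitmx by rewrite -PA unitmx_mul Pu.
  by rewrite unitmx_mul => /andP[].
by rewrite unitmxE det_diag unitfE => /prodf_neq0; exact.
Qed.

Lemma diag_exp n (P : 'M[F]_n) (d : 'rV[F]_n) (A : 'M[F]_n) m : P \in unitmx ->
  P *m A = diag_mx d *m P -> A ^+ m = invmx P *m diag_mx (\row_i (d 0 i ^+ m)) *m P.
Proof.
move=> Pu PA; rewrite -mulmxA; apply: (canRL (mulKmx Pu)); elim: m => [|m IH].
  rewrite expr0 mulmx1 -[LHS]mul1mx; congr (_ *m _); apply/matrixP => i j.
  by rewrite !mxE expr0.
rewrite exprSr -mulmxE mulmxA IH -mulmxA PA mulmxA; congr (_ *m _).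
by rewrite mulmx_diag; congr diag_mx; apply/rowP => i; rewrite !mxE exprSr.
Qed.

Lemma exmx_diag n (P : 'M[F]_n) (d : 'rV[F]_n) (A : 'M[F]_n) : P \in unitmx -> A \in unitmx ->
  P *m A = diag_mx d *m P -> exmx (fun _ m => A ^+ m).
Proof.
move=> Pu Au PA; have d0 := diag_unit Pu Au PA.
apply: (@exmx_ext _ _ (fun _ m => invmx P *m diag_mx (\row_i (d 0 i ^+ m)) *m P)) => [k m|].
  by rewrite (diag_exp m Pu PA).
apply: exmxM; last exact: exmxC; apply: exmxM; first exact: exmxC.
move=> i j; have [->|ij] := eqVneq i j.
  by apply: (expoly_ext _ (expoly_exp (d0 j))) => k m; rewrite !mxE eqxx mulr1n.
by apply: (expoly_ext _ (expolyC 0)) => k m; rewrite !mxE (negPf ij) mulr0n.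
Qed.

Lemma exmx_unip n (N : 'M[F]_n) K : (N - 1) ^+ K = 0 -> exmx (fun k _ => N ^+ k).
Proof.
move=> NK.
have tail a b (j : nat) : (forall k, (a <= k < b)%N -> (N - 1) ^+ k *+ 'C(j, k) = 0) -> (a <= b)%N ->
    \sum_(0 <= k < b) (N - 1) ^+ k *+ 'C(j, k) = \sum_(0 <= k < a) (N - 1) ^+ k *+ 'C(j, k).
  move=> h ab; rewrite (@big_cat_nat _ _ _ a) //= [X in _ + X]big_nat_cond [X in _ + X]big1 ?addr0 // => k.
  by rewrite andbT => /h.
apply: (@exmx_ext _ _ (fun j _ => \sum_(k < K) (bpol F k).[j%:R] *: (N - 1) ^+ k)) => [j _|].
  under eq_bigr do rewrite bpol_nat scaler_nat.
  rewrite -{2}[N](subrKC 1) exprDn_comm; last exact/commr_sym/commr1.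
  under [RHS]eq_bigr do rewrite expr1n mul1r.
  rewrite -(big_mkord xpredT (fun k => (N - 1) ^+ k *+ 'C(j, k))).
  rewrite -[RHS](big_mkord xpredT (fun k => (N - 1) ^+ k *+ 'C(j, k))).
  have [jK|Kj] := leqP j.+1 K.
    by apply: tail => // k /andP[jk _]; rewrite bin_small // mulr0n.
  apply/esym/tail; last exact: ltnW.
  by move=> k /andP[Kk _]; rewrite -(subnK Kk) exprD NK mulr0 mul0rn.
by apply: exmx_sum => k; apply: exmxZ; [exact: expoly_poly|exact: exmxC].
Qed.

Lemma exmx_diag0 m n (A : nat -> nat -> 'M[F]_(m, n)) : exmx A -> (forall k, A k k = 0) ->
  forall k h, A k h = 0.
Proof.
move=> eA A0 k h; apply/matrixP => i j; rewrite [RHS]mxE.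
by apply: (expoly_diag0 (eA i j)) => a; rewrite A0 mxE.
Qed.
End ExpMatrix.

Section Fitting.
Variable F : fieldType.

Lemma horner_mx_inv n (M : 'M[F]_n.+1) (s : 'rV[F]_n.+1 -> Prop) (p : {poly F}) v :
  (forall (a : F) v w, s v -> s w -> s (a *: v + w)) -> s 0 ->
  (forall w, s w -> s (w *m M)) -> s v -> s (v *m horner_mx M p).
Proof.
move=> ls s0 sM; elim/poly_ind: p v => [|p c IH] v sv; first by rewrite rmorph0 mulmx0.
rewrite rmorphD rmorphM /= horner_mx_X horner_mx_C mulmxDr mul_mx_scalar addrC.
by apply: ls => //; rewrite -mulmxE mulmxA; apply: sM; exact: IH.
Qed.

(* Bezout between the part of the characteristic polynomial prime to X and X^n. *)
Lemma fitting_mx n (M : 'M[F]_n) : exists P Q : 'M[F]_n,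
  [/\ 1 = P + Q *m M, P *m M ^+ n = 0, M *m Q = Q *m M &
   forall s : 'rV[F]_n -> Prop, (forall (a : F) v w, s v -> s w -> s (a *: v + w)) -> s 0 ->
     (forall w, s w -> s (w *m M)) -> forall v, s v -> s (v *m P) /\ s (v *m Q)].
Proof.
case: n M => [|n] M.
  have z (A B : 'M[F]_0) : A = B by apply/matrixP => -[].
  exists 0, 0; split; [exact: z|exact: z|exact: z|].
  by move=> s _ s0 _ v _; rewrite !mulmx0.
have [a [g /implyP g0 chi]] := multiplicity_XsubC (char_poly M) 0.
have {}g0 : ~~ root g 0 by apply: g0; rewrite monic_neq0 // char_poly_monic.
rewrite subr0 in chi.
have an : (a <= n.+1)%N.
  have gnz : g != 0 by apply: contraNneq g0 => ->; rewrite root0.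
  have : size (char_poly M) = n.+2 by rewrite size_char_poly.
  rewrite chi size_mul ?expf_neq0 ?polyX_eq0 // size_polyXn addnS /= => h.
  by rewrite -ltnS -h -{1}[a]add0n ltn_add2r size_poly_gt0.
have /Bezout_eq1_coprimepP[[u v] /= uv] : coprimep g ('X ^+ n.+1).
  by apply: coprimep_expr; rewrite -['X]subr0 coprimep_XsubC.
have e : horner_mx M (v * 'X^n * 'X) = horner_mx M (v * 'X^n) *m M by rewrite rmorphM /= horner_mx_X.
exists (horner_mx M (u * g)), (horner_mx M (v * 'X^n)); split.
- by rewrite -e -rmorphD /= -mulrA -exprSr uv rmorph1.
- have Xn : horner_mx M 'X^(n.+1) = M ^+ n.+1 by rewrite rmorphXn /= horner_mx_X.
  rewrite -Xn mulmxE -rmorphM /=.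
  have -> : u * g * 'X^(n.+1) = (u * 'X^(n.+1 - a)) * (g * 'X^a).
    by rewrite mulrACA -exprD subnK.
  by rewrite -chi rmorphM /= Cayley_Hamilton mulr0.
- have e2 : M *m horner_mx M (v * 'X^n) = horner_mx M ('X * (v * 'X^n)) by rewrite [RHS]rmorphM /= horner_mx_X.
  by rewrite e2 mulrC e.
by move=> s ls s0 sM w sw; split; exact: horner_mx_inv.
Qed.

Lemma fitting n (M : 'M[F]_n) (s : 'rV[F]_n -> Prop) v :
  (forall (a : F) v w, s v -> s w -> s (a *: v + w)) -> s 0 ->
  (forall w, s w -> s (w *m M)) -> s v ->
  exists a w, [/\ s a, s w, v = a + w *m M & a *m M ^+ n = 0].
Proof.
move=> ls s0 sM sv; have [P [Q [PQ PM _ PQs]]] := fitting_mx M.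
have [sP sQ] := PQs s ls s0 sM v sv.
exists (v *m P), (v *m Q); split => //; last by rewrite -mulmxA PM mulmx0.
by rewrite -mulmxA -mulmxDr -PQ mulmx1.
Qed.

End Fitting.

Section Semisimple.
Variable R : realType.
Local Notation C := (complex R).
Local Notation toC := (fun x : R => x%:C)%C.

Definition mxC m n (A : 'M[R]_(m, n)) : 'M[C]_(m, n) := map_mx (real_complex R) A.

(** Semisimplicity of a real matrix, expressed by diagonalisation over the complex numbers. *)
Definition cdiag n (A : 'M[R]_n) := exists (P : 'M[C]_n) (d : 'rV[C]_n),
  P \in unitmx /\ P *m mxC A = diag_mx d *m P.

Lemma mxCM m n p (A : 'M[R]_(m, n)) (B : 'M[R]_(n, p)) : mxC (A *m B) = mxC A *m mxC B.
Proof. exact: map_mxM. Qed.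

Lemma mxC_inj m n : injective (@mxC m n).
Proof.
move=> A B /matrixP h; apply/matrixP => i j; have := h i j; rewrite !mxE.
exact: complexI.
Qed.

Lemma mxC0 m n : mxC (0 : 'M[R]_(m, n)) = 0.
Proof. by apply/matrixP => i j; rewrite !mxE. Qed.

Lemma mxC1 n : mxC (1 : 'M[R]_n) = 1.
Proof. exact: map_mx1. Qed.

Lemma mxCB m n (A B : 'M[R]_(m, n)) : mxC (A - B) = mxC A - mxC B.
Proof. exact: map_mxB. Qed.

Lemma mxCX n (A : 'M[R]_n) k : mxC (A ^+ k) = mxC A ^+ k.
Proof. by elim: k => [|k IH]; rewrite ?mxC1 // !exprS -!mulmxE mxCM IH. Qed.

Lemma cdiag_horner n (A : 'M[R]_n.+1) (P : 'M[C]_n.+1) (d : 'rV[C]_n.+1) (p : {poly R}) :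
  P *m mxC A = diag_mx d *m P ->
  P *m mxC (horner_mx A p) = diag_mx (\row_i (map_poly (real_complex R) p).[d 0 i]) *m P.
Proof.
move=> PA; elim/poly_ind: p => [|p c IH].
  rewrite rmorph0 mxC0 mulmx0; have -> : (\row_i (map_poly (real_complex R) 0).[d 0 i]) = 0.
    by apply/rowP => i; rewrite !mxE rmorph0 horner0.
  by rewrite linear0 mul0mx.
rewrite rmorphD rmorphM /= horner_mx_X horner_mx_C.
have -> : mxC (horner_mx A p * A + c%:M) = mxC (horner_mx A p) *m mxC A + (c%:C)%C%:M.
  by rewrite -mxCM; apply/matrixP => i j; rewrite !mxE rmorphD rmorphMn.
rewrite mulmxDr mulmxA IH -mulmxA PA mulmxA mulmx_diag mul_mx_scalar -mul_scalar_mx -mulmxDl; congr (_ *m _).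
apply/matrixP => i j; rewrite !mxE rmorphD rmorphM /= map_polyX map_polyC !hornerE /=.
by case: (i == j); rewrite ?mulr1n // !mulr0n addr0.
Qed.

Lemma cdiag_ker n (A : 'M[R]_n.+1) (p : {poly R}) (v : 'rV[R]_n.+1) N : cdiag A ->
  v *m horner_mx A p ^+ N = 0 -> v *m horner_mx A p = 0.
Proof.
move=> [P [d [Pu PA]]] vN; apply: mxC_inj.
have PB := cdiag_horner p PA; set B := horner_mx A p in PB vN *; set e := \row_i _ in PB.
have e1 : mxC B = invmx P *m diag_mx e *m P by rewrite -mulmxA -PB mulKmx.
pose w := mxC v *m invmx P.
have wN : w *m diag_mx (\row_i (e 0 i ^+ N)) = 0.
  have := congr1 (@mxC 1 n.+1) vN; rewrite mxCM mxCX (diag_exp N Pu PB) mxC0 => /(congr1 (mulmx^~ (invmx P))).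
  by rewrite mul0mx !mulmxA mulmxK.
rewrite mxCM mxC0 e1 !mulmxA -/w.
suff -> : w *m diag_mx e = 0 by rewrite mul0mx.
apply/rowP => i; have /rowP/(_ i) := wN; rewrite !mul_mx_diag !mxE => /eqP.
rewrite mulf_eq0 expf_eq0 => /orP[/eqP ->|/andP[_ /eqP ->]]; by rewrite ?mul0r ?mulr0.
Qed.

Lemma cdiag_fix n (A : 'M[R]_n) (v : 'rV[R]_n) N : cdiag A -> v *m (A - 1) ^+ N = 0 -> v *m A = v.
Proof.
case: n A v => [|n] A v dA; first by move=> _; apply/rowP => -[].
have -> : A - 1 = horner_mx A ('X - 1%:P).
  by rewrite rmorphB /= horner_mx_X horner_mx_C.
move=> /(cdiag_ker dA); rewrite rmorphB /= horner_mx_X horner_mx_C mulmxBr mulmx1.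
by move=> /eqP; rewrite subr_eq0 => /eqP.
Qed.

Lemma max_linsub n (P : set 'rV[R]_n -> Prop) : (forall s, P s -> linsub s) -> (exists s, P s) ->
  exists s, P s /\ forall s', P s' -> s `<=` s' -> s' `<=` s.
Proof.
move=> Pl [s0 Ps0].
have ext (s : set 'rV[R]_n) (S : 'M[R]_n) : (forall v, s v <-> (v <= S)%MS) -> s = [set v | (v <= S)%MS].
  by move=> h; apply/seteqP; split=> v /h.
pose Q r := `[< exists2 S : 'M[R]_n, P [set v | (v <= S)%MS] & \rank S = r >].
have Q0 : exists r, Q r.
  have [S /ext sS] := linsub_mx (Pl _ Ps0).
  by exists (\rank S); apply/asboolP; exists S => //; rewrite -sS.
have Qn r : Q r -> (r <= n)%N by move=> /asboolP[S _ <-]; exact: rank_leq_row.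
case: (ex_maxnP Q0 Qn) => r /asboolP[S PS Sr] max; exists [set v | (v <= S)%MS]; split => //.
move=> s' Ps' SS'; have [S' s'S] := linsub_mx (Pl _ Ps').
have le : (S <= S')%MS.
  by apply/row_subP => i; apply/s'S; apply: SS'; rewrite /= row_sub.
have : (\rank S' <= \rank S)%N.
  by rewrite Sr; apply: max; apply/asboolP; exists S' => //; rewrite -(ext _ _ s'S).
move=> rk; have : (S' <= S)%MS.
  by have [_ h] := mxrank_leqif_sup le; rewrite -h eqn_leq rk mxrankS.
by move=> S'S v /s'S vS'; exact: submx_trans S'S.
Qed.

(** Take w maximal among the invariant subspaces of f that meet s in 0. If w + s misses a vector of
    f, a polynomial q of least degree sending some missed vector into w + s leads to a vector whose
    cyclic span can be added to w. *)
Lemma inv_complement n (A : 'M[R]_n) (f s : set 'rV[R]_n) : cdiag A -> linsub f -> linsub s ->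
  s `<=` f -> (forall v, f v -> f (v *m A)) -> (forall v, s v -> s (v *m A)) ->
  exists w, [/\ linsub w, w `<=` f, forall v, w v -> w (v *m A), forall v, w v -> s v -> v = 0 &
    forall v, f v -> exists a b, [/\ w a, s b & v = a + b]].
Proof.
case: n A f s => [|n] A f s dA lf ls sf fA sA.
  have z (v : 'rV[R]_0) : v = 0 by apply/rowP => -[].
  exists [set 0]; split; last by move=> v _; exists 0, 0; rewrite [v]z addr0; split => //; exact: ls.1.
  - by split=> // a v w _ _; exact: z.
  - by move=> v _; rewrite (z v); exact: lf.1.
  - by move=> v _; exact: z.
  - by move=> v _ _; exact: z.
pose P w := [/\ linsub w, w `<=` f, forall v, w v -> w (v *m A) & forall v, w v -> s v -> v = 0].
have P0 : P [set 0].
  split=> //.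
  - by split=> // a v w -> ->; rewrite scaler0 addr0.
  - by move=> _ ->; exact: lf.1.
  - by move=> _ ->; rewrite /= mul0mx.
have [w [[lw wf wA ws] max]] : exists w, P w /\ forall w', P w' -> w `<=` w' -> w' `<=` w.
  by apply: max_linsub; [move=> ? []|exists [set 0]].
exists w; split => // v0 fv0; apply: contrapT => nv0.
pose Q : set 'rV[R]_n.+1 := [set v | exists a b, [/\ w a, s b & v = a + b]].
have lQ : linsub Q.
  split; first by exists 0, 0; split; [exact: lw.1|exact: ls.1|rewrite addr0].
  move=> c _ _ [a [b [wa sb ->]]] [a' [b' [wa' sb' ->]]].
  exists (c *: a + a'), (c *: b + b'); split; [exact: lw.2|exact: ls.2|vring].
have Qf v : Q v -> f v by move=> [a [b [wa sb ->]]]; apply: linsubD => //; [exact: wf|exact: sf].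
have QA v : Q v -> Q (v *m A).
  move=> [a [b [wa sb ->]]]; exists (a *m A), (b *m A); split; [exact: wA|exact: sA|exact: mulmxDl].
pose m k := `[< exists q v, [/\ q != 0 :> {poly R}, size q = k, f v, ~ Q v & Q (v *m horner_mx A q)] >].
have mex : exists k, m k.
  exists (size (char_poly A)); apply/asboolP; exists (char_poly A), v0; split => //.
    by rewrite monic_neq0 // char_poly_monic.
  by rewrite Cayley_Hamilton mulmx0; exact: lQ.1.
case: (ex_minnP mex) => k /asboolP[q [v [q0 qk fv nQ Qv]]] mink.
have hi (p : {poly R}) (t : set 'rV[R]_n.+1) u : linsub t -> (forall u, t u -> t (u *m A)) -> t u ->
    t (u *m horner_mx A p).
  by move=> lt tA tu; apply: (horner_mx_inv _ lt.2 lt.1 tA).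
(* Fitting inside w + s writes v q(A) as a + r q(A), with a killed by a power of q(A). So v - r is
   killed by a power of q(A), and by q(A) itself as A is semisimple. *)
have [a [r [Qa Qr bE aM]]] := fitting (M := horner_mx A q) lQ.2 lQ.1 (fun u => hi q Q u lQ QA) Qv.
pose v' := v - r.
have fv' : f v' by apply: linsubB => //; exact: Qf.
have nQ' : ~ Q v' by move=> h; apply: nQ; rewrite -(subrK r v); exact: linsubD.
have v'q : v' *m horner_mx A q = 0.
  apply: (cdiag_ker (N := n.+2) dA).
  by rewrite exprS -mulmxE mulmxA mulmxBl bE addrK aM.
pose w' : set 'rV[R]_n.+1 := [set x | exists y (p : {poly R}), w y /\ x = y + v' *m horner_mx A p].
have Pw' : P w'.
  split.
  - split; first by exists 0, 0; split; [exact: lw.1|rewrite rmorph0 mulmx0 addr0].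
    move=> c _ _ [y [p [wy ->]]] [y' [p' [wy' ->]]]; exists (c *: y + y'), (c *: p + p').
    split; first exact: lw.2.
    by rewrite rmorphD /= linearZ /= mulmxDr -scalemxAr; vring.
  - move=> _ [y [p [wy ->]]]; apply: linsubD => //; first exact: wf.
    exact: hi.
  - move=> _ [y [p [wy ->]]]; exists (y *m A), (p * 'X); split; first exact: wA.
    by rewrite mulmxDl rmorphM /= horner_mx_X -mulmxE mulmxA.
  move=> _ [y [p [wy ->]]] sx.
  have pm : v' *m horner_mx A p = v' *m horner_mx A (p %% q).
    rewrite {1}(divp_eq p q) mulrC rmorphD rmorphM /= mulmxDr -mulmxE mulmxA v'q mul0mx add0r //.
  have Qp : Q (v' *m horner_mx A (p %% q)).
    exists (- y), (y + v' *m horner_mx A p); split => //; first exact: linsubN.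
    by rewrite addKr.
  have r0 : p %% q = 0.
    apply/eqP; apply: contraT => r0; have : (size (p %% q)%R < size q)%N by rewrite ltn_modp.
    rewrite ltnNge qk mink //; apply/asboolP.
    by exists (p %% q), v'.
  rewrite pm r0 rmorph0 mulmx0 addr0 in sx *.
  exact: ws.
apply: nQ'; exists v', 0; split; [|exact: ls.1|by rewrite addr0].
apply: (max _ Pw').
  by move=> y wy; exists y, 0; split => //; rewrite rmorph0 mulmx0 addr0.
by exists 0, 1; split; [exact: lw.1|rewrite rmorph1 mulmx1 add0r].
Qed.
End Semisimple.

(** * Affine actions on nilpotent groups *)

Lemma morph_one (X Y : groupType) (f : X -> Y) : {morph f : x y / (x * y)%g} -> f 1%g = 1%g.
Proof. by move=> fM; apply: (mulgI (f 1%g)); rewrite -fM !mulg1. Qed.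

Lemma morph_inv (X Y : groupType) (f : X -> Y) x : {morph f : x y / (x * y)%g} -> f x^-1%g = (f x)^-1%g.
Proof. by move=> fM; apply/esym/mulg1_eq; rewrite -fM mulgV (morph_one fM). Qed.

Lemma palg_bounded (R : realType) (T : Type) (S : set (T -> R)) (f : T -> R) (D : set T) :
  (forall s, S s -> exists C : R, forall x, D x -> `|s x| <= C) -> palg S f ->
  exists C : R, forall x, D x -> `|f x| <= C.
Proof.
move=> h; elim=> [c|s /h //|f1 f2 _ [C1 h1] _ [C2 h2]|f1 f2 _ [C1 h1] _ [C2 h2]].
- by exists `|c|.
- by exists (C1 + C2) => x Dx; apply: le_trans (ler_normD _ _) _; apply: lerD; [exact: h1|exact: h2].
exists (C1 * C2) => x Dx; rewrite normrM.
by apply: ler_pM => //; [exact: h1|exact: h2].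
Qed.

Lemma row_bounded (R : realType) (T : Type) n (f : T -> 'rV[R]_n) (D : set T) :
  (forall i, exists C : R, forall x, D x -> `|f x 0 i| <= C) ->
  exists C : R, forall x, D x -> `|f x| <= C.
Proof.
move=> /choice[C h]; exists (\sum_i `|C i|) => x Dx; apply: row_norm_bound => [|i].
  exact: sumr_ge0.
rewrite (bigD1 i) //=; apply: le_trans (le_trans (h i x Dx) (ler_norm _)) _.
by rewrite lerDl sumr_ge0.
Qed.

Lemma bch_bounded (R : realType) (X : groupType) n (G : expgrp R X n) (B : R) :
  exists C : R, forall u v, `|u| <= B -> `|v| <= B -> `|bch G u v| <= C.
Proof.
have [C h] : exists C : R, forall x : 'rV[R]_n * 'rV[R]_n, `|x.1| <= B /\ `|x.2| <= B -> `|bch G x.1 x.2| <= C.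
  apply: (@row_bounded _ _ _ _ [set x | `|x.1| <= B /\ `|x.2| <= B]) => i; apply: palg_bounded (bch_palg G i) => s [j [->|->]]; exists B => x /= [h1 h2].
    exact: le_trans (row_norm_coord _ _) h1.
  exact: le_trans (row_norm_coord _ _) h2.
by exists C => u v hu hv; exact: (h (u, v)).
Qed.

Lemma nlgM_bounded (R : realType) (X : groupType) n (G : nilgrp R X n) (B : R) :
  exists C : R, forall x y, `|nlg G x| <= B -> `|nlg G y| <= B -> `|nlg G (x * y)%g| <= C.
Proof.
by have [C h] := bch_bounded G B; exists C => x y hx hy; rewrite nlgM; exact: h.
Qed.

Lemma mulmx_bounded (R : realType) m n (A : 'M[R]_(m, n)) (B : R) :
  exists C : R, forall v : 'rV[R]_m, `|v| <= B -> `|v *m A| <= C.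
Proof.
exists (m%:R * B * `|A|) => v hv; apply: le_trans (mulmx_norm v A) _.
by apply: ler_wpM2r => //; apply: ler_wpM2l.
Qed.

Lemma finite_bound (R : realType) (T : Type) (f : T -> R) (D : set T) : finite_set D ->
  exists C : R, forall x, D x -> f x <= C.
Proof.
move=> fD; have /finite_fsetP[S SE] : finite_set (f @` D) by exact: finite_image.
exists (\sum_(r <- finmap.enum_fset S) `|r|) => x Dx.
have fS : f x \in (finmap.enum_fset S).
  by have : (f @` D) (f x) by [exists x]; rewrite SE.
have -> : \sum_(r <- finmap.enum_fset S) `|r| = `|f x| + \sum_(r <- rem (f x) (finmap.enum_fset S)) `|r|.
  exact: big_rem.
by apply: le_trans (ler_norm _) _; rewrite lerDl; exact: sumr_ge0.
Qed.

(** Both sides of the hypothesis are polynomials in k; the conclusion compares their linear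
    coefficients. *)
Lemma expmx_deriv (R : realType) n m (A : 'M[R]_n) (B : 'M[R]_m) (L : 'M[R]_(n, m)) K1 K2 (v : 'rV[R]_n) :
  A ^+ K1 = 0 -> B ^+ K2 = 0 ->
  (forall k : nat, v *m expmx K1 (k%:R *: A) *m L = v *m L *m expmx K2 (k%:R *: B)) ->
  v *m A *m L = v *m L *m B.
Proof.
move=> AK BK h; pose K := (K1 + K2).+2.
have AE (k : nat) : expmx K1 (k%:R *: A) = \sum_(i < K) (k%:R ^+ i / i`!%:R) *: A ^+ i.
  rewrite (@nil_sum_widen _ _ A (fun i => k%:R ^+ i / i`!%:R) K1 K AK) /expmx; last by rewrite /K; lia.
  by apply: eq_bigr => i _; rewrite exprZmx scalerA mulrC.
have BE (k : nat) : expmx K2 (k%:R *: B) = \sum_(i < K) (k%:R ^+ i / i`!%:R) *: B ^+ i.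
  rewrite (@nil_sum_widen _ _ B (fun i => k%:R ^+ i / i`!%:R) K2 K BK) /expmx; last by rewrite /K; lia.
  by apply: eq_bigr => i _; rewrite exprZmx scalerA mulrC.
apply/eqP; rewrite -subr_eq0; apply/eqP/rowP => j; rewrite [RHS]mxE.
pose p : {poly R} := \sum_(i < K) ((v *m A ^+ i *m L - v *m L *m B ^+ i) 0 j / i`!%:R) *: 'X^i.
have p0 : p = 0.
  apply: poly_nat_eq0 => k.
  have /rowP/(_ j)/eqP := h k; rewrite -subr_eq0 => /eqP e; apply: etrans e.
  rewrite AE BE !mulmx_sumr mulmx_suml !summxE -sumrB horner_sum; apply: eq_bigr => i _.
  rewrite -scalemxAr -scalemxAl -scalemxAr hornerZ hornerXn !mxE; ring.
have := congr1 (fun q : {poly R} => q`_1) p0; rewrite coef0 coef_sum (bigD1 (Ordinal (isT : (1 < K)%N))) //=.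
rewrite big1 ?addr0 => [|i]; last first.
  by rewrite -val_eqE /= coefZ coefXn eq_sym => /negPf ->; rewrite mulr0.
by rewrite coefZ coefXn eqxx mulr1 divr1 !expr1.
Qed.

(** The morphism transports conjugation by G (k u) for every k, and [expmx_deriv] extracts the
    bracket from these identities. *)
Lemma morph_alg (R : realType) (X1 X2 : groupType) n1 n2 (G1 : nilgrp R X1 n1) (G2 : nilgrp R X2 n2)
  (L : 'M[R]_(n1, n2)) : {morph (fun x => G2 (nlg G1 x *m L)) : x y / (x * y)%g} ->
  forall u v : 'rV[R]_n1, (v *m L) *m ebr G2 (u *m L) = (v *m ebr G1 u) *m L.
Proof.
move=> dM u v; set d := (fun x => _) in dM.
apply/esym; apply: (expmx_deriv (ebr_exp G1 u) (ebr_exp G2 (u *m L))) => k.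
have dJ (x y : X1) : (d (x * y * x^-1) = d x * d y * (d x)^-1)%g by rewrite !dM (morph_inv _ dM).
have lgd x : nlg G2 (d x) = nlg G1 x *m L by rewrite /d nexpK.
have := congr1 (nlg G2) (dJ (G1 (k%:R *: u)) (G1 v)).
by rewrite lgd !nlgJ lgd nexpK /nAd lgd nexpK -scalemxAl !ebrZ.
Qed.

(** Linear parts are matrices acting on row vectors in logarithmic coordinates, hence the reversed
    order in [amxM]. *)
Record affact (R : realType) (Gam X : groupType) n (G : nilgrp R X n) := AffAct {
  atr : Gam -> X;
  amx : Gam -> 'M[R]_n;
  amx_morph : forall g, {morph (fun x => G (nlg G x *m amx g)) : x y / (x * y)%g};
  amx1 : amx 1%g = 1;
  amxM : forall g h, amx (g * h)%g = amx h *m amx g;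
  atrM : forall g h, atr (g * h)%g = (atr g * G (nlg G (atr h) *m amx g))%g
}.

Section AffAct.
Variables (R : realType) (Gam X : groupType) (n : nat) (G : nilgrp R X n) (a : affact Gam G).
Implicit Types (g h : Gam) (x y : X) (s : set 'rV[R]_n).
Local Notation lg := (nlg G).
Local Notation A := (amx a).
Local Notation tr := (atr a).

Definition aut g x := G (lg x *m A g).
Definition aact g x := (tr g * aut g x)%g.

Lemma lg_aut g x : lg (aut g x) = lg x *m A g. Proof. exact: nexpK. Qed.
Lemma aut_exp g v : aut g (G v) = G (v *m A g). Proof. by rewrite /aut nexpK. Qed.
Lemma autM g : {morph aut g : x y / (x * y)%g}. Proof. exact: amx_morph. Qed.
Lemma aut1 g : aut g 1%g = 1%g. Proof. exact: morph_one (@autM g). Qed.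
Lemma autV g x : aut g x^-1%g = (aut g x)^-1%g. Proof. exact: morph_inv (@autM g). Qed.
Lemma autMM g h x : aut (g * h)%g x = aut g (aut h x).
Proof. by rewrite /aut nexpK amxM mulmxA. Qed.
Lemma aut_fix g x : lg x *m A g = lg x -> aut g x = x.
Proof. by rewrite /aut => ->; rewrite nlgK. Qed.
Lemma aut_id x : aut 1%g x = x.
Proof. by rewrite /aut amx1 mulmx1 nlgK. Qed.
Lemma autK g x : aut g^-1%g (aut g x) = x.
Proof. by rewrite -autMM mulVg aut_id. Qed.
Lemma atr_mul g h : tr (g * h)%g = (tr g * aut g (tr h))%g. Proof. exact: atrM. Qed.
Lemma atr1 : tr 1%g = 1%g.
Proof.
have := atr_mul 1%g 1%g; rewrite mulg1 aut_id => h.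
by apply: (mulgI (tr 1%g)); rewrite mulg1 -h.
Qed.
Lemma amxV g : A g *m A g^-1%g = 1.
Proof. by rewrite -amxM mulVg amx1. Qed.
Lemma amxVr g : A g^-1%g *m A g = 1.
Proof. by rewrite -amxM mulgV amx1. Qed.
Lemma amx_unit g : A g \in unitmx.
Proof. by case: (mulmx1_unit (amxV g)). Qed.
Lemma amxX g k : A (g ^+ k)%g = A g ^+ k.
Proof. by elim: k => [|k IH]; rewrite ?expg0 ?amx1 // expgS amxM IH exprSr. Qed.

Lemma atrVE g : (tr g * aut g (tr g^-1))%g = 1%g.
Proof. by rewrite -atr_mul mulgV atr1. Qed.

Lemma aactM g h x : aact (g * h)%g x = aact g (aact h x).
Proof. by rewrite /aact atr_mul autMM autM mulgA. Qed.
Lemma aact1 g : aact g 1%g = tr g.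
Proof. by rewrite /aact aut1 mulg1. Qed.
Lemma aactK g x : aact g^-1%g (aact g x) = x.
Proof. by rewrite -aactM mulVg /aact atr1 aut_id mul1g. Qed.

Lemma amx_br g (u v : 'rV[R]_n) : (v *m A g) *m ebr G (u *m A g) = (v *m ebr G u) *m A g.
Proof. exact: morph_alg (@amx_morph _ _ _ _ _ a g) u v. Qed.

Lemma amx_fil g k v : nfil (ebr G) k v -> nfil (ebr G) k (v *m A g).
Proof.
elim: k v => [|k IH] v /= fv; first by rewrite fv mul0mx.
move=> u; have -> : u = u *m A g^-1%g *m A g by rewrite -mulmxA amxVr mulmx1.
by rewrite amx_br; apply: IH.
Qed.

Lemma amx_nAd g x : A g *m nAd G (aut g x) = nAd G x *m A g.
Proof.
apply/row_matrixP => i; rewrite !rowE !mulmxA.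
have e y : aut g (x * y * x^-1)%g = (aut g x * aut g y * (aut g x)^-1)%g by rewrite !autM autV.
by have := congr1 lg (e (G (delta_mx 0 i))); rewrite lg_aut !nlgJ lg_aut nexpK.
Qed.

Lemma atr_conj g h : tr (g * h * g^-1)%g = (tr g * aut g (tr h) * aut (g * h * g^-1) (tr g)^-1)%g.
Proof.
rewrite atr_mul atr_mul; congr (_ * _)%g.
have := atrVE g; move=> /(congr1 (fun x => (tr g)^-1 * x)%g); rewrite mulKg mulg1 => e.
by rewrite -e -(autMM (g * h * g^-1)%g) mulgVK.
Qed.
End AffAct.

Section ProdAct.
Variables (R : realType) (Gam X1 X2 : groupType) (n1 n2 : nat).
Variables (G1 : nilgrp R X1 n1) (G2 : nilgrp R X2 n2) (a1 : affact Gam G1) (a2 : affact Gam G2).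

Definition prod_affact : affact Gam (prod_nilgrp G1 G2).
Proof.
refine (@AffAct _ _ _ _ (prod_nilgrp G1 G2) (fun g => (atr a1 g, atr a2 g))
  (fun g => block_mx (amx a1 g) 0 0 (amx a2 g)) _ _ _ _).
- move=> g x y; rewrite /= /pexp /plg !mul_block_diag !row_mxKl !row_mxKr.
  by rewrite -[in LHS]/(aut a1 g _) -[X in (_, X) = _]/(aut a2 g _) !autM.
- by rewrite !amx1; exact/esym/scalar_mx_block.
- by move=> g h; rewrite !amxM mulmx_block !mulmx0 !mul0mx !addr0 add0r.
- move=> g h; rewrite /= /pexp /plg !mul_block_diag !row_mxKl !row_mxKr /=.
  by rewrite !atr_mul.
Defined.
End ProdAct.

Ltac grp := rewrite ?(invgM, invgK, invg1, mulgA, mulg1, mul1g) ?(mulgK, mulgVK, mulVg, mulgV, mul1g, mulg1); done.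

Section Normaliser.
Variables (R : realType) (X : groupType) (n : nat) (G : nilgrp R X n).
Local Notation lg := (nlg G).
Implicit Types (x y : X) (s : set 'rV[R]_n).

Definition nrm s x := forall w, s w -> s (w *m ebr G (lg x)).

Lemma nrm_nAd s x : linsub s -> (forall w, s w -> s (w *m nAd G x)) -> nrm s x.
Proof. by move=> ls h w; exact: (nAd_br ls h). Qed.

Lemma nrmJ s x y : linsub s -> nrm s x -> sgrp G s y -> sgrp G s (x * y * x^-1)%g.
Proof. by move=> ls nx sy; rewrite /sgrp /= nlgJ; exact: linsub_nAd. Qed.

Lemma nrmV s x : linsub s -> nrm s x -> nrm s x^-1%g.
Proof. by move=> ls nx w sw; rewrite nlgV ebrN mulmxN; apply: linsubN => //; exact: nx. Qed.

Lemma nrmJV s x y : linsub s -> nrm s x -> sgrp G s y -> sgrp G s (x^-1 * y * x)%g.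
Proof. by move=> ls nx sy; have := nrmJ ls (nrmV ls nx) sy; rewrite invgK. Qed.

Lemma nrmM s x y : linsub s -> nrm s x -> nrm s y -> nrm s (x * y)%g.
Proof.
move=> ls nx ny; apply: nrm_nAd => // w sw; rewrite nAdM mulmxA.
by do 2!apply: linsub_nAd => //.
Qed.

Lemma nrm1 s : linsub s -> nrm s 1%g.
Proof. by move=> ls w sw; rewrite nlg1 ebr0 mulmx0; exact: ls.1. Qed.

Lemma nrm_sgrp s x : subalg G s -> sgrp G s x -> nrm s x.
Proof. by move=> sa sx w sw; exact: sa.2. Qed.

Lemma nrmZ s v (c : R) : linsub s -> nrm s (G v) -> nrm s (G (c *: v)).
Proof.
move=> ls nx w /nx; rewrite !nexpK ebrZ -scalemxAr; exact: linsubZ.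
Qed.

Lemma nAd_alg x (u v : 'rV[R]_n) : (v *m nAd G x) *m ebr G (u *m nAd G x) = (v *m ebr G u) *m nAd G x.
Proof.
apply: (@morph_alg _ _ _ _ _ G G) => y z.
by rewrite -!nlgJ !nlgK !mulgA mulgVK.
Qed.
End Normaliser.

(** * The subalgebra spanned by the translation parts of a properly acting group *)

Section Hull.
Variables (R : realType) (Gam X X1 : groupType) (n n1 : nat).
Variables (G : nilgrp R X n) (G1 : nilgrp R X1 n1) (a : affact Gam G) (Pi : 'M[R]_(n, n1)).
Local Notation V := 'rV[R]_n.
Local Notation lg := (nlg G).
Local Notation A := (amx a).
Local Notation tr := (atr a).
Local Notation act := (aact a).
Local Notation au := (aut a).
Hypothesis piM : {morph (fun x => G1 (lg x *m Pi)) : x y / (x * y)%g}.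
Hypothesis piA : forall g (v : V), v *m Pi = 0 -> v *m A g *m Pi = 0.
Variable D : set Gam.
Hypotheses (D1 : D 1%g) (DM : forall g h, D g -> D h -> D (g * h)%g) (DV : forall g, D g -> D g^-1%g).
Hypothesis PD : forall B : R, finite_set [set g | D g /\ `|lg (tr g) *m Pi| <= B].

(** Cocompactness of E on the group of s, measured through the projection Pi. *)
Definition coc (E : set Gam) (s : set V) := exists B : R, forall y, sgrp G s y ->
  exists g, E g /\ `|lg (act g y) *m Pi| <= B.

Variables (u0 : set V) (z : Gam -> V).
Hypotheses (u0a : subalg G u0) (u0pi : forall v, u0 v -> v *m Pi = 0 -> v = 0)
  (u0A : forall g, D g -> forall v, u0 v -> u0 (v *m A g))
  (zfix : forall g h, D g -> D h -> z g *m A h = z g)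
  (zU : forall g, D g -> sgrp G u0 ((G (z g))^-1 * tr g)%g)
  (zN : forall g, D g -> nrm G u0 (G (z g)))
  (coc0 : coc [set g | D g /\ sgrp G u0 (tr g)] u0).

Let lu0 : linsub u0 := u0a.1.
Let pi x := G1 (lg x *m Pi).

Let lgpi x : nlg G1 (pi x) = lg x *m Pi. Proof. exact: nexpK. Qed.
Let pM x y : pi (x * y)%g = (pi x * pi y)%g. Proof. exact: piM. Qed.
Let pV x : pi x^-1%g = (pi x)^-1%g. Proof. exact: morph_inv piM. Qed.

Let au_exp0 g v : D g -> (forall h, D h -> v *m A h = v) -> au g (G v) = G v.
Proof. by move=> Dg h; rewrite aut_exp h. Qed.

Let au_sgrp s g x : (forall v, s v -> s (v *m A g)) -> sgrp G s x -> sgrp G s (au g x).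
Proof. by move=> sA; rewrite /sgrp /= lg_aut; exact: sA. Qed.

(* x represents the class of the translation part of g in N(U0)/U0; taking
   classes is a group morphism on D. *)
Let rep x g := [/\ nrm G u0 x, forall h, D h -> au h x = x & sgrp G u0 (x^-1 * tr g)%g].

Let rep_z g : D g -> rep (G (z g)) g.
Proof.
by move=> Dg; split; [exact: zN|move=> h Dh; apply: au_exp0 => // k Dk; exact: zfix|exact: zU].
Qed.

Let repM x y g h : D g -> rep x g -> rep y h -> rep (x * y)%g (g * h)%g.
Proof.
move=> Dg [nx fx ux] [ny fy uy]; split; first exact: nrmM.
  by move=> k Dk; rewrite autM fx ?fy.
have -> : ((x * y)^-1 * tr (g * h) = (y^-1 * (x^-1 * tr g) * y) * au g (y^-1 * tr h))%g.
  by rewrite atr_mul autM autV (fy g Dg) invgM !mulgA mulgK.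
apply: sgrpM => //; first exact: nrmJV.
by apply: au_sgrp => //; exact: u0A.
Qed.

Let repV x g : D g -> rep x g -> rep x^-1%g g^-1%g.
Proof.
move=> Dg [nx fx ux]; split; first exact: nrmV.
  by move=> k Dk; rewrite autV fx.
have -> : ((x^-1)^-1 * tr g^-1 = x * (au g^-1 (x^-1 * tr g))^-1 * x^-1)%g.
  rewrite invgK autM autV (fx _ (DV Dg)) invgM invgK !mulgA mulgK; congr (_ * _)%g.
  rewrite -autV -(autK a g (tr g^-1)%g); congr au.
  by apply/esym/mulg1_eq; exact: atrVE.
apply: nrmJ => //; apply: sgrpV => //; apply: au_sgrp => //; apply: u0A; exact: DV.
Qed.

Let rep1 : rep 1%g 1%g.
Proof.
split; first exact: nrm1.
  by move=> h _; rewrite aut1.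
by rewrite atr1 invg1 mulg1; exact: sgrp1.
Qed.

Let DX g k : D g -> D (g ^+ k)%g.
Proof. by move=> Dg; elim: k => [|k IH]; rewrite ?expg0 // expgS; exact: DM. Qed.

Let repX x g k : D g -> rep x g -> rep (x ^+ k)%g (g ^+ k)%g.
Proof.
move=> Dg xg; elim: k => [|k IH]; first by rewrite !expg0.
by rewrite !expgS; exact: repM.
Qed.

Let Es (s : set V) : set Gam := [set g | D g /\ sgrp G s (tr g)].

(** Minimality among subalgebras belongs to the invariant: it is what makes a new element g
    normalise s, in [nsy]. *)
Let hull s := [/\ subalg G s, u0 `<=` s, forall v, s v -> v *m Pi = 0 -> v = 0,
  forall g, D g -> forall v, s v -> s (v *m A g) & coc (Es s) s] /\
  forall t, subalg G t -> u0 `<=` t -> (forall g, Es s g -> sgrp G t (tr g)) -> s `<=` t.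

Let EsM s g h : hull s -> Es s g -> Es s h -> Es s (g * h)%g.
Proof.
move=> [[sa _ _ sA _] _] [Dg sg] [Dh sh]; split; first exact: DM.
by rewrite atr_mul; apply: sgrpM => //; apply: au_sgrp => //; exact: sA.
Qed.

Let FU j g := exists f, Fil G j f /\ sgrp G u0 (f^-1 * tr g)%g.

(** Modulo U0, a commutator with an element of level j + 1 has level j. Hence an element of least
    level outside s conjugates the elements of [Es s] into [Es s]. *)
Let FU_comm j g h : D g -> D h -> FU j.+1 g -> FU j (g * h * g^-1 * h^-1)%g.
Proof.
move=> Dg Dh [f [Ff uf]]; have [nx fx ux] := rep_z Dg; have [ny fy uy] := rep_z Dh.
set x := G (z g) in nx fx ux; set y := G (z h) in ny fy uy.
have [_ _ uc] : rep (x * y * x^-1 * y^-1)%g (g * h * g^-1 * h^-1)%g.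
  have Dgh := DM Dg Dh; have DgV := DV Dg.
  apply: repM; [exact: DM|apply: repM => //|apply: repV => //; exact: rep_z].
    by apply: repM => //; exact: rep_z.
  by apply: repV => //; exact: rep_z.
pose u2 := (f^-1 * x)%g.
have u2U : sgrp G u0 u2.
  have -> : u2 = ((f^-1 * tr g) * (x^-1 * tr g)^-1)%g by rewrite /u2 invgM invgK !mulgA mulgK.
  by apply: sgrpM => //; exact: sgrpV.
have xE : x = (f * u2)%g by rewrite /u2 mulVKg.
have nf : nrm G u0 f.
  have -> : f = (x * u2^-1)%g by rewrite xE mulgK.
  by apply: nrmM => //; apply: nrm_sgrp => //; exact: sgrpV.
pose u3 := (f * (u2 * (y * u2^-1 * y^-1)) * f^-1)%g.
have u3U : sgrp G u0 u3.
  by apply: nrmJ => //; apply: sgrpM => //; apply: nrmJ => //; exact: sgrpV.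
pose f' := (f * (y * f^-1 * y^-1))%g.
have Ff' : Fil G j f'.
  by have := FilR y (FilV Ff); rewrite invgK.
exists (u3 * f' * u3^-1)%g; split; first exact: FilJ.
set c := (x * y * x^-1 * y^-1)%g in uc.
have cE : c = (u3 * f')%g by rewrite /c xE /u3 /f' !invgM !mulgA !mulgVK.
have -> : ((u3 * f' * u3^-1)^-1 * tr (g * h * g^-1 * h^-1) = u3 * (c^-1 * tr (g * h * g^-1 * h^-1)))%g.
  by rewrite cE; grp.
exact: sgrpM.
Qed.

Let hull0 : hull u0.
Proof. by split; [split => //|move=> t]. Qed.

Section Step.
Variables (s : set V) (g : Gam).
Hypotheses (hs : hull s) (Dg : D g) (ng : ~ sgrp G s (tr g))
  (gE : forall h, Es s h -> Es s (g * h * g^-1)%g).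
Let sa : subalg G s. Proof. by case: hs => -[]. Qed.
Let ls : linsub s. Proof. by case: sa. Qed.
Let us : u0 `<=` s. Proof. by case: hs => -[]. Qed.
Let spi v : s v -> v *m Pi = 0 -> v = 0. Proof. by case: hs => -[_ _ h _ _ _]; exact: h. Qed.
Let sA h v : D h -> s v -> s (v *m A h). Proof. by move=> Dh; case: hs => -[_ _ _ k _] _; exact: k. Qed.
Local Notation zg := (z g).
Local Notation y := (G zg).

Let nsy : nrm G s y.
Proof.
have [_ fy uy] := rep_z Dg; apply: nrm_nAd => //.
pose t : set V := [set v | s (v *m nAd G y)].
suff st : s `<=` t by move=> w /st.
have ta : subalg G t.
  split; first split; rewrite /t /=.
  - by rewrite mul0mx; exact: ls.1.
  - by move=> c v w sv sw; rewrite mulmxDl -scalemxAl; exact: ls.2.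
  - by move=> u v su sv; rewrite /t /= -nAd_alg; exact: sa.2.
have ut : u0 `<=` t by move=> v uv; apply: us; apply: linsub_nAd => //; exact: zN.
have tA h v : D h -> t v -> t (v *m A h).
  move=> Dh tv; have e : A h *m nAd G y = nAd G y *m A h by rewrite -amx_nAd fy.
  by rewrite /t /= -mulmxA e mulmxA; exact: sA.
case: hs => _; apply => // h Eh; have [Dh sh] := Eh; have [Dc sc] := gE Eh.
pose u := (y^-1 * tr g)%g; have xE : tr g = (y * u)%g by rewrite /u mulVKg.
set d := (g * h * g^-1)%g in Dc sc.
pose u' := au d u^-1%g.
have u'U : sgrp G u0 u' by apply: au_sgrp; [exact: u0A|exact: sgrpV].
have tw : sgrp G t (u * au g (tr h) * u')%g.
  rewrite /sgrp /t /= -nlgJ.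
  have -> : (y * (u * au g (tr h) * u') * y^-1)%g = tr d; last exact: sc.
  by have yV : au d y^-1%g = y^-1%g; [rewrite autV fy|rewrite /d atr_conj -/d xE invgM autM yV -/u'; grp].
have tT x : sgrp G u0 x -> sgrp G t x by exact: ut.
have tau : sgrp G t (au g (tr h)).
  have -> : au g (tr h) = (u^-1 * (u * au g (tr h) * u') * u'^-1)%g by grp.
  apply: sgrpM => //; first apply: sgrpM => //; apply: sgrpV => //; try exact: ta.1; exact: tT.
by rewrite -(autK a g (tr h)); apply: au_sgrp tau => v; apply: tA; exact: DV.
Qed.

Let zs : ~ s zg.
Proof.
move=> szg; apply: ng; rewrite -(mulVKg y (tr g)); apply: sgrpM => //; first by rewrite /sgrp /= nexpK.
by apply: us; case: (rep_z Dg).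
Qed.

Let s' : set V := [set v | exists (c : R), s (v - c *: zg)].

Let ls' : linsub s'.
Proof.
split; first by exists 0; rewrite scale0r subr0; exact: ls.1.
move=> c v w [p sp] [q sq]; exists (c * p + q).
have -> : c *: v + w - (c * p + q) *: zg = c *: (v - p *: zg) + (w - q *: zg) by vring.
exact: ls.2.
Qed.

Let ss' : s `<=` s'.
Proof. by move=> v sv; exists 0; rewrite scale0r subr0. Qed.

Let s'a : subalg G s'.
Proof.
split=> // u v [p sp] [q sq]; apply: ss'.
have [u1 [su uE]] : exists u1 : V, s u1 /\ u = u1 + p *: zg by exists (u - p *: zg); rewrite subrK.
have [v1 [sv vE]] : exists v1 : V, s v1 /\ v = v1 + q *: zg by exists (v - q *: zg); rewrite subrK.
have nz w : s w -> s (w *m ebr G zg) by move=> /nsy; rewrite nexpK.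
have -> : v *m ebr G u = v1 *m ebr G u1 + q *: - (u1 *m ebr G zg) + p *: (v1 *m ebr G zg).
  rewrite uE vE ebrD ebrZ mulmxDr !mulmxDl -!scalemxAr -!scalemxAl ebr_self !scaler0 addr0.
  by rewrite -ebr_anti.
apply: linsubD => //; last by apply: linsubZ => //; exact: nz.
apply: linsubD => //; first exact: sa.2.
by apply: linsubZ => //; apply: linsubN => //; exact: nz.
Qed.

Let gpow (k : nat) : D (g ^+ k)%g /\ rep (G (k%:R *: zg)) (g ^+ k)%g.
Proof. by split; [exact: DX|rewrite nexpMn; apply: repX => //; exact: rep_z]. Qed.

Let gpowV (k : nat) : D (g ^- k)%g /\ rep (G (- k%:R *: zg)) (g ^- k)%g.
Proof.
have [Dk rk] := gpow k; split; first exact: DV.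
by rewrite scaleNr nexpN; exact: repV.
Qed.

(** Otherwise some w in zg + s projects to 0. Up to s, the inverse powers of g translate by G (- k
    w), so cocompactness on s gives e_k in [Es s] for which e_k g^-k has bounded projection. These
    elements are pairwise distinct, as no nonzero multiple of zg lies in s, and this contradicts
    [PD]. *)
Let s'pi v : s' v -> v *m Pi = 0 -> v = 0.
Proof.
move=> [c sv] vpi; have [c0|c0] := eqVneq c 0.
  by move: sv; rewrite c0 scale0r subr0 => /spi; exact.
exfalso; pose w := c^-1 *: v.
have swz : s (w - zg).
  have -> : w - zg = c^-1 *: (v - c *: zg) by rewrite scalerBr scalerA mulVf // scale1r.
  exact: linsubZ.
have wpi : w *m Pi = 0 by rewrite -scalemxAl vpi scaler0.
have [B cB] : coc (Es s) s by case: hs => -[].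
have step k : exists e, Es s e /\ `|lg (tr (e * g ^- k)%g) *m Pi| <= B.
  have [Dk [_ _ uk]] := gpowV k; set c' := - k%:R in uk.
  pose p := G (c' *: w).
  have sp : sgrp G s (p^-1 * tr (g ^- k))%g.
    have -> : (p^-1 * tr (g ^- k) = ((G (c' *: zg))^-1 * p)^-1 * ((G (c' *: zg))^-1 * tr (g ^- k)))%g.
      by rewrite invgM invgK !mulgA mulgK.
    apply: sgrpM => //; last exact: us.
    apply: sgrpV => //; apply/nlg_coset => //; first exact: (nrmZ c' ls nsy).
    by rewrite !nexpK -scalerBr; exact: linsubZ.
  have [e [Ee eB]] := cB _ sp; exists e; split => //.
  have -> : tr (e * g ^- k)%g = (tr e * au e p * (tr e)^-1 * act e (p^-1 * tr (g ^- k)))%g.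
    by rewrite atr_mul /aact autM autV; grp.
  set q := act _ _ in eB *; clearbody q; have p1 : pi (au e p) = 1%g by rewrite /pi lg_aut nexpK piA ?nexp0 // -scalemxAl wpi scaler0.
  by rewrite -lgpi !pM p1 pV mulg1 mulgV mul1g lgpi.
have [e eP] := choice step.
have inj k l : (e k * g ^- k = e l * g ^- l)%g -> k = l.
  move=> ekl; apply/eqP; apply: contraT => kl.
  have [Dk [_ _ uk]] := gpow k; have [Dl [_ _ ul]] := gpowV l.
  have E1 : Es s ((e l)^-1 * e k)%g.
    have [[De1 se1] _] := eP k; have [[De2 se2] _] := eP l.
    split; first by apply: DM => //; exact: DV.
    have ev : (tr (e l)^-1 = (au (e l)^-1 (tr (e l)))^-1)%g.
      rewrite -autV -(autK a (e l) (tr (e l)^-1)%g); congr au.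
      by apply/esym/mulg1_eq; exact: atrVE.
    rewrite atr_mul ev; apply: sgrpM => //; first apply: sgrpV => //; apply: au_sgrp => // w1 sw1; apply: sA => //; exact: DV.
  have E2 : ((e l)^-1 * e k = g ^- l * g ^+ k)%g.
    by rewrite -[e k](mulgK (g ^- k)%g) ekl invgK !mulgA mulVg mul1g.
  have [_ _ ukl] := repM Dl (gpowV l).2 (gpow k).2.
  have [_] := E1; rewrite E2 => sE.
  have : sgrp G s (G (- l%:R *: zg) * G (k%:R *: zg))%g.
    set q := (G _ * G _)%g in ukl *; set t := tr _ in ukl sE.
    have -> : q = (t * (q^-1 * t)^-1)%g by grp.
    by apply: sgrpM => //; apply: sgrpV => //; exact: us.
  rewrite -eex_add /sgrp /= nexpK => h; exfalso; apply: zs.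
  have nz : - l%:R + k%:R != 0 :> R by rewrite addrC subr_eq0 eqr_nat.
  have -> : zg = (- l%:R + k%:R)^-1 *: ((- l%:R + k%:R) *: zg) by rewrite scalerA mulVf // scale1r.
  exact: linsubZ.
have fin := PD B; pose F k := (e k * g ^- k)%g.
have : finite_set (F @^-1` [set h | D h /\ `|lg (tr h) *m Pi| <= B]).
  by apply: finite_preimage fin => k l _ _; exact: inj.
rewrite (_ : _ @^-1` _ = setT); first exact: infinite_nat.
apply/seteqP; split => // k _; have [[De _] eB] := eP k; split=> //.
by apply: DM => //; exact: (gpowV k).1.
Qed.

Let s'A h v : D h -> s' v -> s' (v *m A h).
Proof.
move=> Dh [c sv]; exists c.
have -> : v *m A h - c *: zg = (v - c *: zg) *m A h by rewrite mulmxBl -scalemxAl zfix.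
exact: sA.
Qed.

(** A power of g brings the coordinate along zg into [-1, 1], and cocompactness on s handles the
    rest. The factor G ((t + c) zg) is moved to the right end, where it only enlarges the bound. *)
Let coc' : coc (Es s') s'.
Proof.
have [B cB] : coc (Es s) s by case: hs => -[].
have [C Cb] := nlgM_bounded G1 (Num.max B `|zg *m Pi|).
have red (t : R) : exists h c, [/\ D h, rep (G (c *: zg)) h & `|t + c| <= 1].
  have [t0|t0] := leP 0 t.
    have /andP[k1 k2] := truncn_itv t0; set k := Num.truncn t in k1 k2.
    have [Dk rk] := gpowV k; exists (g ^- k)%g, (- k%:R); split => //.
    rewrite ger0_norm ?subr_ge0 // -natr1 in k2 *; lra.
  have nt0 : 0 <= - t by lra.
  have /andP[k1 k2] := truncn_itv nt0; set k := Num.truncn _ in k1 k2.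
  have [Dk rk] := gpow k; exists (g ^+ k)%g, (k%:R); split => //.
  rewrite -natr1 in k2; rewrite ler0_norm; lra.
exists C => y0 [t st]; have [h [c [Dh [_ fh uh] tc]]] := red t.
have nt (b : R) := nrmZ b ls nsy.
pose u := ((G (c *: zg))^-1 * tr h)%g.
pose s1 := ((G (t *: zg))^-1 * y0)%g.
have s1S : sgrp G s s1 by apply/nlg_coset => //; [exact: nt|rewrite nexpK].
pose s3 := (G ((t + c) *: zg) * ((G (t *: zg))^-1 * u * G (t *: zg) * au h s1) * (G ((t + c) *: zg))^-1)%g.
have s3S : sgrp G s s3.
  apply: nrmJ => //; apply: sgrpM => //; first by apply: nrmJV => //; exact: us.
  by apply: au_sgrp => // v; exact: sA.
have [e [[De se] eB]] := cB _ s3S.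
have zfe (b : R) k : D k -> au k (G (b *: zg)) = G (b *: zg).
  by move=> Dk; rewrite aut_exp -scalemxAl zfix.
exists (e * h)%g; split; first split; first exact: DM.
  have ht : sgrp G s' (tr h).
    rewrite -(mulVKg (G (c *: zg)) (tr h)); apply: sgrpM => //; last by apply: ss'; exact: us.
    by rewrite /sgrp /= nexpK; exists c; rewrite subrr; exact: ls.1.
  rewrite atr_mul; apply: sgrpM => //; first exact: ss'.
  by apply: au_sgrp ht => v; exact: s'A.
have -> : act (e * h)%g y0 = (act e s3 * G ((t + c) *: zg))%g.
  rewrite aactM; have -> : act h y0 = (s3 * G ((t + c) *: zg))%g.
    rewrite /s3 mulgVK /aact -[y0](mulVKg (G (t *: zg))) -/s1 autM (zfe _ _ Dh).
    by rewrite (addrC t c) eex_add /u; grp.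
  by rewrite {1}/aact autM (zfe _ _ De) mulgA.
rewrite -lgpi pM; apply: Cb; rewrite lgpi le_max; first by rewrite eB.
by rewrite nexpK -scalemxAl normrZ; apply/orP; right; rewrite -[leRHS]mul1r ler_wpM2r.
Qed.

Let hull_step : exists s1, [/\ hull s1, s `<=` s1 & ~ s1 `<=` s].
Proof.
exists s'; split => //; last first.
  by move=> h; apply: zs; apply: h; exists 1; rewrite scale1r subrr; exact: ls.1.
split; first split => //.
- by move=> v /us /ss'.
- by move=> h Dh v; exact: s'A.
move=> t ta ut tE v [c sv].
have st : s `<=` t.
  case: hs => _; apply => // h [Dh sh]; apply: tE; split => //; exact: ss'.
have tz : t zg.
  have gs : Es s' g.
    split => //; rewrite -(mulVKg y (tr g)); apply: sgrpM => //.
      by rewrite /sgrp /= nexpK; exists 1; rewrite scale1r subrr; exact: ls.1.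
    by apply: ss'; apply: us; case: (rep_z Dg).
  have h1 := tE _ gs; have [_ _ h2] := rep_z Dg.
  have : sgrp G t (tr g * (y^-1 * tr g)^-1)%g.
    by apply: sgrpM => //; apply: sgrpV; [exact: ta.1|exact: ut].
  by rewrite invgM invgK mulVKg /sgrp /= nexpK.
rewrite -(subrK (c *: zg) v); apply: linsubD; [exact: ta.1|exact: st|].
by apply: linsubZ => //; exact: ta.1.
Qed.

Lemma hull_next : exists s1, [/\ hull s1, s `<=` s1 & ~ s1 `<=` s].
Proof. exact: hull_step. Qed.
End Step.

(** Take a maximal hull s. If a translation part lies outside s, an element g of least level with
    this property normalises [Es s], and [hull_next] enlarges s by a line. *)
Theorem hull_exists : exists s, [/\ subalg G s, u0 `<=` s, forall v, s v -> v *m Pi = 0 -> v = 0,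
  forall g, D g -> forall v, s v -> s (v *m A g) & forall g, D g -> sgrp G s (tr g)] /\
  coc D s /\ forall t, subalg G t -> u0 `<=` t -> (forall g, D g -> sgrp G t (tr g)) -> s `<=` t.
Proof.
have [s [hs max]] : exists s, hull s /\ forall s', hull s' -> s `<=` s' -> s' `<=` s.
  by apply: max_linsub; [move=> s [[[]]]|exists u0; exact: hull0].
suff all g : D g -> sgrp G s (tr g).
  have E : Es s = D by apply/seteqP; split=> g; [case|move=> Dg; split => //; exact: all].
  by case: hs; rewrite E => -[sa us spi sA sc] sg; exists s.
move=> Dg; apply: contrapT => ng.
pose Q j := `[< exists g, [/\ D g, ~ sgrp G s (tr g) & FU j g] >].
have Qex : exists j, Q j.
  exists (edeg G); apply/asboolP; exists g; split => //; exists (tr g).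
  by split; [exact: FilT|rewrite mulVg; exact: sgrp1].
case: (ex_minnP Qex) => j /asboolP[g0 [Dg0 ng0 Fj]] min {g Dg ng}.
have [[sa us _ _ _] _] := hs.
case: j Fj min => [|j] Fj min.
  by apply: ng0; case: Fj => f [/Fil0 ->]; rewrite invg1 mul1g; exact: us.
have gE h : Es s h -> Es s (g0 * h * g0^-1)%g.
  move=> Eh; have [Dh sh] := Eh.
  have Dc : D (g0 * h * g0^-1 * h^-1)%g.
    by apply: DM; [apply: DM; [exact: DM|exact: DV]|exact: DV].
  have sc : sgrp G s (tr (g0 * h * g0^-1 * h^-1)%g).
    apply: contrapT => nc; suff : (j < j)%N by rewrite ltnn.
    by apply: min; apply/asboolP; exists (g0 * h * g0^-1 * h^-1)%g; split => //; exact: FU_comm.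
  by rewrite -(mulgVK h (g0 * h * g0^-1)%g); exact: EsM.
have [s1 [h1 ss1 ns1]] := hull_next hs Dg0 ng0 gE.
by apply: ns1; exact: max.
Qed.
End Hull.

(* The left side is an exponential polynomial in (k, m), so an identity on the
   diagonal k = m holds everywhere. *)
Lemma ep_split (R : realType) n p (A N : 'M[R]_n) (C : 'M[R]_(n, p)) (v : 'rV[R]_n) (b : 'rV[R]_p) K :
  cdiag A -> A \in unitmx -> (N - 1) ^+ K = 0 ->
  (forall k, v *m A ^+ k *m N ^+ k *m C = b) -> forall k m, v *m A ^+ m *m N ^+ k *m C = b.
Proof.
move=> [P [d [Pu PA]]] Au NK h k m; apply: mxC_inj; apply/eqP; rewrite -subr_eq0; apply/eqP.
pose F k m := mxC v *m mxC A ^+ m *m mxC N ^+ k *m mxC C - mxC b.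
suff : F k m = 0 by rewrite /F !mxCM !mxCX.
apply: (exmx_diag0 (A := F)) => [|{m}j]; last first.
  by rewrite /F -!mxCX -!mxCM h subrr.
apply: exmxD; last exact: exmxC.
apply: exmxM; last exact: exmxC.
apply: exmxM; last first.
  by apply: (@exmx_unip _ _ _ K); rewrite -(mxC1 R n) -mxCB -mxCX NK mxC0.
apply: exmxM; first exact: exmxC.
by apply: exmx_diag Pu _ PA; rewrite map_unitmx.
Qed.

Lemma nAd_nil (R : realType) (X : groupType) n (G : nilgrp R X n) x : (nAd G x - 1) ^+ edeg G = 0.
Proof.
suff h k (v : 'rV[R]_n) : nfil (ebr G) k v -> v *m (nAd G x - 1) ^+ k = 0.
  by apply/row_matrixP => i; rewrite row0 rowE h //; exact: ebr_fil.
elim: k v => [|k IH] v fv; first by rewrite (fv : v = 0) mul0mx.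
by rewrite exprS -mulmxE mulmxA mulmxBr mulmx1; apply: IH; exact: fil_nAd.
Qed.

Section Stages.
Variables (R : realType) (Gam X X1 : groupType) (n n1 : nat).
Variables (G : nilgrp R X n) (G1 : nilgrp R X1 n1) (a : affact Gam G) (Pi : 'M[R]_(n, n1)).
Local Notation V := 'rV[R]_n.
Local Notation lg := (nlg G).
Local Notation A := (amx a).
Local Notation tr := (atr a).
Local Notation au := (aut a).
Hypothesis piM : {morph (fun x => G1 (lg x *m Pi)) : x y / (x * y)%g}.
Hypothesis piA : forall g (v : V), v *m Pi = 0 -> v *m A g *m Pi = 0.
Variable D : set Gam.
Hypotheses (D1 : D 1%g) (DM : forall g h, D g -> D h -> D (g * h)%g) (DV : forall g, D g -> D g^-1%g).
Hypothesis PD : forall B : R, finite_set [set g | D g /\ `|lg (tr g) *m Pi| <= B].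
Variable g0 : Gam.
Hypotheses (Dg0 : D g0) (dg0 : cdiag (A g0)) (fg0 : lg (tr g0) *m A g0 = lg (tr g0)).
Hypothesis Apoly : forall g, D g -> exists (K : nat) (c : nat -> R),
  \sum_(k < K) c k = 1 /\ A g = \sum_(k < K) c k *: A g0 ^+ k.

Lemma poly_fix g (v : V) : D g -> v *m A g0 = v -> v *m A g = v.
Proof.
move=> /Apoly[K [c [c1 ->]]] fv; rewrite mulmx_sumr -[RHS]scale1r -c1 scaler_suml.
apply: eq_bigr => k _; rewrite -scalemxAr; congr (_ *: _).
by elim: (k : nat) => [|j IH]; rewrite ?expr0 ?mulmx1 // exprSr -mulmxE mulmxA IH.
Qed.

Lemma poly_inv (s : set V) g (v : V) : linsub s -> (forall w, s w -> s (w *m A g0)) -> D g -> s v ->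
  s (v *m A g).
Proof. by move=> ls sA /Apoly[K [c [_ ->]]] sv; exact: (@linsub_mulmx _ _ s (A g0) c K v ls sA sv). Qed.

Lemma poly_comm g h : D g -> D h -> A g *m A h = A h *m A g.
Proof.
move=> /Apoly[K [c [_ ->]]] /Apoly[L [b [_ ->]]]; rewrite !mulmxE.
apply: commr_sum => i _; apply/commr_sym/commr_sum => j _.
rewrite /GRing.comm -!mulmxE -!scalemxAl -!scalemxAr scalerA [RHS]scalerA (mulrC (c _)).
by congr (_ *: _); rewrite !mulmxE -!exprD addnC.
Qed.

Let Delta : set Gam := [set g | D g /\ A g = 1].
Local Notation x0 := (tr g0).
Local Notation A0 := (A g0).
Local Notation N0 := (nAd G x0).

Let aut_Delta d x : Delta d -> au d x = x.
Proof. by move=> [_ d1]; rewrite aut_fix // d1 mulmx1. Qed.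

(** For elements with trivial linear part one can start from u0 = 0, and the logarithm of the
    translation part itself serves as z. *)
Let stage1 : exists u, [/\ subalg G u, forall v, u v -> v *m Pi = 0 -> v = 0,
  forall g, Delta g -> sgrp G u (tr g), coc a Pi Delta u &
  forall t, subalg G t -> (forall g, Delta g -> sgrp G t (tr g)) -> u `<=` t].
Proof.
have z0 : subalg G [set 0 : V].
  by split; [exact: linsub0|move=> u v _ -> /=; rewrite mul0mx].
have [||||||||||] := @hull_exists R Gam X X1 n n1 G G1 a Pi piM piA Delta _ _ _ _ [set 0] (fun g => lg (tr g)) z0.
- by split => //; exact: amx1.
- by move=> g h [Dg Ag] [Dh Ah]; split; [exact: DM|rewrite amxM Ag Ah mulmx1].
- move=> g [Dg Ag]; split; first exact: DV.
  by have := amxV a g; rewrite Ag mul1mx.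
- by move=> B; apply: sub_finite_set (PD B) => g [[Dg _] gB].
- by [].
- by move=> g _ v -> /=; rewrite mul0mx.
- by move=> g h _ [_ ->]; rewrite mulmx1.
- by move=> g _; rewrite nlgK mulVg; exact: sgrp1 (linsub0 _ _).
- by move=> g _ w -> /=; rewrite mul0mx.
- exists 0 => y yU; exists 1%g; split.
    by split; [split => //; exact: amx1|rewrite atr1; exact: sgrp1 (linsub0 _ _)].
  by rewrite /aact atr1 aut_id mul1g (yU : lg y = 0) mul0mx normr0.
move=> u [[ua _ upi _ uD] [uc ug]]; exists u; split => // t ta tD.
by apply: ug => // v ->; exact: ta.1.1.
Qed.

(** The second stage starts from the span u of the translations in D and needs representatives
    modulo u fixed by the linear parts. Conjugation by g0 gives information on the product A0 N0
    only; [ep_split] passes from it to the semisimple factor A0. *)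
Theorem stages : exists s, [/\ subalg G s, forall v, s v -> v *m Pi = 0 -> v = 0,
  forall g, D g -> forall v, s v -> s (v *m A g), forall g, D g -> sgrp G s (tr g) &
  forall t, subalg G t -> (forall g, D g -> sgrp G t (tr g)) -> s `<=` t].
Proof.
have [u [ua upi uD uc ug]] := stage1; have lu := ua.1.
have uT g v : D g -> u v -> u (v *m A g *m nAd G (tr g)).
  move=> Dg; suff h : u `<=` [set v | u (v *m A g *m nAd G (tr g))] by exact: h.
  apply: ug => [|h [Dh Ah]].
    split; first split.
    - by rewrite /= !mul0mx; exact: lu.1.
    - by move=> c v1 w /= h1 h2; rewrite !mulmxDl -!scalemxAl; exact: lu.2.
    - by move=> w v1 /= h1 h2; rewrite -amx_br -nAd_alg; exact: ua.2.
  have Ed : Delta (g * h * g^-1)%g.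
    split; first by apply: DM; [exact: DM|exact: DV].
    by rewrite !amxM Ah mul1mx amxVr.
  have := uD _ Ed; rewrite atr_conj (aut_Delta _ Ed).
  by rewrite /sgrp /= nlgJ lg_aut.
have fx0 : au g0 x0 = x0 by exact: aut_fix.
have AN : A0 *m N0 = N0 *m A0 by rewrite -amx_nAd fx0.
have ANX k : (A0 *m N0) ^+ k = A0 ^+ k *m N0 ^+ k by rewrite !mulmxE exprMn_comm.
have Au := amx_unit a g0.
have NK : (N0 - 1) ^+ edeg G = 0 by exact: nAd_nil.
have [U uU] := linsub_mx lu.
have uC v : u v <-> v *m cokermx U = 0 by rewrite uU submxE; split=> [/eqP|->].
have uk v k : u v -> u (v *m (A0 *m N0) ^+ k).
  move=> uv; elim: k => [|k IH]; first by rewrite expr0 mulmx1.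
  by rewrite exprSr -mulmxE !mulmxA; apply: uT => //; rewrite -mulmxA.
have usplit v k m : u v -> u (v *m A0 ^+ m *m N0 ^+ k).
  move=> uv; apply/uC; apply: (ep_split dg0 Au NK) => j.
  by apply/uC; rewrite -mulmxA -ANX; exact: uk.
have uA0 v : u v -> u (v *m A0) by move=> /(usplit _ 0%N 1%N); rewrite expr0 expr1 mulmx1.
have uA g v : D g -> u v -> u (v *m A g) by move=> Dg; exact: poly_inv.
have un g : D g -> nrm G u (tr g).
  move=> Dg; apply: nrm_nAd => // v uv.
  have := uT g (v *m A g^-1%g) Dg (uA _ _ (DV Dg) uv).
  by rewrite -(mulmxA v) amxVr mulmx1.
have zex g : exists z, D g -> z *m A0 = z /\ u (lg (tr g) - z).
  have [Dg|nDg] := pselect (D g); last by exists 0.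
  (* Linear parts commute on D, so d is a translation in D; modulo u the logarithm of the
     translation part of g is therefore fixed by A0 N0. *)
  pose d := ((g * g0) * (g0 * g)^-1)%g.
  have Ed : Delta d.
    split; first by apply: DM; [exact: DM|apply: DV; exact: DM].
    by rewrite amxM [A (g * g0)%g]amxM (poly_comm Dg0 Dg) -amxM amxVr.
  have e : (x0 * au g0 (tr g) * x0^-1 = (tr d)^-1 * tr g)%g.
    have : tr (g * g0)%g = (tr d * tr (g0 * g))%g.
      by rewrite -[(g * g0)%g](mulgVK (g0 * g)%g) -/d atr_mul (aut_Delta _ Ed).
    rewrite atr_mul (aut_fix (poly_fix Dg fg0)) atr_mul => h.
    have -> : (x0 * au g0 (tr g) = (tr d)^-1 * (tr g * x0))%g by rewrite h mulKg.
    by grp.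
  set v := lg (tr g).
  have v1 : u (v *m (A0 *m N0) - v).
    have := congr1 lg e; rewrite nlgJ lg_aut -/v -mulmxA => ->.
    apply/nlg_coset => //; first exact: un.
    by rewrite mulgA; apply: nrmJV; [|exact: un|apply: sgrpV => //; exact: uD].
  have vk k : u (v *m (A0 *m N0) ^+ k - v).
    elim: k => [|k IH]; first by rewrite expr0 mulmx1 subrr; exact: lu.1.
    have -> : v *m (A0 *m N0) ^+ k.+1 - v = (v *m (A0 *m N0) ^+ k - v) *m (A0 *m N0) ^+ 1 + (v *m (A0 *m N0) - v).
      by rewrite mulmxBl exprSr expr1 -mulmxE mulmxA addrA subrK.
    by apply: linsubD => //; exact: uk.
  have vA : u (v *m A0 - v).
    apply/uC; have := @ep_split _ _ _ A0 N0 (cokermx U) v (v *m cokermx U) (edeg G) dg0 Au NK _ 0%N 1%N.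
    rewrite expr0 expr1 mulmx1 mulmxBl => ->; first by rewrite subrr.
    move=> k; apply/eqP; rewrite -subr_eq0 -mulmxBl -mulmxA -ANX; apply/eqP/uC; exact: vk.
  have uM w : u w -> u (w *m (A0 - 1)).
    by move=> uw; rewrite mulmxBr mulmx1; apply: linsubB => //; exact: uA0.
  (* Fitting for A0 - 1 on u supplies a correction w in u after which the logarithm is killed by a
     power of A0 - 1; semisimplicity makes it fixed by A0. *)
  have [b [w [ub uw vE bM]]] := fitting (M := A0 - 1) lu.2 lu.1 uM vA.
  exists (v - w) => _; split; last by rewrite opprB addrC subrK.
  apply: (cdiag_fix (N := n.+1) dg0); rewrite exprS -mulmxE mulmxA.
  by rewrite mulmxBl mulmxBr mulmx1 vE addrK bM.
have [z zP] := choice zex.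
have zn g : D g -> nrm G u (G (z g)).
  move=> Dg w uw; have [_ uz] := zP _ Dg; rewrite nexpK -[z g](subKr (lg (tr g))).
  rewrite ebrD ebrN mulmxDr mulmxN; apply: linsubB => //; first exact: un.
  exact: ua.2.
have [|||||] := @hull_exists R Gam X X1 n n1 G G1 a Pi piM piA D D1 DM DV PD u z ua upi.
- by move=> g Dg v; exact: uA.
- by move=> g h Dg Dh; apply: poly_fix => //; exact: (zP _ Dg).1.
- move=> g Dg; apply/nlg_coset => //; first exact: zn.
  by rewrite nexpK; exact: (zP _ Dg).2.
- exact: zn.
- have [B cB] := uc; exists B => y /cB[g [Dg gB]]; exists g; split => //; split; first exact: Dg.1.
  exact: uD.
move=> s [[sa us spi sA sD] [_ sg]]; exists s; split => // t ta tD; apply: sg => //.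
by apply: ug => // g [Dg _]; exact: tD.
Qed.
End Stages.

Arguments nfil : simpl never.

Lemma compl_proj (R : realType) n (w s : set 'rV[R]_n) : linsub w -> linsub s ->
  (forall v, w v -> s v -> v = 0) -> exists P : 'M[R]_n, forall a b, w a -> s b -> (a + b) *m P = a.
Proof.
move=> /linsub_mx[W wW] /linsub_mx[S sS] ws; exists (proj_mx W S) => a b /wW aW /sS bS.
have WS : (W :&: S)%MS = 0.
  apply/eqP; rewrite -submx0; apply/row_subP => i; rewrite submx0; apply/eqP; apply: ws.
    by apply/wW; apply: submx_trans (row_sub i _) (capmxSl _ _).
  by apply/sS; apply: submx_trans (row_sub i _) (capmxSr _ _).
by rewrite mulmxDl proj_mx_id // proj_mx_0 // addr0.
Qed.

(** * Cocompactness makes the spanned subspace everything *)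

Section FullProjection.
Variables (R : realType) (Gam X : groupType) (n : nat) (G : nilgrp R X n) (a : affact Gam G).
Local Notation V := 'rV[R]_n.
Local Notation lg := (nlg G).
Local Notation A := (amx a).
Local Notation tr := (atr a).
Variables (D : set Gam) (g0 : Gam).
Hypotheses (dg0 : cdiag (A g0)) (Apoly : forall g, D g -> exists (K : nat) (c : nat -> R),
  \sum_(k < K) c k = 1 /\ A g = \sum_(k < K) c k *: A g0 ^+ k).
Hypothesis PD : forall B : R, finite_set [set g | D g /\ `|lg (tr g)| <= B].
Hypothesis CC : exists B : R, forall y, exists g, D g /\ `|lg (aact a g y)| <= B.

(** Let F be the first filtration level not inside s, w an invariant complement of s in F, and t a
    large multiple of w0 in w. Some g in D brings G t to bounded size; modulo s its logarithm is t
    A(g), which is therefore bounded, and so is the translation part of g. Only finitely many g are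
    possible, so t is bounded as well. *)
Lemma cocompact_full (s : set V) : linsub s -> (forall v, s v -> s (v *m A g0)) ->
  (forall g, D g -> sgrp G s (tr g)) -> forall v, s v.
Proof.
move=> ls sA sD.
have [full|nfull] := pselect (nfil (ebr G) (edeg G) `<=` s).
  by move=> v; apply: full; exact: ebr_fil.
have [k [sk nk]] : exists k, nfil (ebr G) k `<=` s /\ ~ nfil (ebr G) k.+1 `<=` s.
  apply: contrapT => h; apply: nfull; elim: (edeg G) => [|k IH]; first by move=> v ->; exact: ls.1.
  by apply: contrapT => nk; apply: h; exists k.
set F := nfil (ebr G) k.+1 in nk.
have lF : linsub F by exact: nfil_lin.
have lsF : linsub (s `&` F).
  split; first by split; [exact: ls.1|exact: lF.1].
  by move=> c v w [? ?] [? ?]; split; [exact: ls.2|exact: lF.2].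
have [w [lw wF wA wsF wsum]] := @inv_complement _ _ (A g0) F (s `&` F) dg0 lF lsF (@subIsetr _ _ _)
  (fun v => @amx_fil _ _ _ _ _ a g0 k.+1 v)
  (fun v (h : (s `&` F) v) => conj (sA v h.1) (@amx_fil _ _ _ _ _ a g0 k.+1 v h.2)).
have [w0 [ww0 w0n]] : exists w0, w w0 /\ w0 <> 0.
  apply: contrapT => h; apply: nk => v /wsum[b [c [wb [sc _] ->]]].
  have -> : b = 0 by apply: contrapT => b0; apply: h; exists b.
  by rewrite add0r.
exfalso; apply: w0n.
have ws v : w v -> s v -> v = 0 by move=> wv sv; apply: wsF => //; split => //; exact: wF.
have [P Pw] := compl_proj lw ls ws; have [B cB] := CC.
have [C1 hC1] := mulmx_bounded P B; have [C2 hC2] := nlgM_bounded G (Num.max B C1).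
have fin := PD C2.
have [C3 hC3] := finite_bound (fun g => `|A g^-1%g|) fin.
apply: (@norm_harmonic0 _ _ _ (n%:R * C1 * C3)) => k0.
have k00 : 0 < k0.+1%:R :> R by [].
rewrite ler_pdivlMr // mulrC -[X in X * _]normr_nat -normrZ; set t := k0.+1%:R *: w0.
have [g [Dg gB]] := cB (G t); pose wt := t *m A g.
have wwt : w wt.
  rewrite /wt; have [K [c [_ ->]]] := Apoly Dg.
  exact: (@linsub_mulmx _ _ w (A g0) c K t lw wA (linsubZ _ lw ww0)).
have wtC : `|wt| <= C1.
  have e : lg (aact a g (G t)) = wt + (lg (aact a g (G t)) - wt) by rewrite addrC subrK.
  have swt : s (lg (aact a g (G t)) - wt).
    have -> : lg (aact a g (G t)) - wt = (lg (aact a g (G t)) - (lg (tr g) + wt)) + lg (tr g) by vring.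
    apply: linsubD => //; last exact: sD.
    apply: sk; rewrite /aact aut_exp -/wt -{2}(nexpK G wt); apply: nlgM_fil.
    by rewrite /Fil /sgrp /= nexpK; exact: wF.
  rewrite -(Pw _ _ wwt swt) -e; exact: hC1.
have trE : tr g = (aact a g (G t) * G (- wt))%g.
  by rewrite /aact aut_exp -/wt nexpN mulgK.
have fg : D g /\ `|lg (tr g)| <= C2.
  split => //; rewrite trE; apply: hC2; first by rewrite le_max gB.
  by rewrite nexpK normrN le_max wtC orbT.
have -> : t = wt *m A g^-1%g by rewrite /wt -mulmxA amxV mulmx1.
apply: le_trans (mulmx_norm _ _) _.
apply: ler_pM; [exact: mulr_ge0|exact: normr_ge0|exact: ler_wpM2l|exact: hC3 fg].
Qed.
End FullProjection.

(** Moving the base point by (G w)^-1, with w in the current level, changes the translation part by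
    - w (A - 1) modulo the next level. By Fitting, only a part killed by (A - 1)^n survives. *)
Lemma affine_rebase (R : realType) (X : groupType) n (G : nilgrp R X n) (A : 'M[R]_n) (x0 : X) :
  {morph (fun x => G (nlg G x *m A)) : x y / (x * y)%g} ->
  (forall k v, nfil (ebr G) k v -> nfil (ebr G) k (v *m A)) ->
  exists p, let q := (p^-1 * x0 * G (nlg G p *m A))%g in nlg G q *m (A - 1) ^+ n = 0.
Proof.
move=> dM fA; set d := (fun x => _) in dM.
suff h k : (k <= edeg G)%N -> exists p (z f : 'rV[R]_n), [/\ nlg G (p^-1 * x0 * d p)%g = z + f,
    z *m (A - 1) ^+ n = 0 & nfil (ebr G) (edeg G - k) f].
  have [p [z [f [e zA]]]] := h _ (leqnn _); rewrite subnn => f0.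
  by exists p; rewrite /= -/(d p) e (f0 : f = 0) addr0.
elim: k => [_|k IH kK].
  exists 1%g, 0, (nlg G (1^-1 * x0 * d 1%g)%g); split; [by rewrite add0r|exact: mul0mx|].
  by rewrite subn0; exact: ebr_fil.
have [p [z [f [e zA]]]] := IH (ltnW kK).
have -> : (edeg G - k)%N = (edeg G - k.+1).+1 by lia.
set j := (edeg G - k.+1)%N => ff; have lf := nfil_lin G j.+1; have lj := nfil_lin G j.
have fM v : nfil (ebr G) j.+1 v -> nfil (ebr G) j.+1 (v *m (A - 1)).
  by move=> fv; rewrite mulmxBr mulmx1; exact: (linsubB lf (fA j.+1 _ fv) fv).
have [b [w [fb fw fE bM]]] := fitting (M := A - 1) lf.2 lf.1 fM ff.
pose q := (p^-1 * x0 * d p)%g.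
have dV x : d x^-1%g = (d x)^-1%g by exact: morph_inv dM.
exists (p * (G w)^-1)%g, (z + b), (nlg G ((p * (G w)^-1)^-1 * x0 * d (p * (G w)^-1))%g - (z + b)).
split; [by rewrite addrC subrK|by rewrite mulmxDl zA bM addr0|].
have -> : ((p * (G w)^-1)^-1 * x0 * d (p * (G w)^-1) = (G w * q) * (d (G w))^-1)%g.
  by rewrite dM dV /q; grp.
have F1 : Fil G j.+1 (G w) by rewrite /Fil /sgrp /= nexpK.
have F2 : Fil G j.+1 (d (G w))^-1%g.
  by apply: FilV; rewrite /Fil /sgrp /d /= !nexpK; exact: (fA j.+1).
have h1 := nlgM_fil (G w * q)%g F2; have h2 := nlgM_fil2 q F1.
rewrite nlgV {2}/d !nexpK in h1 h2; rewrite -/q in e.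
set y := nlg G (G w * q)%g in h1 h2; set y' := nlg G _ in h1 *.
have -> : y' - (z + b) = (y' - (y - w *m A)) + (y - (w + nlg G q)).
  rewrite e fE mulmxBr mulmx1; vring.
exact: linsubD.
Qed.

Lemma graph_matrix (R : realType) (X1 X2 : groupType) n1 n2 (G1 : nilgrp R X1 n1) (G2 : nilgrp R X2 n2)
  (s : set 'rV[R]_(n1 + n2)) : subalg (prod_nilgrp G1 G2) s -> (forall v, s v -> lsubmx v = 0 -> v = 0) ->
  (forall v1, exists2 v, s v & lsubmx v = v1) ->
  exists L : 'M[R]_(n1, n2), [/\ forall v1, s (row_mx v1 (v1 *m L)), forall v, s v -> rsubmx v = lsubmx v *m L &
    forall u v : 'rV[R]_n1, (v *m L) *m ebr G2 (u *m L) = (v *m ebr G1 u) *m L].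
Proof.
move=> [ls sb] inj surj.
have /choice[f fP] (i : 'I_n1) : exists v2, s (row_mx (delta_mx 0 i) v2).
  by have [v sv e] := surj (delta_mx 0 i); exists (rsubmx v); rewrite -e hsubmxK.
pose L : 'M[R]_(n1, n2) := \matrix_i f i.
have sL v1 : s (row_mx v1 (v1 *m L)).
  have -> : row_mx v1 (v1 *m L) = \sum_i v1 0 i *: row_mx (delta_mx 0 i) (f i).
    have -> : \sum_i v1 0 i *: row_mx (delta_mx 0 i) (f i) = \sum_i row_mx (v1 0 i *: delta_mx 0 i) (v1 0 i *: f i).
      by apply: eq_bigr => i _; rewrite scale_row_mx.
    have -> : v1 *m L = \sum_i v1 0 i *: f i by rewrite mulmx_sum_row; apply: eq_bigr => i _; rewrite rowK.
    rewrite {1}[v1]row_sum_delta.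
    by elim/big_ind3 : _ => // [|? ? ? ? ? ? <- <-]; rewrite ?row_mx0 ?add_row_mx.
  by apply: linsub_sum => // i; apply: linsubZ.
have graph v : s v -> rsubmx v = lsubmx v *m L.
  move=> sv; have /eqP : v - row_mx (lsubmx v) (lsubmx v *m L) = 0.
    apply: inj; first exact: linsubB.
    by apply/rowP => i; rewrite !mxE (unsplitK (inl i)) !mxE subrr.
  by rewrite subr_eq0 => /eqP e; rewrite {1}e row_mxKr.
exists L; split => // u v; have := graph _ (sb _ _ (sL u) (sL v)).
by rewrite /= /pbr mul_block_diag !row_mxKl !row_mxKr.
Qed.

(** [qf] numbers the left cosets of D, and [r] is a system of representatives. *)
Definition finidx (Gam : groupType) (D : set Gam) := exists m (qf : Gam -> 'I_m) (r : 'I_m -> Gam),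
  cancel r qf /\ forall x y, qf x = qf y <-> D (x^-1 * y)%g.

Section Barycenter.
Variables (R : realType) (Gam X : groupType) (n : nat) (G : nilgrp R X n) (a : affact Gam G).
Local Notation V := 'rV[R]_n.
Local Notation lg := (nlg G).
Local Notation A := (amx a).
Variables (D : set Gam) (q : set V) (sig : Gam -> X -> X).
Hypotheses (fD : finidx D) (qa : subalg G q).
Hypotheses (sigQ : forall g x, sgrp G q x -> sgrp G q (sig g x))
  (sigM : forall g h x, sgrp G q x -> sig (g * h)%g x = sig g (sig h x))
  (sigr : forall g x y, sig g (x * y)%g = (sig g x * aut a g y)%g)
  (sigD : forall g x, D g -> sgrp G q x -> sig g x = x).

(** The group is not commutative, so means are taken level by level. Modulo the next level the
    displacement v is an additive cocycle, constant on the cosets of D, and its mean w satisfies v g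
    + w A(g) - w = 0; hence x G(w) is fixed one level further. *)
Lemma barycenter : exists x, sgrp G q x /\ forall g, sig g x = x.
Proof.
have [m [qf [r [rK qfP]]]] := fD.
suff h k : (k <= edeg G)%N -> exists x, sgrp G q x /\ forall g, Fil G (edeg G - k) (x^-1 * sig g x)%g.
  have [x [qx]] := h _ (leqnn _); rewrite subnn => f0; exists x; split => // g.
  by rewrite -[RHS]mulg1 -(Fil0 (f0 g)) mulVKg.
elim: k => [_|k IH kK].
  by exists 1%g; split; [exact: sgrp1 qa.1|move=> g; rewrite subn0; exact: FilT].
have [x [qx]] := IH (ltnW kK).
have -> : (edeg G - k)%N = (edeg G - k.+1).+1 by lia.
set j := (edeg G - k.+1)%N => fx; have lf := nfil_lin G j.+1; have lj := nfil_lin G j.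
pose v g := lg (x^-1 * sig g x)%g.
have qv g : q (v g) by apply: sgrpM => //; [apply: sgrpV => //; exact: qa.1|exact: sigQ].
have vcos g h : qf g = qf h -> v g = v h.
  move=> /qfP dgh; congr (lg (_ * _))%g.
  by rewrite -[h](mulVKg g) sigM // [sig (g^-1 * h)%g x]sigD.
have cocyc g h : nfil (ebr G) j (v (g * h)%g - (v g + v h *m A g)).
  have -> : v (g * h)%g = lg ((x^-1 * sig g x) * aut a g (x^-1 * sig h x))%g.
    by rewrite /v sigM // -[in LHS](mulVKg x (sig h x)) sigr mulgA.
  rewrite /v -lg_aut; apply: nlgM_fil.
  by rewrite /Fil /sgrp /= lg_aut; exact: (@amx_fil _ _ _ _ _ a g j.+1 _ (fx h)).
have m0 : m%:R != 0 :> R.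
  by rewrite pnatr_eq0 -lt0n; case: (m) (qf 1%g) => [[]|].
pose w := m%:R^-1 *: \sum_i v (r i).
have fw : nfil (ebr G) j.+1 w by apply: (linsubZ _ lf); apply: (linsub_sum _ lf) => i; exact: fx.
have qw : q w by apply: linsubZ; [exact: qa.1|apply: linsub_sum; [exact: qa.1|move=> i; exact: qv]].
exists (x * G w)%g; split.
  by apply: sgrpM => //; rewrite /sgrp /= nexpK.
move=> g; have -> : ((x * G w)^-1 * sig g (x * G w) = (G (- w) * (x^-1 * sig g x)) * G (w *m A g))%g.
  by rewrite sigr aut_exp nexpN; grp.
have F1 : Fil G j.+1 (G (- w)) by rewrite /Fil /sgrp /= nexpK; exact: (linsubN lf).
have F2 : Fil G j.+1 (G (w *m A g)) by rewrite /Fil /sgrp /= nexpK; exact: (@amx_fil _ _ _ _ _ a g j.+1).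
have h1 := nlgM_fil (G (- w) * (x^-1 * sig g x))%g F2; have h2 := nlgM_fil2 (x^-1 * sig g x)%g F1.
rewrite !nexpK -/(v g) in h1 h2; rewrite /Fil /sgrp /=.
set y := lg _ in h1 *; set y' := lg _ in h1 h2.
have sumE : \sum_i v (g * r i)%g = \sum_i v (r i).
  have inj : injective (fun i => qf (g * r i)%g).
    move=> i i' /qfP; rewrite invgM mulgA mulgVK => /qfP; rewrite !rK; exact.
  rewrite [RHS](reindex_inj inj); apply: eq_bigr => i _.
  by apply: vcos; rewrite rK.
have bar : nfil (ebr G) j (v g + w *m A g - w).
  have -> : v g + w *m A g - w = m%:R^-1 *: \sum_i (- (v (g * r i)%g - (v g + v (r i) *m A g))).
    rewrite sumrN sumrB sumE big_split /= sumr_const card_ord -mulmx_suml.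
    have -> : \sum_i v (r i) = m%:R *: w by rewrite /w scalerA mulfV // scale1r.
    have -> : m%:R *: w - (v g *+ m + m%:R *: w *m A g) = m%:R *: (w - (v g + w *m A g)).
      by rewrite -scalemxAl scalerBr scalerDr -(scaler_nat m (v g)).
    by rewrite [RHS]scalerN scalerA mulVf // scale1r opprB.
  by apply: linsubZ => //; apply: linsub_sum => // i; apply: linsubN => //; exact: cocyc.
have -> : y = (y - (y' + w *m A g)) + (y' - (- w + v g)) + (v g + w *m A g - w) by vring.
by do 2!apply: linsubD => //.
Qed.
End Barycenter.

Lemma cdiag_block (R : realType) n1 n2 (A : 'M[R]_n1) (B : 'M[R]_n2) : cdiag A -> cdiag B ->
  cdiag (block_mx A 0 0 B).
Proof.
move=> [P [d [Pu PA]]] [Q [e [Qu QB]]]; exists (block_mx P 0 0 Q), (row_mx d e); split.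
  by rewrite unitmxE det_ublock unitrM -!unitmxE Pu.
have -> : mxC (block_mx A 0 0 B) = block_mx (mxC A) 0 0 (mxC B) by rewrite /mxC map_block_mx !map_mx0.
have -> : diag_mx (row_mx d e) = block_mx (diag_mx d) 0 0 (diag_mx e).
  apply/matrixP => i j; rewrite !mxE; case: splitP => i' ii'; rewrite !mxE; case: splitP => j' jj'; rewrite !mxE -?val_eqE /= ?ii' ?jj' ?eqn_add2l //.
  - by have -> : (nat_of_ord i' == n1 + j')%N = false; [apply/eqP; have := ltn_ord i'; lia|rewrite mulr0n].
  - by have -> : (n1 + i' == j')%N = false; [apply/eqP; have := ltn_ord j'; lia|rewrite mulr0n].
by rewrite !mulmx_block !mulmx0 !mul0mx !addr0 !add0r PA QB.
Qed.

Section Uniqueness.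
Variables (R : realType) (Gam X1 X2 : groupType) (n1 n2 : nat).
Variables (G1 : nilgrp R X1 n1) (G2 : nilgrp R X2 n2) (a1 : affact Gam G1) (a2 : affact Gam G2).
Variable g0 : Gam.
Hypotheses (cd2 : cdiag (amx a2 g0)) (f1 : nlg G1 (atr a1 g0) *m amx a1 g0 = nlg G1 (atr a1 g0))
  (f2 : nlg G2 (atr a2 g0) *m amx a2 g0 = nlg G2 (atr a2 g0)).

Lemma atr_pow n (X : groupType) (G : nilgrp R X n) (a : affact Gam G) k :
  nlg G (atr a g0) *m amx a g0 = nlg G (atr a g0) -> atr a (g0 ^+ k)%g = (atr a g0 ^+ k)%g.
Proof.
move=> f; elim: k => [|k IH]; first by rewrite !expg0 atr1.
by rewrite !expgS atr_mul IH aut_fix // nlgX -scalemxAl f.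
Qed.

(* The logarithm of x translated by the powers of g0 is polynomial, while the
   powers of a semisimple matrix are not, unless constant. *)
Lemma equivariant_fixed (L : 'M[R]_(n1, n2)) (x : X2) :
  (forall k, (G2 (nlg G1 (atr a1 (g0 ^+ k)%g) *m L) * x = aact a2 (g0 ^+ k)%g x)%g) ->
  nlg G2 x *m amx a2 g0 = nlg G2 x.
Proof.
move=> h; set A := amx a2 g0; set v := nlg G2 x.
pose u1 := nlg G1 (atr a1 g0) *m L; pose u2 := nlg G2 (atr a2 g0).
have hk (k : nat) : v *m A ^+ k = bch G2 (bch G2 (k%:R *: - u2) (k%:R *: u1)) v.
  have := h k; rewrite /aact !atr_pow // nlgX -scalemxAl -/u1 => e.
  rewrite -amxX -lg_aut; have -> : aut a2 (g0 ^+ k)%g x = ((atr a2 g0 ^+ k)^-1 * (G2 (k%:R *: u1) * x))%g.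
    by rewrite e mulKg.
  by rewrite mulgA !nlgM nlgV nlgX nexpK scalerN.
have pc w : polycurve (fun t : R => t *: w) by exact: polycurve_lin.
have [c cE] : polycurve (fun t => bch G2 (bch G2 (t *: - u2) (t *: u1)) v).
  apply: polycurve_bch; first by apply: polycurve_bch; exact: pc.
  exists (\row_i (v 0 i)%:P) => t; by apply/rowP => i; rewrite !mxE hornerC.
have [P [d [Pu PA]]] := cd2.
have Au := amx_unit a2 g0.
pose F (k m : nat) := mxC v *m mxC A ^+ m - mxC (pev c k%:R).
have F0 k m : F k m = 0.
  apply: (exmx_diag0 (A := F)) => [|j]; last by rewrite /F -mxCX -mxCM hk cE subrr.
  apply: exmxD.
    apply: exmxM; first exact: exmxC.
    by apply: exmx_diag Pu _ PA; rewrite map_unitmx.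
  move=> i j; apply: (@expoly_ext _ (fun k _ => (map_poly (real_complex R) (- c 0 j)).[k%:R])).
    move=> k' m'; rewrite !mxE; rewrite -(rmorph_nat (real_complex R)) horner_map /= hornerN rmorphN.
    by [].
  exact: expoly_poly.
apply: mxC_inj; rewrite mxCM.
have /eqP := F0 0%N 1%N; rewrite /F expr1 subr_eq0 => /eqP ->.
by have /eqP := F0 0%N 0%N; rewrite /F expr0 mulmx1 subr_eq0 => /eqP.
Qed.
End Uniqueness.

(** * From the subgroup D to the whole group *)

Section Equivariant.
Variables (R : realType) (Gam X1 X2 : groupType) (n1 n2 : nat).
Variables (G1 : nilgrp R X1 n1) (G2 : nilgrp R X2 n2) (a1 : affact Gam G1) (a2 : affact Gam G2).
Variables (D : set Gam) (g0 : Gam).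
Hypotheses (D1 : D 1%g) (DM : forall g h, D g -> D h -> D (g * h)%g) (DV : forall g, D g -> D g^-1%g)
  (Dn : forall g h, D h -> D (g * h * g^-1)%g) (fD : finidx D).
Hypotheses (Dg0 : D g0) (cd1 : cdiag (amx a1 g0)) (cd2 : cdiag (amx a2 g0)).
Hypothesis Apoly : forall g, D g -> exists (K : nat) (c : nat -> R),
  [/\ \sum_(k < K) c k = 1, amx a1 g = \sum_(k < K) c k *: amx a1 g0 ^+ k &
      amx a2 g = \sum_(k < K) c k *: amx a2 g0 ^+ k].

Section Fixed.
Hypothesis PD : forall B : R, finite_set [set g | D g /\ `|nlg G1 (atr a1 g)| <= B].
Hypothesis CC : exists B : R, forall y, exists g, D g /\ `|nlg G1 (aact a1 g y)| <= B.
Hypotheses (f1 : nlg G1 (atr a1 g0) *m amx a1 g0 = nlg G1 (atr a1 g0))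
  (f2 : nlg G2 (atr a2 g0) *m amx a2 g0 = nlg G2 (atr a2 g0)).
Let G := prod_nilgrp G1 G2.
Let a : affact Gam G := prod_affact a1 a2.

(** [stages] and [cocompact_full] make the span in the product the graph of L. Uniqueness: the graph
    of a competitor is a subalgebra containing the translation parts of D, so it contains the
    span. *)
Let graph : exists L : 'M[R]_(n1, n2), [/\ forall u v : 'rV[R]_n1, (v *m L) *m ebr G2 (u *m L) = (v *m ebr G1 u) *m L,
  forall g, D g -> nlg G2 (atr a2 g) = nlg G1 (atr a1 g) *m L,
  forall g, D g -> L *m amx a2 g = amx a1 g *m L &
  forall L' : 'M[R]_(n1, n2), (forall u v : 'rV[R]_n1, (v *m L') *m ebr G2 (u *m L') = (v *m ebr G1 u) *m L') ->
    (forall g, D g -> nlg G2 (atr a2 g) = nlg G1 (atr a1 g) *m L') -> L' = L].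
Proof.
pose Pi : 'M[R]_(n1 + n2, n1) := col_mx 1%:M 0.
have PiE (v : 'rV[R]_(n1 + n2)) : v *m Pi = lsubmx v.
  by rewrite -{1}[v]hsubmxK mul_row_col mulmx0 addr0 mulmx1.
have piM : {morph (fun x => G1 (nlg G x *m Pi)) : x y / (x * y)%g}.
  by move=> x y; rewrite !PiE /= !row_mxKl !nlgK.
have [|B||||s [sa spi sA sD sg]] := @stages R Gam _ X1 _ n1 G G1 a Pi piM _ D D1 DM DV _ g0 Dg0.
- by move=> g v; rewrite !PiE /= mul_block_diag row_mxKl => ->; rewrite mul0mx.
- by apply: sub_finite_set (PD B) => g [Dg]; rewrite PiE /= row_mxKl.
- exact: cdiag_block.
- by rewrite /= mul_block_diag row_mxKl row_mxKr f1 f2.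
- move=> g /Apoly[K [c [c1 E1 E2]]]; exists K, c; split => //=.
  rewrite E1 E2; under [RHS]eq_bigr do rewrite block_diag_exp.
  by rewrite (block_diag_sum (fun k : 'I_K => c k)).
have ls := sa.1.
pose s1 : set 'rV[R]_n1 := [set v1 | exists2 v, s v & lsubmx v = v1].
have full : forall v, s1 v.
  apply: (@cocompact_full _ _ _ _ _ a1 D g0 cd1 _ PD CC).
  - by move=> g /Apoly[K [c [c1 E1 _]]]; exists K, c.
  - split; first by exists 0; [exact: ls.1|apply/rowP => i; rewrite !mxE].
    move=> c _ _ [v sv <-] [w sw <-]; exists (c *: v + w); first exact: ls.2.
    by rewrite lsubmx_lin.
  - move=> _ [v sv <-]; exists (v *m amx a g0); first exact: sA.
    by rewrite /= mul_block_diag row_mxKl.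
  - by move=> g /sD sg1; exists (nlg G (atr a g)) => //=; rewrite row_mxKl.
have sinj v : s v -> lsubmx v = 0 -> v = 0 by move=> sv v0; apply: spi => //; rewrite PiE.
have [L [sL gL cL]] := graph_matrix sa sinj full.
exists L; split => //.
- by move=> g /sD/gL /=; rewrite row_mxKl row_mxKr.
- move=> g Dg; apply/row_matrixP => i; rewrite !rowE !mulmxA; set v := delta_mx _ _.
  have := gL _ (sA g Dg _ (sL v)); rewrite /= mul_block_diag !row_mxKl !row_mxKr.
  by move=> ->.
- move=> L' cL' trL'.
  have h : s `<=` [set v | rsubmx v = lsubmx v *m L'].
    apply: sg (graph_subalg cL') _ => g Dg.
    by rewrite /sgrp /= row_mxKl row_mxKr; exact: trL'.
  apply/row_matrixP => i; rewrite !rowE.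
  by have := h _ (sL (delta_mx 0 i)); rewrite /= row_mxKl row_mxKr.
Qed.

(** Transporting the map y |-> d y x by any g gives another D-equivariant map, with some matrix L'.
    Uniqueness gives L' = L, so g only moves the point x, to [sig g x], and a fixed point of this
    action is needed. *)
Let equivariant_fix : exists (L : 'M[R]_(n1, n2)) (x : X2), let d y := G2 (nlg G1 y *m L) in
  {morph d : y z / (y * z)%g} /\ forall g y, aact a2 g (d y * x)%g = (d (aact a1 g y) * x)%g.
Proof.
have [L [cL trL AL uL]] := graph; pose d y := G2 (nlg G1 y *m L).
have dM : {morph d : y z / (y * z)%g} := alg_morph_exp cL.
have lgd y : nlg G2 (d y) = nlg G1 y *m L by exact: nexpK.
(* The admissible points x: those fixed by the linear part of g0, hence by the linear parts of D. *)
pose q : set 'rV[R]_n2 := [set v | v *m amx a2 g0 = v].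
have qa : subalg G2 q.
  split; first split; rewrite /q /=.
  - by rewrite mul0mx.
  - by move=> c v w hv hw; rewrite mulmxDl -scalemxAl hv hw.
  - by move=> u v hu hv; rewrite -amx_br hu hv.
have qfix g x : D g -> sgrp G2 q x -> aut a2 g x = x.
  move=> Dg qx; apply: aut_fix; apply: (@poly_fix _ _ _ _ _ a2 D g0) => //.
  by move=> h /Apoly[K [c [c1 _ E2]]]; exists K, c.
have DE g y x : D g -> sgrp G2 q x -> (d (aact a1 g y) * x = aact a2 g (d y * x))%g.
  move=> Dg qx; rewrite /aact autM (qfix g x Dg qx) dM mulgA; congr (_ * _ * _)%g.
    by rewrite /d -trL // nlgK.
  by rewrite /d /aut !nexpK -!mulmxA AL.
pose sig g x := aact a2 g (d (atr a1 g^-1%g) * x)%g.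
have S1 g x : sgrp G2 q x -> sgrp G2 q (sig g x) /\
    forall y, (aact a2 g (d y * x) = d (aact a1 g y) * sig g x)%g.
  move=> qx; pose c := (atr a2 g * aut a2 g (d (atr a1 g^-1)))%g.
  pose L' := amx a1 g^-1%g *m L *m amx a2 g *m nAd G2 c.
  pose d' y := G2 (nlg G1 y *m L').
  have d'E y : d' y = (c * aut a2 g (d (aut a1 g^-1 y)) * c^-1)%g.
    by rewrite -[RHS](nlgK G2) nlgJ lg_aut lgd lg_aut /d' /L' !mulmxA.
  have cL' (u v : 'rV[R]_n1) : (v *m L') *m ebr G2 (u *m L') = (v *m ebr G1 u) *m L'.
    by rewrite /L' !mulmxA nAd_alg amx_br cL amx_br.
  have dM' : {morph d' : y z / (y * z)%g} := alg_morph_exp cL'.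
  have E y : (aact a2 g (d (aact a1 g^-1 y) * x) = d' y * sig g x)%g.
    by rewrite d'E /sig /aact dM !autM /c; grp.
  have eqv h : D h -> (d' (atr a1 h) * sig g x = aact a2 h (sig g x))%g.
    move=> Dh; rewrite -E -{1}(aact1 a1 h) -aactM.
    have -> : (g^-1 * h = (g^-1 * h * g) * g^-1)%g by grp.
    rewrite aactM DE //; last by have := Dn g^-1%g Dh; rewrite invgK.
    rewrite aact1 -[LHS]aactM /sig -[RHS]aactM; congr (aact _ _ _); grp.
  have qx' : sgrp G2 q (sig g x).
    apply: (@equivariant_fixed _ _ _ _ _ _ _ _ a1 a2 g0 cd2 f1 f2 L') => k.
    apply: eqv; elim: k => [|k IH]; rewrite ?expg0 // expgS; exact: DM.
  have LL : L' = L.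
    apply: uL => // h Dh; have := eqv h Dh; rewrite /aact qfix // => /mulIg e.
    by rewrite -e /d' nexpK.
  split => // y; rewrite -{1}(aactK a1 g y) E; congr (_ * _)%g.
  by rewrite /d' /d LL.
have [x [qx fx]] : exists x, sgrp G2 q x /\ forall g, sig g x = x.
  apply: (barycenter (a := a2) fD qa).
  - by move=> g x /(S1 g)[].
  - move=> g h x qx; have [q1 e1] := S1 h x qx; have [_ e2] := S1 g _ q1; have [_ e3] := S1 (g * h)%g x qx.
    apply: (mulgI (d (aact a1 (g * h)%g 1%g))); rewrite -e3 aactM e1 e2; by rewrite aactM.
  - by move=> g x y; rewrite /sig /aact !autM !mulgA.
  - move=> g x Dg qx; rewrite /sig -DE // -aact1 -aactM mulgV aact1 atr1.
    by rewrite (morph_one dM) mul1g.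
exists L, x; split => // g y; have [_ ->] := S1 g x qx; by rewrite fx.
Qed.

Lemma equivariant_fixed_case : exists (L : 'M[R]_(n1, n2)) (x : X2), let d y := G2 (nlg G1 y *m L) in
  {morph d : y z / (y * z)%g} /\ forall g y, aact a2 g (d y * x)%g = (d (aact a1 g y) * x)%g.
Proof. exact: equivariant_fix. Qed.
End Fixed.
End Equivariant.

Section Rebase.
Variables (R : realType) (Gam X : groupType) (n : nat) (G : nilgrp R X n) (a : affact Gam G) (p : X).

Definition rebase : affact Gam G.
Proof.
refine (@AffAct _ _ _ _ G (fun g => p^-1 * atr a g * aut a g p)%g (amx a) (@amx_morph _ _ _ _ _ a) (amx1 a) (amxM a) _).
move=> g h; rewrite -[G (_ *m _)]/(aut a g _) !autM autV -autMM atr_mul; grp.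
Defined.

Lemma rebase_act g y : aact rebase g y = (p^-1 * aact a g (p * y))%g.
Proof. by rewrite /aact /= -[aut rebase g y]/(aut a g y) autM !mulgA. Qed.
End Rebase.

(** Base points from [affine_rebase] put the translation parts of g0 into generalised fixed spaces
    of its linear parts, and these are fixed spaces by semisimplicity. *)
Theorem equivariant_exists (R : realType) (Gam X1 X2 : groupType) (n1 n2 : nat)
  (G1 : nilgrp R X1 n1) (G2 : nilgrp R X2 n2) (a1 : affact Gam G1) (a2 : affact Gam G2)
  (D : set Gam) (g0 : Gam) :
  D 1%g -> (forall g h, D g -> D h -> D (g * h)%g) -> (forall g, D g -> D g^-1%g) ->
  (forall g h, D h -> D (g * h * g^-1)%g) -> finidx D ->
  D g0 -> cdiag (amx a1 g0) -> cdiag (amx a2 g0) ->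
  (forall g, D g -> exists (K : nat) (c : nat -> R),
    [/\ \sum_(k < K) c k = 1, amx a1 g = \sum_(k < K) c k *: amx a1 g0 ^+ k &
        amx a2 g = \sum_(k < K) c k *: amx a2 g0 ^+ k]) ->
  (forall (p : X1) (B : R), finite_set [set g | D g /\ `|nlg G1 (aact a1 g p)| <= B]) ->
  (exists B : R, forall y, exists g, D g /\ `|nlg G1 (aact a1 g y)| <= B) ->
  exists (d : X1 -> X2) (L : 'M[R]_(n1, n2)) (x : X2),
    [/\ {morph d : y z / (y * z)%g}, forall y, nlg G2 (d y) = nlg G1 y *m L &
      forall g y, aact a2 g (d y * x)%g = (d (aact a1 g y) * x)%g].
Proof.
move=> D1 DM DV Dn fD Dg0 cd1 cd2 Apoly PD [B CC].
have [p1 f1] := affine_rebase (atr a1 g0) (@amx_morph _ _ _ _ _ a1 g0) (amx_fil a1 g0).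
have [p2 f2] := affine_rebase (atr a2 g0) (@amx_morph _ _ _ _ _ a2 g0) (amx_fil a2 g0).
have PD' C : finite_set [set g | D g /\ `|nlg G1 (atr (rebase a1 p1) g)| <= C].
  have [C' hC'] := nlgM_bounded G1 (Num.max C `|nlg G1 p1|).
  apply: sub_finite_set (PD p1 C') => g [Dg gC]; split => //.
  have -> : aact a1 g p1 = (p1 * atr (rebase a1 p1) g)%g by rewrite /aact /=; grp.
  by apply: hC'; rewrite le_max ?lexx ?gC ?orbT.
have CC' : exists C : R, forall y, exists g, D g /\ `|nlg G1 (aact (rebase a1 p1) g y)| <= C.
  have [C hC] := nlgM_bounded G1 (Num.max B `|nlg G1 p1^-1%g|).
  exists C => y; have [g [Dg gB]] := CC (p1 * y)%g; exists g; split => //.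
  by rewrite rebase_act; apply: hC; rewrite le_max ?lexx ?gB ?orbT.
have [L [x]] := @equivariant_fixed_case _ _ _ _ _ _ _ _ (rebase a1 p1) (rebase a2 p2) D g0 D1 DM DV Dn fD Dg0 cd1 cd2 Apoly PD' CC' (cdiag_fix cd1 f1) (cdiag_fix cd2 f2).
set d := (fun y => _) => -[dM dE].
(* Back at the original base points the map is y |-> p2 d(p1^-1 y) x = (c d(y) c^-1) (c x). *)
pose c := (p2 * (d p1)^-1)%g.
exists (fun y => c * d y * c^-1)%g, (L *m nAd G2 c), (c * x)%g; split.
- by move=> y z; rewrite dM; grp.
- by move=> y; rewrite nlgJ /d nexpK mulmxA.
move=> g y; have := dE g (p1^-1 * y)%g; rewrite !rebase_act mulVKg !dM !(morph_inv _ dM).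
move=> /(congr1 (fun z => p2 * z)%g); rewrite mulVKg => e.
rewrite -[X in _ = X]mulgA mulKg; move: e; rewrite /c; grp.
Qed.

(** * Virtually polycyclic groups *)

Section Subgroups.
Variable Gam : groupType.
Implicit Types (x y g h : Gam) (Q S T N : set Gam).
Local Open Scope group_scope.

Lemma sub1 S : is_subgroup S -> S 1. Proof. by case. Qed.
Lemma subM S x y : is_subgroup S -> S x -> S y -> S (x * y).
Proof.
move=> [S1 SD] Sx Sy; rewrite -[y]invgK; apply: (SD) => //; rewrite -[y^-1]mul1g; exact: (SD).
Qed.
Lemma subV S x : is_subgroup S -> S x -> S x^-1.
Proof. by move=> [S1 SD] Sx; rewrite -[x^-1]mul1g; exact: (SD). Qed.
Lemma subX S x k : is_subgroup S -> S x -> S (x ^+ k).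
Proof. by move=> sS Sx; elim: k => [|k IH]; rewrite ?expg0 ?expgS; [exact: sub1|exact: subM]. Qed.
Lemma mk_subgroup S : S 1 -> (forall x y, S x -> S y -> S (x * y)) -> (forall x, S x -> S x^-1) -> is_subgroup S.
Proof. by move=> S1 SM SV; split => // x y Sx Sy; apply: SM => //; exact: SV. Qed.

(** Finite index in the form of a finite cover of S by right translates of Q, which composes and
    transports easily. *)
Definition ficov Q S := exists l : seq Gam, forall s, S s -> exists2 x, x \in l & Q (s * x^-1).

Lemma ficov_sub Q Q' S S' : Q `<=` Q' -> S' `<=` S -> ficov Q S -> ficov Q' S'.
Proof. by move=> QQ SS [l lP]; exists l => s /SS/lP[x xl Qx]; exists x => //; exact: QQ. Qed.

Lemma ficov_refl S : is_subgroup S -> ficov S S.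
Proof. by move=> sS; exists [:: 1] => s Ss; exists 1; rewrite ?inE // invg1 mulg1. Qed.

Lemma ficov_trans Q S T : ficov Q S -> ficov S T -> ficov Q T.
Proof.
move=> [l lP] [k kP]; exists [seq x * y | x <- l, y <- k] => t /kP[y yk /lP[x xl Qx]].
by exists (x * y); [exact: allpairs_f|rewrite invgM mulgA].
Qed.

Lemma nat_pigeon (T : finType) (f : nat -> T) : exists i j, (i < j)%N /\ f i = f j.
Proof.
pose g (i : 'I_#|T|.+1) := f i.
have : ~~ injectiveb g.
  by apply/negP => /injectiveP/leq_card; rewrite card_ord ltnn.
move=> /injectivePn[i [j ij gij]].
have [lt|lt|e] := ltngtP i j; [by exists i, j|by exists j, i|].
by case/eqP: ij; exact: val_inj.
Qed.

Lemma ficov_pow Q S g : is_subgroup Q -> ficov Q S -> (forall k, S (g ^+ k)) ->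
  exists2 e, (0 < e)%N & Q (g ^+ e).
Proof.
move=> sQ [l lP] Sg.
have /choice[f fP] k : exists i : 'I_(size l), Q (g ^+ k * (nth 1 l i)^-1).
  have [x xl Qx] := lP _ (Sg k); have xs : (index x l < size l)%N by rewrite index_mem.
  by exists (Ordinal xs); rewrite nth_index.
have [i [j [ij fij]]] := nat_pigeon f.
exists (j - i)%N; first by rewrite subn_gt0.
have := subM sQ (fP j) (subV sQ (fP i)); rewrite fij.
rewrite -{1}(subnK (ltnW ij)) expgnDr.
by rewrite invgM invgK !mulgA mulgVK mulgK.
Qed.

Lemma finite_quotient_ficov Q S : is_subgroup Q -> finite_quotient Q S -> is_subgroup S -> ficov Q S.
Proof.
move=> sQ fq sS; pose f x : set Gam := [set x * a | a in Q].
have [Z ZE] : exists Z : seq Gam, forall x, S x -> exists2 y, y \in Z & f y = f x.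
  have /finite_fsetP[F FE] := fq.
  have /choice[r rP] (A : set Gam) : exists x, (exists2 y, S y & f y = A) -> f x = A.
    by have [[y _ e]|n] := pselect (exists2 y, S y & f y = A); [exists y|exists 1].
  exists [seq r A | A <- finmap.enum_fset F] => x Sx; exists (r (f x)).
    apply: map_f; have : left_cosets Q S (f x) by exists x.
    by rewrite FE.
  by apply: rP; exists x.
exists [seq x^-1 | x <- Z] => s Ss; have [y yZ e] := ZE _ (subV sS Ss).
exists y^-1; first exact: map_f.
have : f y s^-1 by rewrite e; exists 1; rewrite ?mulg1 //; exact: sub1.
move=> [q Qq yq]; rewrite invgK -[s]invgK -yq invgM mulgVK; exact: subV.
Qed.

Definition mulS N Q : set Gam := [set x | exists2 n, N n & Q (n^-1 * x)].

Lemma mulS_subl N Q : is_subgroup Q -> N `<=` mulS N Q.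
Proof. by move=> sQ x Nx; exists x => //; rewrite mulVg; exact: sub1. Qed.

Lemma mulS_subr N Q : is_subgroup N -> Q `<=` mulS N Q.
Proof. by move=> sN x Qx; exists 1; [exact: sub1|rewrite invg1 mul1g]. Qed.

Lemma mulS_group N Q T : is_subgroup N -> is_subgroup Q -> is_normal_in N T -> Q `<=` T -> is_subgroup (mulS N Q).
Proof.
move=> sN sQ [NT nN] QT; apply: mk_subgroup.
- by apply: mulS_subl => //; exact: sub1.
- move=> x y [n Nn Qx] [m Nm Qy]; pose q := n^-1 * x.
  exists (n * (m ^ q^-1)); first by apply: subM => //; apply: nN => //; apply: QT; exact: subV.
  have -> : (n * m ^ q^-1)^-1 * (x * y) = q * (m^-1 * y) by rewrite /q /conjg; grp.
  exact: subM.
- move=> x [n Nn Qx]; pose q := n^-1 * x.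
  exists (n^-1 ^ q); first by apply: nN; [exact: subV|exact: QT].
  have -> : (n^-1 ^ q)^-1 * x^-1 = q^-1 by rewrite /q /conjg; grp.
  exact: subV.
Qed.

(** Since N0 has finite index, members containing N0 are measured by how many of the representatives
    in l they contain. One with the largest count absorbs any N', because [mulS N N'] cannot contain
    more. This serves for solvable normal subgroups and again, with closedness added, for the
    solvable radical. *)
Lemma largest S N0 (P : set Gam -> Prop) : P N0 -> ficov N0 S -> (forall N, P N -> is_subgroup N /\ N `<=` S) ->
  (forall N N', P N -> P N' -> N0 `<=` N -> P (mulS N N')) ->
  exists N, P N /\ forall N', P N' -> N' `<=` N.
Proof.
move=> P0 [l lP] Pg PM.
pose cnt N := count (fun x => `[< N x >]) l.
pose Q c := `[< exists N, [/\ P N, N0 `<=` N & cnt N = c] >].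
have Qex : exists c, Q c by exists (cnt N0); apply/asboolP; exists N0; split => // x.
have Qb c : Q c -> (c <= size l)%N by move=> /asboolP[N [_ _ <-]]; exact: count_size.
case: (ex_maxnP Qex Qb) => c /asboolP[N [PN N0N cN]] max; exists N; split => // N' PN' y N'y.
have [sN _] := Pg N PN; have [sN' _] := Pg N' PN'.
have PM1 := PM N N' PN PN' N0N; have [sM MS] := Pg _ PM1.
have NM : N `<=` mulS N N' by exact: mulS_subl.
have My : mulS N N' y by exact: mulS_subr.
have [x xl N0x] := lP _ (MS _ My).
have Mx : mulS N N' x.
  have -> : x = (y * x^-1)^-1 * y by grp.
  by apply: subM => //; apply: subV => //; apply: NM; exact: N0N.
suff Nx : N x.
  have -> : y = (y * x^-1) * x by grp.
  by apply: subM => //; exact: N0N.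
apply: contrapT => nNx.
have : (cnt (mulS N N') <= cnt N)%N.
  by rewrite cN; apply: max; apply/asboolP; exists (mulS N N'); split => // z /N0N/NM.
apply/negP; rewrite -ltnNge /cnt; elim: l xl {lP Qb max cN cnt Q Qex} => [//|w l IH].
rewrite inE => /orP[/eqP <-|xl] /=.
  have -> : `[< N x >] = false by apply/asboolP.
  have -> : `[< mulS N N' x >] by apply/asboolP.
  rewrite add0n add1n ltnS; apply: sub_count => z /asboolP Nz; apply/asboolP; exact: NM.
apply: (leq_trans (n := (`[< N w >] + count (fun x => `[< mulS N N' x >]) l)%N)).
  by rewrite ltn_add2l; exact: IH.
rewrite leq_add2r; case: asboolP => // /NM h; by rewrite (asboolT h).
Qed.

Definition core T Q : set Gam := [set g | T g /\ forall h, T h -> Q (h * g * h^-1)].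

Lemma core_sub T Q : is_subgroup T -> core T Q `<=` Q.
Proof. by move=> sT g [_ /(_ 1 (sub1 sT))]; rewrite mul1g invg1 mulg1. Qed.

Lemma core_group T Q : is_subgroup T -> is_subgroup Q -> is_subgroup (core T Q).
Proof.
move=> sT sQ; apply: mk_subgroup.
- by split=> [|h _]; rewrite ?mulg1 ?mulgV; exact: sub1.
- move=> x y [Tx cx] [Ty cy]; split=> [|h Th]; first exact: subM.
  have -> : h * (x * y) * h^-1 = (h * x * h^-1) * (h * y * h^-1) by grp.
  by apply: subM => //; [exact: cx|exact: cy].
- move=> x [Tx cx]; split=> [|h Th]; first exact: subV.
  have -> : h * x^-1 * h^-1 = (h * x * h^-1)^-1 by grp.
  by apply: subV => //; exact: cx.
Qed.

Lemma core_conj T Q g h : is_subgroup T -> T g -> core T Q h -> core T Q (g * h * g^-1).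
Proof.
move=> sT Tg [Th ch]; split=> [|k Tk]; first by apply: subM => //; [exact: subM|exact: subV].
have -> : k * (g * h * g^-1) * k^-1 = (k * g) * h * (k * g)^-1 by grp.
by apply: ch; exact: subM.
Qed.

Lemma core_normal T Q : is_subgroup T -> is_normal_in (core T Q) T.
Proof.
move=> sT; split=> [x []//|x y cx Ty]; rewrite /conjg.
by have := core_conj sT (subV sT Ty) cx; rewrite invgK !mulgA.
Qed.

(** F g records how g^-1 moves the listed coset representatives; elements with the same record agree
    modulo the core. *)
Lemma core_fin T Q : is_subgroup T -> is_subgroup Q -> Q `<=` T -> ficov Q T ->
  exists (I : finType) (F : Gam -> I), forall x y, T x -> T y -> F x = F y -> core T Q (x^-1 * y).
Proof.
move=> sT sQ QT [l lP].
have /choice[f fP] g : exists i : 'I_(size l), T g -> Q (g * (nth 1 l i)^-1).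
  have [Tg|nTg] := pselect (T g).
    have [x xl Qx] := lP g Tg; have xs : (index x l < size l)%N by rewrite index_mem.
    by exists (Ordinal xs); rewrite nth_index.
  have [x xl Qx] := lP 1 (sub1 sT); have xs : (index x l < size l)%N by rewrite index_mem.
  by exists (Ordinal xs).
exists {ffun 'I_(size l) -> 'I_(size l)}, (fun g => [ffun i : 'I_(size l) => f (nth 1 l i * g^-1)]).
move=> x y Tx Ty /ffunP Fxy; split=> [|h Th]; first by apply: subM => //; exact: subV.
have := fP h Th; set a := nth _ _ _ => Qa.
have Ta : T a.
  have -> : a = (h * a^-1)^-1 * h by grp.
  by apply: subM => //; apply: subV => //; exact: QT.
have Qi : Q (a * (x^-1 * y) * a^-1).
  have TV g : T g -> T (a * g^-1) by move=> Tg; apply: subM => //; exact: subV.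
  have := subM sQ (fP _ (TV x Tx)) (subV sQ (fP _ (TV y Ty))).
  have := Fxy (f h); rewrite !ffunE -/a => ->; set b := nth _ _ _.
  by have -> : a * x^-1 * b^-1 * (a * y^-1 * b^-1)^-1 = a * (x^-1 * y) * a^-1 by grp.
have -> : h * (x^-1 * y) * h^-1 = (h * a^-1) * (a * (x^-1 * y) * a^-1) * (h * a^-1)^-1 by grp.
by apply: subM => //; [exact: subM|exact: subV].
Qed.

Lemma core_ficov T Q : is_subgroup T -> is_subgroup Q -> Q `<=` T -> ficov Q T -> ficov (core T Q) T.
Proof.
move=> sT sQ QT fc; have [I [F FP]] := core_fin sT sQ QT fc.
have /choice[r rP] t : exists x, (exists y, T y /\ F y = t) -> T x /\ F x = t.
  by have [[y yP]|n] := pselect (exists y, T y /\ F y = t); [exists y|exists 1].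
exists [seq (r t)^-1 | t : I] => s Ts; exists (r (F s^-1))^-1.
  by apply/mapP; exists (F s^-1); rewrite ?mem_enum.
have TsV := subV sT Ts.
have [Tr Fr] : T (r (F s^-1)) /\ F (r (F s^-1)) = F s^-1 by apply: rP; exists s^-1.
by have := FP _ _ TsV Tr (esym Fr); rewrite !invgK.
Qed.

Lemma fin_finidx (T : finType) (f : Gam -> T) D : is_subgroup D ->
  (forall x y, f x = f y -> D (x^-1 * y)) -> finidx D.
Proof.
move=> sD fD; pose p x : pred T := fun t => `[< exists y, f y = t /\ D (x^-1 * y) >].
pose c x := [pick t | p x t].
have cP x y : c x = c y <-> D (x^-1 * y).
  split=> [|Dxy].
    rewrite /c; case: pickP => [t /asboolP[u [ut Du]]|/(_ (f x))]; last first.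
      by case/negP; apply/asboolP; exists x; rewrite mulVg; split => //; exact: sub1.
    case: pickP => [t' /asboolP[v [vt Dv]]|//] [tt'].
    have -> : x^-1 * y = (x^-1 * u) * (u^-1 * v) * (y^-1 * v)^-1 by grp.
    apply: subM => //; last exact: subV.
    by apply: subM => //; apply: fD; rewrite ut vt tt'.
  apply: eq_pick => t; apply/asboolP/asboolP => -[u [ut Du]]; exists u; split => //.
    have -> : y^-1 * u = (x^-1 * y)^-1 * (x^-1 * u) by grp.
    by apply: subM => //; exact: subV.
  have -> : x^-1 * u = (x^-1 * y) * (y^-1 * u) by grp.
  exact: subM.
pose I := [set t : option T | `[< exists x, c x = t >]]%SET.
have cI x : c x \in I by rewrite inE; apply/asboolP; exists x.
have /choice[r rP] (i : 'I_#|I|) : exists x, c x = enum_val i.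
  by have := enum_valP i; rewrite inE => /asboolP.
exists #|I|, (fun x => enum_rank_in (cI 1) (c x)), r; split.
  by move=> i; rewrite rP enum_valK_in.
move=> x y; rewrite -cP; split=> [e|-> //].
by rewrite -(enum_rankK_in (cI 1) (cI x)) e enum_rankK_in.
Qed.

Lemma core_finidx Q : is_subgroup Q -> ficov Q setT -> finidx (core setT Q).
Proof.
move=> sQ fc; have sT : is_subgroup [set: Gam] by [].
have [I [F FP]] := core_fin sT sQ (@subsetT _ _) fc.
by apply: (@fin_finidx _ F); [exact: core_group|move=> x y; exact: FP].
Qed.


Lemma solv_ext (N M : set Gam) : is_solvable N -> is_subgroup M -> is_normal_in N M -> abelian_quotient N M -> is_solvable M.
Proof.
move=> [k [S [S0 Sk Sg Sn]]] sM nNM aNM.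
exists k.+1, (fun i => if (i <= k)%N then S i else M); split => //; first by rewrite ltnn.
  by move=> i _; case: ifP => // ik; exact: Sg.
move=> i; rewrite ltnS => ik; rewrite ik; case: ifP => [ik'|/negbT]; first exact: Sn.
rewrite -leqNgt => ki; have e : i = k by apply/eqP; rewrite eqn_leq ik.
by rewrite e Sk.
Qed.

Lemma solv_sub (H M : set Gam) : is_subgroup H -> H `<=` M -> is_solvable M -> is_solvable H.
Proof.
move=> sH HM [k [S [S0 Sk Sg Sn]]]; exists k, (fun i => S i `&` H); split.
- rewrite S0; apply/seteqP; split=> x; first by case.
  by move=> ->; split => //; exact: sub1.
- by rewrite Sk; apply/setIidPr.
- move=> i ik; have sS := Sg i ik; apply: mk_subgroup.
  + by split; exact: sub1.
  + by move=> x y [? ?] [? ?]; split; exact: subM.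
  + by move=> x [? ?]; split; exact: subV.
- move=> i ik; have [[SS SJ] Sa] := Sn i ik; split; first split.
  + by move=> x [Sx Hx]; split => //; exact: SS.
  + move=> x y [Sx Hx] [Sy Hy]; split; first exact: SJ.
    by rewrite /conjg; apply: subM => //; [exact: subV|exact: subM].
  + move=> x y [Sx Hx] [Sy Hy]; split; first exact: Sa.
    by rewrite /commg /conjg; apply: subM => //; [exact: subV|apply: subM => //; [exact: subV|exact: subM]].
Qed.

Lemma conj_group N t : is_subgroup N -> is_subgroup [set x | N (t * x * t^-1)].
Proof.
move=> sN; apply: mk_subgroup => /=.
- by rewrite mulg1 mulgV; exact: sub1.
- move=> x y Sx Sy; have -> : t * (x * y) * t^-1 = (t * x * t^-1) * (t * y * t^-1) by grp.
  exact: subM.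
- move=> x Sx; have -> : t * x^-1 * t^-1 = (t * x * t^-1)^-1 by grp.
  exact: subV.
Qed.

Lemma solv_conj N t : is_solvable N -> is_solvable [set x | N (t * x * t^-1)].
Proof.
move=> [k [S [S0 Sk Sg Sn]]]; exists k, (fun i => [set x | S i (t * x * t^-1)]); split.
- rewrite S0; apply/seteqP; split=> x /=; last by move=> ->; rewrite mulg1 mulgV.
  move=> /(congr1 (fun y => t^-1 * y * t)); have -> : t^-1 * (t * x * t^-1) * t = x by grp.
  by move=> ->; rewrite mulg1 mulVg.
- by rewrite Sk.
- by move=> i ik; apply: conj_group; exact: Sg.
- move=> i ik; have [[SS SJ] Sa] := Sn i ik; split; first split => /=.
  + by move=> x /=; exact: SS.
  + move=> x y Sx Sy; have -> : t * x ^ y * t^-1 = (t * x * t^-1) ^ (t * y * t^-1) by rewrite /conjg; grp.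
    exact: SJ.
  + move=> x y Sx Sy /=; have -> : t * [~ x, y] * t^-1 = [~ t * x * t^-1, t * y * t^-1].
      by rewrite /commg /conjg; grp.
    exact: Sa.
Qed.

Section Mod.
Variables N T : set Gam.
Hypotheses (sN : is_subgroup N) (sT : is_subgroup T) (nN : is_normal_in N T).

Lemma normJ x y : N x -> T y -> N (y^-1 * x * y).
Proof. by move=> Nx Ty; have := nN.2 x y Nx Ty; rewrite /conjg mulgA. Qed.

Lemma normJV x y : N x -> T y -> N (y * x * y^-1).
Proof. by move=> Nx Ty; have := normJ Nx (subV sT Ty); rewrite invgK. Qed.

Lemma mulSP Q x : Q `<=` T -> mulS N Q x <-> exists2 q, Q q & N (q^-1 * x).
Proof.
move=> QT; split=> [[n Nn Qx]|[q Qq Nx]].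
  exists (n^-1 * x) => //; have -> : (n^-1 * x)^-1 * x = (n^-1 * x)^-1 * n * (n^-1 * x) by grp.
  by apply: normJ => //; exact: QT.
exists (x * q^-1); last by have -> : (x * q^-1)^-1 * x = q by grp.
have -> : x * q^-1 = q * (q^-1 * x) * q^-1 by grp.
by apply: normJV => //; exact: QT.
Qed.

Lemma modM x x' y y' : T y -> N (x^-1 * x') -> N (y^-1 * y') -> N ((x * y)^-1 * (x' * y')).
Proof.
move=> Ty Nx Ny; have -> : (x * y)^-1 * (x' * y') = (y^-1 * (x^-1 * x') * y) * (y^-1 * y') by grp.
by apply: subM => //; exact: normJ.
Qed.

Lemma modV x x' : T x -> N (x^-1 * x') -> N ((x^-1)^-1 * x'^-1).
Proof.
move=> Tx Nx; have -> : (x^-1)^-1 * x'^-1 = x * (x^-1 * x')^-1 * x^-1 by grp.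
by apply: normJV => //; exact: subV.
Qed.

Lemma modR x x' y y' : T x -> T y -> N (x^-1 * x') -> N (y^-1 * y') -> N ([~ x, y]^-1 * [~ x', y']).
Proof.
move=> Tx Ty Nx Ny; rewrite /commg /conjg.
apply: modM; [|exact: modV|apply: modM; [exact: subM|exact: modV|exact: modM]].
by apply: subM => //; [exact: subV|exact: subM].
Qed.

(** The series of Q multiplied by N continues the series of N: by [modR], commutators can be
    computed modulo N. *)
Lemma mulS_solv Q : is_solvable N -> is_subgroup Q -> Q `<=` T -> is_solvable Q -> is_solvable (mulS N Q).
Proof.
move=> solN sQ QT [k [S [S0 Sk Sg Sn]]].
have ST i : (i <= k)%N -> S i `<=` T.
  move=> ik; apply: subset_trans QT; rewrite -Sk.
  have : forall j, (i + j <= k)%N -> S i `<=` S (i + j)%N.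
    elim=> [|j IH] jk; first by rewrite addn0.
    rewrite addnS in jk *; apply: subset_trans (IH (ltnW jk)) _.
    by have [[]] := Sn _ jk.
  by move=> /(_ (k - i)%N); rewrite subnKC //; exact.
suff h i : (i <= k)%N -> is_solvable (mulS N (S i)) by rewrite -Sk; exact: h.
elim: i => [_|i IH ik].
  rewrite S0; have -> // : mulS N [set 1] = N.
  apply/seteqP; split=> x; last by move=> Nx; exists x; rewrite ?mulVg.
  by move=> [n Nn /= e]; rewrite -(mulVKg n x) e mulg1.
have gM j : (j <= k)%N -> is_subgroup (mulS N (S j)).
  by move=> jk; apply: mulS_group nN _ => //; [exact: Sg|exact: ST].
have [[SS SJ] Sa] := Sn i ik; have ik' := ltnW ik.
have ab (x y : Gam) : mulS N (S i.+1) x -> mulS N (S i.+1) y -> mulS N (S i) [~ x, y].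
  move=> /mulSP-/(_ (ST _ ik))[q Sq Nx] /mulSP-/(_ (ST _ ik))[r Sr Ny].
  apply/mulSP; first exact: ST.
  by exists [~ q, r]; [exact: Sa|apply: modR => //; exact: ST ik _ _].
apply: (solv_ext (IH ik')) => //; first exact: gM.
have sub : mulS N (S i) `<=` mulS N (S i.+1) by move=> x [n Nn Sx]; exists n => //; exact: SS.
split => // x y Mx My; have -> : x ^ y = x * [~ x, y] by rewrite /commg mulgA mulgV mul1g.
by apply: subM => //; [exact: gM|apply: ab => //; exact: sub].
Qed.

(** The centraliser of C modulo N, inside T. *)
Definition cenN (C : set Gam) : set Gam := [set x | T x /\ forall y, C y -> N [~ x, y]].

Lemma cenN_group C : C `<=` T -> is_subgroup (cenN C).
Proof.
move=> CT; apply: mk_subgroup.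
- split=> [|y _]; first exact: sub1.
  by have -> : [~ 1, y] = 1; [rewrite /commg /conjg; grp|exact: sub1].
- move=> x y [Tx cx] [Ty cy]; split=> [|z Cz]; first exact: subM.
  have -> : [~ x * y, z] = (y^-1 * [~ x, z] * y) * [~ y, z] by rewrite /commg /conjg; grp.
  by apply: subM => //; [apply: normJ => //; exact: cx|exact: cy].
- move=> x [Tx cx]; split=> [|z Cz]; first exact: subV.
  have -> : [~ x^-1, z] = x * [~ x, z]^-1 * x^-1 by rewrite /commg /conjg; grp.
  by apply: normJV => //; apply: subV => //; exact: cx.
Qed.

Lemma cenN_sub C : C `<=` T -> N `<=` cenN C.
Proof.
move=> CT x Nx; split=> [|y Cy]; first exact: nN.1.
by rewrite /commg; apply: subM => //; [exact: subV|apply: nN.2 => //; exact: CT].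
Qed.
End Mod.

(** In an infinite cyclic step, the largest solvable normal subgroup N of S i is normal in T by
    uniqueness, and it has finite index in S i. The centre, modulo N, of the centraliser of a is
    then solvable and contains N and a, so it has finite index in T. *)
Lemma vp_solvable : virtually_polycyclic Gam -> exists N : set Gam,
  [/\ is_subgroup N, is_normal_in N setT, is_solvable N & ficov N setT].
Proof.
move=> [k [S [S0 Sk Sg Sn]]].
pose P T N := [/\ is_subgroup N, is_normal_in N T & is_solvable N].
suff h i : (i <= k)%N -> exists Q, [/\ is_subgroup Q, Q `<=` S i, is_solvable Q & ficov Q (S i)].
  have [Q [sQ QS solQ fQ]] := h k (leqnn k); have sT : is_subgroup [set: Gam] by [].
  exists (core setT Q); split; [exact: core_group|exact: core_normal|
    apply: solv_sub solQ; [exact: core_group|exact: core_sub]|].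
  by apply: core_ficov => //; rewrite -Sk.
elim: i => [_|i IH ik].
  exists [set 1]; rewrite S0.
  have s1 : is_subgroup [set 1 : Gam] by split=> // x y -> -> /=; rewrite mulgV.
  split => //; last exact: ficov_refl.
  by exists 0%N, (fun=> [set 1]); split.
have [Q [sQ QS solQ fQ]] := IH (ltnW ik); have sS := Sg i (ltnW ik); have sT := Sg i.+1 ik.
set T := S i.+1 in sT *; have [nST [fq|[_ [a Ta cyc]]]] := Sn i ik.
  exists Q; split => //; first exact: subset_trans nST.1.
  by apply: ficov_trans fQ _; exact: finite_quotient_ficov.
have PN0 : P (S i) (core (S i) Q).
  by split; [exact: core_group|exact: core_normal|apply: solv_sub solQ; [exact: core_group|exact: core_sub]].
have [N [[sN nNS solN] max]] : exists N, P (S i) N /\ forall N', P (S i) N' -> N' `<=` N.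
  apply: (largest PN0 (core_ficov sS sQ QS fQ)) => [N [sN [NS _] _]//|N N' [sN nN solN] [sN' nN' solN'] _].
  have gM : is_subgroup (mulS N N') by exact: mulS_group nN nN'.1.
  split => //; last exact: (mulS_solv sN sS nN solN sN' nN'.1 solN').
  split=> [x [n Nn N'x]|x y [n Nn N'x] Sy].
    by rewrite -(mulVKg n x); apply: subM => //; [exact: nN.1|exact: nN'.1].
  exists (n ^ y); first exact: nN.2.
  have -> : (n ^ y)^-1 * x ^ y = (n^-1 * x) ^ y by rewrite /conjg; grp.
  exact: nN'.2.
have NT : is_normal_in N T.
  split=> [|x y Nx Ty]; first exact: (subset_trans nNS.1 nST.1).
  apply: (max [set z | N (y * z * y^-1)]); last first.
    by rewrite /= /conjg; have -> : y * (y^-1 * (x * y)) * y^-1 = x by grp.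
  split; [exact: conj_group| |exact: solv_conj].
  split=> [z /= Nz|z r /= Nz Sr].
    have -> : z = y^-1 * (y * z * y^-1) * y by grp.
    by apply: (normJ nST) => //; exact: nNS.1.
  have -> : y * z ^ r * y^-1 = (y * z * y^-1) ^ (y * r * y^-1) by rewrite /conjg; grp.
  by apply: nNS.2 => //; exact: (normJV sT nST).
have fN : ficov N (S i).
  by apply: ficov_sub (core_ficov sS sQ QS fQ) => //; exact: max.
pose C := cenN N T [set a]; pose D := cenN N T C.
have aT : [set a] `<=` T by move=> _ ->.
have CT : C `<=` T by move=> x [].
have Ca : C a.
  by split=> // _ ->; have -> : [~ a, a] = 1; [rewrite /commg /conjg; grp|exact: sub1].
have sD : is_subgroup D by exact: cenN_group.
have DC : D `<=` C by move=> x [Tx cx]; split=> // _ ->; exact: cx.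
have Da : D a.
  split=> // y [Ty /(_ a erefl) cy]; have -> : [~ a, y] = [~ y, a]^-1 by rewrite /commg /conjg; grp.
  exact: subV.
have ND : N `<=` D by exact: cenN_sub.
exists D; split => //; first by move=> x [].
  apply: (solv_ext solN sD) => [|x y [Tx cx] /DC Cy]; last exact: cx.
  by split=> // x y Nx [Ty _]; exact: NT.2.
have [l lP] := fN; exists l => s Ts; have [m [Sm|Sm]] := cyc s Ts; have [x xl Nx] := lP _ Sm; exists x => //.
  have -> : s * x^-1 = a ^+ m * (a ^- m * s * x^-1) by grp.
  by apply: subM => //; [exact: subX|exact: ND].
have -> : s * x^-1 = a ^- m * (a ^+ m * s * x^-1) by grp.
by apply: subM => //; [apply: subV => //; exact: subX|exact: ND].
Qed.

End Subgroups.

(** * Linear parts as polynomials in a single one *)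

Section Algebra.
Variables (R : realType) (n : nat).
Local Notation C := (complex R).
Local Notation mxR := 'M[R]_n.+1.
Local Notation mxCx := 'M[C]_n.+1.
Implicit Types (M N A B : mxR) (P : mxCx) (d e : 'rV[C]_n.+1).

Definition inalg M N := exists p, N = horner_mx M p.
Definition dgz P d M := P \in unitmx /\ P *m mxC M = diag_mx d *m P.

Lemma cdiag_diagonalizable M : cdiag M <-> diagonalizable (mxC M).
Proof.
split=> [[P [d [Pu PM]]]|[P Pu /similar_diagPex[d /(similarP Pu) PM]]]; last by exists P, d.
by exists P => //; apply/similar_diagPex; exists d; apply/similarP.
Qed.

Lemma codiag M N : cdiag M -> cdiag N -> M *m N = N *m M -> exists P d e, dgz P d M /\ dgz P e N.
Proof.
move=> /cdiag_diagonalizable dM /cdiag_diagonalizable dN MN.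
have [|P Pu all2] := (codiagonalizableP [:: mxC M; mxC N]).1.
  have c : comm_mx (mxC M) (mxC N) by rewrite /comm_mx -!mxCM MN.
  split=> [f g|f]; rewrite !inE; last by move=> /orP[] /eqP ->.
  by move=> /orP[] /eqP -> /orP[] /eqP -> //; exact: esym c.
move: all2; rewrite /= => /and3P[/similar_diagPex[d /(similarP Pu) Pd] /similar_diagPex[e /(similarP Pu) Pe] _].
by exists P, d, e.
Qed.

Lemma dgzE P d M : dgz P d M -> mxC M = invmx P *m diag_mx d *m P.
Proof. by move=> [Pu PM]; rewrite -mulmxA -PM mulKmx. Qed.

Lemma dgzM P d e M N : dgz P d M -> dgz P e N -> dgz P (\row_i (d 0 i * e 0 i)) (M *m N).
Proof.
move=> [Pu PM] [_ PN]; split=> //; rewrite mxCM mulmxA PM -mulmxA PN mulmxA mulmx_diag.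
by [].
Qed.

Lemma dgzX P d M k : dgz P d M -> dgz P (\row_i (d 0 i ^+ k)) (M ^+ k).
Proof.
move=> [Pu PM]; split=> //; rewrite mxCX (diag_exp k Pu PM) -mulmxA mulKVmx //.
Qed.

Lemma dgz1 : dgz 1%:M (const_mx 1) 1.
Proof. by split; [exact: unitmx1|rewrite mxC1 diag_const_mx]. Qed.

Lemma lagrange (s : seq 'I_n.+1) (d e : 'rV[C]_n.+1) : (forall i j, d 0 i = d 0 j -> e 0 i = e 0 j) ->
  exists p : {poly C}, forall i, i \in s -> p.[d 0 i] = e 0 i.
Proof.
move=> de; elim: s => [|i s [p pE]]; first by exists 0.
have [[j js dij]|nj] := pselect (exists2 j, j \in s & d 0 j = d 0 i).
  by exists p => k; rewrite inE => /orP[/eqP ->|/pE//]; rewrite -dij pE // (de _ _ dij).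
pose q := \prod_(j <- s) ('X - (d 0 j)%:P).
have qi : q.[d 0 i] != 0.
  rewrite horner_prod prodf_seq_neq0; apply/allP => j js /=.
  by rewrite hornerXsubC subr_eq0; apply: contra_notN nj => /eqP ->; exists j.
exists (p + ((e 0 i - p.[d 0 i]) / q.[d 0 i]) *: q) => k.
rewrite inE hornerD hornerZ => /orP[/eqP ->|ks]; first by rewrite divfK // addrC subrK.
have -> : q.[d 0 k] = 0.
  apply/eqP; rewrite horner_prod prodf_seq_eq0; apply/hasP; exists k => //=.
  by rewrite hornerXsubC subrr.
by rewrite pE // mulr0 addr0.
Qed.

(** Lagrange interpolation on the eigenvalues gives a complex polynomial; taking real parts of its
    coefficients is harmless because both matrices are real. *)
Lemma interp P d e M N : dgz P d M -> dgz P e N -> (forall i j, d 0 i = d 0 j -> e 0 i = e 0 j) ->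
  inalg M N.
Proof.
move=> dM dN /(lagrange (enum 'I_n.+1))[p pE].
pose q : {poly R} := \poly_(k < size p) complex.Re p`_k; exists q.
have pM : mxC N = \sum_(k < size p) p`_k *: mxC (M ^+ k).
  rewrite (dgzE dN); have [Pu PM] := dM.
  have -> : diag_mx e = \sum_(k < size p) p`_k *: diag_mx (\row_i (d 0 i ^+ k)).
    apply/matrixP => i j; rewrite summxE !mxE -(pE i) ?mem_enum //.
    rewrite horner_coef -sumrMnl; apply: eq_bigr => k _.
    by rewrite !mxE; case: eqP; rewrite ?mulr1n ?mulr0n ?mulr0.
  rewrite mulmx_sumr mulmx_suml; apply: eq_bigr => k _.
  by rewrite -scalemxAr -scalemxAl (dgzE (dgzX k dM)).
have -> : horner_mx M q = \sum_(k < size p) complex.Re p`_k *: M ^+ k.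
  rewrite /q poly_def linear_sum; apply: eq_bigr => k _.
  by rewrite linearZ /= rmorphXn /= horner_mx_X.
apply/matrixP => i j; have := congr1 (fun Z : mxCx => complex.Re (Z i j)) pM.
rewrite mxE /= => ->; rewrite !summxE raddf_sum /=; apply: eq_bigr => k _.
rewrite !mxE; by case: (p`_k) => a b /=; rewrite mulr0 subr0.
Qed.

Lemma dgz_horner P d M p : dgz P d M -> dgz P (\row_i (map_poly (real_complex R) p).[d 0 i]) (horner_mx M p).
Proof. by move=> [Pu PM]; split => //; exact: cdiag_horner. Qed.

Lemma dgz_cdiag P d M : dgz P d M -> cdiag M.
Proof. by move=> [Pu PM]; exists P, d. Qed.

Lemma inalg_refl M : inalg M M.
Proof. by exists 'X; rewrite horner_mx_X. Qed.

Lemma inalg1 M : inalg M 1.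
Proof. by exists 1; rewrite rmorph1. Qed.

Lemma inalgM M A B : inalg M A -> inalg M B -> inalg M (A *m B).
Proof. by move=> [p ->] [q ->]; exists (p * q); rewrite rmorphM. Qed.

Lemma inalg_trans M N A : inalg M N -> inalg N A -> inalg M A.
Proof.
move=> [p ->] [q ->]; exists (q \Po p); elim/poly_ind: q => [|q c IH]; first by rewrite comp_poly0 !rmorph0.
by rewrite comp_polyD comp_polyM comp_polyX comp_polyC !rmorphD !rmorphM /= IH horner_mx_X !horner_mx_C.
Qed.

Lemma inalg_conj M N A B : A *m B = 1 -> inalg M N -> inalg (B *m M *m A) (B *m N *m A).
Proof.
move=> AB [p ->]; exists p; have [Au Bu] := mulmx1_unit AB.
have -> : B = invmx A by rewrite -[LHS]mul1mx -(mulVmx Au) -mulmxA AB mulmx1.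
by rewrite horner_mx_uconjC.
Qed.

Lemma inalgV P d M N : dgz P d M -> inalg M N -> N \in unitmx -> inalg M (invmx N).
Proof.
move=> dM [p NE] Nu; have dN := dgz_horner p dM; rewrite -NE in dN.
set e := \row_i _ in dN; have [Pu PN] := dN.
have NuC : mxC N \in unitmx by rewrite map_unitmx.
have e0 := diag_unit Pu NuC PN.
have de i j : d 0 i = d 0 j -> e 0 i = e 0 j by move=> dij; rewrite !mxE dij.
clearbody e.
have dNV : dgz P (\row_i (e 0 i)^-1) (invmx N).
  split => //; have -> : mxC (invmx N) = invmx (mxC N) by exact: map_invmx.
  apply: (canLR (mulmxK NuC)); rewrite -mulmxA PN mulmxA mulmx_diag.
  have -> : \row_i ((\row_i0 (e 0 i0)^-1) 0 i * e 0 i) = const_mx 1.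
    by apply/rowP => i; rewrite !mxE mulVf.
  by rewrite diag_const_mx mul1mx.
by apply: (interp dM dNV) => i j dij; rewrite !mxE (de _ _ dij).
Qed.

(** A row of Q pulled back through B is an eigenvector of M for the same eigenvalue. *)
Lemma dgz_eig P d M Q e A B : dgz P d M -> dgz Q e (B *m M *m A) -> A *m B = 1 ->
  forall i, exists j, e 0 i = d 0 j.
Proof.
move=> dM [Qu QN] AB i; have [Pu _] := dM.
pose w := row i Q *m mxC B *m invmx P.
have wd : w *m diag_mx d = e 0 i *: w.
  have e1 : row i Q *m mxC (B *m M *m A) = e 0 i *: row i Q.
    by rewrite -row_mul QN row_mul row_diag_mx -scalemxAl -rowE.
  have PV : invmx P *m diag_mx d = mxC M *m invmx P.
    by rewrite -[RHS]mul1mx -(mulVmx Pu) -!mulmxA (mulmxA P) dM.2 -mulmxA mulmxV // mulmx1.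
  rewrite /w -mulmxA PV.
  have -> : row i Q *m mxC B *m (mxC M *m invmx P) = row i Q *m mxC (B *m M *m A) *m mxC B *m invmx P.
    by rewrite !mxCM !mulmxA -(mulmxA _ (mxC A)) -mxCM AB mxC1 mulmx1.
  by rewrite e1 -!scalemxAl.
have w0 : w != 0.
  apply/eqP => w0; have : row i Q = 0.
    have := congr1 (fun v => v *m P *m mxC A) w0; rewrite !mul0mx /w mulmxKV // -mulmxA -mxCM (mulmx1C AB) mxC1 mulmx1.
    by [].
  rewrite rowE => /(congr1 (mulmx^~ (invmx Q))); rewrite mulmxK // mul0mx => /rowP/(_ i).
  by rewrite !mxE !eqxx => /eqP; rewrite oner_eq0.
have [j wj] : exists j, w 0 j != 0.
  apply/existsP; apply: contraNT w0; rewrite negb_exists => /forallP h.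
  by apply/eqP/rowP => j; rewrite [RHS]mxE; apply/eqP; have := h j; rewrite negbK.
exists j; have := congr1 (fun v : 'rV_n.+1 => v 0 j) wd.
by rewrite mul_mx_diag mxE [RHS]mxE mulrC => /(mulIf wj).
Qed.

(** No two distinct eigenvalues differ by a root of unity; such a matrix is a polynomial in each of
    its positive powers, by [tf_exp]. *)
Definition tfree d := forall i j k, (0 < k)%N -> d 0 i ^+ k = d 0 j ^+ k -> d 0 i = d 0 j.

Definition tf M := exists P d, dgz P d M /\ tfree d.

Lemma tf_any P d M : tf M -> dgz P d M -> tfree d.
Proof.
move=> [Q [e [dQ te]]] dP i j k k0.
have dP' : dgz P d (1 *m M *m 1) by rewrite mul1mx mulmx1.
have [a ->] := dgz_eig dQ dP' (mulmx1 _) i.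
by have [b ->] := dgz_eig dQ dP' (mulmx1 _) j; exact: te.
Qed.

Lemma tf_exp M k : (0 < k)%N -> tf M -> tf (M ^+ k) /\ inalg (M ^+ k) M.
Proof.
move=> k0 [P [d [dM td]]]; have dk := dgzX k dM; split.
  exists P, (\row_i d 0 i ^+ k); split => // i j m m0; rewrite !mxE -!exprM => h.
  by rewrite (td i j (k * m)%N) // muln_gt0 k0.
by apply: (interp dk dM) => i j; rewrite !mxE; exact: td.
Qed.

(* E is the product of the exponents witnessing torsion, over all pairs of indices. *)
Lemma torsion_exp d : exists2 E, (0 < E)%N & forall i j,
  (exists2 k, (0 < k)%N & d 0 i ^+ k = d 0 j ^+ k) -> d 0 i ^+ E = d 0 j ^+ E.
Proof.
have /choice[f fP] (x : 'I_n.+1 * 'I_n.+1) : exists k, (0 < k)%N /\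
    ((exists2 k, (0 < k)%N & d 0 x.1 ^+ k = d 0 x.2 ^+ k) -> d 0 x.1 ^+ k = d 0 x.2 ^+ k).
  have [[k k0 kd]|nk] := pselect (exists2 k, (0 < k)%N & d 0 x.1 ^+ k = d 0 x.2 ^+ k).
    by exists k.
  by exists 1%N; split => // h.
exists (\prod_x f x)%N; first by apply: prodn_gt0 => x; case: (fP x).
move=> i j h; rewrite (bigD1 (i, j)) //= !exprM; congr (_ ^+ _).
by have [_ /(_ h)] := fP (i, j).
Qed.
End Algebra.

Section Generic.
Variables (R : realType) (n : nat) (Gam : groupType) (A : Gam -> 'M[R]_n.+1).
Hypotheses (A1 : A 1%g = 1) (AM : forall g h, A (g * h)%g = A h *m A g).
Hypothesis Apow : forall g, exists2 m, (0 < m)%N & cdiag (A (g ^+ m)%g).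

Let AV g : A g *m A g^-1%g = 1. Proof. by rewrite -AM mulVg A1. Qed.
Let AVr g : A g^-1%g *m A g = 1. Proof. by rewrite -AM mulgV A1. Qed.
Let AX g k : A (g ^+ k)%g = A g ^+ k.
Proof. by elim: k => [|k IH]; rewrite ?expg0 ?A1 // expgS AM IH exprSr. Qed.
Let Au g : A g \in unitmx. Proof. by have [] := mulmx1_unit (AV g). Qed.
Let AinvE g : A g^-1%g = invmx (A g).
Proof. by rewrite -[LHS]mulmx1 -(mulmxV (Au g)) mulmxA AVr mul1mx. Qed.

Definition gen (S Q : set Gam) g0 := [/\ is_subgroup Q, Q `<=` S, ficov Q S & [/\ Q g0, tf (A g0) &
  forall q, Q q -> inalg (A g0) (A q)]].

Let alg_group T g0 : is_subgroup T -> tf (A g0) -> is_subgroup [set t | T t /\ inalg (A g0) (A t)].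
Proof.
move=> sT [P [d [dM _]]]; apply: mk_subgroup.
- by split; [exact: sub1|rewrite A1; exact: inalg1].
- by move=> x y [Tx ix] [Ty iy]; split; [exact: subM|rewrite AM; exact: inalgM].
- by move=> x [Tx ix]; split; [exact: subV|rewrite AinvE; exact: inalgV dM ix (Au x)].
Qed.

(** Some power b of a acts by a semisimple matrix commuting with A g0. For a suitable k, a power of
    b g0^k has eigenvalues that determine those of g0 and of a power of b, so both matrices are
    polynomials in it. *)
Lemma gen_step (S T Q : set Gam) g0 a : is_subgroup S -> is_subgroup T -> is_normal_in S T -> T a ->
  (forall x, T x -> exists k : nat, S (a ^- k * x)%g \/ S (a ^+ k * x)%g) -> gen S Q g0 ->
  exists Q' g0', gen T Q' g0'.
Proof.
move=> sS sT nST Ta cyc [sQ QS fQ [Qg0 tg0 Qalg]]; set b0 := A g0 in tg0 Qalg.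
have SJ t x : T t -> S x -> S (t * x * t^-1)%g by move=> Tt Sx; exact: (normJV sT nST).
pose Qc : set Gam := [set s | S s /\ inalg b0 (A s)].
have sQc : is_subgroup Qc by exact: alg_group.
have conj t : T t -> inalg b0 (A t^-1%g *m b0 *m A t).
  move=> Tt; have Sg : S (t * g0 * t^-1)%g by apply: SJ => //; exact: QS.
  have [e e0 Qe] := ficov_pow sQ fQ (fun k => subX k sS Sg).
  have := Qalg _ Qe.
  have -> : ((t * g0 * t^-1) ^+ e = t * g0 ^+ e * t^-1)%g.
    elim: (e) => [|k IH]; first by rewrite !expg0 mulg1 mulgV.
    by rewrite !expgS IH; grp.
  rewrite !AM AX mulmxA => h; apply: inalg_trans h _.
  apply: inalg_conj => //.
  exact: (tf_exp e0 tg0).2.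
have QcJ t x : T t -> Qc x -> Qc (t * x * t^-1)%g.
  move=> Tt [Sx ix]; split; first exact: SJ.
  by rewrite !AM mulmxA; apply: inalg_trans (conj t Tt) _; exact: inalg_conj.
have [P [d [dM _]]] := tg0.
(* Conjugation by powers of a keeps A g0 inside its own algebra and only relabels its eigenvalues;
   two powers with the same relabelling differ by a power that commutes with A g0. *)
have [m m0 comm] : exists2 m, (0 < m)%N & b0 *m A (a ^+ m)%g = A (a ^+ m)%g *m b0.
  pose bk k := A (a ^+ k)^-1%g *m b0 *m A (a ^+ k)%g.
  have dbk k : exists e, dgz P e (bk k).
    by have [p pE] := conj _ (subX k sT Ta); eexists; rewrite /bk pE; exact: (dgz_horner p dM).
  have /choice[f fP] k : exists f : {ffun 'I_n.+1 -> 'I_n.+1}, dgz P (\row_i d 0 (f i)) (bk k).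
    have [e de] := dbk k; have /choice[f fE] := dgz_eig dM de (AV _).
    exists (finfun f); have -> // : \row_i d 0 (finfun f i) = e.
    by apply/rowP => i; rewrite mxE ffunE fE.
  have [i [j [ij fij]]] := nat_pigeon f.
  have bij : bk i = bk j by apply: mxC_inj; rewrite (dgzE (fP i)) (dgzE (fP j)) fij.
  exists (j - i)%N; first by rewrite subn_gt0.
  have aj : (a ^+ j = a ^+ i * a ^+ (j - i))%g by rewrite -expgnDr subnKC // ltnW.
  have := congr1 (fun Z => A (a ^+ i)%g *m Z *m A (a ^+ i)^-1%g) bij; rewrite /bk !mulmxA AV mul1mx.
  rewrite -(mulmxA b0) AV mulmx1 aj invgM !AM !mulmxA AV mul1mx.
  rewrite -(mulmxA _ (A (a ^+ i)%g)) AV mulmx1 => e.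
  by rewrite [in RHS]e !mulmxA AV mul1mx.
have [m' m'0 dam] := Apow (a ^+ m)%g; set b := ((a ^+ m) ^+ m')%g in dam.
have Tb : T b by do 2!apply: subX => //.
have cb : b0 *m A b = A b *m b0 by rewrite /b AX !mulmxE; apply: commrX.
have [{dM}P [{}d [r [dM dr]]]] := codiag (dgz_cdiag dM) dam cb.
have td := tf_any tg0 dM.
have d0 i : d 0 i != 0 by apply: diag_unit dM.1 _ dM.2 i; rewrite map_unitmx; exact: Au.
have r0 i : r 0 i != 0 by apply: diag_unit dr.1 _ dr.2 i; rewrite map_unitmx; exact: Au.
pose mu k i := d 0 i ^+ k * r 0 i.
pose tor k i j := exists2 e, (0 < e)%N & mu k i ^+ e = mu k j ^+ e.
(* If every k failed, some pair (i, j) would fail for two values of k; dividing the two relations, d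
   i and d j would differ by a root of unity, against [tfree]. *)
have [k kP] : exists k, forall i j, tor k i j -> d 0 i = d 0 j.
  apply: contrapT => h.
  have /choice[f fP] k : exists x : 'I_n.+1 * 'I_n.+1, tor k x.1 x.2 /\ d 0 x.1 <> d 0 x.2.
    apply: contrapT => h2; apply: h; exists k => i j tij; apply: contrapT => dij.
    by apply: h2; exists (i, j).
  have [k [k' [kk' fk]]] := nat_pigeon f; have [[e e0 E1] nd] := fP k; have := (fP k').1; rewrite -fk => -[e' e'0 E2].
  apply: nd; set i := (f k).1 in E1 E2 *; set j := (f k).2 in E1 E2 *.
  apply: (td i j ((k' - k) * (e * e'))%N); first by rewrite !muln_gt0 subn_gt0 kk' e0.
  have F1 : mu k i ^+ (e * e') = mu k j ^+ (e * e') by rewrite !exprM E1.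
  have F2 : mu k' i ^+ (e * e') = mu k' j ^+ (e * e') by rewrite mulnC !exprM E2.
  have muE x : mu k' x = d 0 x ^+ (k' - k) * mu k x.
    by rewrite /mu mulrA -exprD subnK // ltnW.
  rewrite !exprM; move: F2; rewrite !muE ![(_ * mu _ _) ^+ _]exprMn F1 -![(_ ^+ (k' - k)) ^+ _]exprM !exprM.
  apply: mulIf; do 2!apply: expf_neq0; rewrite /mu mulf_neq0 // expf_neq0 //.
pose h := (b * g0 ^+ k)%g.
have dh : dgz P (\row_i mu k i) (A h).
  have := dgzM (dgzX k dM) dr; rewrite /h AM AX.
  by congr dgz; apply/rowP => i; rewrite !mxE.
have [E E0 EP] := torsion_exp (\row_i mu k i).
have dhE := dgzX E dh; have dbE := dgzX E dr.
have Th : T (h ^+ E)%g.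
  by apply: subX => //; apply: subM => //; apply: subX => //; apply: nST.1; exact: QS.
have thE : tf (A (h ^+ E)%g).
  exists P; eexists; split; first by rewrite AX; exact: dhE.
  move=> i j e e0; rewrite !mxE -!exprM => eq.
  by have := EP i j; rewrite !mxE; apply; exists (E * e)%N => //; rewrite muln_gt0 E0.
have hd i j : (\row_i (\row_i0 mu k i0) 0 i ^+ E) 0 i = (\row_i (\row_i0 mu k i0) 0 i ^+ E) 0 j -> d 0 i = d 0 j.
  by rewrite !mxE => eq; apply: kP; exists E.
have ib0 : inalg (A (h ^+ E)%g) b0 by rewrite AX; exact: (interp dhE dM).
have ibE : inalg (A (h ^+ E)%g) (A (b ^+ E)%g).
  rewrite (AX h) (AX b); apply: (interp dhE dbE) => i j eq; have dij := hd i j eq; move: eq; rewrite !mxE /mu !exprMn dij.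
  by apply: mulfI; rewrite !expf_neq0.
pose Q' : set Gam := [set t | T t /\ inalg (A (h ^+ E)%g) (A t)].
have sQ' : is_subgroup Q' by exact: alg_group.
have QcQ' : Qc `<=` Q'.
  by move=> x [Sx ix]; split; [exact: nST.1|exact: inalg_trans ib0 ix].
pose N := (m * m' * E)%N.
have N0 : (0 < N)%N by rewrite !muln_gt0 m0 m'0.
have aN : Q' (a ^+ N)%g by rewrite /N !expgnA; split => //; do 3!apply: subX => //.
exists Q', (h ^+ E)%g; split => //; first by move=> x [].
  have [l lP] := fQ; exists [seq (a ^+ i * x)%g | i <- iota 0 N.+1, x <- l] => t Tt.
  have key i s : (i <= N)%N -> S s -> exists2 x, x \in [seq (a ^+ i * x)%g | i <- iota 0 N.+1, x <- l] &
      Q' (a ^+ i * s * x^-1)%g.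
    move=> iN Ss; have [x xl Qx] := lP s Ss; exists (a ^+ i * x)%g.
      by apply: allpairs_f => //; rewrite mem_iota.
    have -> : (a ^+ i * s * (a ^+ i * x)^-1 = a ^+ i * (s * x^-1) * (a ^+ i)^-1)%g by grp.
    apply: QcQ'; apply: QcJ; first exact: subX.
    by split; [exact: QS|exact: Qalg].
  have [q [Sq|Sq]] := cyc t Tt.
    have [x xl Qx] := key (q %% N)%N _ (ltnW (ltn_pmod q N0)) Sq; exists x => //.
    have -> : (t * x^-1 = (a ^+ N) ^+ (q %/ N) * (a ^+ (q %% N) * (a ^- q * t) * x^-1))%g.
      have -> : (a ^- q * t = (a ^+ (q %% N))^-1 * ((a ^+ N) ^+ (q %/ N))^-1 * t)%g.
        by rewrite -invgM -expgnA -expgnDr mulnC -divn_eq.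
      by grp.
    by apply: subM => //; exact: subX.
  pose c := (q %/ N).+1.
  have qc : (q <= N * c)%N by rewrite /c mulnC; apply: ltnW; exact: ltn_ceil.
  have ic : (N * c - q <= N)%N by rewrite /c; have := divn_eq q N; have := ltn_pmod q N0; nia.
  have [x xl Qx] := key (N * c - q)%N _ ic Sq; exists x => //.
  have -> : (t * x^-1 = ((a ^+ N) ^+ c)^-1 * (a ^+ (N * c - q) * (a ^+ q * t) * x^-1))%g.
    by rewrite (mulgA (a ^+ (N * c - q))%g) -expgnDr subnK // -expgnA; grp.
  by apply: subM => //; apply: subV => //; exact: subX.
split => //; first by split => //; exact: inalg_refl.
by move=> q [].
Qed.

Lemma generic : virtually_polycyclic Gam -> exists (D : set Gam) g0,
  [/\ is_subgroup D, forall g h, D h -> D (g * h * g^-1)%g, finidx D &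
  [/\ D g0, forall m, (0 < m)%N -> inalg (A g0 ^+ m) (A g0) & forall g, D g -> inalg (A g0) (A g)]].
Proof.
move=> [k [S [S0 Sk Sg Sn]]].
have [Q [g0 [sQ _ fQ [Qg0 tg0 Qalg]]]] : exists Q g0, gen setT Q g0.
  suff hi i : (i <= k)%N -> exists Q g0, gen (S i) Q g0 by rewrite -Sk; exact: hi.
  elim: i => [_|i IH ik].
    exists [set 1%g], 1%g; rewrite S0.
    have s1 : is_subgroup [set 1%g : Gam] by split=> // x y -> -> /=; rewrite mulgV.
    split => //; first exact: ficov_refl.
    split => //; last by move=> q ->; exact: inalg_refl.
    exists 1%:M, (const_mx 1); split; first by rewrite A1; exact: dgz1.
    by move=> *; rewrite !mxE.
  have [Q [g0 gQ]] := IH (ltnW ik); have sS := Sg i (ltnW ik); have sT := Sg i.+1 ik.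
  have [nST [fq|[_ [a Ta cyc]]]] := Sn i ik; last exact: (gen_step sS sT nST Ta cyc gQ).
  have [sQ QS fQ gP] := gQ; exists Q, g0; split => //; first exact: subset_trans nST.1.
  by apply: ficov_trans fQ _; exact: finite_quotient_ficov.
have sT : is_subgroup [set: Gam] by [].
(* The core makes the subgroup normal. A power of g0 lies in it, and by [tf_exp] this power still
   generates the algebra of A g0. *)
have fD := core_ficov sT sQ (@subsetT _ _) fQ; have sD := core_group sT sQ.
have [e e0 De] := ficov_pow (g := g0) sD fD (fun=> I).
have [te ie] := tf_exp e0 tg0.
exists (core setT Q), (g0 ^+ e)%g; split => //.
- by move=> g h; exact: core_conj.
- exact: core_finidx.
split => [//|m m0|]; first by rewrite AX; exact: (tf_exp m0 te).2.
move=> g /(core_sub sT)/Qalg h; rewrite AX; exact: inalg_trans ie h.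
Qed.
End Generic.

(** * Jordan decomposition inside the Zariski closure *)

Section PolySequences.
Variable R : realType.

(** Binomial polynomials have binomial antidifferences; removing the leading term lowers the
    degree. *)
Lemma antidiff (q : {poly R}) : exists Q : {poly R}, forall k : nat, Q.[k.+1%:R] - Q.[k%:R] = q.[k%:R].
Proof.
have [N] := ubnP (size q); elim: N q => [|N IH] q; first by [].
rewrite ltnS leq_eqVlt => /orP[/eqP sq|]; last exact: IH.
case: N IH sq => [|N] IH sq.
  exists 0 => k; move/eqP: sq; rewrite size_poly_eq0 => /eqP ->.
  by rewrite !horner0 subrr.
pose M : {poly R} := \prod_(i < N) ('X - i%:R%:P); pose c := q`_N.
have Nf : N`!%:R != 0 :> R by rewrite pnatr_eq0 -lt0n fact_gt0.
have ME : M = N`!%:R *: bpol R N by rewrite /bpol scalerA mulfV // scale1r.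
have sM : size M = N.+1 by rewrite size_prod_XsubC -[RHS]/(N.+1) /index_enum -enumT size_enum_ord.
have mM : M`_N = 1.
  by have /monicP := monic_prod_XsubC (index_enum 'I_N) xpredT (fun i => i%:R : R); rewrite lead_coefE sM.
have [|Q QE] := IH (q - c *: M).
  rewrite ltnS; apply/leq_sizeP => j; rewrite leq_eqVlt => /orP[/eqP <-|Nj].
    by rewrite coefB coefZ mM mulr1 subrr.
  by rewrite coefB coefZ !nth_default ?sM ?sq // mulr0 subrr.
exists (Q + (c * N`!%:R) *: bpol R N.+1) => k.
have e : 'C(k.+1, N.+1)%:R - 'C(k, N.+1)%:R = 'C(k, N)%:R :> R by rewrite binS natrD addrC addKr.
have Mk : M.[k%:R] = N`!%:R * 'C(k, N)%:R by rewrite ME hornerZ bpol_nat.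
have Bk j : ((c * N`!%:R) *: bpol R N.+1).[j%:R] = c * N`!%:R * 'C(j, N.+1)%:R by rewrite hornerZ bpol_nat.
rewrite !hornerD !Bk opprD addrACA QE -mulrBr e hornerD hornerN hornerZ Mk; ring.
Qed.

Lemma diff_poly (f : nat -> R) (q : {poly R}) : (forall k, f k.+1 - f k = q.[k%:R]) ->
  exists p : {poly R}, forall k, f k = p.[k%:R].
Proof.
move=> h; have [Q QE] := antidiff q; exists (Q + (f 0%N - Q.[0])%:P).
elim=> [|k IH]; first by rewrite hornerD hornerC addrC subrK.
by rewrite -(subrK (f k) (f k.+1)) h IH -QE !hornerD !hornerC; ring.
Qed.

Variable n : nat.
Local Notation V := 'rV[R]_n.

Definition pseq (f : nat -> V) := exists c : 'rV[{poly R}]_n, forall k, f k = pev c k%:R.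

Lemma pseq_ext f g : f =1 g -> pseq f -> pseq g.
Proof. by move=> fg [c cE]; exists c => k; rewrite -fg. Qed.

Lemma pseqD f g : pseq f -> pseq g -> pseq (fun k => f k + g k).
Proof. by move=> [c cE] [d dE]; exists (c + d) => k; rewrite cE dE; apply/rowP => i; rewrite !mxE hornerD. Qed.

Lemma pseqN f : pseq f -> pseq (fun k => - f k).
Proof. by move=> [c cE]; exists (- c) => k; rewrite cE; apply/rowP => i; rewrite !mxE hornerN. Qed.

Lemma pseqM f (A : 'M[R]_n) : pseq f -> pseq (fun k => f k *m A).
Proof.
move=> [c cE]; exists (\row_j \sum_i c 0 i * (A i j)%:P) => k; rewrite cE; apply/rowP => j.
by rewrite !mxE horner_sum; apply: eq_bigr => i _; rewrite !mxE hornerM hornerC.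
Qed.

Lemma pseqS f : pseq f -> pseq (fun k => f k.+1).
Proof.
move=> [c cE]; exists (\row_j (c 0 j \Po ('X + 1%:P))) => k; rewrite cE; apply/rowP => j.
by rewrite !mxE horner_comp hornerD hornerX hornerC natr1.
Qed.

Lemma pseq0 : pseq (fun=> 0).
Proof. by exists 0 => k; apply/rowP => i; rewrite !mxE horner0. Qed.

Lemma pseq_diff f : pseq (fun k => f k.+1 - f k) -> pseq f.
Proof.
move=> [c cE]; have /choice[p pE] j : exists p : {poly R}, forall k, f k 0 j = p.[k%:R].
  apply: (@diff_poly (fun k => f k 0 j) (c 0 j)) => k.
  by have /rowP/(_ j) := cE k; rewrite !mxE.
by exists (\row_j p j) => k; apply/rowP => j; rewrite !mxE pE.
Qed.

Lemma pseq_affine (f : nat -> V) (U : 'M[R]_n) K : (U - 1) ^+ K = 0 ->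
  pseq (fun k => f k.+1 - f k *m U) -> pseq f.
Proof.
move=> UK pf; suff h j : (j <= K)%N -> pseq (fun k => f k *m (U - 1) ^+ (K - j)).
  by apply: pseq_ext (h K (leqnn K)) => k; rewrite subnn expr0 mulmx1.
elim: j => [_|j IH jK].
  by apply: pseq_ext pseq0 => k; rewrite subn0 UK mulmx0.
apply: pseq_diff.
have e : (K - j = (K - j.+1).+1)%N by lia.
have := IH (ltnW jK); rewrite e => h1.
apply: pseq_ext (pseqD h1 (pseqM ((U - 1) ^+ (K - j.+1)) pf)) => k.
by rewrite exprS -mulmxE mulmxA -mulmxBl -mulmxDl mulmxBr mulmx1 addrC addrA subrK.
Qed.
End PolySequences.

Section TranslationParts.
Variables (R : realType) (X : groupType) (n : nat) (G : nilgrp R X n) (U : 'M[R]_n).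
Local Notation lg := (nlg G).
Hypotheses (UM : {morph (fun x => G (lg x *m U)) : x y / (x * y)%g}) (K : nat) (UK : (U - 1) ^+ K = 0).
Hypothesis Ufil : forall k v, nfil (ebr G) k v -> nfil (ebr G) k (v *m U).

Lemma bch_fil k u v w : nfil (ebr G) k.+1 w ->
  nfil (ebr G) k (bch G u (v + w) - (bch G u v + w)).
Proof.
move=> fw; have lk := nfil_lin G k.
have Fw : Fil G k.+1 (G w) by rewrite /Fil /sgrp /= nexpK.
pose z := ((G v * G w)^-1 * G (v + w))%g.
have Fz : Fil G k z.
  apply/Fil_coset; rewrite nexpK; have := nlgM_fil (G v) Fw; rewrite !nexpK => /(linsubN lk).
  by rewrite opprB.
have h1 := nlgM_fil (G u * G v)%g Fw.
have e : (G u * G (v + w) = (G u * G v * G w) * z)%g by rewrite /z; grp.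
have h2 : nfil (ebr G) k (lg (G u * G (v + w))%g - lg (G u * G v * G w)%g).
  by apply/Fil_coset; rewrite e mulKg.
have := linsubD lk h2 h1; rewrite -[bch G u (v + w)](nexpK G) -[bch G u v](nexpK G) -!bchE nexpK.
by rewrite addrA subrK.
Qed.

(** Level by level: modulo the next level, the deviation from a polynomial sequence obeys a linear
    recurrence with unipotent matrix U and polynomial inhomogeneity, and its solution P is
    polynomial by [pseq_affine]. *)
Lemma orbit_pseq (v : 'rV[R]_n) (r : nat -> 'rV[R]_n) : r 0%N = 0 ->
  (forall k, r k.+1 = bch G v (r k *m U)) -> pseq r.
Proof.
move=> r0 rS.
suff h i : (i <= edeg G)%N -> exists p, pseq p /\ forall k, nfil (ebr G) (edeg G - i) (r k - p k).
  have [p [pp pr]] := h _ (leqnn _); apply: pseq_ext pp => k.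
  by have := pr k; rewrite subnn => /eqP; rewrite subr_eq0 => /eqP.
elim: i => [_|i IH iK].
  by exists (fun=> 0); split; [exact: pseq0|move=> k; rewrite subn0; exact: ebr_fil].
have [p [pp pr]] := IH (ltnW iK); have e : (edeg G - i = (edeg G - i.+1).+1)%N by lia.
rewrite e in pr; set j := (edeg G - i.+1)%N in pr *; have lj := nfil_lin G j.
pose P := fix P k := if k is k'.+1 then P k' *m U + (bch G v (p k' *m U) - p k'.+1) else r 0%N - p 0%N.
have pP : pseq P.
  apply: (pseq_affine UK); apply: (@pseq_ext _ _ (fun k => bch G v (p k *m U) + - p k.+1)).
    by move=> k /=; rewrite [RHS]addrC addKr.
  apply: pseqD; last by apply: pseqN; exact: pseqS.
  have [c cE] := pseqM U pp.
  have [d dE] : polycurve (fun t => bch G v (pev c t)).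
    apply: polycurve_bch; last by exists c.
    by exists (\row_i (v 0 i)%:P) => t; apply/rowP => a; rewrite !mxE hornerC.
  by exists d => k; rewrite cE dE.
exists (fun k => p k + P k); split; first exact: pseqD.
elim=> [|k IHk].
  by rewrite /= [p 0%N + _]addrC subrK subrr; exact: lj.1.
set ek := r k - _ in IHk; set f := r k - p k; have fk : nfil (ebr G) j.+1 f := pr k.
have fkU : nfil (ebr G) j.+1 (f *m U) := Ufil fk.
have := bch_fil v (p k *m U) fkU; have -> : p k *m U + f *m U = r k *m U.
  by rewrite -mulmxDl /f addrC subrK.
rewrite -rS => h; have := linsubD lj h (Ufil IHk).
have -> // : r k.+1 - (bch G v (p k *m U) + f *m U) + ek *m U = r k.+1 - (p k.+1 + P k.+1).
rewrite /ek /f /= !mulmxBl mulmxDl; vring.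
Qed.
End TranslationParts.

Section Jordan.
Variable R : realType.
Local Notation C := (complex R).

(** Chinese remainders, one root at a time. Evaluated at a matrix with these eigenvalues, q gives
    the semisimple Jordan part. *)
Lemma crt_roots (rs : seq C) K : uniq rs -> exists q : {poly C},
  forall l, l \in rs -> (('X - l%:P) ^+ K %| q - l%:P)%R.
Proof.
elim: rs => [|l rs IH]; first by exists 0.
move=> /= /andP[lrs /IH[q qP]].
pose M := \prod_(m <- rs) ('X - m%:P) ^+ K.
have /Bezout_eq1_coprimepP[[u v] /= uv] : coprimep M (('X - l%:P) ^+ K).
  rewrite /M; elim: rs lrs {IH qP M} => [|m rs IH]; first by rewrite big_nil coprime1p.
  rewrite inE negb_or big_cons => /andP[lm lrs]; rewrite coprimepMl IH // andbT.
  apply: coprimep_expl; apply: coprimep_expr; rewrite coprimep_XsubC root_XsubC eq_sym //.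
  by rewrite eq_sym.
exists (q + u * M * (l%:P - q)) => m; rewrite inE => /orP[/eqP ->|mrs].
  have -> : q + u * M * (l%:P - q) - l%:P = (v * (q - l%:P)) * ('X - l%:P) ^+ K.
    have -> : u * M = 1 - v * ('X - l%:P) ^+ K by rewrite -uv addrK.
    by ring.
  exact: dvdp_mull.
have -> : q + u * M * (l%:P - q) - m%:P = (q - m%:P) + (u * (l%:P - q)) * M by ring.
apply: dvdp_add; first exact: qP.
by apply: dvdp_mull; rewrite /M (big_rem m) //= dvdp_mulr.
Qed.

Lemma jordanC n (A : 'M[C]_n.+1) : A \in unitmx -> exists S U : 'M[C]_n.+1,
  [/\ A = S *m U, S *m U = U *m S, S \in unitmx & (exists P d, P \in unitmx /\ P *m S = diag_mx d *m P) /\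
   (U - 1) ^+ n.+1 = 0].
Proof.
move=> Au; have [rt rtE] := closed_field_poly_normal (char_poly A).
rewrite (monicP (char_poly_monic A)) scale1r in rtE.
have srt : size rt = n.+1.
  by have := size_char_poly A; rewrite rtE size_prod_XsubC => -[].
pose rs := undup rt; have [q qP] := crt_roots n.+1 (undup_uniq rt); rewrite -/rs in qP.
have chi : char_poly A %| \prod_(l <- rs) ('X - l%:P) ^+ n.+1.
  rewrite rtE -big_undup_iterop_count /= -/rs big_seq [X in _ %| X]big_seq.
  elim/big_ind2 : _ => [//|x1 x2 y1 y2 h1 h2|l lrs]; first exact: dvdp_mul.
  have -> : iterop (count_mem l rt) *%R ('X - l%:P) 1 = ('X - l%:P) ^+ count_mem l rt by [].
  by apply: dvdp_exp2l; rewrite -srt; exact: count_size.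
have kill p : char_poly A %| p -> horner_mx A p = 0.
  by move=> /dvdpP[r ->]; rewrite rmorphM /= Cayley_Hamilton mulr0.
pose S := horner_mx A q.
have Nil : (A - S) ^+ n.+1 = 0.
  have -> : A - S = horner_mx A ('X - q) by rewrite rmorphB /= horner_mx_X.
  rewrite -rmorphXn; apply: kill; apply: dvdp_trans chi _.
  rewrite prodrXl; apply: dvdp_exp2r; apply: uniq_roots_dvdp.
    apply/allP => l lrs; rewrite /root !hornerE.
    have : root (q - l%:P) l.
      rewrite -dvdp_XsubCl; apply: dvdp_trans (qP l lrs); rewrite -[X in X %| _]expr1; exact: dvdp_exp2l.
    by rewrite /root !hornerE subr_eq0 => /eqP ->; rewrite subrr.
  by rewrite uniq_rootsE undup_uniq.
have SA : S *m A = A *m S by rewrite /S; apply/esym; exact: comm_mx_horner.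
have Su : S \in unitmx.
  have c : GRing.comm A (A - S) by apply: commrB => //; exact: esym SA.
  have := subrXX_comm n.+1 c; rewrite Nil subr0 subKr => e.
  have : A ^+ n.+1 \in unitmx by exact: unitrX.
  by rewrite e -mulmxE unitmx_mul => /andP[].
have dS : exists P d, P \in unitmx /\ P *m S = diag_mx d *m P.
  have : diagonalizable S.
    apply/diagonalizableP; exists rs; first exact: undup_uniq.
    apply: mxminpoly_min; rewrite rmorph_prod /=.
    have -> : \prod_(l <- rs) horner_mx S ('X - l%:P) = horner_mx A (\prod_(l <- rs) (q - l%:P)).
      rewrite rmorph_prod /=; apply: eq_bigr => l _.
      by rewrite !rmorphB /= horner_mx_X !horner_mx_C.
    apply: kill; apply: dvdp_trans chi _.
    rewrite big_seq [X in _ %| X]big_seq; elim/big_ind2 : _ => [//|x1 x2 y1 y2 h1 h2|l lrs].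
      exact: dvdp_mul.
    exact: qP.
  by move=> [P Pu /similar_diagPex[d /(similarP Pu) PM]]; exists P, d.
exists S, (invmx S *m A); split => //; first by rewrite mulKVmx.
  by rewrite mulKVmx // -mulmxA -SA mulKmx.
split => //; have -> : invmx S *m A - 1 = invmx S *m (A - S) by rewrite mulmxBr mulVmx.
rewrite mulmxE exprMn_comm ?Nil ?mulr0 //.
rewrite /GRing.comm -!mulmxE mulmxBr mulmxBl mulVmx // mulmxV //; congr (_ - _).
by rewrite -[LHS](mulmxK Su) -(mulmxA (invmx S)) -SA mulmxA mulVmx // mul1mx.
Qed.

(** The complex parts S, U and their conjugates decompose the same real matrix. The diagonal
    principle applied to S^m U^k minus its conjugate shows that both parts are real. *)
Lemma jordan n (A : 'M[R]_n) : A \in unitmx -> exists S U : 'M[R]_n,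
  [/\ A = S *m U, S *m U = U *m S, S \in unitmx, cdiag S & (U - 1) ^+ n = 0].
Proof.
case: n A => [|n] A Au.
  exists 1, 1; have z (B B' : 'M[R]_0) : B = B' by apply/matrixP => -[].
  split; [exact: z|exact: z|exact: unitmx1| |exact: z].
  exists 1%:M, (const_mx 1); split; first exact: unitmx1.
  by apply/matrixP => -[].
have AuC : mxC A \in unitmx by rewrite map_unitmx.
have [S [U [AE SU Su [[P [d [Pu PS]]] Un]]]] := jordanC AuC.
pose cj m k (M : 'M[C]_(m, k)) := map_mx (@conjc R) M.
have cjM (M N : 'M[C]_n.+1) : cj _ _ (M *m N) = cj _ _ M *m cj _ _ N by exact: map_mxM.
have cjX (M : 'M[C]_n.+1) k : cj _ _ (M ^+ k) = cj _ _ M ^+ k.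
  elim: k => [|k IH]; first by rewrite !expr0; exact: map_mx1.
  by rewrite !exprS -!mulmxE cjM IH.
have cjA : cj _ _ (mxC A) = mxC A.
  by apply/matrixP => i j; rewrite !mxE; exact: conjc_real.
pose F (k m : nat) := S ^+ m *m U ^+ k - cj _ _ S ^+ m *m cj _ _ U ^+ k.
have F0 k m : F k m = 0.
  apply: (exmx_diag0 (A := F)) => [|j].
    apply: exmxD; first apply: exmxM.
    - exact: exmx_diag PS.
    - exact: exmx_unip Un.
    apply: (@exmx_ext _ _ _ (fun k m => (-1)%:M *m (cj _ _ S ^+ m *m cj _ _ U ^+ k))).
      by move=> k' m'; rewrite mul_scalar_mx scaleN1r.
    apply: exmxM; first exact: exmxC.
    apply: exmxM.
      apply: (@exmx_diag _ _ (cj _ _ P) (cj _ _ d)); rewrite ?map_unitmx //.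
      by rewrite -cjM PS cjM; congr (_ *m _); exact: map_diag_mx.
    apply: (@exmx_unip _ _ _ n.+1).
    have -> : cj _ _ U - 1 = cj _ _ (U - 1) by rewrite /cj map_mxB map_mx1.
    by rewrite -cjX Un /cj map_mx0.
  have SUj : S ^+ j *m U ^+ j = mxC A ^+ j by rewrite AE !mulmxE exprMn_comm.
  by rewrite /F SUj -!cjX -cjM SUj cjX cjA subrr.
have UR : U = cj _ _ U.
  by have /eqP := F0 1%N 0%N; rewrite /F !expr0 !expr1 !mul1mx subr_eq0 => /eqP.
pose Ur : 'M[R]_n.+1 := map_mx (@complex.Re R) U.
have UrE : mxC Ur = U.
  apply/matrixP => i j; rewrite !mxE; have /matrixP/(_ i j) := UR; rewrite !mxE.
  by case: (U i j) => a b /= -[h]; have -> : b = 0 by lra.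
have Uu : U \in unitmx by move: AuC; rewrite AE unitmx_mul => /andP[].
have Uru : Ur \in unitmx by rewrite -(map_unitmx (real_complex R)) -/(mxC Ur) UrE.
pose Sr := A *m invmx Ur.
have SrE : mxC Sr = S.
  rewrite /Sr mxCM AE; have -> : mxC (invmx Ur) = invmx U by rewrite -UrE; exact: map_invmx.
  by rewrite mulmxK.
have ASr : A = Sr *m Ur by rewrite /Sr mulmxKV.
clearbody Sr Ur; exists Sr, Ur; split => //.
- by apply: mxC_inj; rewrite !mxCM SrE UrE.
- by rewrite -(map_unitmx (real_complex R)) -/(mxC Sr) SrE.
- by exists P, d; rewrite SrE.
- by apply: mxC_inj; rewrite mxCX mxCB UrE mxC1 Un mxC0.
Qed.

(** (S - 1) U = (A - 1) - (U - 1) with commuting terms, so v is killed by a power of S - 1, and by S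
    - 1 itself as S is semisimple. *)
Lemma jordan_fix n (A S U : 'M[R]_n) K L (v : 'rV[R]_n) : A = S *m U -> S *m U = U *m S -> cdiag S ->
  (U - 1) ^+ L = 0 -> U \in unitmx -> v *m (A - 1) ^+ K = 0 -> v *m S = v.
Proof.
move=> AE SU dS UL Uu vA; apply: (cdiag_fix (N := (K + L)%N) dS).
have e : (S - 1) *m U = (A - 1) - (U - 1) by rewrite mulmxBl mul1mx -AE opprB addrA subrK.
have AU : GRing.comm (A - 1) (U - 1).
  apply: commrB; last exact: commr1; apply: commr_sym; apply: commrB; last exact: commr1.
  by have : U *m (S *m U) = S *m U *m U; [rewrite mulmxA -SU|rewrite /GRing.comm AE].
have SU' : GRing.comm (S - 1) U.
  by apply: commr_sym; apply: commrB; [rewrite /GRing.comm -!mulmxE|exact: commr1].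
have vZ Z : v *m ((A - 1) ^+ K * Z) = 0 by rewrite -mulmxE mulmxA vA mul0mx.
have z : v *m ((S - 1) ^+ (K + L) *m U ^+ (K + L)) = 0.
  rewrite mulmxE -exprMn_comm // -mulmxE e exprBn_comm // mulmx_sumr big1 // => i _.
  have [iL|iL] := ltnP i L.
    have -> : (K + L - i = K + (L - i))%N by lia.
    rewrite -[(-1) ^+ i * _]commr_sign -mulrA -mulrnAr exprD -mulrA; exact: vZ.
  by rewrite -(subnKC iL) [(U - 1) ^+ _]exprD UL mul0r mulr0 mul0rn mulmx0.
have Uku j : U ^+ j \in unitmx.
  by elim: j => [|j IH]; rewrite ?expr0 ?unitmx1 // exprS -mulmxE unitmx_mul Uu.
by move: z; rewrite mulmxA => /(congr1 (mulmx^~ (invmx (U ^+ (K + L))))); rewrite mulmxK // mul0mx.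
Qed.
End Jordan.

Lemma palg_det (R : realType) (T : Type) (S : set (T -> R)) m (A : T -> 'M[R]_m) :
  (forall i j, palg S (fun x => A x i j)) -> palg S (fun x => \det (A x)).
Proof.
move=> h; apply: (@palg_sum _ _ _ _ _ (fun (s : 'S_m) x => (-1) ^+ s * \prod_i A x i (s i))) => s.
apply: palg_mul; first exact: palg_cst.
by apply: (@palg_prod _ _ _ _ _ (fun i x => A x i (s i))) => i; exact: h.
Qed.

Lemma palg_mulmx (R : realType) (T : Type) (S : set (T -> R)) m n p (A : T -> 'M[R]_(m, n)) (B : T -> 'M[R]_(n, p)) :
  (forall i j, palg S (fun x => A x i j)) -> (forall i j, palg S (fun x => B x i j)) ->
  forall i j, palg S (fun x => (A x *m B x) i j).
Proof.
move=> hA hB i j; have -> : (fun x => (A x *m B x) i j) = (fun x => \sum_k A x i k * B x k j).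
  by apply/funext => x; rewrite mxE.
by apply: palg_sum => k; apply: palg_mul.
Qed.

Lemma palg_adj (R : realType) (T : Type) (S : set (T -> R)) m (A : T -> 'M[R]_m) :
  (forall i j, palg S (fun x => A x i j)) -> forall i j, palg S (fun x => (\adj (A x)) i j).
Proof.
move=> h i j; have -> : (fun x => (\adj (A x)) i j) = (fun x => (-1) ^+ (j + i) * \det (row' j (col' i (A x)))).
  by apply/funext => x; rewrite mxE.
apply: palg_mul; first exact: palg_cst.
apply: palg_det => k l; have -> : (fun x => row' j (col' i (A x)) k l) = (fun x => A x (lift j k) (lift i l)).
  by apply/funext => x; rewrite !mxE.
exact: h.
Qed.

Lemma ppolP (R : realType) (T : Type) (S : set (T -> R)) (p : {poly R}) : ppol S (fun=> p).
Proof.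
elim/poly_ind: p => [|p c IH]; first exact: ppol0.
apply: ppol_add; last by apply: ppolC; exact: palg_cst.
have := @ppol_mulZX _ _ S (fun=> p) (fun=> 1) 1 IH (palg_cst _ 1).
by under eq_fun do rewrite scale1r expr1.
Qed.

Lemma pcurve_pseq (R : realType) n (T : Type) (S : set (T -> R)) (f : nat -> 'rV[R]_n) i : pseq f ->
  pcurve S (fun k : nat => k%:R) (fun _ k => f k 0 i).
Proof. by move=> [c cE]; exists (fun=> c 0 i); [exact: ppolP|move=> x k; rewrite cE mxE]. Qed.

Lemma unip_pseq (R : realType) n (U : 'M[R]_n) K (v : 'rV[R]_n) : (U - 1) ^+ K = 0 -> pseq (fun k => v *m U ^+ k).
Proof.
move=> UK; apply: (pseq_affine UK); apply: pseq_ext (@pseq0 R n) => k.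
by rewrite exprSr -mulmxE mulmxA subrr.
Qed.

(** As a function of k, det (U^k) is both exponential and polynomial. *)
Lemma unip_det (R : realType) n (U : 'M[R]_n) K : (U - 1) ^+ K = 0 -> U \in unitmx -> \det U = 1.
Proof.
move=> UK Uu.
have /choice[c cP] (i : 'I_n) : exists c : 'rV[{poly R}]_n, forall k : nat, row i (U ^+ k) = pev c k%:R.
  by have [c cE] := unip_pseq (delta_mx 0 i) UK; exists c => k; rewrite -cE rowE.
pose p := \det (\matrix_(i, j) c i 0 j).
have pE (k : nat) : p.[k%:R] = \det U ^+ k.
  have -> : \det U ^+ k = \det (U ^+ k).
    by elim: k => [|k IH]; rewrite ?expr0 ?det1 // !exprS -mulmxE det_mulmx IH.
  rewrite -[LHS]/(horner_eval k%:R p) /p -det_map_mx; congr (\det _); apply/matrixP => i j.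
  by rewrite !mxE; have /rowP/(_ j) := cP i k; rewrite !mxE.
have ex : expoly (fun k m => \det U ^+ m + (- p).[k%:R]).
  apply: expolyD; last exact: expoly_poly.
  by apply: expoly_exp; move: Uu; rewrite unitmxE unitfE.
have h := expoly_diag0 ex (fun m => _); have := h _ 0%N 1%N; have := h _ 0%N 0%N.
have d m : \det U ^+ m + (- p).[m%:R] = 0 by rewrite hornerN pE subrr.
move=> /(_ d) + /(_ d); rewrite expr0 expr1 => <- => /eqP; rewrite -subr_eq0 => /eqP e.
by apply/eqP; rewrite -subr_eq0 -e; apply/eqP; ring.
Qed.

(* Both factors satisfy the identity by splitting it off A^k = S^k U^k. *)
Lemma jordan_alg (R : realType) (X : groupType) n (G : nilgrp R X n) (A S U : 'M[R]_n) K : A = S *m U ->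
  S *m U = U *m S -> S \in unitmx -> cdiag S -> (U - 1) ^+ K = 0 ->
  (forall u v : 'rV[R]_n, (v *m A) *m ebr G (u *m A) = (v *m ebr G u) *m A) ->
  forall u v : 'rV[R]_n, (v *m U) *m ebr G (u *m U) = (v *m ebr G u) *m U /\ (v *m S) *m ebr G (u *m S) = (v *m ebr G u) *m S.
Proof.
move=> AE SU Su [P [d [Pu PS]]] UK hA u v.
have hAk k : (v *m A ^+ k) *m ebr G (u *m A ^+ k) = (v *m ebr G u) *m A ^+ k.
  elim: k => [|k IH]; first by rewrite expr0 !mulmx1.
  by rewrite !exprSr -!mulmxE !mulmxA hA IH.
pose F k m := mxC ((v *m S ^+ m *m U ^+ k) *m ebr G (u *m S ^+ m *m U ^+ k) - (v *m ebr G u) *m S ^+ m *m U ^+ k).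
have SuC : mxC S \in unitmx by rewrite map_unitmx.
have exS := exmx_diag Pu SuC PS.
have exU : exmx (fun k _ : nat => mxC U ^+ k).
  by apply: (@exmx_unip _ _ _ K); rewrite -(mxC1 R n) -mxCB -mxCX UK mxC0.
have exv (w : 'rV[R]_n) : exmx (fun k m => mxC (w *m S ^+ m *m U ^+ k)).
  apply: (@exmx_ext _ _ _ (fun k m => mxC w *m mxC S ^+ m *m mxC U ^+ k)).
    by move=> k m; rewrite !mxCM !mxCX.
  by apply: exmxM => //; apply: exmxM => //; exact: exmxC.
have F0 k m : F k m = 0.
  apply: (exmx_diag0 (A := F)) => [|j].
    apply: (@exmx_ext _ _ _ (fun k m => mxC (v *m S ^+ m *m U ^+ k) *m (\sum_j (mxC (u *m S ^+ m *m U ^+ k) 0 j) *: mxC (ebr G (delta_mx 0 j)))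
        + (-1)%:M *m mxC (v *m ebr G u *m S ^+ m *m U ^+ k))).
      move=> k' m'; rewrite /F mxCB [in RHS]mxCM; congr (_ + _); last by rewrite mul_scalar_mx scaleN1r.
      rewrite mxCM; congr (_ *m _).
      rewrite {2}[u *m _ *m _]row_sum_delta ebr_sum /mxC raddf_sum /=; apply: eq_bigr => j _.
      by rewrite ebrZ; apply/matrixP => a b; rewrite !mxE rmorphM.
    apply: exmxD.
      apply: exmxM => //; apply: exmx_sum => j; apply: exmxZ; first exact: (exv u).
      exact: exmxC.
    by apply: exmxM; [exact: exmxC|exact: exv].
  have SUj : S ^+ j *m U ^+ j = A ^+ j by rewrite AE !mulmxE exprMn_comm.
  have e (w : 'rV[R]_n) : w *m S ^+ j *m U ^+ j = w *m A ^+ j by rewrite -mulmxA SUj.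
  by rewrite /F !e hAk subrr mxC0.
split; apply/eqP; rewrite -subr_eq0; apply/eqP; apply: mxC_inj; rewrite mxC0.
  by have := F0 1%N 0%N; rewrite /F !expr0 !expr1 !mulmx1.
by have := F0 0%N 1%N; rewrite /F !expr0 !expr1 !mulmx1.
Qed.

Lemma nbch0 (R : realType) (X : groupType) n (G : nilgrp R X n) v : bch G 0 v = v.
Proof. by apply: (can_inj (nexpK G)); rewrite -bchE nexp0 mul1g. Qed.

(** * The Zariski topology of Aff(N) in logarithmic coordinates *)

Section Regular.
Variables (R : realType) (N : lieGroupType R).
Local Notation n := (@lie_dim R N).
Local Notation V := 'rV[R]_n.
Variable G : nilgrp R N n.
Hypotheses (lgE : nlg G =1 @lie_log R N) (GC : continuous G) (lgC : continuous (@lie_log R N))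
  (dG : forall (d : lie_aut N) (v : V), d (G v) = G (v *m lie_diff d)).
Implicit Types (a b u x y : Aff N).
(* Kept abstract: unification would otherwise unfold the derivative. *)
Variable ld : Aff N -> 'M[R]_n.
Hypothesis ldE : forall a, ld a = lie_diff (aff_lin a).

Definition lt a : V := nlg G (aff_trans a).

Lemma lin_exp a v : aff_lin a (G v) = G (v *m ld a).
Proof. by rewrite ldE dG. Qed.

Lemma linE a (z : N) : aff_lin a z = G (nlg G z *m ld a).
Proof. by rewrite -{1}(nlgK G z) lin_exp. Qed.

Lemma ld_uniq a (M : 'M[R]_n) : (forall v, aff_lin a (G v) = G (v *m M)) -> ld a = M.
Proof.
move=> h; apply/row_matrixP => i; rewrite !rowE; apply: (can_inj (nexpK G)).
by rewrite -lin_exp h.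
Qed.

Lemma ldM a b : ld (a * b)%g = ld b *m ld a.
Proof. by apply: ld_uniq => v; rewrite mulmxA -!lin_exp. Qed.

Lemma ld1 : ld 1%g = 1.
Proof. by apply: ld_uniq => v; rewrite mulmx1. Qed.

Lemma ldVr a : ld a *m ld a^-1%g = 1. Proof. by rewrite -ldM mulVg ld1. Qed.
Lemma ld_unit a : ld a \in unitmx. Proof. by have [] := mulmx1_unit (ldVr a). Qed.
Lemma ldV a : ld a^-1%g = invmx (ld a).
Proof. by rewrite -[LHS]mul1mx -(mulVmx (ld_unit a)) -mulmxA ldVr mulmx1. Qed.
Lemma ldX a k : ld (a ^+ k)%g = ld a ^+ k.
Proof. by elim: k => [|k IH]; rewrite ?expg0 ?ld1 // expgS ldM IH exprSr. Qed.

Lemma ltM a b : lt (a * b)%g = bch G (lt a) (lt b *m ld a).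
Proof. by rewrite /lt /= nlgM linE nexpK. Qed.

Lemma lt1 : lt 1%g = 0. Proof. exact: nlg1. Qed.

Lemma ltV a : lt a^-1%g = - (lt a *m ld a^-1%g).
Proof. by rewrite /lt -[aff_trans a^-1%g]/(aff_lin a^-1%g (aff_trans a)^-1%g) linE nexpK nlgV mulNmx. Qed.

Lemma aff_coord a b : lt a = lt b -> ld a = ld b -> a = b.
Proof.
move=> /(can_inj (nlgK G)) e1 e2; apply: aff_ext => // z.
by rewrite !linE e2.
Qed.

Lemma ld_morph a : {morph (fun z => G (nlg G z *m ld a)) : y z / (y * z)%g}.
Proof. by move=> y z; rewrite -!linE aut_funM. Qed.

Lemma lie_aut_exists (M : 'M[R]_n) : M \in unitmx ->
  (forall u v : V, (v *m M) *m ebr G (u *m M) = (v *m ebr G u) *m M) -> exists d : lie_aut N, lie_diff d = M.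
Proof.
move=> Mu hM; have mor := alg_morph_exp hM.
have cont (B : 'M[R]_n) : continuous (fun z : N => G (nlg G z *m B)).
  move=> z; have -> : (fun z : N => G (nlg G z *m B)) = G \o (fun v => v *m B) \o @lie_log R N.
    by apply/funext => y; rewrite /= lgE.
  apply: continuous_comp; first exact: lgC.
  by apply: continuous_comp; [exact: mulmxr_cvg|exact: GC].
have K1 : cancel (fun z : N => G (nlg G z *m M)) (fun z => G (nlg G z *m invmx M)).
  by move=> z; rewrite nexpK mulmxK // nlgK.
have K2 : cancel (fun z : N => G (nlg G z *m invmx M)) (fun z => G (nlg G z *m M)).
  by move=> z; rewrite nexpK mulmxKV // nlgK.
pose d := LieAut mor (cont M) (cont (invmx M)) K1 K2; exists d.
by rewrite -[d]/(aff_lin (MkAff 1%g d)) -ldE; apply: ld_uniq => v; rewrite /= nexpK.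
Qed.

Lemma aff_exists (v : V) (M : 'M[R]_n) : M \in unitmx ->
  (forall u w : V, (w *m M) *m ebr G (u *m M) = (w *m ebr G u) *m M) -> exists a, lt a = v /\ ld a = M.
Proof.
move=> Mu hM; have [d dM] := lie_aut_exists Mu hM; exists (MkAff (G v) d).
by rewrite /lt ldE /= nexpK.
Qed.

Definition rgen : set (Aff N -> R) := [set f | [\/ exists i, f = (fun a => lt a 0 i),
  exists i j, f = (fun a => ld a i j) | f = (fun a => (\det (ld a))^-1)]].

Lemma regularP f : regular f <-> palg rgen f.
Proof.
split.
- elim=> [c|i|i j||f1 f2 _ h1 _ h2|f1 f2 _ h1 _ h2].
  + exact: palg_cst.
  + apply: palg_gen; constructor 1; exists i; apply/funext => a; by rewrite /lt lgE.
  + by apply: palg_gen; constructor 2; exists i, j; apply/funext => a; rewrite ldE.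
  + by apply: palg_gen; constructor 3; apply/funext => a; rewrite ldE.
  + exact: palg_add.
  + exact: palg_mul.
elim=> [c|s [[i ->]|[i [j ->]]|->]|f1 f2 _ h1 _ h2|f1 f2 _ h1 _ h2].
- exact: regular_cst.
- have -> : (fun a => lt a 0 i) = (fun a : Aff N => lie_log (aff_trans a) ord0 i).
    by apply/funext => a; rewrite /lt lgE.
  exact: regular_log.
- have -> : (fun a => ld a i j) = (fun a : Aff N => lie_diff (aff_lin a) i j).
    by apply/funext => a; rewrite ldE.
  exact: regular_entry.
- have -> : (fun a => (\det (ld a))^-1) = (fun a : Aff N => (\det (lie_diff (aff_lin a)))^-1).
    by apply/funext => a; rewrite ldE.
  exact: regular_invdet.
- exact: regular_add.
- exact: regular_mul.
Qed.

(** Morphisms into Aff(N) as a variety: the generators of the coordinate ring pull back into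
    [palg S]. *)
Definition cmap T (S : set (T -> R)) (g : T -> Aff N) := [/\ forall i, palg S (fun t => lt (g t) 0 i),
  forall i j, palg S (fun t => ld (g t) i j) & palg S (fun t => (\det (ld (g t)))^-1)].

Lemma cmap_comp T (S : set (T -> R)) g f : cmap S g -> regular f -> palg S (f \o g).
Proof.
move=> [h1 h2 h3] /regularP; apply: palg_comp => s [[i ->]|[i [j ->]]|->].
- exact: h1.
- exact: h2.
- exact: h3.
Qed.

Lemma cmap_mul T (S : set (T -> R)) g h : cmap S g -> cmap S h -> cmap S (fun t => g t * h t)%g.
Proof.
move=> [g1 g2 g3] [h1 h2 h3].
have row1 i j : palg S (fun t => lt (h t) i j) by rewrite ord1.
split.
- move=> i; have -> : (fun t => lt (g t * h t)%g 0 i) =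
      (fun x : V * V => bch G x.1 x.2 0 i) \o (fun t => (lt (g t), lt (h t) *m ld (g t))).
    by apply/funext => t; rewrite ltM.
  apply: palg_comp (bch_palg G i) => s [j [->|->]]; first exact: g1.
  exact: palg_mulmx row1 g2 _ _.
- by move=> i j; under eq_fun do rewrite ldM; exact: palg_mulmx.
under eq_fun do rewrite ldM det_mulmx invfM; exact: palg_mul.
Qed.

Lemma cmap_inv T (S : set (T -> R)) g : cmap S g -> cmap S (fun t => (g t)^-1)%g.
Proof.
move=> [g1 g2 g3].
have gV i j : palg S (fun t => ld (g t)^-1%g i j).
  have -> : (fun t => ld (g t)^-1%g i j) = (fun t => (\det (ld (g t)))^-1 * (\adj (ld (g t))) i j).
    by apply/funext => t; rewrite ldV /invmx ld_unit mxE.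
  by apply: palg_mul => //; exact: palg_adj.
split => //.
- move=> i; have -> : (fun t => lt (g t)^-1%g 0 i) = (fun t => (-1) * (lt (g t) *m ld (g t)^-1%g) 0 i).
    by apply/funext => t; rewrite ltV mxE mulN1r.
  apply: palg_mul; first exact: palg_cst.
  by apply: (palg_mulmx _ gV) => k j; rewrite ord1.
under eq_fun do rewrite ldV det_inv invrK; exact: palg_det.
Qed.

Lemma cmap_cst T (S : set (T -> R)) a : cmap S (fun=> a).
Proof. by split=> *; exact: palg_cst. Qed.

Lemma cmap_id : cmap rgen id.
Proof.
split=> [i|i j|]; apply: palg_gen; [constructor 1|constructor 2|constructor 3] => //.
  by exists i.
by exists i, j.
Qed.

Local Notation cl := (@zariski_closure R N).

Lemma clP (A : set (Aff N)) a : cl A a <-> forall f, regular f -> (forall b, A b -> f b = 0) -> f a = 0.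
Proof.
split=> [ca f rf f0|h Z [[S SZ ZE] AZ]].
  apply: (ca [set b | forall g, [set f] g -> g b = 0]); last by [].
  split; first by exists [set f] => // _ ->.
  by move=> b Ab _ ->; exact: f0.
rewrite ZE => f Sf; apply: h; first exact: SZ.
by move=> b /AZ; rewrite ZE; apply.
Qed.

Lemma cl_sub (A : set (Aff N)) : A `<=` cl A.
Proof. by move=> a Aa; apply/clP => f _; apply. Qed.

Lemma cl_mono (A B : set (Aff N)) : A `<=` B -> cl A `<=` cl B.
Proof. by move=> AB a /clP h; apply/clP => f rf f0; apply: h => // b /AB; exact: f0. Qed.

Lemma cl_closed (A : set (Aff N)) : zariski_closed (cl A).
Proof.
exists [set f | regular f /\ forall b, A b -> f b = 0]; first by move=> f [].
apply/seteqP; split=> a /=; first by move=> /clP h f [rf f0]; exact: h.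
by move=> h; apply/clP => f rf f0; exact: h.
Qed.

Lemma closed_cl (Z : set (Aff N)) : zariski_closed Z -> cl Z `<=` Z.
Proof. by move=> cZ a; apply; split. Qed.

(** The variables are freed one at a time, so only morphisms of a single variable occur. *)
Lemma cl2 (w : Aff N -> Aff N -> Aff N) (A B Z : set (Aff N)) :
  (forall y, cmap rgen (w^~ y)) -> (forall x, cmap rgen (w x)) ->
  (forall x y, A x -> B y -> cl Z (w x y)) -> forall x y, cl A x -> cl B y -> cl Z (w x y).
Proof.
move=> w1 w2 h x y /clP Ax /clP By; apply/clP => f rf f0.
apply: (By (f \o w x)); first by apply/regularP; exact: cmap_comp.
move=> b Bb; apply: (Ax (f \o w^~ b)); first by apply/regularP; exact: cmap_comp.
by move=> c Ac /=; have /clP := h c b Ac Bb; apply.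
Qed.

Lemma cl_group (H : set (Aff N)) : is_subgroup H -> is_subgroup (cl H).
Proof.
move=> [H1 HD]; split; first exact: cl_sub.
apply: (@cl2 (fun x y => x * y^-1)%g) => [y|x|x y Hx Hy]; last by apply: cl_sub; exact: HD.
  by apply: cmap_mul; [exact: cmap_id|exact: cmap_cst].
by apply: cmap_mul; [exact: cmap_cst|apply: cmap_inv; exact: cmap_id].
Qed.

Lemma cmap_word : (forall y, cmap rgen (fun x => x ^ y)%g) /\ (forall x, cmap rgen (fun y => x ^ y)%g).
Proof.
split=> z; rewrite /conjg; do !apply: cmap_mul; try apply: cmap_inv; try exact: cmap_id; exact: cmap_cst.
Qed.

Lemma cl_normal (A B : set (Aff N)) : is_normal_in A B -> is_normal_in (cl A) (cl B).
Proof.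
move=> [AB nAB]; split; first exact: cl_mono.
have [w1 w2] := cmap_word; apply: (@cl2 (fun x y => x ^ y)%g) => // x y Ax By.
by apply: cl_sub; exact: nAB.
Qed.

Lemma cl_abelian (A B : set (Aff N)) : abelian_quotient A B -> abelian_quotient (cl A) (cl B).
Proof.
have [w1 w2] := cmap_word; move=> aAB; apply: (@cl2 (fun x y => [~ x, y])%g) => [y|x|x y Bx By].
- by rewrite /commg; apply: cmap_mul => //; apply: cmap_inv; exact: cmap_id.
- by rewrite /commg; apply: cmap_mul => //; exact: cmap_cst.
by apply: cl_sub; exact: aAB.
Qed.

Lemma cl_one : cl [set 1%g] = [set 1%g].
Proof.
apply/seteqP; split; last exact: cl_sub.
move=> a /clP h; apply: aff_coord.
- rewrite lt1; apply/rowP => i; rewrite mxE; apply: (h (fun b => lt b 0 i)).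
    by apply/regularP; apply: palg_gen; constructor 1; exists i.
  by move=> _ ->; rewrite lt1 mxE.
- apply/matrixP => i j; apply/eqP; rewrite -subr_eq0; apply/eqP.
  apply: (h (fun b => ld b i j - ld 1%g i j)); last by move=> _ ->; rewrite subrr.
  apply/regularP; apply: palg_sub; last exact: palg_cst.
  by apply: palg_gen; constructor 2; exists i, j.
Qed.

Lemma cl_solvable (H : set (Aff N)) : is_solvable H -> is_solvable (cl H).
Proof.
move=> [k [S [S0 Sk Sg Sn]]]; exists k, (fun i => cl (S i)); split.
- by rewrite S0 cl_one.
- by rewrite Sk.
- by move=> i ik; apply: cl_group; exact: Sg.
- by move=> i ik; have [nS aS] := Sn i ik; split; [exact: cl_normal|exact: cl_abelian].
Qed.

(** If a avoided all the closed translates, a product of functions separating a from each of them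
    would vanish on M but not at a. *)
Lemma cl_cover (Z M : set (Aff N)) (l : seq (Aff N)) : zariski_closed Z ->
  (forall b, M b -> exists2 x, x \in l & Z (b * x^-1)%g) ->
  forall a, cl M a -> exists2 x, x \in l & Z (a * x^-1)%g.
Proof.
move=> cZ h a /clP ca; apply: contrapT => na.
have /choice[F FP] x : exists f : Aff N -> R, regular f /\ (x \in l -> (forall b, Z b -> f b = 0) /\ f (a * x^-1)%g <> 0).
  have [xl|xl] := boolP (x \in l); last by exists (fun=> 0); split; [exact: regular_cst|].
  have : ~ cl Z (a * x^-1)%g by move=> /(closed_cl cZ) Za; apply: na; exists x.
  move=> nc; apply: contrapT => h2; apply: nc; apply/clP => f rf f0; apply: contrapT => fa.
  by apply: h2; exists f.
pose f b := \prod_(x <- l) F x (b * x^-1)%g.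
have : f a = 0.
  apply: ca; last first.
    move=> b Mb; have [x xl Zx] := h b Mb; apply/eqP; rewrite prodf_seq_eq0; apply/hasP; exists x => //=.
    by apply/eqP; have [_ /(_ xl)[h0 _]] := FP x; exact: h0.
  apply/regularP; apply: (@palg_prod _ _ _ _ _ (fun x b => F x (b * x^-1)%g)) => x.
  apply: (@cmap_comp _ _ (fun b => b * x^-1)%g (F x)); last exact: (FP x).1.
  by apply: cmap_mul; [exact: cmap_id|exact: cmap_cst].
move=> /eqP; rewrite prodf_seq_eq0 => /hasP[x xl /=] /eqP.
by have [_ /(_ xl)[]] := FP x.
Qed.

Lemma taut_trM a b : aff_trans (a * b)%g = (aff_trans a * G (nlg G (aff_trans b) *m ld a))%g.
Proof. by rewrite -linE. Qed.

Definition taut : affact (Aff N) G := AffAct ld_morph ld1 ldM taut_trM.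

Lemma orbit_lt u K : (ld u - 1) ^+ K = 0 -> pseq (fun k => lt (u ^+ k)%g).
Proof.
move=> uK; apply: (@orbit_pseq _ _ _ G (ld u) K uK _ (lt u)).
- exact: (amx_fil taut u).
- by rewrite expg0 lt1.
- by move=> k; rewrite expgS ltM.
Qed.

Lemma ppol_size T (S : set (T -> R)) f : ppol S f -> exists m, forall t, (size (f t) <= m)%N.
Proof.
elim=> [|g c k _ [m h] _]; first by exists 0%N => t; rewrite size_poly0.
exists (maxn m k.+1) => t; apply: leq_trans (size_polyD _ _) _.
rewrite geq_max !leq_max h /=; apply/orP; right.
by apply: leq_trans (size_scale_leq _ _) _; rewrite size_polyXn.
Qed.

(** f (a u^k) is a polynomial in k with coefficients regular in a, so its degree is bounded
    independently of a. Right translation by u is the shift of k, and each difference lowers the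
    degree. *)
Lemma unip_unipotent u K : (ld u - 1) ^+ K = 0 -> unipotent u.
Proof.
move=> uK f /regularP rf; set U := ld u in uK.
have pU : pcmx rgen (fun k : nat => k%:R) (fun (a : Aff N) (k : nat) => U ^+ k).
  move=> i j; apply: (@pcurve_eq _ _ _ _ _ (fun _ k => (delta_mx 0 i *m U ^+ k) 0 j)).
    by move=> a k; have := congr1 (fun v : V => v 0 j) (rowE i (U ^+ k)); rewrite mxE => ->.
  by apply: pcurve_pseq; exact: unip_pseq uK.
have pA : pcmx rgen (fun k : nat => k%:R) (fun (a : Aff N) (k : nat) => ld a).
  by move=> i j; apply: pcurveC; apply: palg_gen; constructor 2; exists i, j.
have pR : pcmx rgen (fun k : nat => k%:R) (fun (a : Aff N) (k : nat) => lt (u ^+ k)%g).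
  by move=> i j; rewrite ord1; apply: pcurve_pseq; exact: orbit_lt uK.
have dU k : \det (U ^+ k) = 1.
  elim: k => [|k IH]; first by rewrite expr0 det1.
  by rewrite exprS -mulmxE det_mulmx IH mulr1; apply: unip_det uK _; exact: ld_unit.
have [fp pfp fE] : pcurve rgen (fun k : nat => k%:R) (fun a k => f (a * u ^+ k)%g).
  apply: pcurve_palg rf _ => s [[i ->]|[i [j ->]]|->].
  - apply: (@pcurve_eq _ _ _ _ _ (fun a k => (fun x : V * V => bch G x.1 x.2 0 i) (lt a, lt (u ^+ k)%g *m ld a))).
      by move=> a k; rewrite ltM.
    apply: pcurve_palg (bch_palg G i) _ => _ [j [->|->]].
      by apply: pcurveC; apply: palg_gen; constructor 1; exists j.
    exact: pcmx_mul pR pA 0 j.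
  - apply: (@pcurve_eq _ _ _ _ _ (fun a k => (U ^+ k *m ld a) i j)).
      by move=> a k; rewrite ldM ldX.
    exact: pcmx_mul pU pA i j.
  apply: (@pcurve_eq _ _ _ _ _ (fun a k => (\det (ld a))^-1)).
    by move=> a k; rewrite ldM ldX det_mulmx dU mul1r.
  by apply: pcurveC; apply: palg_gen; constructor 3.
have [m fm] := ppol_size pfp; exists m.
pose Dl (h : Aff N -> R) := fun a => h (a * u)%g - h a.
pose Dp (p : {poly R}) := shp p - p.
have key j a k : iter j Dl f (a * u ^+ k)%g = (iter j Dp (fp a)).[k%:R].
  elim: j a k => [|j IH] a k; first exact: fE.
  rewrite !iterS /Dl /Dp hornerD hornerN shp_nat -!IH expgSr mulgA.
  by [].
have sz j p : (size (iter j Dp p) <= size p - j)%N.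
  elim: j => [|j IH]; first by rewrite subn0.
  rewrite iterS subnS; have [->|p0] := eqVneq (iter j Dp p) 0.
    by rewrite /Dp /shp comp_poly0 subrr size_poly0.
  have h : (size (Dp (iter j Dp p)) < size (iter j Dp p))%N by exact: size_shp_sub p0.
  by rewrite -ltnS; apply: leq_trans h (leq_trans IH (leqSpred _)).
apply/funext => a; rewrite -[a in LHS]mulg1 -(expg0 u) key.
have /eqP : size (iter m Dp (fp a)) = 0%N.
  by have := sz m (fp a); have := fm a; lia.
by rewrite size_poly_eq0 => /eqP ->; rewrite horner0.
Qed.

(** At the base point of [affine_rebase], a becomes a commuting product of a linear semisimple s and
    some u0; the wanted u is the conjugate of u0. An equation of Z evaluated along s^m u0^k is an
    exponential polynomial that vanishes for k = m, hence also at k = 1, m = 0. *)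
Lemma jordan_part a : exists u, [/\ unipotent u,
  forall Z : set (Aff N), zariski_closed Z -> (forall k, Z (a ^+ k)%g) -> Z u & ld u = 1 -> cdiag (ld a)].
Proof.
have [S [U [AE SU Su dS Un]]] := jordan (ld_unit a).
have Uu : U \in unitmx by have := ld_unit a; rewrite AE unitmx_mul => /andP[].
have alg := jordan_alg (G := G) AE SU Su dS Un (amx_br taut a).
have Sa (v w : V) := (alg w v).2; have Ua (v w : V) := (alg w v).1.
have [p qn] := affine_rebase (aff_trans a) (ld_morph a) (amx_fil taut a).
set q := (_ * _)%g in qn; have qS := jordan_fix AE SU dS Un Uu qn.
have id_alg (u w : V) : (w *m 1%:M) *m ebr G (u *m 1%:M) = (w *m ebr G u) *m 1%:M by rewrite !mulmx1.
have [tp [ltp ldp]] := aff_exists (nlg G p) (unitmx1 _ _) id_alg.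
have [s [lts lds]] := aff_exists 0 Su (fun v' w' => Sa w' v').
have [u0 [ltu ldu]] := aff_exists (nlg G q) Uu (fun v' w' => Ua w' v').
have pE : aff_trans tp = p by apply: (can_inj (nlgK G)).
have ap : (tp^-1 * a * tp = s * u0)%g.
  apply: aff_coord.
  - rewrite [RHS]ltM lts ltu lds qS nbch0 /lt; congr (nlg G _).
    have tpV : aff_trans tp^-1%g = p^-1%g.
      by apply: (can_inj (nlgK G)); rewrite -/(lt _) ltV ldV ldp invmx1 mulmx1 ltp nlgV.
    rewrite -mulgA -[LHS]/(aff_trans tp^-1%g * aff_lin tp^-1%g (aff_trans (a * tp)%g))%g linE.
    rewrite ldV ldp invmx1 mulmx1 nlgK tpV.
    by rewrite -[aff_trans (a * tp)%g]/(aff_trans a * aff_lin a (aff_trans tp))%g linE pE mulgA.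
  - by rewrite !ldM ldV ldp invmx1 mulmx1 mul1mx lds ldu AE SU.
have com : commute s u0.
  apply: aff_coord; last by rewrite !ldM lds ldu SU.
  by rewrite !ltM lts ltu lds ldu qS mul0mx nbch0 bchu0.
pose w := (tp * u0 * tp^-1)%g.
have ldw : ld w = U by rewrite /w !ldM ldV ldp ldu invmx1 mulmx1 mul1mx.
exists w; split; last first.
- by rewrite ldw => U1; rewrite AE U1 mulmx1.
- move=> Z [Q Qr ZE] Zk; rewrite ZE => f Qf; have rf := Qr f Qf.
  pose g (k m : nat) := (s ^+ m * u0 ^+ k)%g.
  have [c cE] : pseq (fun k => lt (u0 ^+ k)%g) by apply: (@orbit_lt u0 n); rewrite ldu.
  have lds' k m : ld (g k m) = U ^+ k *m S ^+ m by rewrite /g ldM !ldX lds ldu.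
  have lts' m : lt (s ^+ m)%g = 0.
    elim: m => [|m IH]; first by rewrite expg0 lt1.
    by rewrite expgS ltM lts IH mul0mx bchu0.
  have lt' k m : lt (g k m) = pev c k%:R *m S ^+ m.
    by rewrite /g ltM lts' nbch0 ldX lds cE.
  have [P [d [Pu PS]]] := dS.
  have SuC : mxC S \in unitmx by rewrite map_unitmx.
  have exS := exmx_diag Pu SuC PS.
  have exU : exmx (fun k _ : nat => mxC U ^+ k).
    by apply: (@exmx_unip _ _ _ n); rewrite -(mxC1 R n) -mxCB -mxCX Un mxC0.
  have exR h : regular h -> expoly (fun k m => (h (g k m))%:C)%C.
    move=> /regularP; elim=> [r|_ [[i ->]|[i [j ->]]|->]|f1 f2 _ h1 _ h2|f1 f2 _ h1 _ h2].
    + exact: expolyC.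
    + have e : exmx (fun k m => mxC (pev c k%:R) *m mxC S ^+ m).
        apply: exmxM => // i' j'; rewrite ord1.
        apply: (@expoly_ext _ (fun k _ => (map_poly (real_complex R) (c 0 j')).[k%:R])).
          by move=> k m; rewrite !mxE -(rmorph_nat (real_complex R)) horner_map.
        exact: expoly_poly.
      apply: expoly_ext (e 0 i) => k m; by rewrite -mxCX -mxCM lt' mxE.
    + have e : exmx (fun k m => mxC U ^+ k *m mxC S ^+ m) by exact: exmxM.
      apply: expoly_ext (e i j) => k m; by rewrite -!mxCX -mxCM lds' mxE.
    + apply: (@expoly_ext _ (fun k m => ((\det S)^-1)%:C%C ^+ m)).
        move=> k m; rewrite lds' det_mulmx.
        have dX (M : 'M[R]_n) j : \det (M ^+ j) = \det M ^+ j.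
          by elim: j => [|j IH]; rewrite ?expr0 ?det1 // !exprS -mulmxE det_mulmx IH.
        by rewrite !dX (unip_det Un Uu) expr1n mul1r -exprVn rmorphXn.
      apply: expoly_exp; rewrite -[0]/(0%:C)%C (inj_eq (@complexI R)) invr_eq0.
      by move: Su; rewrite unitmxE unitfE.
    + apply: expoly_ext (expolyD h1 h2) => k m; by rewrite rmorphD.
    + apply: expoly_ext (expolyM h1 h2) => k m; by rewrite rmorphM.
  have rc : regular (fun x => f (tp * x * tp^-1)%g).
    apply/regularP; apply: (@cmap_comp _ _ (fun x => tp * x * tp^-1)%g f) rf.
    by apply: cmap_mul; [apply: cmap_mul; [exact: cmap_cst|exact: cmap_id]|exact: cmap_cst].
  have ex := exR _ rc.
  have d0 j : (f (tp * g j j * tp^-1)%g)%:C%C = 0.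
    have -> : (tp * g j j * tp^-1 = a ^+ j)%g.
      rewrite /g -expgMn // -ap.
      elim: j => [|j IH]; first by rewrite !expg0 mulg1 mulgV.
      by rewrite !expgS -IH; grp.
    by have := Zk j; rewrite ZE => /(_ f Qf) ->.
  have := expoly_diag0 ex d0 1%N 0%N; rewrite /g expg0 mul1g expg1 -/w => h.
  exact: (@complexI R).
by apply: (@unip_unipotent w n); rewrite ldw.
Qed.

Section Action.
Variables (Gam : groupType) (rho : {multiplicative Gam -> Aff N}).
Hypotheses (vp : virtually_polycyclic Gam) (tl : translation_like rho).

Let rV g : rho g^-1%g = (rho g)^-1%g.
Proof. by apply: morph_inv => x y; exact: gmulfM. Qed.
Let rX g k : rho (g ^+ k)%g = (rho g ^+ k)%g.
Proof. by elim: k => [|k IH]; rewrite ?expg0 ?rho_1 // !expgS gmulfM IH. Qed.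

Lemma img_group (H : set Gam) : is_subgroup H -> is_subgroup (rho @` H).
Proof.
move=> sH; split; first by exists 1%g; [exact: sub1|exact: rho_1].
by move=> _ _ [x Hx <-] [y Hy <-]; exists (x * y^-1)%g; [exact: sH.2|rewrite gmulfM rV].
Qed.

Lemma img_normal (A B : set Gam) : is_normal_in A B -> is_normal_in (rho @` A) (rho @` B).
Proof.
move=> [AB nAB]; split; first by move=> _ [x Ax <-]; exists x => //; exact: AB.
by move=> _ _ [x Ax <-] [y By <-]; exists (x ^ y)%g; [exact: nAB|rewrite /conjg !gmulfM rV].
Qed.

Lemma img_solvable (H : set Gam) : is_solvable H -> is_solvable (rho @` H).
Proof.
move=> [k [S [S0 Sk Sg Sn]]]; exists k, (fun i => rho @` (S i)); split.
- by rewrite S0 image_set1 rho_1.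
- by rewrite Sk.
- by move=> i ik; apply: img_group; exact: Sg.
- move=> i ik; have [nS aS] := Sn i ik; split; first exact: img_normal.
  move=> _ _ [x Sx <-] [y Sy <-]; exists [~ x, y]%g; first exact: aS.
  by rewrite /commg /conjg !gmulfM !rV.
Qed.

(** A power of g lies in the solvable normal subgroup H of finite index, so the unipotent part of
    its image lies in the closure of the image of H. To place it in the unipotent radical, a largest
    closed normal solvable subgroup must first be shown to exist. *)
Lemma power_cdiag g : exists2 m, (0 < m)%N & cdiag (ld (rho (g ^+ m)%g)).
Proof.
have [H [sH nH solH fH]] := vp_solvable vp.
set K := cl (range rho); pose Ks := cl (rho @` H).
have sT : is_subgroup [set: Gam] by [].
have sK : is_subgroup K by apply: cl_group; exact: img_group.
have sKs : is_subgroup Ks by apply: cl_group; exact: img_group.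
have nKs : is_normal_in Ks K by apply: cl_normal; exact: img_normal.
have solKs : is_solvable Ks by apply: cl_solvable; exact: img_solvable.
have fK : ficov Ks K.
  have [l lP] := fH; exists (@map Gam (Aff N) (rho : Gam -> Aff N) l) => a Ka.
  apply: (@cl_cover Ks (range rho)) => //; first exact: cl_closed.
  move=> _ [x _ <-]; have [y yl Hy] := lP x I; exists (rho y : Aff N); first by apply/mapP; exists y.
  by apply: cl_sub; exists (x * y^-1)%g => //; rewrite gmulfM rV.
have P0 : closed_normal_solvable K Ks by split => //; exact: cl_closed.
have [M [PM max]] : exists M, closed_normal_solvable K M /\ forall M', closed_normal_solvable K M' -> M' `<=` M.
  apply: (largest P0 fK) => [M [sM _ [MK _] _]//|M M' [sM cM nM solM] [sM' cM' nM' solM'] KM].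
  have gMM : is_subgroup (mulS M M') by exact: mulS_group nM nM'.1.
  have MMK : mulS M M' `<=` K.
    by move=> x [y My M'x]; rewrite -(mulVKg y x); apply: (subM sK); [exact: nM.1|exact: nM'.1].
  have MMM : M `<=` mulS M M' by exact: mulS_subl.
  split => //; last exact: (mulS_solv sM sK nM solM sM' nM'.1 solM').
    (* A product of closed subgroups may fail to be closed; this one is a finite union of translates
       of [Ks]. *)
    have -> : mulS M M' = cl (mulS M M'); last exact: cl_closed.
    apply/seteqP; split; first exact: cl_sub.
    have [l lP] := fK; pose l' := [seq x <- l | `[< mulS M M' x >]].
    have cov b : mulS M M' b -> exists2 x, x \in l' & Ks (b * x^-1)%g.
      move=> Mb; have [x xl Kx] := lP b (MMK _ Mb); exists x => //.
      rewrite mem_filter xl andbT; apply/asboolP.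
      have -> : (x = (b * x^-1)^-1 * b)%g by grp.
      by apply: subM => //; apply: subV => //; apply: MMM; exact: KM.
    move=> a /(cl_cover (cl_closed _) cov)[x]; rewrite mem_filter => /andP[/asboolP Mx _] Kx.
    by rewrite -(mulgVK x a); apply: subM => //; apply: MMM; exact: KM.
  split => // x y [m Mm M'x] Ky; exists (m ^ y)%g; first exact: nM.2.
  have -> : ((m ^ y)^-1 * x ^ y = (m^-1 * x) ^ y)%g by rewrite /conjg; grp.
  exact: nM'.2.
have [m m0 Hm] := ficov_pow (g := g) sH fH (fun=> I).
exists m => //; have [u [uu uZ uc]] := jordan_part (rho (g ^+ m)%g).
apply: uc; have Ksu : Ks u.
  apply: uZ; first exact: cl_closed.
  by move=> k; apply: cl_sub; exists ((g ^+ m) ^+ k)%g; [exact: subX|exact: rX].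
have : left_translations u.
  apply: tl; split => //; exists M; first by split.
  exact: (max _ P0).
by move=> e; apply: ld_uniq => v; rewrite (e : aff_lin u = id_aut N) mulmx1.
Qed.
End Action.
End Regular.

(** * The equivariant affine map *)

Section Blocks.
Variables (R : realType) (n1 n2 : nat).

(** One matrix carries both linear parts, and the extra entry 1 forces the coefficients of every
    polynomial relation to add up to 1, as [equivariant_exists] requires. *)
Definition blk3 (A : 'M[R]_n1) (B : 'M[R]_n2) : 'M[R]_(1 + (n1 + n2)) :=
  block_mx (1%:M : 'M[R]_1) 0 0 (block_mx A 0 0 B).

Lemma blk3_1 : blk3 1 1 = 1.
Proof. by rewrite /blk3 -!scalar_mx_block. Qed.

Lemma blk3M A B A' B' : blk3 A B *m blk3 A' B' = blk3 (A *m A') (B *m B').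
Proof. by rewrite /blk3 !mulmx_block !mulmx0 !mul0mx !addr0 !add0r mul1mx. Qed.

Lemma blk3X A B k : blk3 A B ^+ k = blk3 (A ^+ k) (B ^+ k).
Proof. by elim: k => [|k IH]; rewrite ?expr0 ?blk3_1 // !exprS -!mulmxE [blk3 A B ^+ k]IH blk3M. Qed.

Lemma horner_mxE n (M : 'M[R]_n.+1) (p : {poly R}) : horner_mx M p = \sum_(k < size p) p`_k *: M ^+ k.
Proof.
rewrite -{1}[p]coefK poly_def linear_sum; apply: eq_bigr => k _.
by rewrite linearZ /= rmorphXn /= horner_mx_X.
Qed.

Lemma inalg_blk3 A B A' B' : inalg (blk3 A B : 'M[R]_((n1 + n2).+1)) (blk3 A' B') -> exists (K : nat) (c : nat -> R),
  [/\ \sum_(k < K) c k = 1, A' = \sum_(k < K) c k *: A ^+ k & B' = \sum_(k < K) c k *: B ^+ k].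
Proof.
move=> [p]; rewrite horner_mxE => e.
have {}e : blk3 A' B' = \sum_(k < size p) p`_k *: blk3 (A ^+ k) (B ^+ k).
  by rewrite e; apply: eq_bigr => k _; rewrite -blk3X.
exists (size p), (fun k => p`_k); split.
- have := congr1 (fun M : 'M[R]_(1 + (n1 + n2)) => ulsubmx M 0 0) e.
  rewrite block_mxKul mxE eqxx => /esym; rewrite !mxE !summxE => h; rewrite -[RHS]h; apply: eq_bigr => k _.
  by rewrite [RHS]mxE -[blk3 _ _ _ _]/(blk3 (A ^+ k) (B ^+ k) (lshift _ 0) (lshift _ 0)) block_mxEul mxE eqxx mulr1.
- have := congr1 (fun M : 'M[R]_(1 + (n1 + n2)) => ulsubmx (drsubmx M)) e.
  rewrite block_mxKdr block_mxKul => ->; apply/matrixP => i j; rewrite !mxE !summxE; apply: eq_bigr => k _.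
  by rewrite [LHS]mxE [RHS]mxE block_mxEdr block_mxEul.
have := congr1 (fun M : 'M[R]_(1 + (n1 + n2)) => drsubmx (drsubmx M)) e.
rewrite block_mxKdr block_mxKdr => ->; apply/matrixP => i j; rewrite !mxE !summxE; apply: eq_bigr => k _.
by rewrite [LHS]mxE [RHS]mxE block_mxEdr block_mxEdr.
Qed.

Lemma cdiag_sum n (A : 'M[R]_n) K (c : nat -> R) : cdiag A -> cdiag (\sum_(k < K) c k *: A ^+ k).
Proof.
case: n A => [|n] A.
  by move=> _; exists 1%:M, 0; split; [exact: unitmx1|apply/matrixP => -[]].
move=> [P [d [Pu PA]]]; have := cdiag_horner (\poly_(k < K) c k) PA; set e := \row_i _ => h.
exists P, e; split => //; rewrite -h; congr (P *m mxC _).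
rewrite poly_def linear_sum; apply: eq_bigr => k _.
by rewrite linearZ /= rmorphXn /= horner_mx_X.
Qed.

Lemma cdiag_pow n (A : 'M[R]_n) k : cdiag A -> cdiag (A ^+ k).
Proof.
move=> [P [d [Pu PA]]]; exists P, (\row_i (d 0 i ^+ k)); split => //.
by rewrite mxCX (diag_exp k Pu PA) -mulmxA mulKVmx.
Qed.

Lemma cdiag1 n : cdiag (1 : 'M[R]_n).
Proof.
exists 1%:M, (const_mx 1); split; first exact: unitmx1.
by rewrite mxC1 diag_const_mx.
Qed.

End Blocks.

Section Pull.
Variables (R : realType) (Gam Gam' X : groupType) (n : nat) (G : nilgrp R X n) (a : affact Gam' G).
Variables (f : Gam -> Gam') (fM : {morph f : x y / (x * y)%g}).

Let pull1 : amx a (f 1%g) = 1. Proof. by rewrite (morph_one fM) amx1. Qed.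
Let pullM g h : amx a (f (g * h)%g) = amx a (f h) *m amx a (f g). Proof. by rewrite fM amxM. Qed.
Let pulltM g h : atr a (f (g * h)%g) = (atr a (f g) * G (nlg G (atr a (f h)) *m amx a (f g)))%g.
Proof. by rewrite fM atrM. Qed.

Definition pull_affact : affact Gam G := AffAct (fun g => amx_morph a (f g)) pull1 pullM pulltM.
End Pull.

Lemma bounded_orbit_finidx (R : realType) (Gam X : groupType) n (G : nilgrp R X n) (a : affact Gam G) (D : set Gam) :
  finidx D -> (exists B : R, forall y, exists g, `|nlg G (aact a g y)| <= B) ->
  exists B : R, forall y, exists g, D g /\ `|nlg G (aact a g y)| <= B.
Proof.
move=> [m [qf [r [rK rP]]]] [B hB].
have /choice[C hC] : forall i, exists C : R, forall y, `|nlg G y| <= B -> `|nlg G (aact a (r i)^-1%g y)| <= C.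
  move=> i; have [C1 h1] := mulmx_bounded (amx a (r i)^-1%g) B.
  have [C2 h2] := nlgM_bounded G (Num.max C1 `|nlg G (atr a (r i)^-1%g)|).
  exists C2 => y yB; apply: h2; first by rewrite le_max lexx orbT.
  by rewrite lg_aut le_max h1.
exists (\sum_i `|C i|) => y; have [g gB] := hB y.
exists ((r (qf g))^-1 * g)%g; split; first by apply/rP; rewrite rK.
rewrite aactM; apply: le_trans (hC _ _ gB) (le_trans (ler_norm _) _).
by rewrite (bigD1 (qf g)) //= lerDl sumr_ge0.
Qed.

(** * Properness and cocompactness as bounds on logarithms *)

Section Topology.
Variables (R : realType) (N : lieGroupType R) (Gam : groupType) (rho : {multiplicative Gam -> Aff N}).
Local Notation n := (@lie_dim R N).
Local Notation V := 'rV[R]_n.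
Variable G : nilgrp R N n.
Hypotheses (GC : continuous G) (lgC : continuous (nlg G)).

Lemma aff_act_continuous (a : Aff N) : continuous (aff_act a).
Proof.
move=> x; rewrite /aff_act.
apply: (@continuous_comp _ _ _ (fun x => (aff_trans a, aff_lin a x)) (fun p : N * N => (p.1 * p.2)%g)).
  by apply: cvg_pair; [exact: cvg_cst|exact: aut_fun_continuous].
exact: lie_mul_continuous.
Qed.

(** The images of the balls |lg y| < k form an increasing open cover of the orbit space, so one of
    them is everything. *)
Lemma cocompact_bounded : cocompact rho -> exists B : R, forall y, exists g, `|nlg G (aff_act (rho g) y)| <= B.
Proof.
rewrite /cocompact => cc.
pose U (k : nat) : set (orbit_space rho) := [set q | exists y, q = \pi_(orbit_space rho)%qT y /\ `|nlg G y| < k%:R].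
have piP y z : \pi_(orbit_space rho)%qT y = \pi_(orbit_space rho)%qT z :> orbit_space rho <-> exists g, aff_act (rho g) y = z.
  by split=> [/eqquotP/asboolP//|h]; apply/eqquotP/asboolP.
have oU k : open (U k).
  change (open (\pi_(orbit_space rho)%qT @^-1` (U k))).
  have -> : \pi_(orbit_space rho)%qT @^-1` (U k) = \bigcup_(g in [set: Gam]) (aff_act (rho g) @^-1` [set y | `|nlg G y| < k%:R]).
    apply/seteqP; split => [z [y [/piP[g gz] yk]]|z [g _ gz]]; first by exists g => //=; rewrite gz.
    by exists (aff_act (rho g) z); split => //; apply/piP; exists g.
  apply: bigcup_open => g _; apply: open_comp => [x _|]; first exact: aff_act_continuous.
  have -> : [set y | `|nlg G y| < k%:R] = (fun y => `|nlg G y|) @^-1` [set r : R | r < k%:R] by [].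
  apply: open_comp => [x _|]; last exact: open_lt.
  by apply: continuous_comp; [exact: lgC|exact: norm_continuous].
move/compact_near_coveringP : cc => /(_ nat \oo (fun k q => U k q) _)[|k _ kU].
  move=> q _; pose k0 := Num.bound `|nlg G (repr q)|.
  have Uq : U k0 q by exists (repr q); split; [rewrite reprK|exact: archi_boundP].
  exists (U k0, [set k | (k0 <= k)%N]); first (split => /=; last by exists k0).
    by apply: (@open_nbhs_nbhs (orbit_space rho)); split => //; exact: oU.
  move=> [q' k] /= [[y [-> yk]] kk]; exists y; split => //.
  by apply: lt_le_trans yk _; rewrite ler_nat.
exists k%:R => y.
have [z [/piP[g gy] zk]] := kU k (leqnn k) (\pi_(orbit_space rho)%qT y) I.
by exists g; rewrite gy; exact: ltW.
Qed.

Lemma proper_finite : properly_discontinuous rho -> forall (p : N) (B : R),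
  finite_set [set g | `|nlg G (aff_act (rho g) p)| <= B].
Proof.
move=> pd p B; pose Kv : set V := [set v | `|v| <= Num.max B `|nlg G p|].
have cK : compact (G @` Kv).
  apply: continuous_compact; first exact: continuous_subspaceT.
  apply: bounded_closed_compact.
    exists (Num.max B `|nlg G p|); split => [|x xB]; first exact: num_real.
    by move=> v vB; exact: le_trans vB (ltW xB).
  have -> : Kv = (fun v => `|v|) @^-1` [set r : R | r <= Num.max B `|nlg G p|] by [].
  by apply: closed_comp => [v _|]; [exact: norm_continuous|exact: closed_le].
apply: sub_finite_set (pd _ cK) => g gB; exists (aff_act (rho g) p); split.
  exists p => //; exists (nlg G p); last exact: nlgK.
  by rewrite /Kv /= le_max lexx orbT.
exists (nlg G (aff_act (rho g) p)); last exact: nlgK.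
by rewrite /Kv /= le_max gB.
Qed.
End Topology.

Theorem theorem1p2 (R : realType) (Gam1 Gam2 : groupType)
    (N1 N2 : lieGroupType R)
    (hGam1 : virtually_polycyclic Gam1) (hGam2 : virtually_polycyclic Gam2)
    (hN1c : connected [set: N1]%classic) (hN1s : simply_connected R N1)
    (hN1n : is_nilpotent N1)
    (hN2c : connected [set: N2]%classic) (hN2s : simply_connected R N2)
    (hN2n : is_nilpotent N2)
    (phi : {multiplicative Gam1 -> Gam2})
    (rho1 : {multiplicative Gam1 -> Aff N1})
    (rho2 : {multiplicative Gam2 -> Aff N2})
    (hrho1t : translation_like rho1) (hrho1c : crystallographic rho1)
    (hrho2t : translation_like rho2) (hrho2c : crystallographic rho2) :
  exists alpha : aff_map N1 N2,
    forall gamma : Gam1,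
      aff_act (rho2 (phi gamma)) \o alpha = alpha \o aff_act (rho1 gamma).
Proof.
have [E1 [EC1 lC1 lK1 eK1 dE1]] := lie_log_exp hN1n hN1c hN1s.
have [E2 [EC2 lC2 lK2 eK2 dE2]] := lie_log_exp hN2n hN2c hN2s.
pose G1 := NilGrp lK1 eK1; pose G2 := NilGrp lK2 eK2.
have [ld1 ldE1] : exists ld, forall a : Aff N1, ld a = lie_diff (aff_lin a) by eexists.
have [ld2 ldE2] : exists ld, forall a : Aff N2, ld a = lie_diff (aff_lin a) by eexists.
have lgE1 : nlg G1 =1 @lie_log R N1 by [].
have lgE2 : nlg G2 =1 @lie_log R N2 by [].
have pM : {morph (rho2 \o phi) : x y / (x * y)%g} by move=> x y /=; rewrite !gmulfM.
have pX k g : phi (g ^+ k)%g = (phi g ^+ k)%g.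
  have p1 : phi 1%g = 1%g by apply: morph_one => x y; exact: gmulfM.
  by elim: k => [|k IH]; rewrite ?expg0 // !expgS gmulfM IH.
pose t1 := @taut R N1 G1 dE1 ld1 ldE1; pose t2 := @taut R N2 G2 dE2 ld2 ldE2.
have rM : {morph rho1 : x y / (x * y)%g} by move=> x y; exact: gmulfM.
pose a1 := pull_affact t1 rM; pose a2 := pull_affact t2 pM.
have act1 g y : aact a1 g y = aff_act (rho1 g) y.
  by rewrite /aact /aff_act /aut /= (@linE R N1 G1 dE1 ld1 ldE1).
have act2 g y : aact a2 g y = aff_act (rho2 (phi g)) y.
  by rewrite /aact /aff_act /aut /= (@linE R N2 G2 dE2 ld2 ldE2).
(* The product of the two exponents serves both actions, since powers of semisimple matrices are
   semisimple. *)
have pw g : exists m, [/\ (0 < m)%N, cdiag (amx a1 (g ^+ m)%g) & cdiag (amx a2 (g ^+ m)%g)].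
  have [m1 m10 c1] := power_cdiag lgE1 EC1 lC1 dE1 ldE1 hGam1 hrho1t g.
  have [m2 m20 c2] := power_cdiag lgE2 EC2 lC2 dE2 ldE2 hGam2 hrho2t (phi g).
  exists (m1 * m2)%N; split; first by rewrite muln_gt0 m10.
    by rewrite expgnA amxX; exact: cdiag_pow.
  by rewrite mulnC expgnA amxX; apply: cdiag_pow; rewrite /= pX.
pose A g : 'M[R]_((@lie_dim R N1 + @lie_dim R N2).+1) := blk3 (amx a1 g) (amx a2 g).
have Apow g : exists2 m, (0 < m)%N & cdiag (A (g ^+ m)%g).
  have [m [m0 c1 c2]] := pw g; exists m => //.
  by apply: (@cdiag_block R 1); [exact: cdiag1|exact: cdiag_block].
have AM g h : A (g * h)%g = A h *m A g by rewrite /A !amxM -blk3M.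
have A1 : A 1%g = 1 by rewrite /A !amx1 blk3_1.
have [D [g0 [sD Dn fD [Dg0 Am Ag]]]] := generic A1 AM Apow hGam1.
(* The linear parts of g0 itself are semisimple too: they are polynomials in those of g0^m. *)
have [m [m0 c1 c2]] := pw g0.
have [K [c [_ e1 e2]]] : exists (K : nat) (c : nat -> R), [/\ \sum_(k < K) c k = 1,
    amx a1 g0 = \sum_(k < K) c k *: amx a1 (g0 ^+ m)%g ^+ k & amx a2 g0 = \sum_(k < K) c k *: amx a2 (g0 ^+ m)%g ^+ k].
  by apply: inalg_blk3; have := Am m m0; rewrite /A [_ ^+ m]blk3X -!amxX.
have [|||||||||||d [L [x [dM dL eq]]]] := @equivariant_exists R Gam1 N1 N2 _ _ G1 G2 a1 a2 D g0 => //.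
- exact: sub1.
- by move=> g h; exact: subM.
- by move=> g; exact: subV.
- by rewrite e1; exact: cdiag_sum.
- by rewrite e2; exact: cdiag_sum.
- by move=> g Dg; apply: inalg_blk3; exact: Ag.
- move=> p B; apply: sub_finite_set (proper_finite (G := G1) EC1 hrho1c.1 p B) => g [_].
  by rewrite act1.
- apply: bounded_orbit_finidx => //; have [B hB] := cocompact_bounded (G := G1) lC1 hrho1c.2.
  by exists B => y; have [g gB] := hB y; exists g; rewrite act1.
have dC : continuous d.
  have -> : d = (fun y => G2 (nlg G1 y *m L)) by apply/funext => y; rewrite -dL nlgK.
  move=> y; apply: (@continuous_comp _ _ _ (fun y => nlg G1 y *m L) G2); last exact: EC2.
  by apply: (@continuous_comp _ _ _ (nlg G1) (fun v => v *m L)); [exact: lC1|exact: mulmxr_cvg].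
exists (AffMap x dM dC) => g; apply/funext => y.
by rewrite /= /aff_map_fun /= -act1 -act2 eq.
Qed.
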